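(* Let $F_{-23}=\sum_{r\,(12)}\left(\frac{12}{r}\right)f_{2,-23,r}=f_{2,-23,1}-f_{2,-23,5}-f_{2,-23,7}+f_{2,-23,11}$, a meromorphic modular form of weight $4$ for $\Gamma_0(6)$, and let $c_{F_{-23}}(n)$ denote its Fourier coefficients at $i\infty$. For every $n\geq1$ we have $$c_{F_{-23}}(n)=n\sum_{m\mid n}\left(\frac{-23}{n/m}\right)\left(\frac{12}{m}\right)m^2\,p\!\left(\frac{23m^2+1}{24}\right)=\sum_{m\mid n}\left(\frac{12}{m}\right)\frac{n}{m}\sum_{d=1}^{\lfloor\sqrt{m^2+24}\rfloor}\left(\frac{12}{d}\right)\frac{m^2-d^2}{24}\,c_j\!\left(\frac{m^2-d^2}{24}\right).$$
   Context: For $r\in\{1,5,7,11\}$ modulo $12$, let $\mathcal{Q}_{6,-23,r}$ be the set of positive definite integral binary quadratic forms $Q=[a,b,c]$, $Q(x,y)=ax^2+bxy+cy^2$, of discriminant $b^2-4ac=-23$ with $6\mid a$ and $b\equiv r\pmod{12}$. Define, for $z$ in the complex upper half-plane, $$f_{2,-23,r}(z)=\frac{1}{(2\pi)^2}\sum_{Q\in\mathcal{Q}_{6,-23,r}}Q(z,1)^{-2}.$$ (This is the case $N=6$, $k=2$, $d=-23$, $D=\rho=1$ of a general family of meromorphic modular forms with genus characters; the genus character for $D=1$ is trivial.) The Fourier expansion $F_{-23}(z)=\sum_{n\ge1}c_{F_{-23}}(n)e^{2\pi i n z}$ is the one valid for $\mathrm{Im}(z)$ sufficiently large. Here $\left(\frac{\cdot}{\cdot}\right)$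 is the Kronecker symbol, $p(n)$ is the number of partitions of $n$, and $c_j(n)$ is the $n$-th Fourier coefficient of the modular $j$-invariant $j(\tau)=q^{-1}+744+196884q+\dots$ with $q=e^{2\pi i\tau}$ (so $c_j(-1)=1$). Terms in which a Kronecker symbol vanishes are understood to be $0$ (the arguments of $p$ and $c_j$ in the remaining terms are integers). *)

(* Defs.v *)
From mathcomp Require Import all_boot all_order all_algebra.
From mathcomp Require Import all_classical all_reals all_analysis.
From mathcomp Require Import complex.
From mathcomp Require summability.

Set Implicit Arguments.
Unset Strict Implicit.
Unset Printing Implicit Defensive.

Import Order.TTheory GRing.Theory Num.Theory.
Import numFieldNormedType.Exports.

Local Open Scope classical_set_scope.
Local Open Scope ring_scope.
Local Open Scope complex_scope.

(* The symbol (a / p) for p prime: the Legendre symbol if p is odd, and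
   (a / 2) = 0, 1, -1 according as a is even, +-1 or +-3 modulo 8. *)
Definition kronecker_prime (a : int) (p : nat) : int :=
  if (p %| a)%Z then 0
  else if p == 2 then (if (a %% 8)%Z \in [:: 1; 7] then 1 else -1)
  else if has (fun x : nat => (a == x%:Z ^+ 2 %[mod p])%Z) (iota 0 p) then 1
  else -1.

(* Kronecker symbol (a / n) with a nonnegative lower argument. *)
Definition kronecker (a : int) (n : nat) : int :=
  if n == 0%N then (`|a|%N == 1%N)%:R
  else \prod_(pe <- prime_decomp n) kronecker_prime a pe.1 ^+ pe.2.

(* A partition of n is encoded as a weakly decreasing sequence of n parts,
   padded with zeros. *)
Definition partition_number (n : nat) : nat :=
  #|[set t : n.-tuple 'I_n.+1 |
       sorted geq [seq val i | i <- t] && (\sum_(i <- t) val i == n)%N]|.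

Section Analysis.
Variable R : realType.
Local Notation C := R[i].

(* Unconditional sum of f over A: the limit, along the finite subsets of I
   ordered by inclusion, of the partial sums of f extended by 0 outside A.
   R[i]^o is R[i] with its topology as a normed space over itself. *)
Definition unordered_sum (I : choiceType) (A : set I) (f : I -> C) : C :=
  summability.sum (patch (fun=> 0) A f : I -> C^o).

Definition cexp (z : C) : C :=
  (expR (complex.Re z))%:C *
  (cos (complex.Im z) +i* sin (complex.Im z)).

Definition e2pi (z : C) : C := cexp ((0 +i* (2 * pi)) * z).

(* f(z) = \sum_(n >= N) c n * e2pi (n z) for Im z sufficiently large. Setting
   c n = 0 for n < N makes such a c unique. *)
Definition is_fourier_expansion (N : int) (f : C -> C) (c : int -> C) : Prop :=
  (forall n, n < N -> c n = 0) /\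
  exists Y : R, forall z : C, Y < complex.Im z ->
    (fun K : nat =>
       \sum_(k < K) c (N + k%:Z) * e2pi ((N + k%:Z)%:~R * z) : C^o) @ \oo
    --> (f z : C^o).

(* The junk value 0 is only taken when f has no such expansion. *)
Definition fourier_coef (N : int) (f : C -> C) : int -> C :=
  xget (fun=> 0) [set c | is_fourier_expansion N f c].

(* The triple (a, b, c) stands for the form [a, b, c]. *)
Definition form : Type := int * int * int.

Definition form_eval (K : comPzRingType) (Q : form) (x y : K) : K :=
  let: (a, b, c) := Q in
  a%:~R * x ^+ 2 + b%:~R * x * y + c%:~R * y ^+ 2.

Definition form_disc (Q : form) : int :=
  let: (a, b, c) := Q in b ^+ 2 - 4 * a * c.

Definition pos_def (Q : form) : Prop :=
  forall x y : R, (x, y) != (0, 0) -> 0 < form_eval Q x y.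

Definition forms (N : nat) (d r : int) : set form :=
  [set Q | [/\ pos_def Q, form_disc Q = d, (N %| Q.1.1)%Z
             & (Q.1.2 = r %[mod (2 * N)%N])%Z]].

(* f_{2,-23,r} at level 6; at a pole the term with Q(z,1) = 0 is 0. *)
Definition f2 (r : int) (z : C) : C :=
  ((2 * (pi : R)%:C) ^+ 2)^-1 *
  unordered_sum (forms 6 (-23) r) (fun Q => form_eval Q z 1 ^- 2).

Definition F23 (z : C) : C :=
  \sum_(r < 12) (kronecker 12 r)%:~R * f2 r%:Z z.

Lemma F23E (z : C) : F23 z = f2 1 z - f2 5 z - f2 7 z + f2 11 z.
Proof.
rewrite /F23 !big_ord_recr big_ord0 /= /kronecker /= !unlock /=.
by rewrite !mul0r !mul1r !mulN1r !addr0 !add0r.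
Qed.

Definition eisenstein_sum (k : nat) (z : C) : C :=
  unordered_sum [set w : int * int | w != (0, 0)]
    (fun w => (w.1%:~R * z + w.2%:~R) ^- k).

(* The classical j = 1728 g2^3 / (g2^3 - 27 g3^2), so j = q^-1 + 744 + ... *)
Definition modular_j (z : C) : C :=
  let g2 := 60 * eisenstein_sum 4 z in
  let g3 := 140 * eisenstein_sum 6 z in
  1728 * g2 ^+ 3 / (g2 ^+ 3 - 27 * g3 ^+ 2).

End Analysis.

Arguments F23 R : clear implicits.
Arguments modular_j R : clear implicits.
Arguments kronecker a%_Z n%_N.

(* Main.v *)
(* Each f_{2,-23,r} is a sum over Heegner forms; summing first over translates with Lipschitz's
   formula writes the n-th coefficient of F_{-23} as the series over c >= 1 of
   (2n/23) Psi(pi n sqrt 23 / (6c)) S_c(n), where Psi(x) = cosh x - sinh x / x and S_c(n) is the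
   Salie sum of chi(l) e(nl/12c) over l mod 12c with 24c | l^2 + 23, chi = (12/.).

   Rademacher-type formulas express the coefficients of g = P(j)/eta = q^(-m^2/24) + O(q^(23/24)),
   P a polynomial, as similar series with Kloosterman sums in place of S_c(n).  They come from a
   primitive H of e(-Mz/24) g: the absolutely convergent sum of H(gamma(rho + 1)) - H(gamma rho)
   over the bottom rows (c, d) of SL_2(Z) vanishes because z -> -1/z exchanges rho and rho + 1,
   the rows with c = 0 give the wanted coefficient, and for fixed c and fixed d mod c the sum
   telescopes to the jump of H at a cusp, which the transformation law of eta makes explicit.

   For the partition function take P = 1; Hecke-type recursions in n express S_c(n) through the
   sums V_{c/k}(n/k), where V_c(s) is the sum of chi(l) e(l/12c) over l mod 12c with
   24c | l^2 + 23 s^2, and these are the Kloosterman sums of the partition function.  For the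
   j-function, sorting additive characters modulo c by their order expresses S_c(n) through the
   Kloosterman sums with M = 23; the coefficient of q^(23/24) in P(j)/eta is then read off from
   the vanishing constant term of the weight 2 form j' P(j). *)
Require Import Defs.
From mathcomp Require Import all_boot all_order all_algebra.
From mathcomp Require Import all_classical all_reals all_analysis.
From mathcomp Require Import complex finmap.
From mathcomp Require summability.
From mathcomp Require Import cyclic finfield.
From mathcomp Require Import ring lra zify.
Set Implicit Arguments.
Unset Strict Implicit.
Unset Printing Implicit Defensive.
Import Order.TTheory GRing.Theory Num.Theory.
Import numFieldNormedType.Exports.
Local Open Scope ring_scope.
Local Open Scope complex_scope.

(** * Unordered sums *)

(** Both formulas carry the same transcendental factor. The Rademacher-type series for leading
    exponent -m^2/24 and twist e(-Mz/24) evaluates [Psi] at pi m sqrt M / (6c), which depends only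
    on m sqrt M / c. The partition function enters with leading exponent -1/24 and M = 23 m^2, the
    form P(j)/eta with leading exponent -m^2/24 and M = 23, and scaling m and c by the same k
    changes nothing. So each formula reduces, modulus by modulus, to a finite identity between
    exponential sums. The obstacle is convergence: 1/eta has weight -1/2. Passing to a primitive
    gains two powers of the denominator, so the terms are O(|cz+d|^(-5/2)) and the sum over all
    bottom rows converges absolutely without any bound on Kloosterman sums. Of the multiplier of eta
    only the modulus is followed through Euclid's algorithm; its phase stays inside Gauss sums,
    which replaces Dedekind sums. Contour integrals are replaced by primitives and a mean value
    inequality, the one special function being the primitive of exp(u^2). *)

Section Norm.
Variable R : realType.
Local Notation C := R[i].

(** The norm of [R[i]] takes its values in [R[i]] again; a modulus with values in [R] keeps all
    estimates inside the ordered field. *)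
Definition nm (z : C) : R := Num.sqrt (complex.Re z ^+ 2 + complex.Im z ^+ 2).

Lemma nmE (z : C) : (nm z)%:C = `|z|.
Proof. by rewrite normc_def. Qed.

Lemma nm_ge0 (z : C) : 0 <= nm z. Proof. exact: sqrtr_ge0. Qed.

Lemma nmM (x y : C) : nm (x * y) = nm x * nm y.
Proof. by apply: (@complexI R); rewrite rmorphM /= !nmE normrM. Qed.

Lemma nmD (x y : C) : nm (x + y) <= nm x + nm y.
Proof. by rewrite -lecR rmorphD /= !nmE ler_normD. Qed.

Lemma nmN (x : C) : nm (- x) = nm x.
Proof. by apply: (@complexI R); rewrite !nmE normrN. Qed.

Lemma nmB (x y : C) : nm (x - y) <= nm x + nm y.
Proof. by rewrite -[nm y]nmN nmD. Qed.

Lemma nm_subC (x y : C) : nm (x - y) = nm (y - x).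
Proof. by rewrite -nmN opprB. Qed.

Lemma nm_tri (y x z : C) : nm (x - z) <= nm (x - y) + nm (y - z).
Proof. by apply: le_trans (nmD _ _); rewrite addrA subrK. Qed.

Lemma nm_real (x : R) : nm x%:C = `|x|.
Proof. by rewrite /nm /= expr0n /= addr0 sqrtr_sqr. Qed.

Lemma nm0 : nm 0 = 0. Proof. by rewrite nm_real normr0. Qed.

Lemma nm1 : nm 1 = 1. Proof. by rewrite nm_real normr1. Qed.

Lemma nm_eq0 (x : C) : (nm x == 0) = (x == 0).
Proof. by rewrite -(inj_eq (@complexI R)) nmE normr_eq0. Qed.

Lemma nm_gt0 (x : C) : (0 < nm x) = (x != 0).
Proof. by rewrite lt_def nm_ge0 andbT nm_eq0. Qed.

Lemma nmV (x : C) : nm x^-1 = (nm x)^-1.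
Proof. by apply: (@complexI R); rewrite fmorphV /= !nmE normfV. Qed.

Lemma nmX (x : C) n : nm (x ^+ n) = nm x ^+ n.
Proof. by apply: (@complexI R); rewrite rmorphXn /= !nmE normrX. Qed.

Lemma nm_nat n : nm n%:R = n%:R.
Proof. by rewrite -(rmorph_nat (real_complex R)) nm_real ger0_norm. Qed.

Lemma nm_int (n : int) : nm n%:~R = `|n|%:~R.
Proof. by rewrite -(rmorph_int (real_complex R)) nm_real intr_norm. Qed.

Lemma nm_conj (x : C) : nm (conjc x) = nm x.
Proof. by case: x => a b; rewrite /nm /= sqrrN. Qed.

Lemma nm_sqr (x : C) : nm x ^+ 2 = complex.Re x ^+ 2 + complex.Im x ^+ 2.
Proof. by rewrite /nm sqr_sqrtr // addr_ge0 // sqr_ge0. Qed.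

Lemma Re_nm (x : C) : `|complex.Re x| <= nm x.
Proof. by rewrite /nm -sqrtr_sqr ler_sqrt ?addr_ge0 ?sqr_ge0// lerDl sqr_ge0. Qed.

Lemma Im_nm (x : C) : `|complex.Im x| <= nm x.
Proof. by rewrite /nm -sqrtr_sqr ler_sqrt ?addr_ge0 ?sqr_ge0// lerDr sqr_ge0. Qed.

Lemma nm_ReIm (x : C) : nm x <= `|complex.Re x| + `|complex.Im x|.
Proof.
rewrite -[leRHS]ger0_norm ?addr_ge0// -sqrtr_sqr /nm ler_sqrt ?sqr_ge0//.
by rewrite sqrrD !real_normK ?num_real// -addrA lerD2l lerDr mulrn_wge0.
Qed.

Lemma nm_sum (I : Type) (s : seq I) (f : I -> C) :
  nm (\sum_(i <- s) f i) <= \sum_(i <- s) nm (f i).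
Proof.
elim: s => [|i s IH]; first by rewrite !big_nil nm0.
by rewrite !big_cons (le_trans (nmD _ _))// lerD2l.
Qed.

Lemma nm_small_eq (x y : C) : (forall e : R, 0 < e -> nm (x - y) < e) -> x = y.
Proof.
move=> H; apply/eqP; rewrite -subr_eq0 -nm_eq0; apply/eqP.
apply/le_anti; rewrite nm_ge0 andbT leNgt; apply/negP => /H.
by rewrite ltxx.
Qed.

Lemma ReD (x y : C) : complex.Re (x + y) = complex.Re x + complex.Re y.
Proof. by case: x y => [? ?] [? ?]. Qed.

Lemma ImD (x y : C) : complex.Im (x + y) = complex.Im x + complex.Im y.
Proof. by case: x y => [? ?] [? ?]. Qed.

Lemma ReN (x : C) : complex.Re (- x) = - complex.Re x.
Proof. by case: x. Qed.

Lemma ImN (x : C) : complex.Im (- x) = - complex.Im x.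
Proof. by case: x. Qed.

Lemma ReM (x y : C) : complex.Re (x * y) =
  complex.Re x * complex.Re y - complex.Im x * complex.Im y.
Proof. by case: x y => [? ?] [? ?]. Qed.

Lemma ImM (x y : C) : complex.Im (x * y) =
  complex.Re x * complex.Im y + complex.Im x * complex.Re y.
Proof. by case: x y => [? ?] [? ?]. Qed.

Lemma complex_ext (x y : C) :
  complex.Re x = complex.Re y -> complex.Im x = complex.Im y -> x = y.
Proof. by case: x y => [? ?] [? ?] /= -> ->. Qed.

End Norm.

Section HasSum.
Variable R : realType.
Local Notation C := R[i].

Definition cvto (u : nat -> C) (l : C) :=
  forall e : R, 0 < e -> exists n0, forall n, (n0 <= n)%N -> nm (u n - l) < e.

Lemma cvto_uniq u l l' : cvto u l -> cvto u l' -> l = l'.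
Proof.
move=> H H'; apply: nm_small_eq => e e0.
have e20 : 0 < e / 2 by rewrite divr_gt0.
have [n Hn] := H _ e20; have [n' Hn'] := H' _ e20.
have := Hn (maxn n n') (leq_maxl _ _); have := Hn' (maxn n n') (leq_maxr _ _).
have := nm_tri (u (maxn n n')) l l'; rewrite (nm_subC l (u _)).
lra.
Qed.

Lemma cvto_cst l : cvto (fun=> l) l.
Proof. by move=> e e0; exists 0%N => n _; rewrite subrr nm0. Qed.

Lemma cvto_ext u v l : (forall n, u n = v n) -> cvto u l -> cvto v l.
Proof. by move=> uv H e /H [n0 Hn]; exists n0 => n /Hn; rewrite uv. Qed.

Lemma cvtoD u v l m : cvto u l -> cvto v m -> cvto (fun n => u n + v n) (l + m).
Proof.
move=> H H' e e0; have e20 : 0 < e / 2 by rewrite divr_gt0.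
have [n Hn] := H _ e20; have [n' Hn'] := H' _ e20.
exists (maxn n n') => k; rewrite geq_max => /andP[/Hn a /Hn' b].
rewrite opprD addrACA (le_lt_trans (nmD _ _))//; lra.
Qed.

Lemma cvtoZ a u l : cvto u l -> cvto (fun n => a * u n) (a * l).
Proof.
move=> H e e0; have a0 : 0 < nm a + 1 by rewrite ltr_wpDl ?nm_ge0.
have [n Hn] := H (e / (nm a + 1)) (divr_gt0 e0 a0).
exists n => k /Hn; rewrite ltr_pdivlMr// => Hk.
rewrite -mulrBr nmM (le_lt_trans _ Hk)// mulrDr mulr1 mulrC lerDl nm_ge0//.
Qed.

Lemma cvto_sq u l (b : nat -> R) : (forall n, nm (u n - l) <= b n) ->
  (forall e, 0 < e -> exists n0, forall n, (n0 <= n)%N -> b n < e) -> cvto u l.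
Proof.
move=> H Hb e /Hb[n0 Hn]; exists n0 => n /Hn; exact: le_lt_trans (H n).
Qed.

(** Relational form of [unordered_sum]: convergence and value are one statement, and no default
    value can intervene. *)
Definition hasum (I : choiceType) (f : I -> C) (s : C) :=
  forall e : R, 0 < e -> exists A : {fset I}, forall B : {fset I},
    (A `<=` B)%fset -> nm (\sum_(i <- B) f i - s) < e.

(** Absolute convergence of a nonnegative family, encoded as a bound on all finite sums; an explicit
    [M] can be carried through pairs and scalings. *)
Definition bsum (I : choiceType) (g : I -> R) (M : R) :=
  forall A : {fset I}, \sum_(i <- A) g i <= M.

Definition smb (I : choiceType) (g : I -> R) := exists M, bsum g M.

Section OneIndex.
Variable I : choiceType.
Implicit Types (f : I -> C) (g : I -> R) (A B : {fset I}).

Lemma hasum_uniq f s s' : hasum f s -> hasum f s' -> s = s'.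
Proof.
move=> H H'; apply: nm_small_eq => e e0.
have e20 : 0 < e / 2 by rewrite divr_gt0.
have [A HA] := H _ e20; have [A' HA'] := H' _ e20.
have := HA (A `|` A')%fset (fsubsetUl _ _); have := HA' (A `|` A')%fset (fsubsetUr _ _).
set u := \sum_(i <- _) _ => h1 h2.
have := nm_tri u s s'; rewrite (nm_subC s u); lra.
Qed.

Lemma hasum_ext f f' s : (forall i, f i = f' i) -> hasum f s -> hasum f' s.
Proof. by move=> /funext ->. Qed.

Lemma hasum0 : hasum (fun _ : I => 0) 0.
Proof. by move=> e e0; exists fset0%fset => B _; rewrite big1// subrr nm0. Qed.

Lemma hasumD f f' s s' : hasum f s -> hasum f' s' ->
  hasum (fun i => f i + f' i) (s + s').
Proof.
move=> H H' e e0; have e20 : 0 < e / 2 by rewrite divr_gt0.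
have [A HA] := H _ e20; have [A' HA'] := H' _ e20.
exists (A `|` A')%fset => B; rewrite fsubUset => /andP[/HA a /HA' b].
rewrite big_split /= opprD addrACA (le_lt_trans (nmD _ _))//; lra.
Qed.

Lemma hasumZ a f s : hasum f s -> hasum (fun i => a * f i) (a * s).
Proof.
move=> H e e0; have a0 : 0 < nm a + 1 by rewrite ltr_wpDl ?nm_ge0.
have [A HA] := H (e / (nm a + 1)) (divr_gt0 e0 a0).
exists A => B /HA; rewrite ltr_pdivlMr// => Hk.
rewrite -mulr_sumr -mulrBr nmM (le_lt_trans _ Hk)//.
by rewrite mulrDr mulr1 mulrC lerDl nm_ge0.
Qed.

Lemma hasumN f s : hasum f s -> hasum (fun i => - f i) (- s).
Proof.
move=> H; rewrite -mulN1r; apply: hasum_ext (hasumZ (-1) H) => i.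
by rewrite mulN1r.
Qed.

Lemma hasumB f f' s s' : hasum f s -> hasum f' s' ->
  hasum (fun i => f i - f' i) (s - s').
Proof. by move=> H /hasumN; exact: hasumD. Qed.

Lemma hasum_fin (A : {fset I}) f : (forall i, i \notin A -> f i = 0) ->
  hasum f (\sum_(i <- A) f i).
Proof.
move=> H e e0; exists A => B AB; rewrite (big_fsetIDcond _ (mem A)) /=.
rewrite [X in _ + X - _]big_seq_cond [X in _ + X - _]big1 ?addr0.
  rewrite (_ : [fset x | x in B & x \in A]%fset = A) ?subrr ?nm0//.
  apply/fsetP => i; rewrite !inE /=; case: (boolP (i \in A)); rewrite ?andbF//.
  by move=> iA; rewrite (fsubsetP AB).
by move=> i; rewrite !inE /= andbT => /andP[_ /H].
Qed.

Lemma ler_sum_fset g A B : (forall i, 0 <= g i) -> (A `<=` B)%fset ->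
  \sum_(i <- A) g i <= \sum_(i <- B) g i.
Proof.
move=> g0 AB; rewrite [leRHS](big_fsetIDcond _ (mem A)) /=.
rewrite (_ : [fset x | x in B & x \in A]%fset = A) ?lerDl ?sumr_ge0//.
apply/fsetP => i; rewrite !inE /=; case: (boolP (i \in A)); rewrite ?andbF//.
by move=> iA; rewrite (fsubsetP AB).
Qed.

Lemma hasum_bound f g s M : hasum f s -> (forall i, nm (f i) <= g i) ->
  bsum g M -> nm s <= M.
Proof.
move=> H fg gM; apply/ler_addgt0Pr => e e0; have [A HA] := H _ e0.
have := HA _ (fsubset_refl A).
set u := \sum_(i <- A) f i => h1.
have : nm u <= M by apply: le_trans (nm_sum _ _) (le_trans (ler_sum _ _) (gM A)).
have := nm_tri u s 0; rewrite !subr0 (nm_subC s u); lra.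
Qed.

Lemma bsum_le g g' M : (forall i, g i <= g' i) -> bsum g' M -> bsum g M.
Proof. by move=> H HM A; apply: le_trans (HM A); exact: ler_sum. Qed.

Lemma smb_le g g' : (forall i, g i <= g' i) -> smb g' -> smb g.
Proof. by move=> H [M HM]; exists M; exact: bsum_le HM. Qed.

Lemma bsumZ a g M : 0 <= a -> bsum g M -> bsum (fun i => a * g i) (a * M).
Proof. by move=> a0 H A; rewrite -mulr_sumr ler_wpM2l. Qed.

Lemma smbZ a g : 0 <= a -> smb g -> smb (fun i => a * g i).
Proof. by move=> a0 [M /(bsumZ a0) H]; exists (a * M). Qed.

Lemma smbD g g' : smb g -> smb g' -> smb (fun i => g i + g' i).
Proof. by move=> [M H] [M' H']; exists (M + M') => A; rewrite big_split lerD. Qed.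

Lemma bsum_ge0 g M : bsum g M -> 0 <= M.
Proof. by move=> /(_ fset0%fset); rewrite big_seq_fset0. Qed.

Lemma smb_hasum_pos g : (forall i, 0 <= g i) -> smb g ->
  exists s : R, hasum (fun i => (g i)%:C) s%:C.
Proof.
move=> g0 [M HM].
pose E : classical_sets.set R := fun x => exists A : {fset I}, x = \sum_(i <- A) g i.
have supE : has_sup E.
  split; first by exists 0; exists fset0%fset; rewrite big_seq_fset0.
  by exists M => x [A ->].
exists (sup E) => e e0.
have [x [A ->] HA] := sup_adherent e0 supE.
exists A => B AB; rewrite -rmorph_sum -rmorphB /= nm_real distrC ger0_norm.
  by have := ler_sum_fset g0 AB; lra.
by rewrite subr_ge0; apply: ub_le_sup; [case: supE|exists B].
Qed.

Lemma smb_hasum f : smb (fun i => nm (f i)) -> exists s, hasum f s.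
Proof.
move=> H.
have Hp (u : I -> R) : (forall i, `|u i| <= nm (f i)) ->
    exists s : R, hasum (fun i => (u i)%:C) s%:C.
  move=> Hu.
  (* A real family [u] dominated by [nm (f i)] is the difference of the nonnegative families
     [nm (f i) + u i] and [nm (f i)]. *)
  have [||s1 h1] := @smb_hasum_pos (fun i => nm (f i) + u i).
  - by move=> i; have := Hu i; rewrite ler_norml; lra.
  - apply: smb_le (smbZ (ler0n _ 2) H) => i.
    by have := Hu i; rewrite ler_norml; lra.
  have [s2 h2] := smb_hasum_pos (fun i => nm_ge0 (f i)) H.
  exists (s1 - s2); rewrite rmorphB; apply: hasum_ext (hasumB h1 h2) => i /=.
  by rewrite -rmorphB /= addrC addKr.
have [|a ha] := Hp (fun i => complex.Re (f i)); first by move=> i; exact: Re_nm.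
have [|b hb] := Hp (fun i => complex.Im (f i)); first by move=> i; exact: Im_nm.
exists (a%:C + 'i * b%:C); apply: hasum_ext (hasumD ha (hasumZ 'i hb)) => i.
by rewrite -complexE.
Qed.

End OneIndex.

Lemma hasum_inj (I J : choiceType) (h : J -> I) (f : I -> C) s :
  injective h -> (forall i, (forall j, h j <> i) -> f i = 0) ->
  hasum (f \o h) s <-> hasum f s.
Proof.
move=> hI f0; split=> H e e0; have [A HA] := H _ e0.
- exists [fset h j | j in A]%fset => B AB.
  (* The preimage of [B] under [h]; no inverse of [h] is given, so it is assembled by choice on the
     indices that are hit. *)
  pose B' := [fset j | j in (pmap (fun i => 
     if pselect (exists j, h j = i) is left p then Some (projT1 (cid p)) else None) B)]%fset.
  have B'P j : (j \in B') = (h j \in B).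
    rewrite /B' !inE /= mem_pmap; apply/mapP/idP.
      move=> [i iB]; case: pselect => // p [->].
      by case: (cid p) => /= x ->.
    move=> hB; exists (h j) => //; case: pselect => [p|[]]; last by exists j.
    by congr Some; case: (cid p) => /= x /hI.
  have : (A `<=` B')%fset.
    apply/fsubsetP => j jA; rewrite B'P (fsubsetP AB)//; apply/imfsetP.
    by exists j.
  move=> /HA; congr (nm (_ - s) < e) => /=.
  have <- : \sum_(i <- [fset h j | j in B']%fset) f i = \sum_(j <- B') f (h j).
    by apply: big_imfset => ? ? _ _ /hI.
  rewrite [RHS](big_fsetIDcond _ (mem [fset h j | j in B']%fset)) /=.
  rewrite [X in _ + X]big_seq_cond [X in _ + X]big1 ?addr0.
    apply: eq_fbigl => i; rewrite !inE /=; apply/idP/idP => [|/andP[]//].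
    by move=> iB'; rewrite iB' andbT; case/imfsetP: iB' => j /= + ->; rewrite B'P.
  move=> i; rewrite !inE /= andbT => /andP[iB /negP ni]; apply: f0 => j hj.
  by apply: ni; apply/imfsetP; exists j => //=; rewrite B'P hj.
- pose A' := [fset j | j in (pmap (fun i => 
     if pselect (exists j, h j = i) is left p then Some (projT1 (cid p)) else None) A)]%fset.
  have A'P j : (h j \in A) -> (j \in A').
    rewrite /A' !inE /= mem_pmap => hB; apply/mapP; exists (h j) => //.
    case: pselect => [p|[]]; last by exists j.
    by congr Some; case: (cid p) => /= x /hI.
  exists A' => B AB.
  have /HA : (A `<=` A `|` [fset h j | j in B])%fset by exact: fsubsetUl.
  congr (nm (_ - s) < e) => /=.
  have <- : \sum_(i <- [fset h j | j in B]%fset) f i = \sum_(j <- B) f (h j).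
    by apply: big_imfset => ? ? _ _ /hI.
  rewrite (big_fsetIDcond _ (mem [fset h j | j in B]%fset)) /=.
  rewrite [X in _ + X]big_seq_cond [X in _ + X]big1 ?addr0.
    apply: eq_fbigl => i; rewrite !inE /=; case: (i \in [fset h j | j in B]%fset);
    by rewrite ?orbT ?andbF.
  move=> i; rewrite !inE /= andbT => /andP[/orP[iA|->//] /negP ni].
  apply: f0 => j hj; apply: ni; apply/imfsetP; exists j => //=.
  by rewrite (fsubsetP AB)// A'P// hj.
Qed.

Lemma hasum_bij (I J : choiceType) (h : J -> I) (f : I -> C) s :
  bijective h -> hasum (f \o h) s <-> hasum f s.
Proof.
move=> [g hg gh]; apply: hasum_inj; first exact: can_inj hg.
by move=> i /(_ (g i)); rewrite gh.
Qed.

Lemma smb_inj (I J : choiceType) (h : J -> I) (g : I -> R) :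
  injective h -> smb g -> smb (g \o h).
Proof.
move=> hI [M HM]; exists M => A; have := HM [fset h j | j in A]%fset.
by rewrite big_imfset//= => ? ? _ _ /hI.
Qed.

End HasSum.

Section Sums.
Variable R : realType.
Local Notation C := R[i].

Definition prodfs (I J : choiceType) (A : {fset I}) (B : {fset J}) : {fset I * J} :=
  seq_fset tt [seq (i, j) | i <- A, j <- B].

Lemma in_prodfs (I J : choiceType) (A : {fset I}) (B : {fset J}) x :
  (x \in prodfs A B) = (x.1 \in A) && (x.2 \in B).
Proof.
case: x => i j /=; rewrite seq_fsetE; apply/allpairsP/andP.
  by move=> [[a b] /= [ha hb [-> ->]]].
by move=> [ha hb]; exists (i, j).
Qed.

Lemma sum_prodfs (V : nmodType) (I J : choiceType) (A : {fset I}) (B : {fset J})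
    (F : I * J -> V) :
  \sum_(x <- prodfs A B) F x = \sum_(i <- A) \sum_(j <- B) F (i, j).
Proof.
have -> : \sum_(x <- prodfs A B) F x =
    \sum_(x <- [seq (i, j) | i <- A, j <- B]) F x.
  apply: perm_big; rewrite (perm_trans (seq_fset_perm _ _))// undup_id//.
  by apply: allpairs_uniq => // -[a b] [a' b'] /= _ _.
by rewrite big_allpairs.
Qed.

Lemma sub_prodfs (I J : choiceType) (A : {fset I * J}) (B : {fset I}) (D : {fset J}) :
  ([fset x.1 | x in A] `<=` B)%fset -> ([fset x.2 | x in A] `<=` D)%fset ->
  (A `<=` prodfs B D)%fset.
Proof.
move=> /fsubsetP h1 /fsubsetP h2; apply/fsubsetP => x xA.
by rewrite in_prodfs h1 ?h2//; apply/imfsetP; exists x.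
Qed.

(** For finitely many rows one column set [D] serves all of them: each row is then within an equal
    share of [e / 2] of its sum, while the rectangle still contains the finite set that controls the
    double sum. *)
Lemma hasum_sigma (I J : choiceType) (F : I * J -> C) (g : I -> C) (s : C) :
  hasum F s -> (forall i, hasum (fun j => F (i, j)) (g i)) -> hasum g s.
Proof.
move=> H Hi e e0; have e20 : 0 < e / 2 by rewrite divr_gt0.
have [A HA] := H _ e20.
exists [fset x.1 | x in A]%fset => B AB.
pose e' := e / 2 / (#|` B|.+1)%:R.
have e'0 : 0 < e' by rewrite divr_gt0.
have /choice[Ai HAi] : forall i, exists Ai : {fset J}, forall D : {fset J},
    (Ai `<=` D)%fset -> nm (\sum_(j <- D) F (i, j) - g i) < e'.
  by move=> i; exact: Hi.
pose D := (\bigcup_(i <- B) Ai i `|` [fset x.2 | x in A])%fset.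
have /HA : (A `<=` prodfs B D)%fset by rewrite sub_prodfs// fsubsetUr.
rewrite sum_prodfs => h1.
have h2 : nm (\sum_(i <- B) g i - \sum_(i <- B) \sum_(j <- D) F (i, j)) <= e / 2.
  rewrite -sumrB (le_trans (nm_sum _ _))//.
  apply: (@le_trans _ _ (\sum_(i <- B) e')).
    rewrite big_seq [leRHS]big_seq; apply: ler_sum => i iB.
    rewrite nm_subC ltW// HAi// /D (fsubset_trans _ (fsubsetUl _ _))//.
    exact: bigfcup_sup.
  rewrite big_const_seq count_predT iter_addr addr0 -[size B]/(#|` B|).
  rewrite -[leLHS]mulr_natr /e' mulrAC ler_pdivrMr// ler_pM2l// ler_nat.
  exact: leqnSn.
apply: le_lt_trans (nm_tri (\sum_(i <- B) \sum_(j <- D) F (i, j)) _ _) _.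
by rewrite [e]splitr ler_ltD.
Qed.

Lemma bsum_pair (I J : choiceType) (G : I * J -> R) (M : I -> R) K :
  (forall x, 0 <= G x) -> (forall i, bsum (fun j => G (i, j)) (M i)) ->
  bsum M K -> bsum G K.
Proof.
move=> G0 HM HK A.
pose B := [fset x.1 | x in A]%fset; pose D := [fset x.2 | x in A]%fset.
apply: (@le_trans _ _ (\sum_(x <- prodfs B D) G x)).
  by apply: ler_sum_fset => //; exact: sub_prodfs.
by rewrite sum_prodfs (le_trans _ (HK B))// ler_sum// => i _; exact: HM.
Qed.

Lemma smb_pair (I J : choiceType) (G : I * J -> R) (M : I -> R) :
  (forall x, 0 <= G x) -> (forall i, bsum (fun j => G (i, j)) (M i)) ->
  smb M -> smb G.
Proof. by move=> G0 HM [K HK]; exists K; exact: bsum_pair HK. Qed.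

Lemma smb_prod (I J : choiceType) (g : I -> R) (h : J -> R) :
  (forall i, 0 <= g i) -> (forall j, 0 <= h j) -> smb g -> smb h ->
  smb (fun x : I * J => g x.1 * h x.2).
Proof.
move=> g0 h0 Hg [M HM].
apply: (@smb_pair _ _ _ (fun i => M * g i)) => [x|i|]; first by rewrite mulr_ge0.
  by rewrite /= mulrC; exact: bsumZ.
by apply: smbZ Hg; exact: bsum_ge0 HM.
Qed.

Lemma smb_fst (I J : choiceType) (G : I * J -> R) i :
  smb G -> smb (fun j => G (i, j)).
Proof. by apply: (smb_inj (h := fun j => (i, j))) => a b []. Qed.

Lemma hasum_swap (I J : choiceType) (F : I * J -> C) (s : C) :
  hasum F s -> hasum (fun x : J * I => F (x.2, x.1)) s.
Proof.
move=> H; apply/(@hasum_bij _ _ _ (fun x : J * I => (x.2, x.1)) F).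
  by exists (fun x => (x.2, x.1)) => -[].
exact: H.
Qed.

Lemma hasum_exch (I J : choiceType) (F : I * J -> C) (g : I -> C) (h : J -> C) s :
  smb (fun x => nm (F x)) ->
  (forall i, hasum (fun j => F (i, j)) (g i)) ->
  (forall j, hasum (fun i => F (i, j)) (h j)) ->
  hasum g s -> hasum h s.
Proof.
move=> /smb_hasum[t Ht] Hg Hh Hs.
have := hasum_sigma Ht Hg => /(hasum_uniq Hs) st; rewrite st.
exact: (hasum_sigma (hasum_swap Ht)).
Qed.

Lemma hasum_prod (I J : choiceType) (f : I -> C) (g : J -> C) s t :
  smb (fun i => nm (f i)) -> smb (fun j => nm (g j)) ->
  hasum f s -> hasum g t -> hasum (fun x : I * J => f x.1 * g x.2) (s * t).
Proof.
move=> sf sg Hf Hg.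
have /smb_hasum[u Hu] : smb (fun x : I * J => nm (f x.1 * g x.2)).
  apply: smb_le (smb_prod (fun=> nm_ge0 _) (fun=> nm_ge0 _) sf sg) => x.
  by rewrite nmM.
have : hasum (fun i => t * f i) u.
  by apply: (hasum_sigma Hu) => i /=; rewrite mulrC; exact: hasumZ.
by move=> /(hasum_uniq (hasumZ t Hf)) e; rewrite mulrC e.
Qed.

Lemma hasum_nat_cvto (f : nat -> C) s :
  hasum f s -> cvto (fun n => \sum_(i < n) f i) s.
Proof.
move=> H e /H[A HA].
exists (\max_(i <- A) i.+1)%N => n hn.
pose B := [fset i in iota 0 n]%fset.
have -> : \sum_(i < n) f i = \sum_(i <- B) f i.
  rewrite -(big_mkord xpredT f) /index_iota subn0; apply: perm_big.
  rewrite perm_sym /B; apply: uniq_perm; rewrite ?fset_uniq ?iota_uniq//.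
  by move=> i; rewrite in_fset.
apply: HA; apply/fsubsetP => i iA; rewrite in_fset /= mem_iota add0n /=.
apply: leq_trans hn; exact: (@leq_bigmax_seq _ (enum_fset A) xpredT succn i iA isT).
Qed.

Lemma bsum_nat (g : nat -> R) M : (forall n, 0 <= g n) ->
  (forall n, \sum_(i < n) g i <= M) -> bsum g M.
Proof.
move=> g0 H A; pose n := (\max_(i <- A) i.+1)%N.
apply: le_trans (H n); rewrite -(big_mkord xpredT g) /index_iota subn0.
pose B := [fset i in iota 0 n]%fset.
have -> : \sum_(i <- iota 0 n) g i = \sum_(i <- B) g i.
  apply: perm_big; rewrite perm_sym /B.
  apply: uniq_perm; rewrite ?fset_uniq ?iota_uniq//.
  by move=> i; rewrite in_fset.
apply: ler_sum_fset => //; apply/fsubsetP => i iA; rewrite in_fset /= mem_iota /=.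
exact: (@leq_bigmax_seq _ (enum_fset A) xpredT succn i iA isT).
Qed.

(** Dominated convergence for series: outside one finite set [A] the majorant contributes at most
    [e / 4] to the sum of every [F n] and of [f], and on [A] the convergence is termwise. *)
Lemma tannery (I : choiceType) (F : nat -> I -> C) (f : I -> C) (g : I -> R)
    (S : nat -> C) :
  (forall i, cvto (fun n => F n i) (f i)) -> (forall n i, nm (F n i) <= g i) ->
  smb g -> (forall n, hasum (F n) (S n)) ->
  exists s, hasum f s /\ cvto S s.
Proof.
move=> Hc Hb Hg HS.
have fg i : nm (f i) <= g i.
  apply/ler_addgt0Pr => e /(Hc i)[n0 /(_ _ (leqnn _))].
  have := nm_tri (F n0 i) (f i) 0; rewrite !subr0 (nm_subC (f i)).
  have := Hb n0 i; lra.
have [s Hs] : exists s, hasum f s by apply: smb_hasum; exact: smb_le Hg.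
exists s; split=> // e e0.
have g0 i : 0 <= g i by apply: le_trans (fg i); exact: nm_ge0.
have [G HG] := smb_hasum_pos g0 Hg.
have e8 : 0 < e / 8 by rewrite divr_gt0.
have [A HA] := HG _ e8.
have tail (h : I -> C) t : hasum h t -> (forall i, nm (h i) <= g i) ->
    nm (t - \sum_(i <- A) h i) <= e / 4.
  move=> Ht hg; apply/ler_addgt0Pr => d /Ht[B HB].
  have /HB h1 := fsubsetUl B A.
  have h2 : nm (\sum_(i <- (B `|` A)%fset) h i - \sum_(i <- A) h i) <= e / 4.
    rewrite (big_fsetIDcond _ (mem A)) /=.
    have eA : [fset x | x in (B `|` A)%fset & x \in A]%fset = A.
      apply/fsetP => i; rewrite !inE /=.
      by case: (i \in A); rewrite ?andbF ?orbT.
    rewrite eA addrAC subrr add0r (le_trans (nm_sum _ _))//.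
    apply: (@le_trans _ _ (\sum_(i <- [fset x | x in (B `|` A)%fset & x \notin A]%fset) g i)).
      exact: ler_sum.
    have := HA _ (fsubset_refl A); have := HA _ (fsubsetUr B A).
    rewrite -!rmorph_sum -!rmorphB /= !nm_real (big_fsetIDcond _ (mem A)) /= eA.
    rewrite !ltr_norml => /andP[_ q1] /andP[q2 _].
    move: q1 q2; set u := \sum_(i <- A) _; set v := \sum_(i <- _) _; lra.
  have := nm_tri (\sum_(i <- (B `|` A)%fset) h i) t (\sum_(i <- A) h i).
  rewrite (nm_subC t (\sum_(i <- (B `|` A)%fset) h i)); lra.
have [n0 Hn0] : exists n0, forall n, (n0 <= n)%N ->
    nm (\sum_(i <- A) F n i - \sum_(i <- A) f i) < e / 4.
  have e4 : 0 < e / 4 by rewrite divr_gt0.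
  have : cvto (fun n => \sum_(i <- A) F n i) (\sum_(i <- A) f i).
    elim: (enum_fset A) => [|i l IH].
      rewrite big_nil; apply: cvto_ext (cvto_cst 0) => n.
      by rewrite big_nil.
    rewrite big_cons; apply: cvto_ext (cvtoD (Hc i) IH) => n.
    by rewrite big_cons.
  by move=> /(_ _ e4).
exists n0 => n /Hn0 h1.
have h2 := tail _ _ (HS n) (Hb n); have h3 := tail _ _ Hs fg.
have := nm_tri (\sum_(i <- A) F n i) (S n) s.
have := nm_tri (\sum_(i <- A) f i) (\sum_(i <- A) F n i) s.
move=> q1 q2; rewrite (nm_subC s) in h3.
move: h1 h2 h3 q1 q2; set x1 := nm _; set x2 := nm _; set x3 := nm _; set x4 := nm _; set x5 := nm _.
lra.
Qed.

Lemma bsum_geom (x : R) : 0 <= x < 1 -> bsum (fun n : nat => x ^+ n) (1 - x)^-1.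
Proof.
move=> /andP[x0 x1]; apply: bsum_nat => n; first by rewrite exprn_ge0.
have -> : \sum_(i < n) x ^+ i = (1 - x ^+ n) / (1 - x).
  apply: (mulIf (x := 1 - x)); first by lra.
  rewrite mulfVK; last by lra.
  by rewrite -[LHS]opprK -mulrN opprB mulrC -subrX1 opprB.
by rewrite ler_pdivrMr ?mulVf; [have := exprn_ge0 n x0; lra|lra|lra].
Qed.

Lemma smb_geom (x : R) : 0 <= x < 1 -> smb (fun n : nat => x ^+ n).
Proof. by move=> /bsum_geom; exists (1 - x)^-1. Qed.

(* n x^n <= 1 + x + ... + x^(n-1) <= 1/(1-x), applied with x = sqrt r. *)

Lemma poly_geom (k : nat) (r : R) : 0 <= r < 1 -> exists K rho : R,
  [/\ 0 <= K, 0 <= rho < 1 & forall n : nat, n%:R ^+ k * r ^+ n <= K * rho ^+ n].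
Proof.
elim: k r => [|k IH] r /andP[r0 r1].
  by exists 1, r; split; rewrite ?r0 // => n; rewrite expr0 mul1r mul1r.
have s0 := sqrtr_ge0 r; set x := Num.sqrt r in s0.
have xr : x ^+ 2 = r by exact: sqr_sqrtr.
have x1 : x < 1 by nra.
have [|K [rho [K0 rho1 H]]] := IH x; first by rewrite s0.
exists (K / (1 - x)), rho; split=> //; first by rewrite divr_ge0// subr_ge0 ltW.
move=> n; rewrite exprS -xr -exprM mulnC exprM expr2.
have h : n%:R * x ^+ n <= (1 - x)^-1.
  have xx : 0 <= x < 1 by rewrite s0.
  apply: le_trans (bsum_geom xx [fset i in iota 0 n]%fset).
  have -> : \sum_(i <- [fset i in iota 0 n]%fset) x ^+ i = \sum_(i <- iota 0 n) x ^+ i.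
    apply: perm_big; apply: uniq_perm; rewrite ?fset_uniq ?iota_uniq//.
    by move=> i; rewrite in_fset.
  rewrite [leLHS]mulr_natl.
  have -> : x ^+ n *+ n = \sum_(i <- iota 0 n) x ^+ n.
    by rewrite big_const_seq count_predT size_iota iter_addr addr0.
  rewrite big_seq [leRHS]big_seq; apply: ler_sum => i; rewrite mem_iota => /andP[_ hi].
  by apply: ler_wiXn2l => //; [exact: ltW|lia].
rewrite (_ : _ * _ = (n%:R * x ^+ n) * (n%:R ^+ k * x ^+ n)); last by ring.
rewrite (_ : K / _ * _ = (1 - x)^-1 * (K * rho ^+ n)); last by ring.
by apply: ler_pM => //; rewrite mulr_ge0// exprn_ge0// ler0n.
Qed.

Lemma smb_poly_geom (k : nat) (r : R) : 0 <= r < 1 ->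
  smb (fun n : nat => n%:R ^+ k * r ^+ n).
Proof.
move=> /(poly_geom k)[K [rho [K0 rho1 H]]].
exact: smb_le H (smbZ K0 (smb_geom rho1)).
Qed.

Lemma sqrt_ge1 (x : R) : 1 <= x -> 1 <= Num.sqrt x.
Proof. by move=> x1; rewrite -{1}(@sqrtr1 R) ler_sqrt// (le_trans ler01). Qed.

(* (n+1)^(-5/4), written with iterated square roots. *)
Definition zw (n : nat) : R := (Num.sqrt (Num.sqrt n.+1%:R)) ^- 5.

Lemma zw_gt0 n : 0 < zw n.
Proof. by rewrite invr_gt0 exprn_gt0// !sqrtr_gt0. Qed.

Lemma zw_ge0 n : 0 <= zw n. Proof. exact/ltW/zw_gt0. Qed.

(* With u_n = n^(1/4), u_(n+1)^4 - u_n^4 = 1 makes u_(n+1)^(-5) telescope. *)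

Lemma smb_zw : smb zw.
Proof.
exists 5; apply: bsum_nat => n; first exact: zw_ge0.
pose u (n : nat) : R := Num.sqrt (Num.sqrt n.+1%:R).
have u1 k : 1 <= u k.
  by rewrite /u !sqrt_ge1// ler1n.
have u4 k : u k ^+ 4 = k.+1%:R.
  by rewrite (exprM _ 2 2) sqr_sqrtr ?sqrtr_ge0// sqr_sqrtr.
have step k : (u k.+1) ^- 5 <= 4 * ((u k)^-1 - (u k.+1)^-1).
  have h : u k.+1 ^+ 4 - u k ^+ 4 = 1 by rewrite !u4 -natr1; ring.
  have a1 := u1 k; have b1 := u1 k.+1.
  set a := u k in h a1 *; set b := u k.+1 in h b1 *.
  have a0 : 0 < a by lra. have b0 : 0 < b by lra.
  have ab : a <= b.
    rewrite leNgt; apply/negP => ba.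
    have : b ^+ 4 < a ^+ 4 by rewrite ltrXn2r// ltW.
    lra.
  have h2 : 1 <= 4 * (b - a) * b ^+ 3.
    rewrite -[leLHS]h (_ : b ^+ 4 - a ^+ 4 = (b - a) * (b ^+ 3 + b ^+ 2 * a + b * a ^+ 2 + a ^+ 3)); last by ring.
    rewrite (_ : 4 * (b - a) * b ^+ 3 = (b - a) * (4 * b ^+ 3)); last by ring.
    apply: ler_wpM2l; first by lra.
    have : b ^+ 2 * a <= b ^+ 3 by rewrite [b ^+ 3]exprSr ler_wpM2l// exprn_ge0// ltW.
    have : b * a ^+ 2 <= b ^+ 3.
      have : a ^+ 2 <= b ^+ 2 by rewrite lerXn2r// nnegrE ltW.
      by move=> /(ler_wpM2l (ltW b0)); rewrite -[b * b ^+ 2]exprS.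
    have : a ^+ 3 <= b ^+ 3 by rewrite lerXn2r// nnegrE ltW.
    lra.
  rewrite (_ : 4 * _ = 4 * (b - a) * b ^+ 3 * (b ^- 3 / (a * b))); last first.
    field; rewrite (gt_eqF a0) (gt_eqF b0)//.
  apply: (@le_trans _ _ (1 * (b ^- 3 / (a * b)))).
    rewrite mul1r -invfM lef_pV2 ?posrE ?mulr_gt0 ?exprn_gt0//.
    rewrite (_ : b ^+ 5 = b ^+ 3 * (b * b)); last by ring.
    by apply: ler_wpM2l; [exact/exprn_ge0/ltW|rewrite ler_pM2r].
  by rewrite ler_wpM2r// divr_ge0 ?mulr_ge0 ?invr_ge0 ?exprn_ge0 ?ltW.
have : forall n, \sum_(i < n.+1) zw i <= 1 + 4 * (1 - (u n)^-1).
  elim => [|m IH].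
    rewrite big_ord_recr big_ord0 /= add0r /zw -/(u 0%N).
    have -> : u 0%N = 1 by rewrite /u !sqrtr1.
    by rewrite expr1n invr1; lra.
  rewrite big_ord_recr /= /zw -/(u m.+1); have := step m.
  move: IH; lra.
case: n => [_|n /(_ n) h]; first by rewrite big_ord0.
have : 0 < (u n)^-1 by rewrite invr_gt0 (lt_le_trans _ (u1 n)).
lra.
Qed.

Lemma bsum_int (g : int -> R) (h : nat -> R) M : (forall n, 0 <= g n) ->
  (forall n, g n <= h `|n|%N) -> bsum h M -> bsum g (2 * M).
Proof.
move=> g0 gh HM A.
pose A1 := [fset n in A | 0 <= n]%fset; pose A2 := [fset n in A | ~~ (0 <= n)]%fset.
have aux (B : {fset int}) : {in B &, injective absz} -> \sum_(n <- B) g n <= M.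
  move=> inj; apply: le_trans (HM [fset absz n | n in B]%fset).
  by rewrite big_imfset//=; exact: ler_sum.
have -> : \sum_(n <- A) g n = \sum_(n <- A1) g n + \sum_(n <- A2) g n.
  by rewrite (big_fsetIDcond _ (fun n : int => 0 <= n)).
have h1 : \sum_(n <- A1) g n <= M.
  by apply: aux => x y; rewrite !inE /= => /andP[_ x0] /andP[_ y0]; lia.
have h2 : \sum_(n <- A2) g n <= M.
  by apply: aux => x y; rewrite !inE /= => /andP[_ x0] /andP[_ y0]; lia.
lra.
Qed.

Lemma smb_int (g : int -> R) (h : nat -> R) : (forall n, 0 <= g n) ->
  (forall n, g n <= h `|n|%N) -> smb h -> smb g.
Proof. by move=> g0 gh [M HM]; exists (2 * M); exact: bsum_int HM. Qed.

Lemma smb_zw_int : smb (fun n : int => zw `|n|).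
Proof. by apply: (@smb_int _ zw) => //; [move=> n; exact: zw_ge0|exact: smb_zw]. Qed.

Lemma smb_zw_int2 : smb (fun x : int * int => zw `|x.1| * zw `|x.2|).
Proof.
have h (n : int) : 0 <= zw `|n| by exact: zw_ge0.
exact: smb_prod (h) (h) smb_zw_int smb_zw_int.
Qed.

Lemma zw_ge (n k : nat) : (2 <= k)%N -> (n.+1%:R ^- k : R) <= zw n.
Proof.
move=> k2; rewrite /zw; set u := Num.sqrt _.
have u1 : 1 <= u.
  by rewrite /u !sqrt_ge1// ler1n.
have u4 : u ^+ 4 = n.+1%:R.
  by rewrite (exprM _ 2 2) sqr_sqrtr ?sqrtr_ge0// sqr_sqrtr.
rewrite -u4 lef_pV2 ?posrE ?exprn_gt0 ?(lt_le_trans _ u1)//.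
by rewrite -exprM ler_weXn2l//; lia.
Qed.

End Sums.

(** * Real estimates by the mean value theorem *)

Section RealCalculus.
Variable R : realType.

(** Bridge between a quadratic error bound, the notion of derivative used for complex functions, and
    the library derivative, for which the mean value theorem is available. *)
Lemma is_derive_quad (f : R -> R) (t l K d : R) : 0 < d ->
  (forall h, `|h| < d -> `|f (t + h) - f t - h * l| <= K * h ^+ 2) ->
  is_derive t 1 f l.
Proof.
move=> d0 H.
have cv : (h^-1 *: (f (h + t) - f t) @[h --> 0^'] --> l)%classic.
  apply/cvgrPdist_le => e e0; near=> h.
  have h0 : h != 0 by near: h; exact: nbhs_dnbhs_neq.
  have K1 : 0 < `|K| + 1 by rewrite ltr_wpDl.
  have hd : `|h| < d.
    near: h; apply: nbhs_dnbhs; apply: filterS (nbhsx_ballx (0 : R) _ d0) => x.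
    by rewrite -ball_normE /= sub0r normrN.
  have he : `|h| < e / (`|K| + 1).
    near: h; apply: nbhs_dnbhs.
    have K2 : 0 < `|K| + 1 by rewrite ltr_wpDl.
    apply: filterS (nbhsx_ballx (0 : R) _ (divr_gt0 e0 K2)) => x.
    by rewrite -ball_normE /= sub0r normrN.
  have -> : l - h^-1 *: (f (h + t) - f t) = - (h^-1 * (f (t + h) - f t - h * l)).
    rewrite (addrC t) mulrBr (mulrA _ h) mulVf// mul1r opprB.
    by rewrite /GRing.scale /=.
  rewrite normrN normrM normfV ler_pdivrMl ?normr_gt0//.
  apply: le_trans (H _ hd) _; rewrite -normr_gt0 in h0.
  rewrite -[h ^+ 2]real_normK ?num_real// expr2 mulrA mulrC ler_wpM2l//.
  rewrite ltr_pdivlMr// in he; apply: le_trans (ltW he).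
  by rewrite mulrC ler_wpM2l// (le_trans (ler_norm _))// lerDl.
apply: DeriveDef; last first.
  apply: cvg_lim => //=.
  by move: cv; under eq_fun do rewrite -[X in f (X + _)]mulr1.
apply/cvg_ex; exists l.
by move: cv; under eq_fun do rewrite -[X in f (X + _)]mulr1.
Unshelve. all: by end_near. Qed.

Lemma mvt_all (f df : R -> R) (a b : R) : a <= b ->
  (forall x, a <= x <= b -> is_derive x 1 f (df x)) ->
  exists c, a <= c <= b /\ f b - f a = df c * (b - a).
Proof.
move=> ab H.
have D x : x \in `]a, b[ -> is_derive x 1 f (df x).
  by rewrite in_itv /= => /andP[/ltW h1 /ltW h2]; apply: H; rewrite h1.
have Cn : {within `[a, b], continuous f}%classic.
  apply: derivable_within_continuous => x; rewrite in_itv /= => /H dx.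
  exact: ex_derive.
have [c] := MVT_segment ab D Cn.
by rewrite in_itv /= => h1 h2; exists c.
Qed.

(** Integrates an inequality from 0. The bounds for sine and cosine below arise from each other by
    repeated use, and so do those for the numerator of [Psi]. *)
Lemma mvt_ge0 (f df : R -> R) : f 0 = 0 ->
  (forall x : R, is_derive x 1 f (df x)) -> (forall x, 0 <= x -> 0 <= df x) ->
  forall x, 0 <= x -> 0 <= f x.
Proof.
move=> f0 H H0 x x0; have [c [/andP[c0 _]]] := mvt_all x0 (fun y _ => H y).
by rewrite f0 !subr0 => ->; rewrite mulr_ge0// H0.
Qed.

Lemma sin_le_id (x : R) : 0 <= x -> sin x <= x.
Proof.
move=> x0; rewrite -subr_ge0; move: x x0.
apply: (@mvt_ge0 _ (fun x => 1 - cos x)) => [|x _].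
- by rewrite sin0 subr0.
- by rewrite subr_ge0 cos_le1.
Qed.

Lemma is_derive_sqr2 (x : R) : is_derive x 1 (fun x => x ^+ 2 / 2) x.
Proof.
apply: (@is_derive_quad _ _ _ 1 1) => // h _.
rewrite (_ : _ - _ - _ = h ^+ 2 / 2); last by field.
rewrite ger0_norm ?divr_ge0 ?sqr_ge0//; have := sqr_ge0 h; lra.
Qed.

Lemma is_derive_cube6 (x : R) : is_derive x 1 (fun x => x ^+ 3 / 6) (x ^+ 2 / 2).
Proof.
apply: (@is_derive_quad _ _ _ (`|x| + 1) 1) => // h h1.
rewrite (_ : _ - _ - _ = h ^+ 2 * (x / 2 + h / 6)); last by field.
rewrite normrM ger0_norm ?sqr_ge0// mulrC ler_wpM2r ?sqr_ge0//.
rewrite (le_trans (ler_normD _ _))// !normrM !normfV !(ger0_norm (ler0n _ _)).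
have := normr_ge0 x; lra.
Qed.

Lemma cos_ge_quad (x : R) : 0 <= x -> 1 - cos x <= x ^+ 2 / 2.
Proof.
move=> x0; rewrite -subr_ge0; move: x x0.
apply: (@mvt_ge0 _ (fun x => x - sin x)) => [|x|x /sin_le_id]; last by rewrite subr_ge0.
  by rewrite cos0 expr0n /= mul0r subrr subr0.
apply: is_deriveB; first exact: is_derive_sqr2.
rewrite -[sin x]opprK -[X in is_derive _ _ _ X]sub0r; exact: is_deriveB.
Qed.

Lemma sin_ge_cube (x : R) : 0 <= x -> x - x ^+ 3 / 6 <= sin x.
Proof.
move=> x0; rewrite -subr_ge0; move: x x0.
apply: (@mvt_ge0 _ (fun x => cos x - (1 - x ^+ 2 / 2))) => [|x|x /cos_ge_quad].
- by rewrite sin0 expr0n /= mul0r !subr0.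
- apply: is_deriveB; apply: is_deriveB; exact: is_derive_cube6.
- lra.
Qed.

Lemma cos_near0 (y : R) : `|cos y - 1| <= y ^+ 2.
Proof.
rewrite -cos_norm -[y ^+ 2]real_normK ?num_real// distrC.
have := cos_ge_quad (normr_ge0 y); have := cos_le1 `|y|; have := sqr_ge0 `|y|.
move=> h1 h2 h3; have h4 : 0 <= 1 - cos `|y| by rewrite subr_ge0.
rewrite (ger0_norm h4); apply: le_trans h3 _.
by rewrite ler_pdivrMr// ler_peMr// ler1n.
Qed.

Lemma sin_near0 (y : R) : `|y| <= 1 -> `|sin y - y| <= y ^+ 2.
Proof.
wlog y0 : y / 0 <= y.
  move=> W; case: (lerP 0 y) => [/W//|y0 y1].
  have := W (- y); rewrite normrN sqrrN sinN => /(_ _ y1) H.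
  rewrite -normrN opprD; apply: H; rewrite oppr_ge0; exact: ltW.
rewrite ger0_norm// => y1.
have h1 := sin_le_id y0; have h2 := sin_ge_cube y0.
rewrite distrC ger0_norm ?subr_ge0//.
have h3 : y ^+ 3 <= y ^+ 2 by rewrite exprSr ler_piMr ?sqr_ge0.
have := sqr_ge0 y; lra.
Qed.

Lemma sin_lower (x : R) : 0 <= x <= pi / 2 -> x / 3 <= sin x.
Proof.
move=> /andP[x0 x1]; apply: le_trans (sin_ge_cube x0).
have : x <= 2 by have := @pihalf_lt2 R; lra.
move=> x2; have : x * x ^+ 2 <= x * 4 by apply: ler_wpM2l => //; nra.
rewrite -exprS; lra.
Qed.

Lemma exp_near0 (x : R) : `|x| <= 1 / 2 -> `|expR x - 1 - x| <= 2 * x ^+ 2.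
Proof.
rewrite ler_norml => /andP[x0 x1].
have h1 := expR_ge1Dx x; rewrite ger0_norm; last by lra.
have h2 := expR_ge1Dx (- x); rewrite expRN in h2.
have e0 := expR_gt0 x; set e := expR x in h1 h2 e0 *.
have h3 : (1 - x) * e <= 1.
  by have := ler_wpM2r (ltW e0) h2; rewrite mulVf// lt0r_neq0.
have : (1 - x) * (e - 1 - x) <= (1 - x) * (2 * x ^+ 2) by nra.
by rewrite ler_pM2l//; lra.
Qed.

End RealCalculus.

(** * Complex exponential and complex derivative *)

Section ComplexExp.
Variable R : realType.
Local Notation C := R[i].
Implicit Types (z w : C).

Lemma cexpD z w : cexp (z + w) = cexp z * cexp w.
Proof.
rewrite /cexp ReD ImD expRD cosD sinD rmorphM /= mulrACA; congr (_ * _).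
by apply: complex_ext => /=; ring.
Qed.

Lemma cexp0 : cexp (0 : C) = 1.
Proof. by rewrite /cexp /= expR0 cos0 sin0 mul1r. Qed.

Lemma nm_cexp z : nm (cexp z) = expR (complex.Re z).
Proof.
rewrite /cexp nmM nm_real ger0_norm ?expR_ge0//.
by rewrite /nm /= cos2Dsin2 sqrtr1 mulr1.
Qed.

Lemma cexp_neq0 z : cexp z != 0.
Proof. by rewrite -nm_gt0 nm_cexp expR_gt0. Qed.

Lemma cexpN z : cexp (- z) = (cexp z)^-1.
Proof.
by apply: (mulfI (cexp_neq0 z)); rewrite -cexpD subrr cexp0 mulfV ?cexp_neq0.
Qed.

Lemma cexpMn z n : cexp (n%:R * z) = cexp z ^+ n.
Proof.
by elim: n => [|n IH]; rewrite ?mul0r ?cexp0// -natr1 mulrDl mul1r cexpD IH exprSr.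
Qed.

Lemma cexp_real (x : R) : cexp x%:C = (expR x)%:C.
Proof. by rewrite /cexp /= cos0 sin0 mulr1. Qed.

Lemma conj_cexp z : conjc (cexp z) = cexp (conjc z).
Proof.
case: z => a b; rewrite /cexp /= cosN sinN; apply: complex_ext => /=; ring.
Qed.

Lemma cexp_near0 z : nm z <= 1 / 2 -> nm (cexp z - 1 - z) <= 20 * nm z ^+ 2.
Proof.
move=> z1; set x := complex.Re z; set y := complex.Im z.
have hx : `|x| <= 1 / 2 by exact: le_trans (Re_nm z) z1.
have hy : `|y| <= 1 / 2 by exact: le_trans (Im_nm z) z1.
have E := exp_near0 hx; have Cy := cos_near0 y.
have Sy : `|sin y - y| <= y ^+ 2 by apply: sin_near0; lra.
have e2 : expR x <= 2.
  have := E; have x2 : x ^+ 2 <= 1 / 4.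
    by rewrite -[x ^+ 2]real_normK ?num_real//; have := normr_ge0 x; nra.
  move: hx; rewrite !ler_norml; lra.
have e0 := expR_gt0 x.
have -> : cexp z - 1 - z = ((expR x - 1 - x) + expR x * (cos y - 1)) +i*
    (expR x * (sin y - y) + (expR x - 1 - x) * y + x * y).
  by apply: complex_ext; rewrite !(ReD, ImD, ReN, ImN) /cexp !(ReM, ImM) /= -/x -/y; ring.
rewrite nm_sqr -/x -/y; apply: le_trans (nm_ReIm _) _ => /=.
have x2 := sqr_ge0 x; have y2 := sqr_ge0 y.
have H1 : `|expR x - 1 - x + expR x * (cos y - 1)| <= 2 * x ^+ 2 + 2 * y ^+ 2.
  rewrite (le_trans (ler_normD _ _))// lerD// normrM ger0_norm ?(ltW e0)//.
  by apply: ler_pM => //; exact: ltW.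
have H2 : `|expR x * (sin y - y) + (expR x - 1 - x) * y + x * y| <=
   2 * y ^+ 2 + 2 * x ^+ 2 + (x ^+ 2 + y ^+ 2).
  rewrite (le_trans (ler_normD _ _))// lerD//; last first.
    rewrite normrM -[x ^+ 2]real_normK ?num_real// -[y ^+ 2]real_normK ?num_real//.
    by have := normr_ge0 x; have := normr_ge0 y; nra.
  rewrite (le_trans (ler_normD _ _))// lerD//.
    by rewrite normrM ger0_norm ?(ltW e0)//; apply: ler_pM => //; exact: ltW.
  by rewrite normrM -[leRHS]mulr1; apply: ler_pM => //; lra.
lra.
Qed.

Lemma e2piD z w : e2pi (z + w) = e2pi z * e2pi w.
Proof. by rewrite /e2pi mulrDr cexpD. Qed.

Lemma e2pi0 : e2pi (0 : C) = 1.
Proof. by rewrite /e2pi mulr0 cexp0. Qed.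

Lemma e2pi_neq0 z : e2pi z != 0. Proof. exact: cexp_neq0. Qed.

Lemma e2piN z : e2pi (- z) = (e2pi z)^-1.
Proof. by rewrite /e2pi mulrN cexpN. Qed.

Lemma e2piB z w : e2pi (z - w) = e2pi z / e2pi w.
Proof. by rewrite e2piD e2piN. Qed.

Lemma e2piMn z n : e2pi (n%:R * z) = e2pi z ^+ n.
Proof. by rewrite /e2pi mulrCA cexpMn. Qed.

Lemma e2pi1 : e2pi (1 : C) = 1.
Proof.
rewrite /e2pi mulr1 /cexp /= expR0 mul1r.
have -> : 2 * pi = pi *+ 2 :> R by rewrite mulr_natl.
by rewrite cos2pi sin2pi.
Qed.

Lemma e2pi_nat n : e2pi (n%:R : C) = 1.
Proof. by rewrite -[n%:R]mulr1 e2piMn e2pi1 expr1n. Qed.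

Lemma e2pi_int (n : int) : e2pi (n%:~R : C) = 1.
Proof.
case: n => n; first exact: e2pi_nat.
by rewrite NegzE mulrNz e2piN (e2pi_nat n.+1) invr1.
Qed.

Lemma e2piDint z (n : int) : e2pi (z + n%:~R) = e2pi z.
Proof. by rewrite e2piD e2pi_int mulr1. Qed.

Lemma nm_e2pi z : nm (e2pi z) = expR (- (2 * pi * complex.Im z)).
Proof. by rewrite /e2pi nm_cexp ReM /= mul0r sub0r. Qed.

Lemma nm_e2pi_real (x : R) : nm (e2pi x%:C) = 1.
Proof. by rewrite nm_e2pi /= mulr0 oppr0 expR0. Qed.

Lemma conj_e2pi z : conjc (e2pi z) = e2pi (- conjc z).
Proof.
by case: z => a b; rewrite /e2pi conj_cexp; congr cexp; apply: complex_ext => /=; ring.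
Qed.

Lemma e2pi_real (x : R) : e2pi x%:C = cos (2 * pi * x) +i* sin (2 * pi * x).
Proof. by rewrite /e2pi /cexp /=; apply: complex_ext; rewrite !(ReM, ImM) /=; rewrite !(mulr0, mul0r, subr0, add0r, addr0, expR0, mul1r, oppr0). Qed.

(** The right-hand side is [2 * |sin (pi * t)|]; since pi >= 2, the crude bound [x / 3 <= sin x]
    already suffices. *)
Lemma e2pi_dist (t : R) : `|t| <= 1 / 2 -> `|t| <= nm (1 - e2pi t%:C).
Proof.
move=> t2.
have E : nm (1 - e2pi t%:C) = 2 * `|sin (pi * t)|.
  rewrite -[RHS]ger0_norm ?mulr_ge0// -sqrtr_sqr /nm e2pi_real /=.
  congr Num.sqrt; rewrite exprMn real_normK ?num_real// sub0r sqrrN.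
  have -> : 2 * pi * t = (pi * t) *+ 2 by rewrite -mulr_natl; ring.
  rewrite cos_mulr2n sin_mulr2n -(mulr_natl (cos _ ^+ 2)) -(mulr_natl (cos _ * _)).
  have := cos2Dsin2 (pi * t); set c := cos _; set s := sin _ => h.
  have -> : c ^+ 2 = 1 - s ^+ 2 by rewrite -h; ring.
  rewrite (_ : (2 * (c * s)) ^+ 2 = 4 * c ^+ 2 * s ^+ 2); last by ring.
  have -> : c ^+ 2 = 1 - s ^+ 2 by rewrite -h; ring.
  by ring.
rewrite E; have -> : `|sin (pi * t)| = `|sin (pi * `|t|)|.
  case: (leP 0 t) => [|/ltW] t0; first by rewrite (ger0_norm t0).
  by rewrite (ler0_norm t0) mulrN sinN normrN.
have p2 := @pi_ge2 R.
have h : pi * `|t| / 3 <= sin (pi * `|t|).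
  by apply: sin_lower; have := normr_ge0 t; nra.
have := ler_norm (sin (pi * `|t|)); have := normr_ge0 t; nra.
Qed.

End ComplexExp.

(** * Complex derivatives and the mean value inequality *)

Section ComplexDerivative.
Variable R : realType.
Local Notation C := R[i].
Implicit Types (f g : C -> C) (z w l m : C).

(* Complex derivative with a quadratic error term: this is all that is needed for
   analytic functions, and composes without any limit argument. *)
Definition cder f z l := exists K d : R, 0 < d /\
  forall h, nm h < d -> nm (f (z + h) - f z - h * l) <= K * nm h ^+ 2.

Lemma cder_K f z l : cder f z l -> exists K d : R, [/\ 0 < d, 0 <= K, d <= 1 &
  forall h, nm h < d -> nm (f (z + h) - f z - h * l) <= K * nm h ^+ 2].
Proof.
move=> [K [d [d0 H]]]; exists `|K|, (Num.min d 1); split=> //.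
- by rewrite lt_min d0 ltr01.
- by rewrite ge_min lexx orbT.
move=> h; rewrite lt_min => /andP[/H h1 _]; apply: le_trans h1 _.
by rewrite ler_wpM2r ?exprn_ge0 ?nm_ge0// ler_norm.
Qed.

Lemma cder_cst c z : cder (fun=> c) z 0.
Proof. by exists 0, 1; split=> // h _; rewrite subrr mulr0 subrr nm0 mul0r. Qed.

Lemma cder_id z : cder id z 1.
Proof.
exists 0, 1; split=> // h _.
by rewrite /= mulr1 (addrC z) addrK subrr nm0 mul0r.
Qed.

Lemma cder_ext f g z l : (forall w, f w = g w) -> cder f z l -> cder g z l.
Proof. by move=> /funext ->. Qed.

Lemma cder_near f g z l d : 0 < d -> (forall w, nm (w - z) < d -> f w = g w) ->
  cder f z l -> cder g z l.
Proof.
move=> d0 fg [K [d' [d'0 H]]]; exists K, (Num.min d d'); split.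
  by rewrite lt_min d0.
move=> h; rewrite lt_min => /andP[h1 h2]; rewrite -!fg ?H//.
  by rewrite subrr nm0.
by rewrite addrAC subrr add0r.
Qed.

Lemma cderD f g z l m : cder f z l -> cder g z m ->
  cder (fun w => f w + g w) z (l + m).
Proof.
move=> [K [d [d0 H]]] [K' [d' [d'0 H']]]; exists (K + K'), (Num.min d d').
split; first by rewrite lt_min d0.
move=> h; rewrite lt_min => /andP[/H h1 /H' h2].
rewrite (_ : _ - _ = (f (z + h) - f z - h * l) + (g (z + h) - g z - h * m)).
  by rewrite (le_trans (nmD _ _))// mulrDl lerD.
by ring.
Qed.

Lemma cderZ c f z l : cder f z l -> cder (fun w => c * f w) z (c * l).
Proof.
move=> [K [d [d0 H]]]; exists (nm c * K), d; split=> // h /H h1.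
rewrite (_ : _ - _ = c * (f (z + h) - f z - h * l)); last by ring.
by rewrite nmM -mulrA ler_wpM2l// nm_ge0.
Qed.

Lemma cderN f z l : cder f z l -> cder (fun w => - f w) z (- l).
Proof.
by move=> /(cderZ (-1)); rewrite mulN1r; apply: cder_ext => w; rewrite mulN1r.
Qed.

Lemma cderB f g z l m : cder f z l -> cder g z m ->
  cder (fun w => f w - g w) z (l - m).
Proof. by move=> H /cderN; exact: cderD. Qed.

Lemma cder_lip f z l : cder f z l -> exists K d : R, [/\ 0 < d, 0 <= K &
  forall h, nm h < d -> nm (f (z + h) - f z) <= K * nm h].
Proof.
move=> /cder_K[K [d [d0 K0 d1 H]]]; exists (K + nm l), d; split=> //.
  by rewrite addr_ge0// nm_ge0.
move=> h hd; have := H _ hd; have := nmD (f (z + h) - f z - h * l) (h * l).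
rewrite subrK nmM mulrDl => h1 h2; apply: le_trans h1 _; rewrite (mulrC (nm l)) lerD2r.
apply: le_trans h2 _; rewrite expr2 mulrA ler_piMr ?mulr_ge0 ?nm_ge0//.
by rewrite (le_trans (ltW hd)).
Qed.

Lemma cderM f g z l m : cder f z l -> cder g z m ->
  cder (fun w => f w * g w) z (l * g z + f z * m).
Proof.
move=> /[dup] /cder_lip[L [e [e0 L0 HL]]] /cder_K[K [d [d0 K0 d1 H]]].
move=> /[dup] /cder_lip[L' [e' [e'0 L'0 HL']]] /cder_K[K' [d' [d'0 K'0 d'1 H']]].
exists (K * nm (g z) + nm (f z) * K' + L * L'), (Num.min (Num.min e d) (Num.min e' d')).
split; first by rewrite !lt_min e0 d0 e'0 d'0.
move=> h; rewrite !lt_min => /andP[/andP[/HL h1 /H h2] /andP[/HL' h3 /H' h4]].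
rewrite (_ : _ - _ = (f (z + h) - f z - h * l) * g z + f z * (g (z + h) - g z - h * m)
   + (f (z + h) - f z) * (g (z + h) - g z)); last by ring.
apply: le_trans (nmD _ _) _; rewrite [leRHS]mulrDl; apply: lerD.
  apply: le_trans (nmD _ _) _; rewrite [leRHS]mulrDl; apply: lerD; rewrite nmM.
    by rewrite mulrAC ler_wpM2r// nm_ge0.
  by rewrite -mulrA ler_wpM2l// nm_ge0.
rewrite nmM (_ : L * L' * _ = (L * nm h) * (L' * nm h)); last by ring.
by apply: ler_pM => //; exact: nm_ge0.
Qed.

Lemma cder_eq f z l l' : l = l' -> cder f z l -> cder f z l'.
Proof. by move=> ->. Qed.

Lemma cder_comp f g z l m : cder g z m -> cder f (g z) l ->
  cder (fun w => f (g w)) z (l * m).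
Proof.
move=> /[dup] /cder_lip[L [e [e0 L0 HL]]] /cder_K[K [d [d0 K0 d1 H]]].
move=> /cder_K[K' [d' [d'0 K'0 d'1 H']]].
have L1 : 0 < L + 1 by rewrite ltr_wpDl.
exists (K' * L ^+ 2 + nm l * K), (Num.min (Num.min e d) (d' / (L + 1))).
split; first by rewrite !lt_min e0 d0 divr_gt0.
move=> h; rewrite !lt_min => /andP[/andP[/HL h1 /H h2]].
rewrite ltr_pdivlMr// => h3.
have h4 : nm (g (z + h) - g z) < d'.
  apply: le_lt_trans h1 (le_lt_trans _ h3).
  by rewrite mulrDr mulr1 mulrC lerDl nm_ge0.
have := H' _ h4; rewrite (addrC (g z)) subrK => h5.
rewrite (_ : _ - _ - _ = (f (g (z + h)) - f (g z) - (g (z + h) - g z) * l)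
   + l * (g (z + h) - g z - h * m)); last by ring.
apply: le_trans (nmD _ _) _; rewrite [leRHS]mulrDl; apply: lerD.
  apply: le_trans h5 _; rewrite -mulrA ler_wpM2l// -exprMn lerXn2r// nnegrE.
    exact: nm_ge0.
  by rewrite mulr_ge0// nm_ge0.
by rewrite nmM -mulrA ler_wpM2l// nm_ge0.
Qed.

Lemma cder_inv z : z != 0 -> cder (fun w => w^-1) z (- z ^- 2).
Proof.
move=> z0; have n0 : 0 < nm z by rewrite nm_gt0.
exists (2 / nm z ^+ 3), (nm z / 2); split; first by rewrite divr_gt0.
move=> h hz; have h2 : nm z / 2 <= nm (z + h).
  have := nmB (z + h) h; rewrite addrK; lra.
have zh0 : z + h != 0 by rewrite -nm_gt0; lra.
rewrite (_ : _ - _ - _ = h ^+ 2 / (z ^+ 2 * (z + h))); last first.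
  by field; rewrite zh0 z0.
rewrite nmM nmV nmM !nmX mulrC ler_wpM2r ?exprn_ge0 ?nm_ge0//.
rewrite -[X in _ <= X]invrK lef_pV2 ?posrE ?mulr_gt0 ?exprn_gt0 ?nm_gt0 ?invr_gt0 ?divr_gt0//.
  by rewrite invf_div exprSr -mulrA ler_wpM2l// exprn_ge0// nm_ge0.
exact: exprn_gt0.
Qed.

Lemma cderV f z l : f z != 0 -> cder f z l -> cder (fun w => (f w)^-1) z (- l / f z ^+ 2).
Proof.
move=> fz H; have := cder_comp H (cder_inv fz).
by apply: cder_eq; rewrite mulrC mulrN mulNr.
Qed.

Lemma cderX n z : cder (fun w => w ^+ n.+1) z (n.+1%:R * z ^+ n).
Proof.
elim: n => [|n IH].
  by rewrite expr0 mulr1; apply: cder_ext (cder_id z) => w; rewrite expr1.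
have := cderM (cder_id z) IH; rewrite mul1r.
apply: cder_eq => /=; rewrite exprS -[n.+2%:R]natr1; ring.
Qed.

Lemma cder_cexp z : cder (@cexp R) z (cexp z).
Proof.
exists (nm (cexp z) * 20), (1 / 2); split=> // h h1.
rewrite (_ : _ - _ - _ = cexp z * (cexp h - 1 - h)); last by rewrite cexpD; ring.
by rewrite nmM -mulrA ler_wpM2l ?nm_ge0// cexp_near0// ltW.
Qed.

Lemma cder_cexp_comp f z l : cder f z l ->
  cder (fun w => cexp (f w)) z (cexp (f z) * l).
Proof. by move=> H; exact: cder_comp H (cder_cexp _). Qed.

Lemma cder_e2pi z : cder (@e2pi R) z (e2pi z * (0 +i* (2 * pi))).
Proof.
apply: cder_cexp_comp; rewrite -[X in cder _ _ X]mulr1.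
exact: cderZ (cder_id z).
Qed.

Lemma cder_uniq f z l l' : cder f z l -> cder f z l' -> l = l'.
Proof.
move=> /cder_K[K [d [d0 K0 _ H]]] /cder_K[K' [d' [d'0 K'0 _ H']]].
apply: nm_small_eq => e e0.
have K2 : 0 < K + K' + 1 by rewrite ltr_wpDl// addr_ge0.
pose t := Num.min (Num.min (d / 2) (d' / 2)) (e / 2 / (K + K' + 1)).
have t0 : 0 < t by rewrite /t !lt_min !divr_gt0.
have td : t < d by rewrite /t !gt_min; apply/orP; left; apply/orP; left; lra.
have td' : t < d' by rewrite /t !gt_min; apply/orP; left; apply/orP; right; lra.
have te : t * (K + K' + 1) <= e / 2.
  by rewrite -ler_pdivlMr// /t ge_min lexx orbT.
have nt : nm t%:C = t by rewrite nm_real gtr0_norm.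
have := H t%:C; have := H' t%:C; rewrite !nt => /(_ td') h1 /(_ td) h2.
have h3 : t * nm (l - l') <= (K + K') * t ^+ 2.
  rewrite -[X in X * _]nt -nmM.
  rewrite (_ : _ * _ = (f (z + t%:C) - f z - t%:C * l') - (f (z + t%:C) - f z - t%:C * l)).
    by rewrite (le_trans (nmB _ _))// mulrDl addrC lerD.
  by ring.
have h4 : nm (l - l') <= (K + K') * t by move: h3; rewrite expr2 mulrCA ler_pM2l.
nra.
Qed.

(** With [u = f z1 - f z0], the real function [Re (conj u * f)] grows by [|u|^2] along the segment,
    and the real mean value theorem bounds this growth by [|u|] times the claimed bound. This
    inequality takes over the role of contour integrals. *)
Lemma cmvt f z0 z1 (M : R) :
  (forall t : R, 0 <= t <= 1 -> exists l, cder f (z0 + t%:C * (z1 - z0)) l /\ nm l <= M) ->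
  nm (f z1 - f z0) <= M * nm (z1 - z0).
Proof.
move=> H.
have [->|fne] := eqVneq (f z1) (f z0).
  have [|l [_ h]] := H 0; first by rewrite lexx ler01.
  by rewrite subrr nm0 mulr_ge0 ?nm_ge0// (le_trans _ h)// nm_ge0.
have n0 : 0 < nm (f z1 - f z0) by rewrite nm_gt0 subr_eq0.
set u := f z1 - f z0 in n0 *; set dz := z1 - z0.
pose L (t : R) := if pselect (0 <= t <= 1) is left p then projT1 (cid (H t p)) else 0.
have HL t : 0 <= t <= 1 -> cder f (z0 + t%:C * dz) (L t) /\ nm (L t) <= M.
  by move=> ht; rewrite /L; case: pselect => // p; case: cid.
pose phi (t : R) := complex.Re (conjc u * f (z0 + t%:C * dz)).
pose dphi (t : R) := complex.Re (conjc u * (dz * L t)).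
have D (t : R) : 0 <= t <= 1 -> is_derive t 1 phi (dphi t).
  move=> /HL[/cder_K[K [d [d0 K0 d1 Hd]]] _].
  have z1' : 0 < nm dz + 1 by rewrite ltr_wpDl ?nm_ge0.
  apply: (@is_derive_quad _ _ _ _ (nm u * K * nm dz ^+ 2) (d / (nm dz + 1))).
    by rewrite divr_gt0.
  move=> h; rewrite ltr_pdivlMr// => hd.
  have hd' : nm (h%:C * dz) < d.
    rewrite nmM nm_real; apply: le_lt_trans hd.
    by rewrite mulrDr mulr1 lerDl.
  have := Hd _ hd'; set E := _ - _ - _ => HE.
  have -> : phi (t + h) - phi t - h * dphi t = complex.Re (conjc u * E).
    have -> : h * dphi t = complex.Re (h%:C * (conjc u * (dz * L t))).
      by rewrite [RHS]ReM /= mul0r subr0.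
    rewrite /phi -!ReN -!ReD; congr complex.Re; rewrite /E.
    have -> : z0 + (t + h)%:C * dz = z0 + t%:C * dz + h%:C * dz.
      by rewrite rmorphD /=; ring.
    by ring.
  apply: le_trans (Re_nm _) _; rewrite nmM nm_conj.
  rewrite -!mulrA ler_wpM2l ?nm_ge0//; apply: le_trans HE _.
  rewrite ler_wpM2l// nmM nm_real exprMn real_normK ?num_real//.
  by rewrite expr2 mulrC mulrA.
have [c [/HL[_ hc]]] := mvt_all ler01 D.
rewrite subr0 mulr1 /phi mul1r mul0r addr0 (_ : z0 + dz = z1); last by rewrite /dz addrC subrK.
have -> : complex.Re (conjc u * f z1) - complex.Re (conjc u * f z0) = nm u ^+ 2.
  rewrite -ReN -ReD -mulrN -mulrDr -/u nm_sqr ReM.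
  by case: (u) => a b /=; ring.
move=> h.
have : nm u ^+ 2 <= nm u * (nm dz * M).
  rewrite h /dphi (le_trans (ler_norm _))// (le_trans (Re_nm _))// nmM nm_conj.
  by rewrite ler_wpM2l ?nm_ge0// nmM ler_wpM2l// nm_ge0.
by rewrite expr2 ler_pM2l// mulrC.
Qed.

Lemma cder0_cst f z0 z1 :
  (forall t : R, 0 <= t <= 1 -> cder f (z0 + t%:C * (z1 - z0)) 0) -> f z1 = f z0.
Proof.
move=> H; have := @cmvt f z0 z1 0; rewrite mul0r => h.
apply/eqP; rewrite -subr_eq0 -nm_eq0; apply/eqP/le_anti.
rewrite nm_ge0 andbT; apply: h => t /H h; exists 0; by rewrite nm0.
Qed.

(** Quadratic remainders with summable constants add up to a quadratic remainder, so termwise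
    differentiation needs no interchange of limits. *)
Lemma cder_hasum (I : choiceType) (F : I -> C -> C) (F' : I -> C) (B : I -> R)
    (f : C -> C) z l d : 0 < d ->
  (forall i h, nm h < d -> nm (F i (z + h) - F i z - h * F' i) <= B i * nm h ^+ 2) ->
  smb B -> (forall h, nm h < d -> hasum (fun i => F i (z + h)) (f (z + h))) ->
  hasum F' l -> cder f z l.
Proof.
move=> d0 HB [K HK] Hf Hl; exists K, d; split=> // h hd.
have f0 := Hf 0; rewrite addr0 nm0 in f0.
have := hasumB (hasumB (Hf _ hd) (f0 d0)) (hasumZ h Hl).
move=> /hasum_bound; apply; last by rewrite mulrC; apply: bsumZ HK; exact: sqr_ge0.
by move=> i /=; rewrite (le_trans (HB _ _ hd))// mulrC.
Qed.

End ComplexDerivative.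

(** * The primitive of exp(u^2) *)

Section Erf.
Variable R : realType.
Local Notation C := R[i].
Implicit Types (z w u : C).

Lemma nm_tri_lt (y x z : C) (a b c : R) :
  nm (x - y) <= a -> nm (y - z) < b -> a + b <= c -> nm (x - z) < c.
Proof.
by move=> h1 h2; apply: lt_le_trans; apply: le_lt_trans (nm_tri y _ _) (ler_ltD h1 h2).
Qed.

Lemma nm_tri_le (y x z : C) (a b c : R) :
  nm (x - y) <= a -> nm (y - z) <= b -> a + b <= c -> nm (x - z) <= c.
Proof.
by move=> h1 h2; apply: le_trans; apply: le_trans (nm_tri y _ _) (lerD h1 h2).
Qed.

Lemma hasum_smb_pos (I : choiceType) (g : I -> R) t : (forall i, 0 <= g i) ->
  hasum (fun i => (g i)%:C) t -> smb g.
Proof.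
move=> g0 H; exists (complex.Re t) => A; apply/ler_addgt0Pr => e /H[B HB].
have := HB _ (fsubsetUl B A); rewrite -rmorph_sum /= => h.
have h2 := ler_sum_fset g0 (fsubsetUr B A).
apply: le_trans h2 _; move: h; set v := \sum_(i <- _) _ => h.
have := Re_nm (v%:C - t); rewrite ReD ReN /=.
by move=> /le_lt_trans /(_ h); rewrite ltr_norml; lra.
Qed.

Lemma pow_quad z h n : nm h <= 1 ->
  nm ((z + h) ^+ n - z ^+ n - h * (n%:R * z ^+ n.-1)) <=
    n%:R ^+ 2 * (nm z + 1) ^+ n * nm h ^+ 2.
Proof.
move=> h1; have M1 : 1 <= nm z + 1 by rewrite lerDr nm_ge0.
elim: n => [|n IH].
  by rewrite !expr0 mul0r mulr0 subrr subr0 nm0 expr0n /= !mul0r.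
have -> : (z + h) ^+ n.+1 - z ^+ n.+1 - h * (n.+1%:R * z ^+ n.+1.-1) =
   (z + h) * ((z + h) ^+ n - z ^+ n - h * (n%:R * z ^+ n.-1)) + n%:R * (h ^+ 2 * z ^+ n.-1).
  by case: n {IH} => [|n] /=; rewrite ?expr0 ?expr1 ?mul0r ?exprS -?natr1; ring.
apply: le_trans (nmD _ _) _; rewrite !nmM nm_nat !nmX.
have a1 : nm (z + h) <= nm z + 1 by apply: le_trans (nmD _ _) _; rewrite lerD2l.
have a2 : nm z ^+ n.-1 <= (nm z + 1) ^+ n.+1.
  apply: (@le_trans _ _ ((nm z + 1) ^+ n.-1)).
    by rewrite lerXn2r ?nnegrE ?nm_ge0 ?addr_ge0 ?nm_ge0// lerDl.
  by rewrite ler_weXn2l//; lia.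
have a3 : nm (z + h) * nm ((z + h) ^+ n - z ^+ n - h * (n%:R * z ^+ n.-1)) <=
    (nm z + 1) * (n%:R ^+ 2 * (nm z + 1) ^+ n * nm h ^+ 2).
  by apply: ler_pM => //; exact: nm_ge0.
apply: le_trans (lerD a3 (lexx _)) _.
have a4 : n%:R * (nm h ^+ 2 * nm z ^+ n.-1) <= n%:R * ((nm z + 1) ^+ n.+1 * nm h ^+ 2).
  by rewrite ler_wpM2l// mulrC ler_wpM2r// sqr_ge0.
apply: le_trans (lerD (lexx _) a4) _.
rewrite (_ : _ + _ = (n%:R ^+ 2 + n%:R) * ((nm z + 1) ^+ n.+1 * nm h ^+ 2)); last first.
  by rewrite [_ ^+ n.+1]exprS; ring.
rewrite -[leRHS]mulrA ler_wpM2r ?mulr_ge0 ?exprn_ge0 ?nm_ge0// ?(le_trans ler01)//.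
by rewrite -natrX -natrD -natrX ler_nat; lia.
Qed.

Lemma smb_expcoef (k : nat) (r : R) : 0 <= r ->
  smb (fun n : nat => n%:R ^+ k * (r ^+ n / n`!%:R)).
Proof.
move=> r0.
have [n0 Hn0] : exists n0 : nat, 2 * r < n0%:R.
  by exists (Num.truncn (2 * r)).+1; rewrite truncnS_gt.
(* From [n0] on the ratio of successive terms is at most 1/2; the factor [2 ^+ n0 * (r + 1) ^+ n0]
   covers the terms before that. *)
pose K : R := 2 ^+ n0 * (r + 1) ^+ n0.
have K0 : 0 <= K by rewrite !mulr_ge0 ?exprn_ge0// addr_ge0.
have H n : r ^+ n / n`!%:R <= K * 2^-1 ^+ n.
  elim: n => [|n IH].
    rewrite fact0 expr0 divr1 expr0 mulr1 /K.
    have h1 : 1 <= (2 : R) ^+ n0 by rewrite exprn_ege1// ler1n.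
    have h3 : 1 <= (r + 1) ^+ n0 by rewrite exprn_ege1// lerDr.
    by rewrite !mulr_ege1.
  have [nn|nn] := leqP n0 n.
    have nr : r / n.+1%:R <= 2^-1.
      rewrite ler_pdivrMr// ler_pdivlMl//; apply: (le_trans (ltW Hn0)).
      by rewrite ler_nat leqW.
    rewrite factS natrM exprS (_ : _ / _ = (r / n.+1%:R) * (r ^+ n / n`!%:R)); last first.
      by field; rewrite ?nat1r ?pnatr_eq0 -?lt0n ?fact_gt0.
    by rewrite exprS [leRHS]mulrCA; apply: ler_pM nr IH => //; apply: divr_ge0 => //; exact: exprn_ge0.
  apply: (@le_trans _ _ ((r + 1) ^+ n0)).
    apply: (@le_trans _ _ (r ^+ n.+1)).
      by rewrite ler_pdivrMr ?ltr0n ?fact_gt0// ler_peMr ?exprn_ge0// ler1n fact_gt0.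
    apply: (@le_trans _ _ ((r + 1) ^+ n.+1)).
      by rewrite lerXn2r ?nnegrE ?addr_ge0// lerDl.
    by rewrite ler_weXn2l// lerDr.
  rewrite /K mulrAC ler_peMl ?exprn_ge0 ?addr_ge0//.
  by rewrite exprVn ler_pdivlMr ?exprn_gt0// mul1r ler_weXn2l// ler1n.
apply: (@smb_le _ _ _ (fun n => K * (n%:R ^+ k * 2^-1 ^+ n))) => [n|].
  by rewrite [leRHS]mulrCA ler_wpM2l ?exprn_ge0.
apply: smbZ K0 _; apply: smb_poly_geom; rewrite invr_ge0 ler0n /=.
by rewrite invf_lt1// ltr1n.
Qed.

Lemma hasum_expcoef z : exists s, hasum (fun n : nat => z ^+ n / n`!%:R) s.
Proof.
apply: smb_hasum; apply: smb_le (smb_expcoef 0 (nm_ge0 z)) => n.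
by rewrite expr0 mul1r nmM nmV nmX nm_nat.
Qed.

Lemma cder_pseries (a : nat -> C) (f f' : C -> C) :
  (forall r : R, 0 <= r -> smb (fun n : nat => n%:R ^+ 2 * (nm (a n) * r ^+ n))) ->
  (forall z, hasum (fun n => a n * z ^+ n) (f z)) ->
  (forall z, hasum (fun n => a n * (n%:R * z ^+ n.-1)) (f' z)) ->
  forall z, cder f z (f' z).
Proof.
move=> Ha Hf Hf' z.
apply: (@cder_hasum _ _ (fun n z => a n * z ^+ n) _
  (fun n => n%:R ^+ 2 * (nm (a n) * (nm z + 1) ^+ n)) f z _ 1 ltr01) => //.
  move=> n h /ltW h1; rewrite mulrCA -!mulrBr nmM.
  rewrite (mulrCA _ (nm (a n))) -!mulrA ler_wpM2l ?nm_ge0// mulrA -expr2 mulrA.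
  exact: pow_quad.
by apply: Ha; rewrite addr_ge0// nm_ge0.
Qed.

Lemma hasum_shift (f : nat -> C) s : f 0 = 0 ->
  hasum (fun n => f n.+1) s <-> hasum f s.
Proof.
move=> f0; apply: (@hasum_inj _ _ _ succn f); first exact: succn_inj.
by case=> // n /(_ n).
Qed.

(** The sum [S] of the series satisfies [S' = S], so [S w * cexp (- w)] has derivative 0 and keeps
    its value 1 at the origin. *)
Lemma cexp_series z : hasum (fun n : nat => z ^+ n / n`!%:R) (cexp z).
Proof.
have /choice[S HS] := hasum_expcoef.
have HS' w : hasum (fun n : nat => (n`!%:R^-1 : C) * w ^+ n) (S w).
  by apply: hasum_ext (HS w) => n; rewrite mulrC.
have D w : cder S w (S w).
  apply: (@cder_pseries (fun n => n`!%:R^-1) S S) => [r r0|//|v].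
    apply: smb_le (smb_expcoef 2 r0) => n.
    by rewrite nmV nm_nat mulrA mulrAC mulrA.
  apply/hasum_shift; first by rewrite mul0r mulr0.
  apply: hasum_ext (HS v) => n /=; rewrite factS natrM.
  by field; rewrite ?nat1r ?pnatr_eq0 -?lt0n ?fact_gt0.
have D2 w : cder (fun w => S w * cexp (- w)) w 0.
  have := cderM (D w) (cder_cexp_comp (cderN (cder_id w))).
  by apply: cder_eq => /=; ring.
have := @cder0_cst _ (fun w => S w * cexp (- w)) 0 z (fun t _ => D2 _).
have S0 : S 0 = 1.
  apply: hasum_uniq (HS 0) _.
  have := @hasum_fin R nat [fset 0%N]%fset (fun n : nat => (0 : C) ^+ n / n`!%:R).
  rewrite big_seq_fset1 fact0 divr1 expr0; apply.
  by move=> [|n]; rewrite !inE// expr0n /= mul0r.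
rewrite S0 oppr0 cexp0 mulr1 cexpN => h.
have -> : cexp z = S z; last exact: HS.
by rewrite -[RHS](mulfVK (cexp_neq0 z)) h mul1r.
Qed.

Lemma erf_ex u : exists s, hasum (fun k : nat => u ^+ (2 * k).+1 / (k`! * (2 * k).+1)%:R) s.
Proof.
apply: smb_hasum.
have := smbZ (nm_ge0 u) (smb_expcoef 0 (exprn_ge0 2 (nm_ge0 u))).
apply: smb_le => n; rewrite expr0 mul1r nmM nmV nmX nm_nat exprS exprM -mulrA.
rewrite ler_wpM2l ?nm_ge0// ler_wpM2l ?exprn_ge0 ?nm_ge0//.
by rewrite lef_pV2 ?posrE ?ltr0n ?muln_gt0 ?fact_gt0// ler_nat leq_pmulr.
Qed.

(* The odd entire primitive of exp(u^2). *)
Definition erfi u : C := projT1 (cid (erf_ex u)).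

Lemma erfiP u : hasum (fun k : nat => u ^+ (2 * k).+1 / (k`! * (2 * k).+1)%:R) (erfi u).
Proof. by rewrite /erfi; case: cid. Qed.

Lemma erfi0 : erfi 0 = 0.
Proof.
apply: hasum_uniq (erfiP 0) _; apply: hasum_ext (@hasum0 R nat) => n.
by rewrite expr0n /= mul0r.
Qed.

Lemma erfiN u : erfi (- u) = - erfi u.
Proof.
apply: hasum_uniq (erfiP _) _; apply: hasum_ext (hasumN (erfiP u)) => n.
by rewrite [(- u) ^+ _]exprNn [(-1) ^+ _]exprS exprM sqrrN !expr1n mulr1 mulN1r mulNr.
Qed.

Lemma cder_erfi u : cder erfi u (cexp (u ^+ 2)).
Proof.
pose a (n : nat) : C := if odd n then (n./2`! * n)%:R^-1 else 0.
have inj : injective (fun k => (2 * k).+1) by move=> x y; lia.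
have supp n : (forall j, (2 * j).+1 <> n) -> odd n = false.
  move=> h; apply/negP => on; apply: (h n./2); rewrite mul2n.
  by rewrite -[RHS]odd_double_half on.
have half k : ((2 * k).+1)./2 = k by lia.
have odd2 k : odd (2 * k).+1 by rewrite /= mul2n odd_double.
apply: (@cder_pseries a erfi (fun u => cexp (u ^+ 2))) => [r r0|z|z].
- pose b n : R := n%:R ^+ 2 * (nm (a n) * r ^+ n).
  have [s Hs] : exists s, hasum (fun k => (b (2 * k).+1)%:C) s.
    apply: smb_hasum; have r2 : 0 <= r * (2 + r) by nra.
    apply: smb_le (smbZ r2 (smbD (smb_expcoef 2 (exprn_ge0 2 r0))
       (smb_expcoef 0 (exprn_ge0 2 r0)))) => k.
    rewrite nm_real ger0_norm; last by rewrite /b !mulr_ge0 ?exprn_ge0 ?nm_ge0.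
    rewrite /b /a odd2 half nmV nm_nat [r ^+ _.+1]exprS [r ^+ (_ * _)]exprM expr0 mul1r natrM.
    rewrite (_ : _ * (_ * _) = r * ((2 * k).+1%:R * (r ^+ 2 ^+ k / k`!%:R))); last first.
      have := @pnatr_eq0 R (2 * k).+1; move: (_.+1%:R) => c /= /negbT c0.
      by field; rewrite c0 ?pnatr_eq0 -?lt0n ?fact_gt0.
    rewrite -mulrA ler_wpM2l//; set q := _ / _.
    have q0 : 0 <= q by rewrite divr_ge0// !exprn_ge0.
    have : (2 * k).+1%:R <= 2 * (k%:R ^+ 2 + 1) :> R.
      by rewrite -natrX natr1 -natrM ler_nat; nia.
    move=> h; apply: (@le_trans _ _ (2 * (k%:R ^+ 2 + 1) * q)).
      exact: ler_wpM2r.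
    rewrite (_ : _ * (_ + q) = (2 + r) * (k%:R ^+ 2 + 1) * q); last by ring.
    apply: ler_wpM2r => //.
    have k0 : 0 <= k%:R ^+ 2 :> R by exact: sqr_ge0.
    by nra.
  suff [t Ht] : exists t, hasum (fun n => (b n)%:C) t.
    have b0 n : 0 <= b n by rewrite /b !mulr_ge0 ?exprn_ge0 ?nm_ge0.
    exact: hasum_smb_pos Ht.
  exists s; apply/(hasum_inj (h := fun k => (2 * k).+1)) => // n /supp on.
  by rewrite /b /a on nm0 mul0r mulr0.
- apply/(hasum_inj (h := fun k => (2 * k).+1)) => //.
    by move=> n /supp on; rewrite /a on mul0r.
  by apply: hasum_ext (erfiP z) => k /=; rewrite /a odd2 half mulrC.
- apply/(hasum_inj (h := fun k => (2 * k).+1)) => //.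
    by move=> n /supp on; rewrite /a on mul0r.
  apply: hasum_ext (cexp_series (z ^+ 2)) => k /=.
  rewrite /a odd2 half natrM exprM.
  have := @pnatr_eq0 C (2 * k).+1; move: (_.+1%:R) => c /= /negbT c0.
  by field; rewrite c0 ?nat1r ?pnatr_eq0 -?lt0n ?fact_gt0.
Qed.

Lemma cexp_gauss_nm (x y : R) : nm (cexp ((x +i* y) ^+ 2)) = expR (x ^+ 2 - y ^+ 2).
Proof. by rewrite nm_cexp; congr expR; rewrite expr2 ReM /=; ring. Qed.

Lemma erfi_vertical (y y' : R) : 0 <= y <= y' ->
  nm (erfi (0 +i* y') - erfi (0 +i* y)) <= expR (- y ^+ 2) * (y' - y).
Proof.
move=> /andP[y0 yy'].
have -> : y' - y = nm ((0 +i* y') - (0 +i* y) : C).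
  have -> : (0 +i* y') - (0 +i* y) = 0 +i* (y' - y) :> C.
    by apply: complex_ext; rewrite ?ReD ?ImD ?ReN ?ImN /=; ring.
  by rewrite /nm /= expr0n /= add0r sqrtr_sqr ger0_norm// subr_ge0.
apply: cmvt => t /andP[t0 t1]; eexists; split; first exact: cder_erfi.
set u := (X in X ^+ 2).
have -> : u = 0 +i* (y + t * (y' - y)).
  by rewrite /u; apply: complex_ext; rewrite !(ReD, ImD, ReM, ImM, ReN, ImN) /=; ring.
have h : 0 <= t * (y' - y) by rewrite mulr_ge0// subr_ge0.
rewrite cexp_gauss_nm ler_expR expr0n /= sub0r lerN2 lerXn2r ?nnegrE ?addr_ge0//.
by rewrite lerDl.
Qed.

Lemma expR_gauss_le (y : R) : expR (- y ^+ 2) <= (1 + y ^+ 2)^-1.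
Proof.
rewrite expRN lef_pV2 ?posrE ?expR_gt0 ?expR_ge1Dx//.
by rewrite ltr_pwDl// sqr_ge0.
Qed.

Lemma smb_inv_sqr : smb (fun n : nat => (1 + n%:R ^+ 2 : R)^-1).
Proof.
apply: smb_le (smbZ (ler0n R 2) (smb_zw R)) => n.
apply: le_trans (ler_wpM2l (ler0n _ 2) (zw_ge R n (leqnn 2))).
rewrite ler_pdivlMr ?exprn_gt0// ler_pdivrMl ?ltr_pwDl ?sqr_ge0//.
have := sqr_ge0 (n%:R - 1 : R); rewrite -[n.+1%:R]natr1; nra.
Qed.

Lemma erfi_lim_ex : exists l : C, forall e : R, 0 < e -> exists Y : R,
  forall y, Y <= y -> nm (erfi (0 +i* y) - l) < e.
Proof.
pose a (n : nat) := erfi (0 +i* n%:R : C).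
have bd n : nm (a n.+1 - a n) <= (1 + n%:R ^+ 2)^-1.
  have := @erfi_vertical n%:R n.+1%:R; rewrite ler0n ler_nat leqnSn => /(_ isT).
  have -> : n.+1%:R - n%:R = 1 :> R by rewrite -natrB// subSnn.
  rewrite mulr1 => h.
  exact: le_trans h (expR_gauss_le _).
have [l Hl] : exists l, hasum (fun n => a n.+1 - a n) l.
  by apply: smb_hasum; exact: smb_le smb_inv_sqr.
have cv := hasum_nat_cvto Hl.
have tel n : \sum_(i < n) (a i.+1 - a i) = a n.
  rewrite -(big_mkord xpredT (fun i => a i.+1 - a i)) telescope_sumr// /a.
  by rewrite mulr0n -[0 +i* 0]/(0 : C) erfi0 subr0.
exists l => e e0; have e2 : 0 < e / 2 by rewrite divr_gt0.
have [n0 Hn] := cv _ e2.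
have [n1 Hn1] : exists n1 : nat, 2 / e < n1%:R.
  by exists (Num.truncn (2 / e)).+1; rewrite truncnS_gt.
exists (maxn n0 n1)%:R => y Hy.
have y0 : 0 <= y by apply: le_trans Hy.
pose n := Num.truncn y.
have /andP[ny yn] : n%:R <= y < n.+1%:R by exact: truncn_itv.
have nn : (maxn n0 n1 <= n)%N by rewrite truncn_ge_nat.
have h1 := Hn n (leq_trans (leq_maxl _ _) nn); rewrite tel in h1.
have h2 := @erfi_vertical n%:R y; rewrite ler0n ny in h2; have {}h2 := h2 isT.
have h3 : expR (- n%:R ^+ 2) * (y - n%:R) <= e / 2.
  apply: (@le_trans _ _ ((1 + n%:R ^+ 2)^-1 * 1)).
    apply: ler_pM; rewrite ?expR_ge0 ?subr_ge0 ?expR_gauss_le//.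
    by move: yn; rewrite -natr1; lra.
  have n1n : n1%:R <= n%:R :> R by rewrite ler_nat (leq_trans (leq_maxr _ _) nn).
  have n0' : 0 <= n%:R :> R by [].
  rewrite mulr1 -[e / 2]invrK lef_pV2 ?posrE ?invr_gt0 ?invf_div ?ltr_pwDl ?sqr_ge0//.
  have : 2 / e <= n%:R by apply: ltW; apply: lt_le_trans Hn1 n1n.
  set q := n%:R; move=> h; have := sqr_ge0 (q - 1 / 2); nra.
apply: nm_tri_lt (le_trans h2 h3) h1 _; lra.
Qed.

(* The limit of erfi at +i oo; its value i sqrt(pi)/2 comes out of Poisson summation. *)
Definition erfi_lim : C := projT1 (cid erfi_lim_ex).

(* Compare with the imaginary axis along a horizontal segment. *)

Lemma erfi_cvg (K e : R) : 0 < e -> exists Y : R, 0 < Y /\ forall u,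
  complex.Re (u ^+ 2) <= K -> Y <= complex.Im u -> nm (erfi u - erfi_lim) < e.
Proof.
move=> e0; have e4 : 0 < e / 4 by rewrite divr_gt0.
have [Y0 HY] : exists Y : R, forall y, Y <= y -> nm (erfi (0 +i* y) - erfi_lim) < e / 4.
  by rewrite /erfi_lim; case: cid => l /= /(_ _ e4).
have EK := expR_gt0 K.
(* At [u] itself the integrand is only bounded by [expR K], so a first piece of length [d] is split
   off, which costs at most [e / 4]. Beyond it the exponent has dropped by about [2 * d * |x|],
   which outweighs the length of the remaining segment. *)
pose d := e / 4 / expR K.
have d0 : 0 < d by rewrite divr_gt0.
have dK : expR K * d = e / 4 by rewrite mulrC divfK// gt_eqF.
pose D := expR (K + d ^+ 2) / d ^+ 2.
have D0 : 0 < D by rewrite divr_gt0 ?expR_gt0// exprn_gt0.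
exists (1 + `|Y0| + 2 * d + 4 / e + 8 * D / e); split.
  have a1 := normr_ge0 Y0; have a2 : 0 < 4 / e by rewrite divr_gt0.
  have a3 : 0 < 8 * D / e by rewrite divr_gt0// mulr_gt0.
  lra.
case=> x y /= HK yY.
have Y00 : 0 <= `|Y0| by [].
have e40 : 0 < 4 / e by rewrite divr_gt0.
have D80 : 0 < 8 * D / e by rewrite divr_gt0// mulr_gt0.
have {}HK : x ^+ 2 - y ^+ 2 <= K by rewrite !expr2.
have yY0 : Y0 <= y by have := ler_norm Y0; lra.
have y0 : 0 < y by lra.
have ye : 4 < y * e by rewrite -ltr_pdivrMr//; lra.
have yD : 8 * D < y * e by rewrite -ltr_pdivrMr//; lra.
have h0 := HY _ yY0.
have hor (x1 x2 M : R) : x1 ^+ 2 <= M -> x2 ^+ 2 <= M ->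
    nm (erfi (x2 +i* y) - erfi (x1 +i* y)) <= expR (M - y ^+ 2) * `|x2 - x1|.
  move=> h1 h2.
  have -> : `|x2 - x1| = nm ((x2 +i* y) - (x1 +i* y) : C).
    have -> : (x2 +i* y) - (x1 +i* y) = (x2 - x1)%:C :> C.
      by apply: complex_ext; rewrite ?ReD ?ImD ?ReN ?ImN /= ?subrr.
    by rewrite nm_real.
  apply: cmvt => t /andP[t0 t1]; eexists; split; first exact: cder_erfi.
  set u := (X in X ^+ 2).
  have -> : u = (x1 + t * (x2 - x1)) +i* y.
    by rewrite /u; apply: complex_ext; rewrite !(ReD, ImD, ReM, ImM, ReN, ImN) /=; ring.
  rewrite cexp_gauss_nm ler_expR lerD2r.
  rewrite (_ : _ ^+ 2 = (1 - t) * x1 ^+ 2 + t * x2 ^+ 2 - t * (1 - t) * (x2 - x1) ^+ 2);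
    last by ring.
  have a1 : (1 - t) * x1 ^+ 2 <= (1 - t) * M by rewrite ler_wpM2l// subr_ge0.
  have a2 : t * x2 ^+ 2 <= t * M by rewrite ler_wpM2l.
  have a3 : 0 <= t * (1 - t) * (x2 - x1) ^+ 2.
    by rewrite mulr_ge0 ?sqr_ge0// mulr_ge0// subr_ge0.
  lra.
have xx : `|x| ^+ 2 = x ^+ 2 by rewrite real_normK ?num_real.
suff h1 : nm (erfi (x +i* y) - erfi (0 +i* y)) <= 3 / 4 * e.
  by apply: nm_tri_lt h1 h0 _; lra.
have [xy|xy] := leP `|x| (y / 2).
  have h1 := hor 0 x (x ^+ 2); rewrite expr0n /= sqr_ge0 lexx subr0 in h1.
  apply: le_trans (h1 isT isT) _.
  have x34 : x ^+ 2 - y ^+ 2 <= - (y / 2) ^+ 2.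
    by rewrite -xx; have := normr_ge0 x; nra.
  apply: (@le_trans _ _ ((1 + (y / 2) ^+ 2)^-1 * (y / 2))).
    apply: ler_pM => //; rewrite ?expR_ge0//.
    by apply: le_trans (expR_gauss_le _); rewrite ler_expR.
  rewrite ler_pdivrMl ?ltr_pwDl ?sqr_ge0//; move: ye y0 e0; clear; nra.
have x0 : 0 < `|x| by lra.
have xd : d <= `|x| by lra.
pose s := 1 - d / `|x|.
have s0 : 0 <= s by rewrite subr_ge0 ler_pdivrMr// mul1r.
have s1 : s <= 1 by rewrite lerBlDr lerDl divr_ge0// ltW.
have sx : s * `|x| = `|x| - d by rewrite mulrBl mul1r divfK// gt_eqF.
have sx2 : (s * x) ^+ 2 = (`|x| - d) ^+ 2 by rewrite -sx !exprMn xx.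
have h1 : nm (erfi (x +i* y) - erfi (s * x +i* y)) <= e / 4.
  have h := hor (s * x) x (x ^+ 2); apply: le_trans (h _ (lexx _)) _.
    by rewrite sx2 -xx; move: d0 xd; clear; nra.
  rewrite -dK; apply: ler_pM; rewrite ?expR_ge0 ?ler_expR//.
  rewrite (_ : x - s * x = (1 - s) * x); last by ring.
  by rewrite normrM ger0_norm ?subr_ge0// mulrBl mul1r sx opprB addrC subrK.
have h2 : nm (erfi (s * x +i* y) - erfi (0 +i* y)) <= e / 4.
  have h := hor 0 (s * x) ((s * x) ^+ 2); apply: le_trans (h _ (lexx _)) _.
    by rewrite expr0n /= sqr_ge0.
  rewrite subr0 normrM (ger0_norm s0).
  have b1 : (s * x) ^+ 2 - y ^+ 2 <= K + d ^+ 2 - 2 * d * `|x|.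
    rewrite sx2 (_ : _ ^+ 2 = `|x| ^+ 2 - 2 * d * `|x| + d ^+ 2); last by ring.
    by move: HK; rewrite xx; clear; lra.
  have dx : 0 < d * `|x| by rewrite mulr_gt0.
  have b2 : expR (- (2 * d * `|x|)) <= (d * `|x|) ^- 2.
    rewrite expRN lef_pV2 ?posrE ?expR_gt0 ?exprn_gt0//.
    rewrite -mulrA (expRM_natl 2) lerXn2r ?nnegrE ?expR_ge0 ?(ltW dx)//.
    by apply: le_trans (expR_ge1Dx _); rewrite lerDr.
  apply: (@le_trans _ _ (expR (K + d ^+ 2) * (d * `|x|) ^- 2 * `|x|)).
    apply: ler_pM; rewrite ?expR_ge0 ?mulr_ge0//; last by rewrite ler_piMl.
    apply: (@le_trans _ _ (expR (K + d ^+ 2 - 2 * d * `|x|))); first by rewrite ler_expR.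
    by rewrite expRD ler_wpM2l// expR_ge0.
  rewrite (_ : _ * `|x| = D / `|x|); last first.
    by rewrite /D; field; rewrite !gt_eqF.
  rewrite ler_pdivrMr//; move: yD xy e0; clear; nra.
apply: nm_tri_le h1 h2 _; lra.
Qed.

Lemma erfi_cvgN (K e : R) : 0 < e -> exists Y : R, 0 < Y /\ forall u,
  complex.Re (u ^+ 2) <= K -> complex.Im u <= - Y -> nm (erfi u + erfi_lim) < e.
Proof.
move=> /(erfi_cvg K)[Y [Y0 H]]; exists Y; split=> // u uK uY.
have := H (- u); rewrite sqrrN ImN => /(_ uK); rewrite erfiN -nmN opprB opprK addrC.
by apply; lra.
Qed.

End Erf.

(** * Poisson summation and Lipschitz's formula *)

Section Poisson.
Variable R : realType.
Local Notation C := R[i].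

Lemma intC (m : int) : m%:~R = (m%:~R : R)%:C :> C.
Proof. by rewrite rmorph_int. Qed.

Lemma absz_norm (m : int) : `|m%:~R| = (absz m)%:R :> R.
Proof. by rewrite natr_absz intr_norm. Qed.

Lemma natC (m : nat) : m%:R = (m%:R : R)%:C :> C.
Proof. by rewrite rmorph_nat. Qed.

Definition wgt (x : R) : R := (1 + x ^+ 2)^-1.

Lemma wgt_gt0 x : 0 < wgt x.
Proof. by rewrite invr_gt0 ltr_pwDl// sqr_ge0. Qed.

Lemma wgt_ge0 x : 0 <= wgt x. Proof. exact/ltW/wgt_gt0. Qed.

Lemma wgt_le1 x : wgt x <= 1.
Proof. by rewrite invf_le1 ?ltr_pwDl ?sqr_ge0// lerDl sqr_ge0. Qed.

Lemma wgt_near x y : `|y - x| <= 1 -> wgt y <= 3 * wgt x.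
Proof.
move=> h; have x1 : 0 < 1 + x ^+ 2 by rewrite ltr_pwDl// sqr_ge0.
have y1 : 0 < 1 + y ^+ 2 by rewrite ltr_pwDl// sqr_ge0.
rewrite /wgt ler_pdivlMr// mulrC ler_pdivrMr//.
have : (y - x) ^+ 2 <= 1 by rewrite -real_normK ?num_real// expr_le1.
have := sqr_ge0 (2 * y - x); nra.
Qed.

Lemma wgtN x : wgt (- x) = wgt x. Proof. by rewrite /wgt sqrrN. Qed.

(** Each term with positive index is at most an increment of the arctangent, so the bound is
    independent of the mesh; the 1 accounts for the index 0 and the factor 2 for the two signs. *)
Lemma riemann_wgt (N : nat) : (0 < N)%N ->
  bsum (fun k : int => N%:R^-1 * wgt (k%:~R / N%:R)) (2 * (1 + pi / 2)).
Proof.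
move=> N0; have N0' : 0 < N%:R :> R by rewrite ltr0n.
have Ni : N%:R^-1 <= 1 :> R by rewrite invf_le1// ler1n.
apply: (@bsum_int _ _ (fun k => N%:R^-1 * wgt (k%:R / N%:R))) => [n|n|].
- by apply: mulr_ge0; [rewrite invr_ge0|exact: wgt_ge0].
- case: n => n //; rewrite NegzE mulrNz mulNr wgtN abszN //.
apply: bsum_nat => n; first by apply: mulr_ge0; [rewrite invr_ge0|exact: wgt_ge0].
have step (k : nat) : N%:R^-1 * wgt (k.+1%:R / N%:R) <=
    atan (k.+1%:R / N%:R) - atan (k%:R / N%:R).
  have kk : k%:R / N%:R <= k.+1%:R / N%:R :> R by rewrite ler_wpM2r ?invr_ge0// ler_nat.
  have [c [/andP[c0 c1] ->]] := mvt_all kk (fun x _ => @is_derive1_atan R x).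
  rewrite -mulrBl -natrB// subSnn mul1r mulrC ler_wpM2r ?invr_ge0// /wgt.
  have k0 : 0 <= k%:R / N%:R :> R by rewrite divr_ge0.
  by rewrite lef_pV2 ?posrE ?ltr_pwDl ?sqr_ge0// lerD2l lerXn2r ?nnegrE// (le_trans k0)// (le_trans c0).
have : forall n, \sum_(i < n.+1) N%:R^-1 * wgt (i%:R / N%:R) <= 1 + atan (n%:R / N%:R).
  elim=> [|m IH].
    rewrite big_ord_recl big_ord0 addr0 mul0r atan0 addr0.
    by rewrite -[leRHS]mulr1; apply: ler_pM; rewrite ?invr_ge0 ?wgt_ge0 ?wgt_le1.
  by rewrite big_ord_recr /=; have := step m; lra.
have p2 := @pi_gt0 R.
case: n => [_|n /(_ n)]; first by rewrite big_ord0; lra.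
have := atan_ltpi2 (n%:R / N%:R : R); lra.
Qed.

Lemma sum_seq_fset (V : nmodType) (I : choiceType) (s : seq I) (f : I -> V) : uniq s ->
  \sum_(i <- seq_fset tt s) f i = \sum_(i <- s) f i.
Proof.
by move=> us; apply: perm_big; rewrite (perm_trans (seq_fset_perm _ _))// undup_id.
Qed.

Definition zrange (n : nat) : seq int := [seq i%:Z - n%:Z | i <- iota 0 (2 * n).+1].

Lemma zrange_uniq n : uniq (zrange n).
Proof. by rewrite map_inj_uniq ?iota_uniq// => a b; lia. Qed.

Lemma mem_zrange n (m : int) : (m \in zrange n) = (`|m| <= n)%N.
Proof.
apply/mapP/idP; first by move=> [i ]; rewrite mem_iota => hi ->; lia.
by move=> hm; exists (`|(m + n)%R|)%N; rewrite ?mem_iota; lia.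
Qed.

Lemma hasum_int_cvto (f : int -> C) s :
  hasum f s -> cvto (fun n => \sum_(i <- zrange n) f i) s.
Proof.
move=> H e /H[A HA]; exists (\max_(i <- A) `|i|)%N => n hn.
rewrite -(sum_seq_fset _ (zrange_uniq n)); apply: HA; apply/fsubsetP => i iA.
rewrite seq_fsetE mem_zrange; apply: leq_trans hn.
exact: (@leq_bigmax_seq _ (enum_fset A) xpredT absz i iA isT).
Qed.

Lemma sum_zrange_tele (g : int -> C) n :
  \sum_(i <- zrange n) (g (i + 1) - g i) = g n.+1%:Z - g (- n%:Z).
Proof.
rewrite big_map -[iota _ _]/(index_iota 0 (2 * n).+1).
rewrite (telescope_sumr_eq (fun i : nat => g (i%:Z - n%:Z)))//.
  congr (g _ - g _); lia.
by move=> i _; congr (g _ - _); lia.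
Qed.

Lemma hasum_sum (I : choiceType) (T : Type) (l : seq T) (f : T -> I -> C) (s : T -> C) :
  (forall m, hasum (f m) (s m)) -> hasum (fun i => \sum_(m <- l) f m i) (\sum_(m <- l) s m).
Proof.
move=> H; elim: l => [|m l IH].
  by rewrite big_nil; apply: hasum_ext (@hasum0 R I) => i; rewrite big_nil.
by rewrite big_cons; apply: hasum_ext (hasumD (H m) IH) => i; rewrite big_cons.
Qed.

Lemma taylor1 (P p p' : C -> C) (x h M : R) :
  (forall t : R, 0 <= t <= 1 -> cder P (x + t * h)%:C (p (x + t * h)%:C)) ->
  (forall t : R, 0 <= t <= 1 -> cder p (x + t * h)%:C (p' (x + t * h)%:C)) ->
  (forall t : R, 0 <= t <= 1 -> nm (p' (x + t * h)%:C) <= M) ->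
  nm (P (x + h)%:C - P x%:C - h%:C * p x%:C) <= M * h ^+ 2.
Proof.
move=> HP Hp HM.
have M0 : 0 <= M by apply: le_trans (HM 0 _); rewrite ?nm_ge0// lexx ler01.
have seg (t : R) : x%:C + t%:C * ((x + h)%:C - x%:C) = (x + t * h)%:C.
  by rewrite -rmorphB /= addrAC subrr add0r -rmorphM -rmorphD.
have Hd (t : R) : 0 <= t <= 1 -> nm (p (x + t * h)%:C - p x%:C) <= M * `|h|.
  move=> /andP[t0 t1].
  apply: (@le_trans _ _ (M * nm ((x + t * h)%:C - x%:C))).
    apply: cmvt => u /andP[u0 u1]; exists (p' (x + u * t * h)%:C).
    have ut : 0 <= u * t <= 1 by rewrite mulr_ge0//= mulr_ile1.
    rewrite -rmorphB /= addrAC subrr add0r -rmorphM -rmorphD mulrA; split; first exact: Hp.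
    exact: HM.
  rewrite -rmorphB /= addrAC subrr add0r nm_real normrM ler_wpM2l// ler_piMl//.
  by rewrite ger0_norm.
have := @cmvt _ (fun w => P w - w * p x%:C) x%:C (x + h)%:C (M * `|h|).
rewrite -[(x + h)%:C - x%:C]rmorphB /= addrAC subrr add0r nm_real.
rewrite (_ : _ - _ - _ = P (x + h)%:C - P x%:C - h%:C * p x%:C); last first.
  by rewrite rmorphD /=; ring.
rewrite -mulrA -expr2 real_normK ?num_real//; apply => t ht.
exists (p (x + t * h)%:C - p x%:C); split; last exact: Hd.
rewrite -rmorphM -rmorphD; apply: cderB; first exact: HP.
have := cderZ (p x%:C) (cder_id (x + t * h)%:C); rewrite mulr1.
by apply: cder_ext => w; rewrite mulrC.
Qed.

Definition limp (P : R -> C) l := forall e : R, 0 < e -> exists X : R,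
  forall x, X <= x -> nm (P x - l) < e.
Definition limm (P : R -> C) l := forall e : R, 0 < e -> exists X : R,
  forall x, x <= X -> nm (P x - l) < e.

Lemma natr_gt (x : R) : exists n : nat, x < n%:R.
Proof. by exists (Num.truncn x).+1; rewrite truncnS_gt. Qed.

Lemma riemann_sum (P p : R -> C) (A D : R) (lp lm : C) :
  (forall x, nm (p x) <= A * wgt x) ->
  (forall (N : nat) (k : int), (0 < N)%N -> nm (P ((k + 1)%:~R / N%:R) - P (k%:~R / N%:R) -
     N%:R^-1%:C * p (k%:~R / N%:R)) <= D * wgt (k%:~R / N%:R) / N%:R ^+ 2) ->
  limp P lp -> limm P lm ->
  exists c : nat -> C, (forall n, hasum (fun k : int => (n.+1%:R^-1)%:C * p (k%:~R / n.+1%:R)) (c n))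
    /\ cvto c (lp - lm).
Proof.
move=> HA HD Hp Hm.
have A0 : 0 <= A.
  have := le_trans (nm_ge0 _) (HA 0); rewrite pmulr_lge0 ?wgt_gt0//.
have D0 : 0 <= D.
  have := le_trans (nm_ge0 _) (HD 1%N 0 isT).
  by rewrite expr1n divr1 pmulr_lge0 ?wgt_gt0.
pose K : R := 2 * (1 + pi / 2).
have HK n : bsum (fun k : int => n.+1%:R^-1 * wgt (k%:~R / n.+1%:R)) K by exact: riemann_wgt.
have Hn n : exists c, hasum (fun k : int => (n.+1%:R^-1)%:C * p (k%:~R / n.+1%:R)) c.
  apply: smb_hasum; exists (A * K); apply: bsum_le (bsumZ A0 (HK n)) => k.
  by rewrite nmM nm_real ger0_norm ?invr_ge0// mulrCA ler_wpM2l ?invr_ge0.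
have [c Hc] := choice Hn; exists c; split=> //.
have tel n : hasum (fun k : int => P ((k + 1)%:~R / n.+1%:R) - P (k%:~R / n.+1%:R)) (lp - lm).
  have [s Hs] : exists s, hasum (fun k : int => P ((k + 1)%:~R / n.+1%:R) - P (k%:~R / n.+1%:R)) s.
    apply: smb_hasum; exists ((D + A) * K).
    apply: bsum_le (bsumZ (addr_ge0 D0 A0) (HK n)) => k.
    set q := k%:~R / _; set N := n.+1%:R.
    have N1 : 1 <= N :> R by rewrite ler1n.
    have := HD n.+1 k isT; rewrite -/q -/N => h1.
    set a := P _ - P _ in h1 *; set b := N^-1%:C * _ in h1.
    have -> : a = (a - b) + b by rewrite subrK.
    apply: le_trans (nmD _ _) _; rewrite mulrDl; apply: lerD.
      apply: le_trans h1 _; rewrite -mulrA ler_wpM2l// mulrC ler_wpM2r ?wgt_ge0//.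
      by rewrite lef_pV2 ?posrE ?exprn_gt0 ?(lt_le_trans _ N1)// expr2 ler_peMl// (le_trans _ N1).
    rewrite /b nmM nm_real ger0_norm ?invr_ge0 ?(le_trans _ N1)// mulrCA ler_wpM2l//.
    by rewrite invr_ge0 (le_trans _ N1).
  have cv := hasum_int_cvto Hs.
  suff -> : lp - lm = s by [].
  apply: cvto_uniq cv; apply: (@cvto_ext _ (fun m => P (m.+1%:R / n.+1%:R) - P (- m%:R / n.+1%:R))).
    move=> m; rewrite (sum_zrange_tele (fun k : int => P (k%:~R / n.+1%:R))).
    by rewrite mulrNz.
  move=> e e0; have e2 : 0 < e / 2 by rewrite divr_gt0.
  have [X HX] := Hp _ e2; have [X' HX'] := Hm _ e2.
  have [m0 Hm0] := natr_gt ((`|X| + `|X'|) * n.+1%:R).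
  exists m0 => m mm.
  have n0 : 0 < n.+1%:R :> R by [].
  have hm : `|X| + `|X'| <= m%:R / n.+1%:R.
    by rewrite ler_pdivlMr// (le_trans (ltW Hm0))// ler_nat.
  set a := P _; set b := P _; rewrite (_ : _ - _ = (a - lp) - (b - lm)); last by ring.
  rewrite {}/a {}/b.
  apply: le_lt_trans (nmB _ _) _; rewrite [e]splitr; apply: ltrD; [apply: HX|apply: HX'].
    apply: (@le_trans _ _ (m%:R / n.+1%:R)); last by rewrite ler_pM2r ?invr_gt0// ler_nat.
    by apply: le_trans hm; rewrite (le_trans (ler_norm _))// lerDl.
  rewrite mulNr lerNl; apply: le_trans hm.
  by rewrite (le_trans (ler_norm _))// normrN lerDr.
apply: (@cvto_sq _ _ _ (fun n => D * K / n.+1%:R)) => [n|e e0].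
  have := hasumB (Hc n) (tel n) => /hasum_bound; apply; last first.
    by move: (bsumZ (divr_ge0 D0 (ler0n R n.+1)) (HK n)); rewrite mulrAC; exact.
  move=> k /=; rewrite nm_subC; apply: le_trans (HD n.+1 k isT) _.
  set w := wgt _; rewrite le_eqVlt; apply/orP; left; apply/eqP.
  by field.
have K0 : 0 <= K by exact: bsum_ge0 (HK 0%N).
have [n0 Hn0] := natr_gt (D * K / e); exists n0 => n nn.
rewrite ltr_pdivrMr// -ltr_pdivrMl// mulrC; apply: lt_le_trans Hn0 _.
by rewrite ler_nat ltnW.
Qed.

Lemma e2pi_eq1 (x : R) : e2pi x%:C = 1 -> exists m : int, x = m%:~R.
Proof.
move=> h; exists (Num.floor (x + 1 / 2)); set m := Num.floor _.
have /andP[m1 m2] : m%:~R <= x + 1 / 2 < (m + 1)%:~R by exact: floor_itv.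
rewrite intrD in m2.
have E : e2pi (x - m%:~R)%:C = 1.
  by rewrite rmorphB /= e2piB h rmorph_int e2pi_int divr1.
have := @e2pi_dist R (x - m%:~R); rewrite E subrr nm0.
have b : `|x - m%:~R| <= 1 / 2 by rewrite ler_norml; apply/andP; split; lra.
by move=> /(_ b) h2; apply/eqP; rewrite -subr_eq0 -normr_le0.
Qed.

Lemma zrange_orth n (k : int) :
  \sum_(m <- zrange n) e2pi (- (m%:~R * k%:~R / (2 * n).+1%:R) : C) =
    if ((2 * n).+1 %| k)%Z then (2 * n).+1%:R else 0.
Proof.
set N := (2 * n).+1; have N0 : N%:R != 0 :> C by rewrite pnatr_eq0.
have N0' : N%:R != 0 :> R by rewrite pnatr_eq0.
pose w : C := e2pi (- (k%:~R / N%:R)).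
have wN : w ^+ N = 1.
  by rewrite /w -e2piMn mulrN mulrC divfK// -mulrNz e2pi_int.
have -> : \sum_(m <- zrange n) e2pi (- (m%:~R * k%:~R / N%:R) : C) =
    e2pi (n%:R * (k%:~R / N%:R)) * \sum_(i < N) w ^+ i.
  rewrite big_map -[iota _ _]/(index_iota 0 N) big_mkord mulr_sumr.
  apply: eq_bigr => i _; rewrite /w -e2piMn -e2piD; congr e2pi.
  by rewrite intrB; field.
case: ifPn => [/dvdzP[q kq]|kN].
  have w1 : w = 1.
    by rewrite /w kq intrM mulfK// -mulrNz e2pi_int.
  rewrite kq intrM mulfK// -[n%:R * _]/(n%:Z%:~R * _) -intrM e2pi_int mul1r w1.
  under eq_bigr do rewrite expr1n.
  by rewrite sumr_const card_ord.
have wn1 : w != 1.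
  apply/negP => /eqP; rewrite /w.
  have -> : - (k%:~R / N%:R) = (- (k%:~R / N%:R) : R)%:C.
    by rewrite rmorphN rmorphM fmorphV /= rmorph_int rmorph_nat.
  move=> /e2pi_eq1[m hm]; move/negP: kN; apply.
  apply/dvdzP; exists (- m); apply/eqP; rewrite -(eqr_int R) intrM mulrNz -hm opprK.
  by rewrite divfK.
have := subrX1 w N; rewrite wN subrr => /esym/eqP; rewrite mulf_eq0 subr_eq0 (negPf wn1) /=.
by move=> /eqP ->; rewrite mulr0.
Qed.

Lemma cvto_bounded (u : nat -> C) l : cvto u l -> exists K : R, forall n, nm (u n) <= K.
Proof.
move=> /(_ 1 ltr01)[n0 Hn].
exists (nm l + 1 + \sum_(i < n0) nm (u i)) => n.
have s0 : 0 <= \sum_(i < n0) nm (u i) by rewrite sumr_ge0// => i _; exact: nm_ge0.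
have [/Hn h|h] := leqP n0 n.
  have := nmD (u n - l) l; rewrite subrK => h2; apply: le_trans h2 _.
  by rewrite addrC -addrA lerD2l (le_trans (ltW h))// lerDl.
apply: (@le_trans _ _ (\sum_(i < n0) nm (u i))); last first.
  by rewrite lerDr addr_ge0// nm_ge0.
by rewrite (bigD1 (Ordinal h))//= lerDl sumr_ge0// => i _; exact: nm_ge0.
Qed.

(* Poisson summation: average over N-th roots of unity the Riemann sums with step 1/N,
   and let N = 2n+1 tend to infinity by dominated convergence; two summations by parts
   bound the m-th coefficient by 1/m^2. *)

Lemma poisson (f : R -> C) (A B : R) (L : int -> C) :
  (forall x, nm (f x) <= A * wgt x) ->
  (forall N : nat, (0 < N)%N -> bsum (fun k : int => nm (f ((k + 1)%:~R / N%:R) - 2 * f (k%:~R / N%:R)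
     + f ((k - 1)%:~R / N%:R))) (B / N%:R)) ->
  (forall m : int, exists c : nat -> C, (forall n, hasum (fun k : int => (n.+1%:R^-1)%:C *
     (f (k%:~R / n.+1%:R) * e2pi (- (m%:~R * (k%:~R / n.+1%:R)%:C)))) (c n)) /\ cvto c (L m)) ->
  exists S, hasum L S /\ hasum (fun t : int => f t%:~R) S.
Proof.
move=> HA HB /choice[c Hc].
have A0 : 0 <= A by have := le_trans (nm_ge0 _) (HA 0); rewrite pmulr_lge0 ?wgt_gt0.
have B0 : 0 <= B.
  by have := bsum_ge0 (HB 1%N isT); rewrite divr1.
have [K0 HK0] := cvto_bounded (Hc 0).2.
pose F n (m : int) := if (`|m| <= n)%N then c m (2 * n)%N else 0.
(* [K0] bounds the coefficient at 0; elsewhere [B / m^2 <= 4 * B / (|m| + 1)^2], which [zw]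
   dominates. *)
pose g (m : int) : R := (K0 + 4 * B) * zw R `|m|.
have K00 : 0 <= K0 by apply: le_trans (HK0 0%N); exact: nm_ge0.
have bnd n (m : int) : nm (F n m) <= g m.
  have [->|m0] := eqVneq m 0.
    rewrite /F /= /g /zw /= !sqrtr1 expr1n invr1 mulr1 (le_trans (HK0 _))// lerDl.
    by rewrite mulr_ge0.
  rewrite /F; case: ifPn => mn; last by rewrite nm0 mulr_ge0 ?zw_ge0// addr_ge0// mulr_ge0.
  set N := (2 * n).+1; have N0 : 0 < N%:R :> R by rewrite ltr0n.
  have [H1 _] := Hc m; have {}H1 := H1 (2 * n)%N; rewrite -/N in H1.
  pose a : R := m%:~R / N%:R; pose w := e2pi a%:C.
  pose T (k : int) := (N%:R^-1)%:C * (f (k%:~R / N%:R) * e2pi (- (m%:~R * (k%:~R / N%:R)%:C))).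
  have aE : a%:C = m%:~R / N%:R.
    by rewrite rmorphM fmorphV /= rmorph_int rmorph_nat.
  have sh (j : int) : hasum (fun k => T (k + j)) (c m (2 * n)%N).
    apply/(@hasum_bij _ _ _ (fun k : int => k + j) T); last exact: H1.
    by exists (fun k => k - j) => k; rewrite ?addrK ?subrK.
  (* Shifting the index by 1 and -1 turns second differences of [f] into the factor
     [- (1 - w) * (1 - w^-1)], of modulus at least [a ^ 2]; this is the double summation by
     parts. *)
  have := hasumD (hasumB (hasumZ w (sh 1)) (hasumZ 2 (sh 0))) (hasumZ w^-1 (sh (-1))).
  set s := _ - _ + _ => Hs.
  have sE : s = - (1 - w) * (1 - w^-1) * c m (2 * n)%N.
    have w0 : w != 0 by exact: e2pi_neq0.
    by rewrite /s; field.
  have hb : nm s <= B / N%:R / N%:R.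
    rewrite mulrC; apply: hasum_bound Hs _ (bsumZ _ (HB N isT)); last by rewrite invr_ge0.
    move=> k; rewrite /T.
    have -> : (k + 0)%:~R = k%:~R :> R by rewrite addr0.
    have cst (j : int) : e2pi (- (m%:~R * ((k + j)%:~R / N%:R)%:C)) =
        e2pi (- (m%:~R * (k%:~R / N%:R)%:C)) * e2pi (- (j%:~R * a%:C)).
      rewrite -e2piD; congr e2pi; rewrite aE !rmorphM /= !fmorphV /= !rmorph_int rmorph_nat intrD.
      by ring.
    rewrite (cst 1) (cst (-1)) mul1r mulN1r opprK (e2piN a%:C) -/w.
    have w0 : w != 0 by exact: e2pi_neq0.
    set u := e2pi _; set f1 := f _; set f2 := f _; set f3 := f _.
    have alg (v : C) : w * (v * (f1 * (u / w))) - 2 * (v * (f2 * u)) + w^-1 * (v * (f3 * (u * w)))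
       = v * u * (f1 - 2 * f2 + f3) by field.
    rewrite alg.
    suff nu : nm u = 1.
      by rewrite nmM [nm (_ * u)]nmM nu mulr1 nm_real ger0_norm ?invr_ge0.
    rewrite /u; have -> : - ((m%:~R : C) * (k%:~R / N%:R : R)%:C) = (- (m%:~R * (k%:~R / N%:R)) : R)%:C.
      by rewrite intC -rmorphM -rmorphN.
    exact: nm_e2pi_real.
  have a2 : `|a| <= 1 / 2.
    rewrite /a normrM normfV (ger0_norm (ltW N0)) ler_pdivrMr// absz_norm.
    have : (2 * `|m|%N)%:R <= N%:R :> R by rewrite ler_nat; lia.
    by rewrite natrM => hN; clear - hN; lra.
  have d1 := e2pi_dist a2.
  have d2 : `|a| <= nm (1 - w^-1).
    by have := @e2pi_dist R (- a); rewrite normrN rmorphN e2piN => /(_ a2).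
  have a0 : 0 < `|a|.
    by rewrite normr_gt0 /a mulf_neq0 ?invr_eq0 ?intr_eq0// gt_eqF.
  have h3 : `|a| ^+ 2 * nm (c m (2 * n)%N) <= B / N%:R / N%:R.
    apply: le_trans hb; rewrite sE !nmM nmN ler_wpM2r ?nm_ge0// expr2.
    by apply: ler_pM.
  have h4 : nm (c m (2 * n)%N) <= B / (m%:~R) ^+ 2.
    move: h3; rewrite /a normrM normfV (ger0_norm (ltW N0)) exprMn real_normK ?num_real//.
    have m2 : 0 < m%:~R ^+ 2 :> R by rewrite lt_def sqrf_eq0 intr_eq0 m0 sqr_ge0.
    move=> h; rewrite ler_pdivlMr//; have N2 : 0 < N%:R ^+ 2 :> R by rewrite exprn_gt0.
    rewrite -(ler_pM2r N2) in h; set y := nm _ in h *; clear - h N0.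
    have Nn : N%:R != 0 :> R by rewrite gt_eqF.
    have e1 : m%:~R ^+ 2 * N%:R^-1 ^+ 2 * y * N%:R ^+ 2 = y * m%:~R ^+ 2 by field.
    have e2 : B / N%:R / N%:R * N%:R ^+ 2 = B by field.
    by rewrite e1 e2 in h.
  apply: le_trans h4 _; rewrite /g.
  have z2 := zw_ge R `|m| (leqnn 2).
  apply: (@le_trans _ _ (4 * B * `|m|%N.+1%:R ^- 2)); last first.
    apply: (@le_trans _ _ (4 * B * zw R `|m|)); first by rewrite ler_wpM2l// mulr_ge0.
    by rewrite ler_wpM2r ?zw_ge0// lerDr.
  have mm : 1 <= (absz m)%:R :> R by rewrite ler1n absz_gt0.
  have -> : m%:~R ^+ 2 = (absz m)%:R ^+ 2 :> R.
    by rewrite -absz_norm real_normK ?num_real.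
  rewrite -[(absz m).+1%:R]natr1; set x := (absz m)%:R in mm *.
  rewrite (_ : 4 * B * _ = B * (4 / (x + 1) ^+ 2)); last by ring.
  rewrite ler_wpM2l// ler_pdivlMr ?exprn_gt0; [|clear - mm; lra|clear - mm; lra].
  rewrite mulrC ler_pdivrMr ?exprn_gt0//; [clear - mm; nra|clear - mm; lra].
have smg : smb g by apply: smbZ (smb_zw_int R); rewrite addr_ge0// mulr_ge0.
have cvF m : cvto (F^~ m) (L m).
  move=> e e0; have [n0 Hn] := (Hc m).2 _ e0; exists (maxn n0 `|m|) => n.
  rewrite geq_max => /andP[h1 h2]; rewrite /F h2; apply: Hn; lia.
have [T HT] : exists T, hasum (fun t : int => f t%:~R) T.
  have := riemann_wgt (ltn0Sn 0) => /(bsumZ A0) H.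
  apply: smb_hasum; eexists; apply: bsum_le H => t.
  by rewrite (mulr1n (1 : R)) invr1 mul1r mulr1.
have HS n : hasum (F n) T.
  have E : hasum (F n) (\sum_(m <- zrange n) F n m).
    rewrite -(sum_seq_fset _ (zrange_uniq n)); apply: hasum_fin => m.
    by rewrite seq_fsetE mem_zrange /F => /negPf ->.
  suff -> : T = \sum_(m <- zrange n) F n m by [].
  set N := (2 * n).+1.
  pose G (k : int) := if (N %| k)%Z then f (k%:~R / N%:R) else 0.
  have N0 : N%:Z != 0 by [].
  have HG : hasum G T.
    apply/(hasum_inj (h := fun t : int => t * N)).
    - by move=> a b /(mulIf N0).
    - move=> k hk; rewrite /G; case: ifPn => // /dvdzP[q kq].
      by case: (hk q); rewrite kq.
    apply: hasum_ext HT => t /=; rewrite /G dvdz_mull// intrM mulfK//.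
    by rewrite pnatr_eq0.
  have := hasum_sum (zrange n) (fun m => (Hc m).1 (2 * n)%N); rewrite -/N => H.
  have -> : \sum_(m <- zrange n) F n m = \sum_(m <- zrange n) c m (2 * n)%N.
    rewrite big_seq [RHS]big_seq; apply: eq_bigr => m; rewrite mem_zrange /F => -> //.
  apply: hasum_uniq H; apply: hasum_ext HG => k.
  under eq_bigr do rewrite mulrA.
  rewrite -mulr_sumr /G.
  have -> : \sum_(m <- zrange n) e2pi (- (m%:~R * (k%:~R / N%:R)%:C)) =
      \sum_(m <- zrange n) e2pi (- (m%:~R * k%:~R / N%:R) : C).
    apply: eq_bigr => m _; congr e2pi.
    by rewrite rmorphM fmorphV /= rmorph_int rmorph_nat mulrA.
  rewrite zrange_orth -/N; case: ifP => _; last by rewrite mulr0.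
  rewrite fmorphV /= rmorph_nat mulrAC mulVf ?mul1r//.
  by rewrite pnatr_eq0.
have [s [Hs cvs]] := tannery cvF bnd smg HS.
exists T; split=> //.
by rewrite (cvto_uniq (cvto_cst T) cvs).
Qed.

End Poisson.

(** * Poisson summation with explicit primitives *)

Section PoissonApplications.
Variable R : realType.
Local Notation C := R[i].

Lemma grid_seg (N : nat) (k : int) (t : R) : (0 < N)%N -> 0 <= t <= 1 ->
  `|k%:~R / N%:R + t * N%:R^-1 - k%:~R / N%:R| <= 1 :> R.
Proof.
move=> N0 /andP[t0 t1]; rewrite addrAC subrr add0r normrM !ger0_norm ?invr_ge0//.
rewrite -[leRHS]mulr1; apply: ler_pM => //; rewrite ?invr_ge0// invf_le1 ?ltr0n// ler1n//.
Qed.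

Lemma grid_segN (N : nat) (k : int) (t : R) : (0 < N)%N -> 0 <= t <= 1 ->
  `|k%:~R / N%:R + t * - N%:R^-1 - k%:~R / N%:R| <= 1 :> R.
Proof.
move=> N0 /(grid_seg k N0) h; rewrite mulrN addrAC subrr add0r normrN.
by rewrite addrAC subrr add0r in h.
Qed.

Lemma cder_twist (F F' : C -> C) (m : int) (z : C) : cder F z (F' z) ->
  cder (fun w => F w * e2pi (- (m%:~R * w))) z
    ((F' z - (m%:~R * (0 +i* (2 * pi))) * F z) * e2pi (- (m%:~R * z))).
Proof.
move=> H; have E : cder (fun w => - (m%:~R * w)) z (- m%:~R : C).
  by have := cderN (cderZ (m%:~R) (cder_id z)); rewrite mulr1.
have := cderM H (cder_comp E (cder_e2pi _)); apply: cder_eq.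
by ring.
Qed.

Lemma nm_twist (m : int) (x : R) : nm (e2pi (- (m%:~R * x%:C))) = 1.
Proof. by rewrite intC -rmorphM -rmorphN nm_e2pi_real. Qed.

Lemma nm_twist_der (m : int) (x A : R) (a b : C) :
  nm a <= A * wgt x -> nm b <= A * wgt x ->
  nm ((a - (m%:~R * (0 +i* (2 * pi))) * b) * e2pi (- (m%:~R * x%:C))) <=
    (1 + `|m%:~R| * (2 * pi)) * A * wgt x.
Proof.
move=> ha hb; rewrite nmM nm_twist mulr1; apply: le_trans (nmB _ _) _.
rewrite -[leRHS]mulrA [leRHS]mulrDl mul1r; apply: lerD => //.
rewrite !nmM nm_int intr_norm; have -> : nm (0 +i* (2 * pi) : C) = 2 * pi.
  by rewrite /nm /= expr0n /= add0r sqrtr_sqr ger0_norm// mulr_ge0// pi_ge0.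
by rewrite ler_wpM2l// !mulr_ge0// pi_ge0.
Qed.

(** The m-th Fourier coefficient is supplied as the total increment [lp m - lm m] of a primitive of
    the twisted function; the bound on [F''] controls, by Taylor expansion at the grid points, the
    second differences that [poisson] asks for. *)
Lemma poisson_full (F F' F'' : C -> C) (A : R) (P : int -> C -> C) (lp lm : int -> C) :
  (forall x : R, cder F x%:C (F' x%:C)) -> (forall x : R, cder F' x%:C (F'' x%:C)) ->
  (forall x : R, nm (F x%:C) <= A * wgt x) -> (forall x : R, nm (F' x%:C) <= A * wgt x) ->
  (forall x : R, nm (F'' x%:C) <= A * wgt x) ->
  (forall (m : int) (x : R), cder (P m) x%:C (F x%:C * e2pi (- (m%:~R * x%:C)))) ->
  (forall m, limp (fun x => P m x%:C) (lp m)) -> (forall m, limm (fun x => P m x%:C) (lm m)) ->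
  exists S, hasum (fun m => lp m - lm m) S /\ hasum (fun t : int => F (t%:~R)) S.
Proof.
move=> H1 H2 B0 B1 B2 HP Hp Hm.
have A0 : 0 <= A by have := le_trans (nm_ge0 _) (B0 0); rewrite pmulr_lge0 ?wgt_gt0.
have [||m|S [h1 h2]] := @poisson R (fun x => F x%:C) A (6 * A * (2 * (1 + pi / 2))) (fun m => lp m - lm m).
- exact: B0.
- move=> N N0.
  have N0' : 0 < N%:R :> R by rewrite ltr0n.
  have c0 : 0 <= 6 * A / N%:R by rewrite !mulr_ge0// invr_ge0.
  rewrite mulrAC; apply: bsum_le (bsumZ c0 (riemann_wgt R N0)) => k.
  set x := k%:~R / N%:R; set h := N%:R^-1.
  have -> : (k + 1)%:~R / N%:R = x + h by rewrite intrD mulrDl mul1r.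
  have -> : (k - 1)%:~R / N%:R = x + - h by rewrite intrB mulrBl mul1r.
  have t1 := @taylor1 R F F' F'' x h (3 * A * wgt x) (fun t _ => H1 _) (fun t _ => H2 _).
  have t2 := @taylor1 R F F' F'' x (- h) (3 * A * wgt x) (fun t _ => H1 _) (fun t _ => H2 _).
  have {}t1 : nm (F (x + h)%:C - F x%:C - h%:C * F' x%:C) <= 3 * A * wgt x * h ^+ 2.
    apply: t1 => t /(grid_seg k N0) ht; apply: le_trans (B2 _) _.
    by rewrite mulrAC [leRHS]mulrC ler_wpM2l// wgt_near.
  have {}t2 : nm (F (x + - h)%:C - F x%:C - (- h)%:C * F' x%:C) <= 3 * A * wgt x * h ^+ 2.
    rewrite -(sqrrN h); apply: t2 => t /(grid_segN k N0) ht; apply: le_trans (B2 _) _.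
    by rewrite mulrAC [leRHS]mulrC ler_wpM2l// wgt_near.
  have -> : F (x + h)%:C - 2 * F x%:C + F (x - h)%:C =
    (F (x + h)%:C - F x%:C - h%:C * F' x%:C) + (F (x + - h)%:C - F x%:C - (- h)%:C * F' x%:C).
    by rewrite rmorphN /=; ring.
  apply: le_trans (nmD _ _) (le_trans (lerD t1 t2) _).
  by rewrite le_eqVlt; apply/orP; left; apply/eqP; rewrite /h; field; rewrite gt_eqF.
- have [||c Hc] := @riemann_sum R (fun x => P m x%:C) (fun x => F x%:C * e2pi (- (m%:~R * x%:C)))
     A (3 * ((1 + `|m%:~R| * (2 * pi)) * A)) (lp m) (lm m) _ _ (Hp m) (Hm m).
  + by move=> x; rewrite nmM nm_twist mulr1.
  + move=> N k N0; set x := k%:~R / N%:R; set h := N%:R^-1.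
    have -> : (k + 1)%:~R / N%:R = x + h by rewrite intrD mulrDl mul1r.
    have := @taylor1 R (P m) (fun w => F w * e2pi (- (m%:~R * w)))
      (fun z => (F' z - (m%:~R * (0 +i* (2 * pi))) * F z) * e2pi (- (m%:~R * z))) x h
      (3 * ((1 + `|m%:~R| * (2 * pi)) * A) * wgt x) (fun t _ => HP m _).
    rewrite -exprVn; apply=> [t _|t /(grid_seg k N0) ht].
      exact: cder_twist.
    apply: le_trans (nm_twist_der _ (B1 _) (B0 _)) _.
    have q0 : 0 <= (1 + `|m%:~R| * (2 * pi)) * A.
      by rewrite mulr_ge0// addr_ge0// mulr_ge0// mulr_ge0// pi_ge0.
    by rewrite -[leRHS]mulrA [leRHS]mulrCA; apply: ler_wpM2l (wgt_near ht).
  by exists c.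
exists S; split=> //; apply: hasum_ext h2 => t.
by rewrite -intC.
Qed.

Lemma smb_single (I : choiceType) (i0 : I) (a : R) : 0 <= a ->
  bsum (fun i => if i == i0 then a else 0) a.
Proof.
move=> a0 B; have [iB|iB] := boolP (i0 \in B).
  rewrite (big_fsetD1 i0)//= eqxx big_seq big1 ?addr0// => i.
  by rewrite !inE => /andP[/negPf ->].
rewrite big_seq big1// => i iiB; case: eqP => // ii; by rewrite -ii iiB in iB.
Qed.

Lemma bsumD (I : choiceType) (g h : I -> R) M N : bsum g M -> bsum h N ->
  bsum (fun i => g i + h i) (M + N).
Proof. by move=> H K B; rewrite big_split lerD. Qed.

(** Because [F 0 = 0], extending [F] by zero to the left is continuous with a corner at 0. Among the
    second differences the corner only affects the one at index 0, by at most [A / N], which the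
    hypothesis of [poisson] tolerates. *)
Lemma poisson_half (F F' F'' : C -> C) (A : R) (P : int -> C -> C) (lp : int -> C) :
  (forall x : R, cder F x%:C (F' x%:C)) -> (forall x : R, cder F' x%:C (F'' x%:C)) ->
  (forall x : R, 0 <= x -> nm (F x%:C) <= A * wgt x) ->
  (forall x : R, 0 <= x -> nm (F' x%:C) <= A * wgt x) ->
  (forall x : R, 0 <= x -> nm (F'' x%:C) <= A * wgt x) ->
  F 0 = 0 ->
  (forall (m : int) (x : R), cder (P m) x%:C (F x%:C * e2pi (- (m%:~R * x%:C)))) ->
  (forall m, limp (fun x => P m x%:C) (lp m)) ->
  exists S, hasum (fun m => lp m - P m 0) S /\ hasum (fun n : nat => F n%:R) S.
Proof.
move=> H1 H2 B0 B1 B2 F0 HP Hp.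
have A0 : 0 <= A.
  by have := le_trans (nm_ge0 _) (B0 0 (lexx _)); rewrite pmulr_lge0 ?wgt_gt0.
pose f (x : R) := if 0 <= x then F x%:C else 0.
have f0 (x : R) : x <= 0 -> f x = 0.
  by rewrite /f le_eqVlt => /orP[/eqP ->|x0]; rewrite ?lexx// leNgt x0.
have fp (x : R) : 0 <= x -> f x = F x%:C by rewrite /f => ->.
have Bf x : nm (f x) <= A * wgt x.
  rewrite /f; case: ifP => [/B0//|_]; by rewrite nm0 mulr_ge0// wgt_ge0.
have kN (N : nat) (k : int) : (0 < N)%N -> 0 <= k -> 0 <= k%:~R / N%:R :> R.
  by move=> _ k0; rewrite divr_ge0// ler0z.
have seg (x h t : R) : 0 <= x -> 0 <= x + h -> 0 <= t <= 1 -> 0 <= x + t * h.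
  by move=> x0 xh /andP[t0 t1]; nra.
have kN0 (N : nat) (k : int) : (0 < N)%N -> k <= 0 -> k%:~R / N%:R <= 0 :> R.
  by move=> N0 k0; rewrite pmulr_lle0 ?invr_gt0 ?ltr0n// lerz0.
have [||m|S [h1 h2]] := @poisson R f A (A + 6 * A * (2 * (1 + pi / 2))) (fun m => lp m - P m 0).
- exact: Bf.
- move=> N N0.
  have N0' : 0 < N%:R :> R by rewrite ltr0n.
  have c0 : 0 <= 6 * A / N%:R by rewrite !mulr_ge0// invr_ge0.
  have c1 : 0 <= A / N%:R by rewrite !mulr_ge0// invr_ge0.
  rewrite mulrDl [X in _ + X]mulrAC.
  apply: bsum_le (bsumD (smb_single (0 : int) c1) (bsumZ c0 (riemann_wgt R N0))) => k.
  set x := k%:~R / N%:R; set h := N%:R^-1.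
  have h0 : 0 <= h by rewrite invr_ge0.
  have w0 : 0 <= 6 * A / N%:R * (h * wgt x) by rewrite mulr_ge0// mulr_ge0// wgt_ge0.
  have [k0|k0|k0] := ltgtP k 0; rewrite /=.
  + rewrite !f0; last 3 first.
    * by apply: kN0 => //; lia.
    * by apply: kN0 => //; lia.
    * by apply: kN0 => //; lia.
    by rewrite mulr0 subr0 addr0 nm0 add0r.
  + rewrite add0r !fp; last 3 first.
    * by apply: kN => //; lia.
    * by apply: kN => //; lia.
    * by apply: kN => //; lia.
    have xm : 0 <= x + - h.
      by have := @kN N (k - 1) N0; rewrite intrB mulrBl mul1r; apply; lia.
    have xp : 0 <= x + h.
      by have := @kN N (k + 1) N0; rewrite intrD mulrDl mul1r; apply; lia.
    have x0 : 0 <= x by apply: kN => //; lia.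
    have -> : (k + 1)%:~R / N%:R = x + h by rewrite intrD mulrDl mul1r.
    have -> : (k - 1)%:~R / N%:R = x + - h by rewrite intrB mulrBl mul1r.
    have t1 := @taylor1 R F F' F'' x h (3 * A * wgt x) (fun t _ => H1 _) (fun t _ => H2 _).
    have t2 := @taylor1 R F F' F'' x (- h) (3 * A * wgt x) (fun t _ => H1 _) (fun t _ => H2 _).
    have {}t1 : nm (F (x + h)%:C - F x%:C - h%:C * F' x%:C) <= 3 * A * wgt x * h ^+ 2.
      apply: t1 => t /[dup] /(seg _ _ _ x0 xp) ts /(grid_seg k N0) ht; apply: le_trans (B2 _ ts) _.
      by rewrite mulrAC [leRHS]mulrC ler_wpM2l// wgt_near.
    have {}t2 : nm (F (x + - h)%:C - F x%:C - (- h)%:C * F' x%:C) <= 3 * A * wgt x * h ^+ 2.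
      rewrite -(sqrrN h); apply: t2 => t /[dup] /(seg _ _ _ x0 xm) ts /(grid_segN k N0) ht.
      apply: le_trans (B2 _ ts) _.
      by rewrite mulrAC [leRHS]mulrC ler_wpM2l// wgt_near.
    have -> : F (x + h)%:C - 2 * F x%:C + F (x - h)%:C =
      (F (x + h)%:C - F x%:C - h%:C * F' x%:C) + (F (x + - h)%:C - F x%:C - (- h)%:C * F' x%:C).
      by rewrite rmorphN /=; ring.
    apply: le_trans (nmD _ _) (le_trans (lerD t1 t2) _).
    by rewrite le_eqVlt; apply/orP; left; apply/eqP; rewrite /h; field; rewrite gt_eqF.
  + apply: (@le_trans _ _ (A * h)); last by rewrite lerDl.
    rewrite /x k0.
    rewrite (f0 ((0 - 1)%:~R / N%:R)); last by apply: kN0.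
    rewrite (f0 (0%:~R / N%:R)); last by rewrite mul0r.
    rewrite mulr0 subr0 addr0 add0r fp ?mul1r ?invr_ge0//.
    have := @cmvt R F 0 (h%:C) A; rewrite F0 !subr0 nm_real ger0_norm//; apply => t /andP[t0 t1].
    exists (F' (t * h)%:C); rewrite add0r -rmorphM; split; first exact: H1.
    have th : 0 <= t * h by rewrite mulr_ge0.
    by apply: le_trans (B1 _ th) _; rewrite ler_piMr ?wgt_le1.
(* The primitive of the extended function, normalised to vanish at 0, so that its limit on the left
   is 0. *)
- pose Q (x : R) := if 0 <= x then P m x%:C - P m 0 else 0.
  have Q0 (x : R) : x <= 0 -> Q x = 0.
    by rewrite /Q le_eqVlt => /orP[/eqP ->|x0]; rewrite ?lexx ?subrr// leNgt x0.
  have Qp (x : R) : 0 <= x -> Q x = P m x%:C - P m 0 by rewrite /Q => ->.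
  have [||||c] := @riemann_sum R Q (fun x => f x * e2pi (- (m%:~R * x%:C)))
     A (3 * ((1 + `|m%:~R| * (2 * pi)) * A)) (lp m - P m 0) 0.
  + by move=> x; rewrite nmM nm_twist mulr1.
  + move=> N k N0; set x := k%:~R / N%:R; set h := N%:R^-1.
    have m0 : 0 <= 3 * ((1 + `|m%:~R| * (2 * pi)) * A).
      by rewrite mulr_ge0// mulr_ge0// addr_ge0// mulr_ge0// mulr_ge0// pi_ge0.
    have [k0|k0] := leP 0 k; last first.
      rewrite !Q0 ?f0; last 3 first.
      * by apply: kN0 => //; lia.
      * by apply: kN0 => //; lia.
      * by apply: kN0 => //; lia.
      by rewrite mul0r mulr0 !subr0 nm0 divr_ge0 ?exprn_ge0// mulr_ge0// wgt_ge0.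
    have xp : 0 <= x + h.
      by have := @kN N (k + 1) N0; rewrite intrD mulrDl mul1r; apply; lia.
    have x0 : 0 <= x by apply: kN => //; lia.
    have -> : (k + 1)%:~R / N%:R = x + h by rewrite intrD mulrDl mul1r.
    rewrite !Qp// fp// opprB addrA subrK.
    have := @taylor1 R (P m) (fun w => F w * e2pi (- (m%:~R * w)))
      (fun z => (F' z - (m%:~R * (0 +i* (2 * pi))) * F z) * e2pi (- (m%:~R * z))) x h
      (3 * ((1 + `|m%:~R| * (2 * pi)) * A) * wgt x) (fun t _ => HP m _).
    rewrite -exprVn; apply=> [t _|t /[dup] /(seg _ _ _ x0 xp) ts /(grid_seg k N0) ht].
      exact: cder_twist.
    apply: le_trans (nm_twist_der _ (B1 _ ts) (B0 _ ts)) _.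
    have q0 : 0 <= (1 + `|m%:~R| * (2 * pi)) * A.
      by rewrite mulr_ge0// addr_ge0// mulr_ge0// mulr_ge0// pi_ge0.
    by rewrite -[leRHS]mulrA [leRHS]mulrCA; apply: ler_wpM2l (wgt_near ht).
  + move=> e /(Hp m)[X HX]; exists (Num.max X 0) => x; rewrite ge_max => /andP[x1 x2].
    by rewrite Qp// opprB addrA subrK; exact: HX.
  + by move=> e e0; exists 0 => x x0; rewrite Q0// subrr nm0.
  by rewrite subr0 => Hc; exists c.
exists S; split=> //.
have : hasum ((fun t : int => f t%:~R) \o Posz) S.
  apply/(hasum_inj (h := Posz)) => //; first by move=> a b [].
  move=> [n|n] hn; first by case: (hn n).
  by apply: f0; rewrite lerz0.
by apply: hasum_ext => n /=; rewrite fp//= -natC.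
Qed.

End PoissonApplications.

(** * Poisson summation for Gaussians *)

Section ThetaPoisson.
Variable R : realType.
Local Notation C := R[i].

Lemma gauss_bd (g : R) : 0 < g -> exists A : R, 0 <= A /\
  forall y, expR (- (g * y ^+ 2)) * (1 + y ^+ 2) ^+ 2 <= A.
Proof.
move=> g0; exists ((1 + 2 / g) ^+ 2); split; first exact: sqr_ge0.
move=> y; have y2 := sqr_ge0 y.
have h1 : expR (- (g * y ^+ 2)) <= (1 + g * y ^+ 2 / 2) ^- 2.
  have p : 0 < 1 + g * y ^+ 2 / 2 by rewrite ltr_pwDl// divr_ge0// mulr_ge0// ltW.
  rewrite expRN lef_pV2 ?posrE ?expR_gt0 ?exprn_gt0//.
  have e : g * y ^+ 2 = 2%:R * (g * y ^+ 2 / 2) by field.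
  rewrite [X in expR X]e expRM_natl lerXn2r ?nnegrE ?expR_ge0 ?(ltW p)//.
  exact: expR_ge1Dx.
have h2 : 1 + y ^+ 2 <= (1 + 2 / g) * (1 + g * y ^+ 2 / 2).
  have -> : (1 + 2 / g) * (1 + g * y ^+ 2 / 2) = 1 + y ^+ 2 + 2 / g + g * y ^+ 2 / 2.
    by field; rewrite gt_eqF.
  have : 0 <= 2 / g by rewrite divr_ge0// ltW.
  have : 0 <= g * y ^+ 2 / 2 by rewrite divr_ge0// mulr_ge0// ltW.
  lra.
apply: le_trans (ler_wpM2r (sqr_ge0 _) h1) _.
rewrite mulrC ler_pdivrMr ?exprn_gt0//; last first.
  by rewrite ltr_pwDl// divr_ge0// mulr_ge0// ltW.
rewrite -exprMn lerXn2r ?nnegrE//; first by rewrite addr_ge0.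
by rewrite (le_trans _ h2)// addr_ge0.
Qed.

Lemma wgt_shift (x x0 : R) : wgt (x + x0) <= 2 * (1 + x0 ^+ 2) * wgt x.
Proof.
rewrite /wgt ler_pdivlMr ?ltr_pwDl ?sqr_ge0// mulrC ler_pdivrMr ?ltr_pwDl ?sqr_ge0//.
rewrite -subr_ge0 (_ : _ - _ = 1 + (x + 2 * x0) ^+ 2 + 2 * (x0 * (x + x0)) ^+ 2); last by ring.
by have := sqr_ge0 (x + 2 * x0); have := sqr_ge0 (x0 * (x + x0)); lra.
Qed.

Lemma Re_inv (z : C) : complex.Re z^-1 = complex.Re z / nm z ^+ 2.
Proof. by rewrite nm_sqr; case: z. Qed.

Lemma gauss_bd1 (n y : R) : 0 <= n -> 0 <= y -> 2 * n * y <= (4 * n ^+ 2 + 2 * n + 1) * (1 + y ^+ 2).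
Proof.
move=> n0 y0; have : 0 <= 4 * n ^+ 2 * (1 + y ^+ 2) by rewrite !mulr_ge0// addr_ge0 ?sqr_ge0.
have : 0 <= n * (y - 1) ^+ 2 by rewrite mulr_ge0 ?sqr_ge0.
have : 0 <= n * (1 + y ^+ 2) by rewrite mulr_ge0// addr_ge0 ?sqr_ge0.
have := sqr_ge0 y; lra.
Qed.

Lemma gauss_bd2 (n y : R) : 0 <= n ->
  4 * n ^+ 2 * y ^+ 2 + 2 * n <= (4 * n ^+ 2 + 2 * n + 1) * (1 + y ^+ 2).
Proof.
move=> n0; have := sqr_ge0 n; have := sqr_ge0 y.
have : 0 <= n * y ^+ 2 by rewrite mulr_ge0 ?sqr_ge0.
lra.
Qed.

(** The value of [erfi_lim] is still unknown, so the theta transformation is first obtained up to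
    this constant. *)
Let kap0 : C := 2 * erfi_lim R / ('i * (Num.sqrt pi)%:C).

Let gauss_term (s x0 z : C) : C := cexp (- (pi%:C / s ^+ 2 * (z + x0) ^+ 2)).

Lemma theta_sq (j sg p w y m : C) : sg ^+ 2 = p / w -> w != 0 -> j ^+ 2 = - 1 ->
  (j * sg * (y + j * m * w)) ^+ 2 = - (p / w * y ^+ 2) - 2 * p * j * (m * y) + p * m ^+ 2 * w.
Proof.
move=> sE w0 jE.
transitivity (j ^+ 2 * (sg ^+ 2 * (y ^+ 2 + 2 * j * m * w * y + j ^+ 2 * m ^+ 2 * w ^+ 2))); first by ring.
by rewrite sE jE; field.
Qed.

(** Completing the square makes [erfi] of the affine function [u m] a primitive of the Gaussian
    times e(-mz), up to the constant [K m / ('i * sg)]. The square of [u m] has bounded real part on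
    the real line, so the limits at the two ends are given by [erfi_lim] and [- erfi_lim]. *)
Lemma theta_poisson_aux (s : C) (x0 : R) : 0 < complex.Re s -> 0 < complex.Re (s ^+ 2) ->
  exists S, hasum (fun m : int => kap0 * s * (cexp (- (pi%:C * m%:~R ^+ 2 * s ^+ 2)) *
      e2pi (m%:~R * x0%:C))) S /\
    hasum (fun t : int => gauss_term s x0%:C t%:~R) S.
Proof.
move=> s0 s20; have sn0 : s != 0 by apply/eqP => sE; rewrite sE /= ltxx in s0.
have p0 := @pi_gt0 R.
set w := s ^+ 2; have w0 : w != 0 by rewrite expf_neq0.
pose c := pi%:C / w; pose X0 : C := x0%:C.
have g0 : 0 < complex.Re c.
  rewrite /c ReM /= mul0r subr0 Re_inv mulr_gt0// divr_gt0// exprn_gt0// nm_gt0//.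
have [A [A0 HA]] := gauss_bd g0.
pose sg : C := (Num.sqrt pi)%:C / s.
have sq0 : 0 < Num.sqrt pi :> R by rewrite sqrtr_gt0.
have sqn : (Num.sqrt pi)%:C != 0 :> C by rewrite -nm_gt0 nm_real gtr0_norm.
have sg2 : sg ^+ 2 = c.
  rewrite /sg exprMn -rmorphXn /= sqr_sqrtr ?pi_ge0// exprVn//.
have sg0 : sg != 0 by rewrite mulf_neq0 ?invr_eq0.
have Resg : 0 < complex.Re sg.
  by rewrite /sg ReM /= mul0r subr0 Re_inv mulr_gt0// divr_gt0// exprn_gt0// nm_gt0.
pose F (z : C) := cexp (- (c * (z + X0) ^+ 2)).
pose F' (z : C) := - (2 * c) * ((z + X0) * F z).
pose F'' (z : C) := (4 * c ^+ 2 * (z + X0) ^+ 2 - 2 * c) * F z.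
have DX z : cder (fun z : C => z + X0) z 1.
  by have := cderD (cder_id z) (cder_cst X0 z); rewrite addr0.
have DF z : cder F z (F' z).
  have := cder_cexp_comp (cderN (cderZ c (cder_comp (DX z) (cderX 1 (z + X0))))).
  by apply: cder_eq; rewrite /F' /F expr1; ring.
have DF' z : cder F' z (F'' z).
  have := cderZ (- (2 * c)) (cderM (DX z) (DF z)).
  by apply: cder_eq; rewrite /F'' /F'; ring.
pose u (m : int) (z : C) := 'i * sg * (z + X0 + 'i * m%:~R * w).
pose K (m : int) : C := cexp (- (pi%:C * m%:~R ^+ 2 * w)) * e2pi (m%:~R * X0).
pose P (m : int) (z : C) := K m / ('i * sg) * erfi (u m z).
have i0 : ('i : C) != 0 by rewrite eq_complex /= oner_eq0 andbF.
have Du m z : cder (u m) z ('i * sg).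
  have := cderZ ('i * sg) (cderD (DX z) (cder_cst ('i * m%:~R * w) z)).
  by rewrite addr0 mulr1.
have u2 m z : u m z ^+ 2 = - (c * (z + X0) ^+ 2) - (0 +i* (2 * pi)) * (m%:~R * (z + X0)) +
    pi%:C * m%:~R ^+ 2 * w.
  rewrite /u (@theta_sq _ _ pi%:C w _ _ _ _ (sqr_i R))// (_ : 0 +i* (2 * pi) = 2 * pi%:C * 'i :> C)//.
  by apply: complex_ext; rewrite !(ReM, ImM) /=; ring.
have DP m (x : R) : cder (P m) x%:C (F x%:C * e2pi (- (m%:~R * x%:C))).
  have := cderZ (K m / ('i * sg)) (cder_comp (Du m x%:C) (cder_erfi _)).
  apply: cder_eq; rewrite u2 /F.
  rewrite (_ : _ + _ = - (c * (x%:C + X0) ^+ 2) + ((0 +i* (2 * pi)) * (- (m%:~R * (x%:C + X0)))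
     + pi%:C * m%:~R ^+ 2 * w)); last by ring.
  rewrite cexpD [cexp (_ + _ * w)]cexpD /K cexpN.
  rewrite -/(e2pi (- (m%:~R * (x%:C + X0)))) mulrDr opprD e2piD !e2piN.
  set a := cexp _; set b := cexp _; set d := e2pi _; set e := e2pi _.
  have b0 : b != 0 by exact: cexp_neq0.
  have e0 : e != 0 by exact: e2pi_neq0.
  have d0 : d != 0 by exact: e2pi_neq0.
  field; rewrite e0 d0 sg0 ?neq0Ci ?i0 ?b0 ?cexp_neq0//.
have Reu2 m (x : R) : complex.Re (u m x%:C ^+ 2) <= pi * m%:~R ^+ 2 * complex.Re w.
  rewrite u2 /X0 -rmorphD -(rmorph_int (real_complex R)) -!rmorphXn -!rmorphM /=.
  rewrite !(ReD, ReN, ReM) /= !mul0r !mulr0 !subr0 gerDr oppr_le0.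
  by have := g0; rewrite /c ReM /= mul0r subr0 => /ltW h; rewrite mulr_ge0 ?sqr_ge0.
have Imu m (x : R) : complex.Im (u m x%:C) =
    complex.Re sg * x + (complex.Re sg * x0 + complex.Re (sg * ('i * m%:~R * w))).
  by rewrite /u /X0 -mulrA ImM /= mul1r mul0r add0r mulrDr ReD -rmorphD ReM /= mulr0 subr0 mulrDr addrA.
have B (x : R) : let y := x + x0 in
   expR (- (complex.Re c * y ^+ 2)) * (1 + y ^+ 2) <= A * (2 * (1 + x0 ^+ 2)) * wgt x.
  move=> y; apply: (@le_trans _ _ (A * wgt y)).
    rewrite ler_pdivlMr ?ltr_pwDl ?sqr_ge0// -mulrA -expr2; exact: HA.
  by rewrite -mulrA ler_wpM2l// wgt_shift.
have FE (x : R) : nm (F x%:C) = expR (- (complex.Re c * (x + x0) ^+ 2)).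
  rewrite /F /X0 nm_cexp -rmorphD -rmorphXn /= ReN ReM /= mulr0 subr0 //.
pose A1 := (4 * nm c ^+ 2 + 2 * nm c + 1) * (A * (2 * (1 + x0 ^+ 2))).
have nc := nm_ge0 c.
have bnd (x : R) (a : C) : nm a <= (4 * nm c ^+ 2 + 2 * nm c + 1) * (1 + (x + x0) ^+ 2) ->
    nm (a * F x%:C) <= A1 * wgt x.
  move=> ha; rewrite nmM FE /A1 -mulrA.
  apply: (@le_trans _ _ ((4 * nm c ^+ 2 + 2 * nm c + 1) * ((expR (- (complex.Re c * (x + x0) ^+ 2))) * (1 + (x + x0) ^+ 2)))).
    by rewrite (mulrC (expR _)) [leRHS]mulrA ler_wpM2r ?expR_ge0.
  apply: ler_wpM2l (B x); rewrite !addr_ge0// mulr_ge0// exprn_ge0//.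
have xx (x : R) : nm (x%:C + X0) = `|x + x0| by rewrite /X0 -rmorphD nm_real.
have y2 (x : R) : `|x + x0| ^+ 2 = (x + x0) ^+ 2 by rewrite real_normK ?num_real.
have [x|x|x|m|m|S [h1 h2]] := @poisson_full R F F' F'' A1 P
   (fun m => K m / ('i * sg) * erfi_lim R) (fun m => K m / ('i * sg) * - erfi_lim R)
   (fun x => DF _) (fun x => DF' _) _ _ _ DP.
- rewrite -[F _]mul1r; apply: bnd; rewrite nm1.
  have := sqr_ge0 (x + x0); have := sqr_ge0 (nm c); nra.
- rewrite /F' mulrA; apply: bnd; rewrite (nmM _ (x%:C + X0)) nmN (nmM 2 c) (nm_nat R 2) xx -(y2 x).
  exact: gauss_bd1.
- apply: bnd; apply: le_trans (nmB _ _) _; rewrite (nmM _ (_ ^+ 2)) (nmM 4) (nmM 2 c).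
  by rewrite (nm_nat R 2) (nm_nat R 4) !nmX xx -(y2 x); exact: gauss_bd2.
- move=> e e0; pose k := nm (K m / ('i * sg)) + 1.
  have k0 : 0 < k by rewrite ltr_wpDl// nm_ge0.
  have [Y [Y0 HY]] := erfi_cvg (pi * m%:~R ^+ 2 * complex.Re w) (divr_gt0 e0 k0).
  exists ((Y - (complex.Re sg * x0 + complex.Re (sg * ('i * m%:~R * w)))) / complex.Re sg) => x.
  rewrite ler_pdivrMr// lerBlDr mulrC -Imu => /(HY _ (Reu2 m x)).
  rewrite /P -mulrBr nmM ltr_pdivlMr// => h; apply: le_lt_trans h.
  by rewrite /k mulrDr mulr1 mulrC lerDl nm_ge0.
- move=> e e0; pose k := nm (K m / ('i * sg)) + 1.
  have k0 : 0 < k by rewrite ltr_wpDl// nm_ge0.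
  have [Y [Y0 HY]] := erfi_cvgN (pi * m%:~R ^+ 2 * complex.Re w) (divr_gt0 e0 k0).
  exists ((- Y - (complex.Re sg * x0 + complex.Re (sg * ('i * m%:~R * w)))) / complex.Re sg) => x.
  rewrite ler_pdivlMr// lerBrDr mulrC -Imu => /(HY _ (Reu2 m x)).
  rewrite /P -mulrBr opprK nmM ltr_pdivlMr// => h; apply: le_lt_trans h.
  by rewrite /k mulrDr mulr1 mulrC lerDl nm_ge0.
exists S; split=> //; apply: hasum_ext h1 => m.
rewrite /kap0 /sg -/X0 -/w -/(K m).
field; rewrite sn0 sqn ?neq0Ci ?i0//.
Qed.

(** At s = 1 and x0 = 0 both sides are the same theta series, which is nonzero because its terms are
    positive. *)
Lemma kap0_eq1 : kap0 = 1.
Proof.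
have [||S [h1 h2]] := @theta_poisson_aux 1 0; rewrite ?expr1n//= ?ltr01//.
have e1 (m : int) : cexp (- (pi%:C * m%:~R ^+ 2 * 1 ^+ 2)) * e2pi (m%:~R * 0%:C) =
    (expR (- (pi * m%:~R ^+ 2)))%:C :> C.
  rewrite mulr0 e2pi0 mulr1 expr1n mulr1 -cexp_real; congr cexp.
  by rewrite intC -rmorphXn -rmorphM -rmorphN.
have e2 (m : int) : gauss_term 1 0%:C m%:~R = (expR (- (pi * m%:~R ^+ 2)))%:C.
  rewrite /gauss_term addr0 expr1n divr1 -cexp_real; congr cexp.
  by rewrite intC -rmorphXn -rmorphM -rmorphN.
have {}h1 : hasum (fun m : int => kap0 * (expR (- (pi * m%:~R ^+ 2)))%:C) S.
  by apply: hasum_ext h1 => m; rewrite e1 mulr1.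
have {}h2 : hasum (fun m : int => (expR (- (pi * m%:~R ^+ 2)))%:C) S.
  by apply: hasum_ext h2 => m; rewrite e2.
have S0 : S != 0.
  apply/eqP => S0; have [A] := h2 _ (ltr01 : (0 : R) < 1).
  move=> /(_ (A `|` [fset 0%R])%fset (fsubsetUl _ _)); rewrite S0 subr0 -rmorph_sum /= nm_real.
  rewrite ger0_norm; last by rewrite sumr_ge0// => i _; exact: expR_ge0.
  rewrite (big_fsetD1 (0 : int)) ?inE ?eqxx ?orbT//= expr0n /= mulr0 oppr0 expR0.
  rewrite gtrDl ltNge sumr_ge0// => i _; exact: expR_ge0.
by apply: (mulIf S0); rewrite mul1r; apply: hasum_uniq h1; exact: hasumZ.
Qed.

Lemma theta_poisson (s : C) (x0 : R) : 0 < complex.Re s -> 0 < complex.Re (s ^+ 2) ->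
  exists S, hasum (fun m : int => s * (cexp (- (pi%:C * m%:~R ^+ 2 * s ^+ 2)) *
      e2pi (m%:~R * x0%:C))) S /\
    hasum (fun t : int => cexp (- (pi%:C / s ^+ 2 * (t%:~R + x0%:C) ^+ 2))) S.
Proof.
move=> h1 h2; have [S [a b]] := theta_poisson_aux x0 h1 h2; exists S; split=> //.
by apply: hasum_ext a => m; rewrite kap0_eq1 mul1r.
Qed.

Lemma erfi_lim_eq : erfi_lim R = 'i * (Num.sqrt pi)%:C / 2.
Proof.
have := kap0_eq1; rewrite /kap0 => h.
have q : 'i * (Num.sqrt pi)%:C != 0 :> C.
  rewrite mulf_neq0//; first by rewrite eq_complex /= oner_eq0 andbF.
  by rewrite -nm_gt0 nm_real normr_gt0 gt_eqF// sqrtr_gt0 pi_gt0.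
move: q h; set v := _ * _ => q h; move: h => /(congr1 (fun x => x * v)).
by rewrite mulfVK// mul1r => <-; field.
Qed.

End ThetaPoisson.

(** * Polynomials times exponentials and Lipschitz's formula *)

Section PolyExp.
Variable R : realType.
Local Notation C := R[i].

Definition pe (p : {poly C}) (l z : C) : C := p.[z] * cexp (l * z).

Lemma cder_horner (p : {poly C}) z : cder (fun z => p.[z]) z (p^`()).[z].
Proof.
elim/poly_ind: p => [|p c IH].
  by rewrite deriv0 horner0; apply: cder_ext (cder_cst 0 z) => w; rewrite horner0.
have := cderD (cderM IH (cder_id z)) (cder_cst c z); rewrite derivMXaddC.
rewrite hornerD hornerMX mulr1 addr0 addrC; apply: cder_ext => w.
by rewrite hornerMXaddC.
Qed.

Lemma cder_pe p l z : cder (pe p l) z (pe (p^`() + l *: p) l z).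
Proof.
have E : cder (fun z => l * z) z l by have := cderZ l (cder_id z); rewrite mulr1.
have := cderM (cder_horner p z) (cder_cexp_comp E).
apply: cder_eq; rewrite /pe hornerD hornerZ; ring.
Qed.

Lemma pow_exp_bd (j : nat) (a : R) : 0 < a -> exists A : R, 0 <= A /\
  forall x, 0 <= x -> x ^+ j * expR (- (a * x)) <= A.
Proof.
move=> a0; exists (j.+1`!%:R / a ^+ j.+1 + 1); split.
  by rewrite addr_ge0// divr_ge0// exprn_ge0// ltW.
move=> x x0; have ax0 : 0 <= a * x by rewrite mulr_ge0// ltW.
have aj : 0 < a ^+ j.+1 by rewrite exprn_gt0.
have [x1|x1] := leP x 1.
  rewrite -[leLHS]mulr1 mulr1; apply: (@le_trans _ _ 1).
    rewrite -[leRHS]mulr1; apply: ler_pM; rewrite ?exprn_ge0 ?expR_ge0 ?exprn_ile1//.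
    by rewrite -expR0 ler_expR oppr_le0.
  by rewrite lerDr divr_ge0// ltW.
apply: (@le_trans _ _ (j.+1`!%:R / a ^+ j.+1)); last by rewrite lerDl.
have h := expR_ge1Dxn j ax0.
have f0 : 0 < j.+1`!%:R :> R by rewrite ltr0n fact_gt0.
have h2 : (a * x) ^+ j.+1 / j.+1`!%:R <= expR (a * x) by apply: le_trans h; rewrite lerDr.
rewrite expRN ler_pdivrMr ?expR_gt0// mulrAC ler_pdivlMr//.
rewrite ler_pdivrMr// in h2; rewrite (mulrC _ (expR _)); apply: le_trans h2.
by rewrite exprMn mulrC ler_wpM2l ?(ltW aj)// exprS ler_peMl ?exprn_ge0// ltW.
Qed.

Lemma pe_bd p l : complex.Re l < 0 -> exists A : R, 0 <= A /\
  forall x, 0 <= x -> nm (pe p l x%:C) <= A * wgt x.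
Proof.
move=> l0; pose a := - complex.Re l; have a0 : 0 < a by rewrite oppr_gt0.
have /choice[B HB] j := pow_exp_bd j a0.
exists (\sum_(i < size p) nm p`_i * (B i + B i.+2)); split.
  rewrite sumr_ge0// => i _; rewrite mulr_ge0 ?nm_ge0// addr_ge0//.
    by case: (HB i).
  by case: (HB i.+2).
move=> x x0; rewrite /pe nmM nm_cexp ReM /= mulr0 subr0.
have -> : complex.Re l * x = - (a * x) by rewrite /a mulNr opprK.
rewrite horner_coef mulr_suml; apply: le_trans (ler_wpM2r (expR_ge0 _) (nm_sum _ _)) _.
rewrite mulr_suml; apply: ler_sum => i _; rewrite nmM nmX nm_real (ger0_norm x0).
rewrite -!mulrA ler_wpM2l ?nm_ge0// ler_pdivlMr ?ltr_pwDl ?sqr_ge0// mulrDr mulr1.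
have [_ h1] := HB i; have [_ h2] := HB i.+2; apply: lerD; first exact: h1.
by rewrite mulrAC -exprD addn2; exact: h2.
Qed.

Lemma pe_limp p l : complex.Re l < 0 -> limp (fun x => pe p l x%:C) 0.
Proof.
move=> /(pe_bd p)[A [A0 H]] e e0; exists (A / e + 1) => x Hx.
have x0 : 0 <= A / e by rewrite divr_ge0// ltW.
have x1 : 1 <= x by lra.
rewrite subr0; apply: le_lt_trans (H x _) _; first by lra.
rewrite /wgt ltr_pdivrMr ?ltr_pwDl ?sqr_ge0// mulrC -ltr_pdivrMr//.
by have := sqr_ge0 (x - 1); nra.
Qed.

Definition twist (l : C) (m : int) : C := l - (0 +i* (2 * pi)) * m%:~R.

(** Two exponentials are treated together because [poisson_half] requires the value 0 at the origin:
    for a quadratic form the two constant terms cancel only against each other. *)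
Lemma poisson_pe2 (p1 p2 : {poly C}) (l1 l2 : C) (q1 q2 : int -> {poly C}) :
  complex.Re l1 < 0 -> complex.Re l2 < 0 -> p1.[0] + p2.[0] = 0 ->
  (forall m, (q1 m)^`() + twist l1 m *: q1 m = p1) ->
  (forall m, (q2 m)^`() + twist l2 m *: q2 m = p2) ->
  exists S, hasum (fun m : int => - ((q1 m).[0] + (q2 m).[0])) S /\
    hasum (fun n : nat => pe p1 l1 n%:R + pe p2 l2 n%:R) S.
Proof.
move=> l10 l20 p0 H1 H2.
pose D l (p : {poly C}) := p^`() + l *: p.
pose F z := pe p1 l1 z + pe p2 l2 z.
pose F' z := pe (D l1 p1) l1 z + pe (D l2 p2) l2 z.
pose F'' z := pe (D l1 (D l1 p1)) l1 z + pe (D l2 (D l2 p2)) l2 z.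
pose P m z := pe (q1 m) (twist l1 m) z + pe (q2 m) (twist l2 m) z.
have Retw l (m : int) : complex.Re (twist l m) = complex.Re l.
  by rewrite /twist intC ReD ReN ReM /= mul0r mulr0 subrr subr0.
have tw p l m z : pe p (twist l m) z = pe p l z * e2pi (- (m%:~R * z)).
  rewrite /pe /e2pi -mulrA -cexpD; congr (_ * cexp _); rewrite /twist; ring.
have bd2 (p p' : {poly C}) : exists A : R, forall x, 0 <= x ->
    nm (pe p l1 x%:C + pe p' l2 x%:C) <= A * wgt x.
  have [A1 [_ h1]] := pe_bd p l10; have [A2 [_ h2]] := pe_bd p' l20.
  exists (A1 + A2) => x x0; apply: le_trans (nmD _ _) _.
  by rewrite mulrDl lerD ?h1 ?h2.
have [A0 h0] := bd2 p1 p2; have [A1 h1] := bd2 (D l1 p1) (D l2 p2).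
have [A2 h2] := bd2 (D l1 (D l1 p1)) (D l2 (D l2 p2)).
have [A [a0 a1 a2]] : exists A : R, [/\ A0 <= A, A1 <= A & A2 <= A].
  by exists (Num.max A0 (Num.max A1 A2)); rewrite !le_max !lexx !orbT.
have [|x|x x0|x x0|x x0||m x|m|S [s1 s2]] := @poisson_half R F F' F'' A P (fun=> 0).
- by move=> x; apply: cderD; exact: cder_pe.
- by apply: cderD; exact: cder_pe.
- by apply: le_trans (h0 _ x0) _; rewrite ler_wpM2r ?wgt_ge0.
- by apply: le_trans (h1 _ x0) _; rewrite ler_wpM2r ?wgt_ge0.
- by apply: le_trans (h2 _ x0) _; rewrite ler_wpM2r ?wgt_ge0.
- by rewrite /F /pe !mulr0 cexp0 !mulr1.
- have := cderD (cder_pe (q1 m) (twist l1 m) x%:C) (cder_pe (q2 m) (twist l2 m) x%:C).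
  by apply: cder_eq; rewrite H1 H2 !tw mulrDl.
- move=> e e0; have e2 : 0 < e / 2 by rewrite divr_gt0.
  have [|X1 HX1] := @pe_limp (q1 m) (twist l1 m) _ _ e2; first by rewrite Retw.
  have [|X2 HX2] := @pe_limp (q2 m) (twist l2 m) _ _ e2; first by rewrite Retw.
  exists (Num.max X1 X2) => x; rewrite ge_max => /andP[/HX1 b1 /HX2 b2].
  rewrite !subr0 in b1 b2 *; apply: le_lt_trans (nmD _ _) _.
  by rewrite [e]splitr ltrD.
exists S; split; last by [].
by apply: hasum_ext s1 => m; rewrite sub0r /P /pe !mulr0 cexp0 !mulr1.
Qed.

(** Repeated integration by parts: [qpoly k u] times e^(uX) is a primitive of X^k e^(uX). *)
Fixpoint qpoly (k : nat) (u : C) : {poly C} :=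
  if k is k'.+1 then u^-1 *: 'X^k - (k%:R / u) *: qpoly k' u else u^-1%:P.

Lemma qpolyP k u : u != 0 -> (qpoly k u)^`() + u *: qpoly k u = 'X^k.
Proof.
move=> u0; elim: k => [|k IH].
  by rewrite /= derivC add0r -[u^-1%:P]alg_polyC scalerA mulfV// scale1r expr0.
rewrite [qpoly _ _]/= derivB !derivZ derivXn scalerBr !scalerA mulfV// scale1r.
have -> : u * (k.+1%:R / u) = k.+1%:R by rewrite mulrC mulfVK.
have -> : (qpoly k u)^`() = 'X^k - u *: qpoly k u by rewrite -IH addrK.
rewrite scalerBr scalerA mulfVK// /= -scaler_nat scalerA.
rewrite (mulrC u^-1) subKr addrC subrK.
by [].
Qed.

Lemma qpoly0 k (u : C) : u != 0 -> (qpoly k u).[0] = (- 1) ^+ k * k`!%:R / u ^+ k.+1.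
Proof.
move=> u0; elim: k => [|k IH].
  by rewrite /= hornerC expr0 mul1r fact0 mul1r expr1.
rewrite [qpoly _ _]/= hornerD hornerN !hornerZ hornerXn expr0n /= mulr0 sub0r IH.
rewrite factS natrM [(-1) ^+ k.+1]exprS [u ^+ k.+2]exprS.
have := expf_neq0 k.+1 u0; move: (u ^+ k.+1) ((-1) ^+ k) => a b a0.
by field; rewrite a0 u0.
Qed.

Lemma twist_neq0 l m : complex.Re l < 0 -> twist l m != 0.
Proof.
move=> l0; apply/eqP => /(congr1 (@complex.Re R)).
rewrite /twist intC ReD ReN ReM /= mul0r mulr0 subrr subr0 => h.
by rewrite h ltxx in l0.
Qed.

Definition tpi : C := 0 +i* (2 * pi).

Lemma tpi_neq0 : tpi != 0.
Proof. by rewrite eq_complex /= eqxx /= mulf_neq0// gt_eqF// pi_gt0. Qed.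

Lemma Re_tpiM z : complex.Re (tpi * z) = - (2 * pi * complex.Im z).
Proof. by rewrite ReM /= mul0r sub0r. Qed.

Lemma pe_nat (c : {poly C}) (z : C) (n : nat) : pe c (tpi * z) n%:R = c.[n%:R] * e2pi (n%:R * z).
Proof. by rewrite /pe /e2pi -/tpi; congr (_ * cexp _); ring. Qed.

Lemma lipschitz (k : nat) (z : C) : (0 < k)%N -> 0 < complex.Im z ->
  exists S, hasum (fun m : int => (z + m%:~R) ^- k.+1) S /\
    hasum (fun n : nat => (- tpi) ^+ k.+1 / k`!%:R * (n%:R ^+ k * e2pi (n%:R * z))) S.
Proof.
move=> k0 z0; pose l := tpi * z.
have l0 : complex.Re l < 0.
  by rewrite Re_tpiM oppr_lt0 mulr_gt0// mulr_gt0// pi_gt0.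
have [|||||S [s1 s2]] := @poisson_pe2 'X^k 0 l l (fun m => qpoly k (twist l m)) (fun=> 0).
- by [].
- by [].
- by rewrite hornerXn horner0 addr0 expr0n; case: k k0.
- by move=> m; exact/qpolyP/twist_neq0.
- by move=> m; rewrite deriv0 scaler0 addr0.
have kf : k`!%:R != 0 :> C by rewrite pnatr_eq0 -lt0n fact_gt0.
have t0 := tpi_neq0.
exists ((- tpi) ^+ k.+1 / k`!%:R * S); split; last first.
  apply: hasumZ; apply: hasum_ext s2 => n.
  by rewrite !pe_nat hornerXn horner0 mul0r addr0.
apply/(@hasum_bij _ _ _ (fun m : int => - m)); first by exists (fun m : int => - m) => x; rewrite opprK.
apply: hasum_ext (hasumZ _ s1) => m /=.
have tw := twist_neq0 m l0.
rewrite horner0 addr0 qpoly0// mulrNz.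
have twE : twist l m = tpi * (z - m%:~R) by rewrite /twist /l /tpi; ring.
rewrite twE in tw *; have zm : z - m%:~R != 0 by move: tw; rewrite mulf_eq0 negb_or => /andP[].
rewrite exprMn [(- tpi) ^+ _]exprNn [(-1) ^+ k.+1]exprS.
have : (-1) ^+ k * (-1) ^+ k = 1 :> C by rewrite -exprMn mulrNN mulr1 expr1n.
move: ((-1) ^+ k) => e ee.
transitivity (e * e * ((z - m%:~R) ^+ k.+1)^-1); last by rewrite ee mul1r.
have := expf_neq0 k.+1 t0; have := expf_neq0 k.+1 zm.
move: (tpi ^+ _) (_ ^+ k.+1) => a b b0 a0.
by field; rewrite a0 b0 kf.
Qed.

(** Partial fractions of 1/(x^2 (x+d)^2) contain the simple poles -2/(d^3 x) and 2/(d^3 (x+d)).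
    Their separate sums over translates do not converge absolutely, and they account for the
    opposite constants [2 * tpi / d ^+ 3] in the two exponentials. *)
Lemma lipschitz_form (u d : C) : d != 0 -> 0 < complex.Im u -> 0 < complex.Im (u + d) ->
  exists S, hasum (fun m : int => ((u + m%:~R) * (u + d + m%:~R)) ^- 2) S /\
    hasum (fun n : nat => (tpi ^+ 2 / d ^+ 2 * n%:R + 2 * tpi / d ^+ 3) * e2pi (n%:R * u) +
       (tpi ^+ 2 / d ^+ 2 * n%:R - 2 * tpi / d ^+ 3) * e2pi (n%:R * (u + d))) S.
Proof.
move=> d0 u0 v0; set v := u + d.
have Rel z : 0 < complex.Im z -> complex.Re (tpi * z) < 0.
  by move=> z0; rewrite Re_tpiM oppr_lt0 mulr_gt0// mulr_gt0// pi_gt0.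
have l10 := Rel _ u0; have l20 := Rel _ v0.
pose a := tpi ^+ 2 / d ^+ 2; pose b := 2 * tpi / d ^+ 3.
have qP (l : C) (c : C) m : complex.Re l < 0 ->
  (a *: qpoly 1 (twist l m) + c *: qpoly 0 (twist l m))^`() +
    twist l m *: (a *: qpoly 1 (twist l m) + c *: qpoly 0 (twist l m)) = a *: 'X + c%:P.
  move=> /twist_neq0 - /(_ m) tn; rewrite derivD !derivZ scalerDr !scalerA !(mulrC (twist l m)).
  rewrite -!scalerA addrACA -!scalerDr !qpolyP// expr1 expr0.
  by rewrite alg_polyC.
have [|||||S [s1 s2]] := @poisson_pe2 (a *: 'X + b%:P) (a *: 'X + (- b)%:P) (tpi * u) (tpi * v)
  (fun m => a *: qpoly 1 (twist (tpi * u) m) + b *: qpoly 0 (twist (tpi * u) m))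
  (fun m => a *: qpoly 1 (twist (tpi * v) m) + (- b) *: qpoly 0 (twist (tpi * v) m)).
- exact: l10.
- exact: l20.
- by rewrite !hornerD !hornerZ hornerX !hornerC; ring.
- by move=> m; exact: qP.
- by move=> m; exact: qP.
exists S; split; last first.
  apply: hasum_ext s2 => n; rewrite !pe_nat !hornerD !hornerZ hornerX !hornerC.
  by rewrite /a /b.
apply/(@hasum_bij _ _ _ (fun m : int => - m)); first by exists (fun m : int => - m) => x; rewrite opprK.
apply: hasum_ext s1 => m; rewrite [RHS]/=.
have tw1 := twist_neq0 m l10; have tw2 := twist_neq0 m l20.
rewrite !hornerD !hornerZ !qpoly0// mulrNz.
have twE z : twist (tpi * z) m = tpi * (z - m%:~R) by rewrite /twist /tpi; ring.
rewrite !twE in tw1 tw2 *.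
have zm1 : u - m%:~R != 0 by move: tw1; rewrite mulf_eq0 negb_or => /andP[].
have zm2 : v - m%:~R != 0 by move: tw2; rewrite mulf_eq0 negb_or => /andP[].
have t0 := tpi_neq0.
have dE : d = (v - m%:~R) - (u - m%:~R) by rewrite /v; ring.
rewrite /a /b -/v; move: zm1 zm2 d0; rewrite dE; move: (u - _ : C) (v - _ : C) => x y x0 y0 xy.
rewrite fact0 expr0 !expr1 (_ : 1`! = 1%N)//; field.
by rewrite xy y0 x0 t0.
Qed.

End PolyExp.

(** * q-series on the upper half-plane *)

Section QSeries.
Variable R : realType.
Local Notation C := R[i].

Definition rdec (a : nat -> C) := forall r : R, 0 <= r < 1 ->
  smb (fun n : nat => nm (a n) * r ^+ n).

(** An expansion in the powers q^(n + al), absolutely convergent on the whole upper half-plane; [al]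
    is fractional for eta and negative at a pole. *)
Definition qser (al : C) (a : nat -> C) (f : C -> C) := rdec a /\
  forall z, 0 < complex.Im z -> hasum (fun n : nat => a n * e2pi ((n%:R + al) * z)) (f z).

Definition cauchy (a b : nat -> C) (n : nat) : C := \sum_(i < n.+1) a i * b (n - i)%N.

Lemma e2pi_shift (al z : C) n : e2pi ((n%:R + al) * z) = e2pi (al * z) * e2pi z ^+ n.
Proof. by rewrite mulrDl e2piD e2piMn mulrC. Qed.

Lemma e2piE (z : C) : e2pi z = cexp (tpi R * z). Proof. by []. Qed.

Lemma nm_q_lt1 (z : C) : 0 < complex.Im z -> 0 <= nm (e2pi z) < 1.
Proof.
move=> z0; rewrite nm_ge0 nm_e2pi -expR0 ltr_expR oppr_lt0.
by rewrite !mulr_gt0 ?pi_gt0.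
Qed.

Lemma rdec_ext a b : (forall n, a n = b n) -> rdec a -> rdec b.
Proof. by move=> E H r /H; apply: smb_le => n; rewrite E. Qed.

Lemma rdec_le a b : (forall n, nm (a n) <= nm (b n)) -> rdec b -> rdec a.
Proof.
move=> E H r r01; move: (H r r01); apply: smb_le => n; apply: ler_wpM2r (E n).
by rewrite exprn_ge0//; case/andP: r01.
Qed.

Lemma rdecD a b : rdec a -> rdec b -> rdec (fun n => a n + b n).
Proof.
move=> Ha Hb r r01; have := smbD (Ha r r01) (Hb r r01); apply: smb_le => n.
rewrite -mulrDl ler_wpM2r ?nmD// exprn_ge0//; by case/andP: r01.
Qed.

Lemma rdecZ c a : rdec a -> rdec (fun n => c * a n).
Proof.
move=> Ha r r01; have := smbZ (nm_ge0 c) (Ha r r01); apply: smb_le => n.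
by rewrite nmM mulrA.
Qed.

Lemma rdec_pow k a : rdec a -> rdec (fun n => n%:R ^+ k * a n).
Proof.
move=> Ha r /andP[r0 r1]; pose r' := (r + 1) / 2.
have r'0 : 0 < r' by rewrite /r'; lra.
have r'1 : r' < 1 by rewrite /r'; lra.
have rr : r < r' by rewrite /r'; lra.
have [|K [rho [K0 /andP[p0 p1] H]]] := @poly_geom R k (r / r').
  by rewrite divr_ge0 ?(ltW r'0)//= ltr_pdivrMr// mul1r.
have [|M HM] := Ha r'; first by rewrite (ltW r'0).
have : smb (fun n => K * (nm (a n) * r' ^+ n)) by apply: smbZ => //; exists M.
apply: smb_le => n; rewrite nmM nmX nm_nat.
have -> : r ^+ n = (r / r') ^+ n * r' ^+ n by rewrite -exprMn mulfVK// gt_eqF.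
rewrite (mulrC (_ ^+ k)) -!mulrA (mulrA (_ ^+ k)) [leRHS]mulrCA.
apply: ler_wpM2l; rewrite ?nm_ge0//; apply: ler_wpM2r; first by rewrite exprn_ge0// ltW.
apply: le_trans (H n) _; rewrite -[leRHS]mulr1 ler_wpM2l// exprn_ile1// ltW//.
Qed.

Lemma rdec_smb a (al z : C) : 0 < complex.Im z -> rdec a ->
  smb (fun n : nat => nm (a n * e2pi ((n%:R + al) * z))).
Proof.
move=> z0 Ha; have := smbZ (nm_ge0 (e2pi (al * z))) (Ha _ (nm_q_lt1 z0)).
apply: smb_le => n; by rewrite e2pi_shift 2!nmM nmX mulrCA.
Qed.

Lemma cauchy_hasum (f g : nat -> C) s t : smb (fun n => nm (f n)) -> smb (fun n => nm (g n)) ->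
  hasum f s -> hasum g t -> hasum (cauchy f g) (s * t).
Proof.
move=> nf ng hf hg.
pose h (x : nat * nat) := ((x.1 + x.2)%N, x.1).
pose F (x : nat * nat) : C := if (x.2 <= x.1)%N then f x.2 * g (x.1 - x.2)%N else 0.
have hi : injective h.
  by move=> [i j] [i' j'] [] e1 e2 /=; subst i'; move/addnI: e1 => ->.
apply: (@hasum_sigma R _ _ F).
  apply/(@hasum_inj _ _ _ h _ _ hi); last first.
    by apply: hasum_ext (hasum_prod nf ng hf hg) => -[i j]; rewrite /F /h /= leq_addr addKn.
  move=> [n i] H; rewrite /F /=; case: leqP => // le; case: (H (i, n - i)%N).
  by rewrite /h /= subnKC.
move=> n; rewrite /cauchy.
have -> : \sum_(i < n.+1) f i * g (n - i)%N = \sum_(i <- seq_fset tt (iota 0 n.+1)) F (n, i).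
  rewrite sum_seq_fset ?iota_uniq// -[iota 0 n.+1]/(index_iota 0 n.+1) big_mkord.
  by apply: eq_bigr => i _; rewrite /F /= -ltnS ltn_ord.
apply: hasum_fin => i; rewrite seq_fsetE mem_iota /= add0n ltnS /F /= => /negbTE ->//.
Qed.

Lemma rdec_cauchy a b : rdec a -> rdec b -> rdec (cauchy a b).
Proof.
move=> Ha Hb r r01; have r0 : 0 <= r by case/andP: r01.
have P c : forall n, 0 <= nm (c n : C) * r ^+ n by move=> n; rewrite mulr_ge0 ?nm_ge0 ?exprn_ge0.
have [s hs] := smb_hasum_pos (P a) (Ha r r01); have [t ht] := smb_hasum_pos (P b) (Hb r r01).
have N c : rdec c -> smb (fun n => nm (nm (c n) * r ^+ n)%:C).
  by move=> Hc; apply: smb_le (Hc r r01) => n; rewrite nm_real ger0_norm ?P.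
have := cauchy_hasum (N _ Ha) (N _ Hb) hs ht.
have E n : cauchy (fun n => (nm (a n) * r ^+ n)%:C) (fun n => (nm (b n) * r ^+ n)%:C) n
  = (\sum_(i < n.+1) nm (a i) * nm (b (n - i)%N) * r ^+ n)%:C.
  rewrite /cauchy rmorph_sum /=; apply: eq_bigr => i _; rewrite -rmorphM /=; congr (_%:C).
  by rewrite mulrACA -exprD subnKC// -ltnS ltn_ord.
move/(hasum_ext E)/hasum_smb_pos => H; apply: smb_le (H _) => n.
  rewrite -mulr_suml ler_wpM2r ?exprn_ge0//; apply: le_trans (nm_sum _ _) _.
  by apply: ler_sum => i _; rewrite nmM.
by rewrite sumr_ge0// => i _; rewrite !mulr_ge0 ?nm_ge0 ?exprn_ge0.
Qed.

Definition qsum (al : C) (a : nat -> C) (z : C) : C :=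
  xget 0 [set s | hasum (fun n : nat => a n * e2pi ((n%:R + al) * z)) s]%classic.

Lemma qsumP al a : rdec a -> qser al a (qsum al a).
Proof.
move=> Ha; split=> // z z0; have [s hs] := smb_hasum (rdec_smb al z0 Ha).
by rewrite /qsum; case: xgetP => [y _ //|/(_ s)]; case.
Qed.

Lemma qser_ext al a f g : (forall z, 0 < complex.Im z -> f z = g z) -> qser al a f -> qser al a g.
Proof. by move=> E [Ha H]; split=> // z z0; rewrite -E//; exact: H. Qed.

Lemma qser_coef al a b f : (forall n, a n = b n) -> qser al a f -> qser al b f.
Proof.
move=> E [Ha H]; split; first exact: rdec_ext Ha.
by move=> z z0; apply: hasum_ext (H z z0) => n; rewrite E.
Qed.

Lemma qser_al al al' a f : al = al' -> qser al a f -> qser al' a f.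
Proof. by move=> ->. Qed.

Lemma qserD al a b f g : qser al a f -> qser al b g ->
  qser al (fun n => a n + b n) (fun z => f z + g z).
Proof.
move=> [Ha Hf] [Hb Hg]; split; first exact: rdecD.
by move=> z z0; apply: hasum_ext (hasumD (Hf z z0) (Hg z z0)) => n; rewrite [RHS]mulrDl.
Qed.

Lemma qserZ al a f c : qser al a f -> qser al (fun n => c * a n) (fun z => c * f z).
Proof.
move=> [Ha Hf]; split; first exact: rdecZ.
by move=> z z0; apply: hasum_ext (hasumZ c (Hf z z0)) => n; rewrite mulrA.
Qed.

Lemma qserM al be a b f g : qser al a f -> qser be b g ->
  qser (al + be) (cauchy a b) (fun z => f z * g z).
Proof.
move=> [Ha Hf] [Hb Hg]; split; first exact: rdec_cauchy.
move=> z z0; apply: hasum_ext (cauchy_hasum (rdec_smb al z0 Ha) (rdec_smb be z0 Hb) (Hf z z0) (Hg z z0)) => n.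
rewrite /cauchy mulr_suml; apply: eq_bigr => i _; rewrite mulrACA -e2piD; congr (_ * e2pi _).
have le : (i <= n)%N by rewrite -ltnS.
by rewrite natrB//; ring.
Qed.

Lemma rdec_single N c : rdec (fun n => if n == N then c else 0).
Proof.
move=> r /andP[r0 _]; exists (nm c * r ^+ N).
move: (@smb_single R nat N (nm c * r ^+ N)); rewrite mulr_ge0 ?nm_ge0 ?exprn_ge0// => /(_ isT).
by apply: bsum_le => n; case: eqP => [->//|_]; rewrite nm0 mul0r.
Qed.

Lemma qser_single N al be : al = N%:R + be ->
  qser be (fun n => if n == N then 1 else 0) (fun z => e2pi (al * z)).
Proof.
move=> ->; split; first exact: rdec_single.
move=> z z0; have := @hasum_fin R nat [fset N]%fset
  (fun n => (if n == N then 1 else 0) * e2pi ((n%:R + be) * z)).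
rewrite big_seq_fset1 eqxx mul1r; apply=> n; rewrite inE => /negbTE ->.
by rewrite mul0r.
Qed.

Lemma qser_e2pi al : qser al (fun n => if n == 0%N then 1 else 0) (fun z => e2pi (al * z)).
Proof. by apply: qser_single; rewrite add0r. Qed.

Lemma qser_const N : qser (- N%:R) (fun n => if n == N then 1 else 0) (fun=> 1).
Proof.
apply: qser_ext (@qser_single N 0 _ _) => [z _|]; first by rewrite mul0r e2pi0.
by rewrite subrr.
Qed.

Lemma qserX al a f n : qser al a f -> exists a', qser (n%:R * al) a' (fun z => f z ^+ n) /\ a' 0%N = a 0%N ^+ n.
Proof.
move=> H; elim: n => [|n [a' [IH a0]]].
  exists (fun n => if n == 0%N then 1 else 0); split=> //.
  by rewrite mul0r; apply: qser_ext (qser_e2pi 0) => z _; rewrite mul0r e2pi0.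
exists (cauchy a a'); split; last by rewrite /cauchy big_ord1 subnn a0 exprS.
apply: qser_ext (_ : qser _ _ (fun z => f z * f z ^+ n)); first by move=> z _; rewrite exprS.
by rewrite -nat1r mulrDl mul1r; exact: qserM.
Qed.

Lemma rdec_shift a : rdec (fun n => a n.+1) <-> rdec a.
Proof.
split=> H r r01; have r0 : 0 <= r by case/andP: r01.
  have := smbZ r0 (H r r01) => -[M HM].
  exists (nm (a 0%N) + M); apply: bsum_nat => [n|n]; first by rewrite mulr_ge0 ?nm_ge0 ?exprn_ge0.
  case: n => [|n]; first by rewrite big_ord0 addr_ge0 ?nm_ge0 ?(bsum_ge0 HM).
  rewrite big_ord_recl expr0 mulr1 lerD2l.
  have := HM (seq_fset tt (iota 0 n)).
  have -> : iota 0 n = index_iota 0 n by rewrite /index_iota subn0.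
  rewrite sum_seq_fset ?iota_uniq// big_mkord.
  by apply: le_trans; apply: ler_sum => i _; rewrite /= exprS mulrCA.
have [->|rn0] := eqVneq r 0.
  exists (nm (a 1%N)); move: (@smb_single R nat 0%N _ (nm_ge0 (a 1%N))).
  apply: bsum_le => n; case: eqP => [->|]; first by rewrite expr0 mulr1.
  by case: n => // n _; rewrite exprS mul0r mulr0.
have rp : 0 < r by rewrite lt_def rn0.
have ri : 0 <= r^-1 by rewrite invr_ge0.
have := smbZ ri (smb_inj (@succn_inj) (H r r01)); apply: smb_le => n /=.
by rewrite exprS (mulrCA (nm _)) mulKf.
Qed.

Lemma qser_shift al a f : a 0%N = 0 -> qser al a f <-> qser (al + 1) (fun n => a n.+1) f.
Proof.
move=> a0.
have E z : 0 < complex.Im z -> hasum (fun n : nat => a n.+1 * e2pi ((n%:R + (al + 1)) * z)) (f z) <->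
    hasum (fun n : nat => a n * e2pi ((n%:R + al) * z)) (f z).
  move=> z0; have := @hasum_shift R (fun n : nat => a n * e2pi ((n%:R + al) * z)) (f z).
  rewrite a0 mul0r => /(_ erefl) E; apply: iff_trans E.
  have e n : a n.+1 * e2pi ((n%:R + (al + 1)) * z) = a n.+1 * e2pi ((n.+1%:R + al) * z).
    by rewrite -nat1r addrA addrAC (addrC 1).
  split; first exact: (hasum_ext e).
  exact: (hasum_ext (fun n => esym (e n))).
split=> -[Ha H]; split.
- exact: (proj2 (rdec_shift a) Ha).
- move=> z z0; exact: (proj2 (E z z0) (H z z0)).
- exact: (proj1 (rdec_shift a) Ha).
move=> z z0; exact: (proj1 (E z z0) (H z z0)).
Qed.

Lemma qser_strip N al a f : (forall i, (i < N)%N -> a i = 0) -> qser al a f ->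
  qser (al + N%:R) (fun n => a (N + n)%N) f.
Proof.
elim: N al a => [|N IH] al a H Ha; first by rewrite addr0.
have := IH (al + 1) (fun n => a n.+1) (fun i Hi => H i.+1 Hi).
rewrite -addrA nat1r; apply.
by apply: (proj1 (qser_shift _ _ _)) => //; exact: H.
Qed.

Lemma eqW (x y : R) : x = y -> x <= y. Proof. by move=> ->. Qed.

Lemma bsum_ord (g : nat -> R) M n : bsum g M -> \sum_(i < n) g i <= M.
Proof.
move=> /(_ (seq_fset tt (iota 0 n))); have -> : iota 0 n = index_iota 0 n by rewrite /index_iota subn0.
by rewrite sum_seq_fset ?iota_uniq// big_mkord.
Qed.

Lemma bsum_delay (g : nat -> R) M : (forall n, 0 <= g n) -> bsum g M ->
  bsum (fun n => if n is n'.+1 then g n' else 0) M.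
Proof.
move=> g0 H; apply: bsum_nat => [[|n]//|[|n]]; first by rewrite big_ord0 (bsum_ge0 H).
by rewrite big_ord_recl add0r; exact: bsum_ord.
Qed.

Lemma cexp_rem (z : C) : nm (cexp z - 1 - z) <= 20 * nm z ^+ 2 * expR (nm z).
Proof.
have n0 := nm_ge0 z; have e1 : 1 <= expR (nm z) by rewrite -expR0 ler_expR.
have [h|h] := leP (nm z) (1 / 2).
  apply: le_trans (cexp_near0 h) _; rewrite ler_peMr// mulr_ge0// exprn_ge0//.
have h1 : nm (cexp z) <= expR (nm z).
  by rewrite nm_cexp ler_expR; apply: le_trans (Re_nm z); exact: ler_norm.
have h2 : nm z <= expR (nm z) by apply: le_trans (expR_ge1Dx _); lra.
apply: le_trans (nmB _ _) _; apply: (@le_trans _ _ (3 * expR (nm z))).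
  have := nmB (cexp z) 1; rewrite nm1; lra.
rewrite ler_wpM2r ?expR_ge0//; have : (1 / 2) ^+ 2 <= nm z ^+ 2.
  by rewrite lerXn2r ?nnegrE ?divr_ge0//; exact: ltW.
lra.
Qed.

Lemma qser_cder al a F f : qser al a F ->
  qser al (fun n => tpi R * (n%:R + al) * a n) f ->
  forall z, 0 < complex.Im z -> cder F z (f z).
Proof.
move=> [Ha HF] [Hb Hf] z z0; pose d := complex.Im z / 2.
have d0 : 0 < d by rewrite divr_gt0.
have pi0 := @pi_gt0 R.
pose t := nm (tpi R); have t0 : 0 <= t := nm_ge0 _.
have tE : t = 2 * pi.
  by rewrite /t /tpi /nm /= expr0n add0r sqrtr_sqr gtr0_norm// mulr_gt0.
(* [r'] equals e^(-pi Im z): half of the decay of q is spent on displacements of modulus below Im z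
   / 2. *)
pose r := expR (- (2 * pi * complex.Im z)); pose r' := r * expR (t * d).
have r'E : 0 <= r' < 1.
  rewrite mulr_ge0 ?expR_ge0//= /r' -expRD -[X in _ < X]expR0 ltr_expR tE /d.
  have : 0 < pi * complex.Im z by rewrite mulr_gt0.
  clear; lra.
pose cst := 20 * t ^+ 2 * nm (e2pi (al * z)) * expR (t * nm al * d).
have cst0 : 0 <= cst by rewrite !mulr_ge0 ?expR_ge0 ?nm_ge0// exprn_ge0.
pose B (n : nat) := cst * (2 * (nm (n%:R ^+ 2 * a n) * r' ^+ n) + 2 * nm al ^+ 2 * (nm (a n) * r' ^+ n)).
apply: (@cder_hasum R nat (fun n w => a n * e2pi ((n%:R + al) * w))
   (fun n => tpi R * (n%:R + al) * a n * e2pi ((n%:R + al) * z)) B F z (f z) d d0).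
- move=> n h hd; set l := n%:R + al.
  have lb : nm l <= n%:R + nm al by apply: le_trans (nmD _ _) _; rewrite nm_nat.
  have l0 : 0 <= nm l := nm_ge0 _.
  have -> : a n * e2pi (l * (z + h)) - a n * e2pi (l * z) - h * (tpi R * l * a n * e2pi (l * z))
     = a n * e2pi (l * z) * (cexp (tpi R * l * h) - 1 - tpi R * l * h).
    by rewrite mulrDr e2piD [e2pi (l * h)]e2piE (mulrA (tpi R) l h); move: (cexp _) (e2pi _) => X1 X2; ring.
  rewrite nmM; apply: le_trans (ler_wpM2l (nm_ge0 _) (cexp_rem _)) _.
  rewrite nmM /l e2pi_shift -/l nmM nmX [nm (e2pi z)]nm_e2pi -/r 2!nmM -/t.
  have e1 : expR (t * nm l * nm h) <= expR (t * nm al * d) * expR (t * d) ^+ n.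
    rewrite -expRM_natl -expRD ler_expR.
    have := ler_wpM2l t0 (ler_pM l0 (nm_ge0 h) lb (ltW hd)).
    rewrite -(mulrA t (nm l)); move: (nm l * nm h) => u hu.
    by apply: le_trans hu _; apply/eqW; ring.
  have l2 : nm l ^+ 2 <= 2 * n%:R ^+ 2 + 2 * nm al ^+ 2.
    have : nm l ^+ 2 <= (n%:R + nm al) ^+ 2 by rewrite lerXn2r ?nnegrE ?addr_ge0 ?nm_ge0.
    have := sqr_ge0 (n%:R - nm al); lra.
  have rn0 : 0 <= r ^+ n by rewrite exprn_ge0 ?expR_ge0.
  rewrite /B /cst /r' [(r * _) ^+ n]exprMn (nmM (n%:R ^+ 2)) nmX nm_nat.
  apply: (@le_trans _ _ (nm (a n) * (nm (e2pi (al * z)) * r ^+ n) *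
     (20 * (t * nm l * nm h) ^+ 2 * (expR (t * nm al * d) * expR (t * d) ^+ n)))).
    by rewrite ler_wpM2l ?mulr_ge0 ?nm_ge0// ler_wpM2l// mulr_ge0// sqr_ge0.
  set E1 := expR (t * nm al * d); set E2 := expR (t * d) ^+ n; set E3 := nm (e2pi _).
  rewrite [leLHS](_ : _ = (20 * t ^+ 2 * E3 * E1 * (nm (a n) * (r ^+ n * E2))) * nm l ^+ 2 * nm h ^+ 2); last by ring.
  rewrite ler_wpM2r ?sqr_ge0// [leRHS](_ : _ = (20 * t ^+ 2 * E3 * E1 * (nm (a n) * (r ^+ n * E2))) * (2 * n%:R ^+ 2 + 2 * nm al ^+ 2)); last by ring.
  by rewrite ler_wpM2l// !mulr_ge0 ?nm_ge0 ?expR_ge0 ?exprn_ge0 ?expR_ge0.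
- apply: smbZ => //; apply: smbD; first by apply: smbZ => //; exact: rdec_pow.
  by apply: smbZ; [rewrite mulr_ge0// sqr_ge0|exact: Ha].
- move=> h hd; apply: HF; rewrite ImD; have := Im_nm h; rewrite ler_norml => /andP[h1 _].
  have := le_lt_trans h1 (_ : _ < _); rewrite /d in hd; lra.
- exact: Hf.
Qed.

(** High up in the half-plane the terms with n >= 1 are together O(|q|), so the constant term is
    arbitrarily small. *)
Lemma qs_uniq0 (b : nat -> C) (K B Y : R) : 0 <= K -> 0 < B -> (forall n, nm (b n) <= K * B ^+ n) ->
  (forall z, Y < complex.Im z -> hasum (fun n => b n * e2pi (n%:R * z)) 0) -> b 0%N = 0.
Proof.
move=> K0 B0 Hb H; apply: nm_small_eq => e e0; rewrite subr0.
pose r0 := Num.min (1 / (2 * B)) (e / (2 * (K * B + 1))); pose r1 := expR (- (2 * pi * (Num.max Y 0 + 1))).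
have KB : 0 < 2 * (K * B + 1) by rewrite mulr_gt0// ltr_wpDl// mulr_ge0// ltW.
have r00 : 0 < r0 by rewrite lt_min !divr_gt0// mulr_gt0.
pose r := Num.min r0 r1; have r_gt0 : 0 < r by rewrite lt_min r00 expR_gt0.
pose y := - ln r / (2 * pi); have p2 : 0 < 2 * pi :> R by rewrite mulr_gt0 ?pi_gt0.
have yY : Y < y.
  rewrite ltr_pdivlMr// ltrNr -(@ltr_expR R) lnK ?posrE//.
  apply: (@le_lt_trans _ _ r1); first by rewrite ge_min lexx orbT.
  rewrite ltr_expR ltrN2 mulrC ltr_pM2l// ltr_pwDr// le_max lexx//.
pose z : C := 0 +i* y.
have qE : nm (e2pi z) = r by rewrite nm_e2pi /= mulrC divfK ?gt_eqF// opprK lnK.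
have rB : r * B <= 1 / 2.
  have : r <= 1 / (2 * B) by rewrite !ge_min lexx.
  by rewrite ler_pdivlMr ?mulr_gt0//; lra.
have rB0 : 0 <= r * B by rewrite mulr_ge0 ?ltW.
have Hz := H z yY.
have h1 : hasum (fun n : nat => if n == 0%N then b 0%N else 0) (b 0%N).
  have := @hasum_fin R nat [fset 0%N]%fset (fun n => if n == 0%N then b 0%N else 0).
  by rewrite big_seq_fset1 eqxx; apply=> n; rewrite inE => /negbTE ->.
have := hasumB Hz h1; rewrite sub0r => h2.
pose g (n : nat) := K * B * r * (r * B) ^+ n * 2.
have h3 : nm (- b 0%N) <= K * B * r * 2.
  have g2 : bsum (fun n : nat => K * B * r * (r * B) ^+ n) (K * B * r * 2).
    apply: bsumZ; first by rewrite !mulr_ge0// ltW.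
    have := @bsum_geom R (r * B) _; rewrite rB0 /= => /(_ _) G A.
    apply: le_trans (G _ A) _; first by lra.
    rewrite -[leRHS]invrK lef_pV2 ?posrE ?invr_gt0//; first by lra.
    by rewrite subr_gt0; lra.
  apply: (@hasum_bound R nat (fun n : nat => if n is n'.+1 then b n * e2pi (n%:R * z) else 0)
    (fun n => if n is n'.+1 then K * B * r * (r * B) ^+ n' else 0)).
  - by apply: hasum_ext h2 => -[|n] /=; rewrite ?subr0// mul0r e2pi0 mulr1 subrr.
  - case=> [|n]; first by rewrite nm0.
    rewrite nmM e2piMn nmX qE; apply: le_trans (ler_wpM2r _ (Hb _)) _.
      by rewrite exprn_ge0// ltW.
    by rewrite [B ^+ _]exprS [r ^+ _]exprS exprMn; apply/eqW; ring.
  - apply: (bsum_delay _ g2) => n; by rewrite !mulr_ge0 ?exprn_ge0// ltW.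
rewrite -nmN; apply: le_lt_trans h3 _.
have : r <= e / (2 * (K * B + 1)) by rewrite !ge_min lexx orbT.
rewrite ler_pdivlMr// => h4.
have : 0 < 2 * r by lra.
lra.
Qed.

Lemma qs_uniq (b : nat -> C) (K B Y : R) : 0 <= K -> 0 < B -> (forall n, nm (b n) <= K * B ^+ n) ->
  (forall z, Y < complex.Im z -> hasum (fun n => b n * e2pi (n%:R * z)) 0) -> forall n, b n = 0.
Proof.
move=> K0 B0 Hb H n; elim: n {-2}n (leqnn n) => [|n IH] m; rewrite ?leqn0.
  by move=> /eqP ->; exact: (qs_uniq0 K0 B0 Hb H).
move=> mn; have Z i : (i < m)%N -> b i = 0 by move=> im; apply: IH; rewrite -ltnS (leq_trans im).
rewrite -[m]addn0; apply: (@qs_uniq0 (fun k => b (m + k)%N) (K * B ^+ m) B Y) => //.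
- by rewrite mulr_ge0// exprn_ge0// ltW.
- by move=> k; rewrite -mulrA -exprD.
move=> z z0; have := H z z0.
elim: m Z {mn} => [//|m IHm] Z h.
have {}h := IHm (fun i Hi => Z i (ltnW Hi)) h.
have q0 := e2pi_neq0 z.
have := hasumZ (e2pi z)^-1 h; rewrite mulr0.
have -> : (fun n : nat => (e2pi z)^-1 * (b (m + n)%N * e2pi (n%:R * z))) =
  (fun n : nat => (e2pi z)^-1 * (b (m + n)%N * e2pi (n%:R * z))) by [].
move=> /(proj2 (hasum_shift _ _)) => /(_ _) h1.
have h2 := h1 _; apply: hasum_ext (h2 _) => [k|] /=; last by rewrite addn0 Z// mul0r mulr0.
by rewrite addnS addSn !e2piMn exprS mulrCA mulKf.
Qed.

Lemma rdec_bound a : rdec a -> exists K : R, 0 <= K /\ forall n, nm (a n) <= K * 2 ^+ n.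
Proof.
move=> /(_ (1/2)) []; first by apply/andP; split; lra.
move=> M HM; exists M; split=> [|n]; first exact: bsum_ge0 HM.
have := HM [fset n]%fset; rewrite big_seq_fset1 => h.
by rewrite -ler_pdivrMr ?exprn_gt0// -exprVn; move: h; rewrite div1r.
Qed.

Lemma qser_uniq al a b f : qser al a f -> qser al b f -> forall n, a n = b n.
Proof.
move=> [Ha Hf] [Hb Hg] n; apply/eqP; rewrite -subr_eq0; apply/eqP.
have [K [K0 HK]] := rdec_bound (rdecD Ha (rdecZ (-1) Hb)).
rewrite -mulN1r; apply: (@qs_uniq (fun n => a n + -1 * b n) K 2 0 K0 _ HK) => // z z0.
have := hasumZ (e2pi (al * z))^-1 (hasumB (Hf z z0) (Hg z z0)); rewrite subrr mulr0.
apply: hasum_ext => k; rewrite -mulrBl e2pi_shift mulrCA e2piMn mulKf ?e2pi_neq0//.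
by rewrite mulN1r.
Qed.

Lemma smb_bound_q (a : nat -> C) (K B : R) (z : C) : 0 <= K -> 0 < B ->
  (forall n, nm (a n) <= K * B ^+ n) -> 2 * B * nm (e2pi z) <= 1 ->
  smb (fun n => nm (a n * e2pi (n%:R * z))).
Proof.
move=> K0 B0 Ha Hz; have h : 0 <= B * nm (e2pi z) < 1.
  by rewrite mulr_ge0 ?nm_ge0 ?(ltW B0)//=; lra.
have := smbZ K0 (smb_geom h); apply: smb_le => n.
rewrite nmM e2piMn nmX exprMn mulrA ler_wpM2r// exprn_ge0// nm_ge0//.
Qed.

Lemma nm_q_small (B : R) : 0 < B -> exists Y : R, forall z, Y < complex.Im z -> 2 * B * nm (e2pi z) <= 1.
Proof.
move=> B0; have p2 : 0 < 2 * pi :> R by rewrite mulr_gt0 ?pi_gt0.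
have B2 : 0 < 2 * B by rewrite mulr_gt0.
exists (ln (2 * B) / (2 * pi)) => z; rewrite ltr_pdivrMr// => h.
have E : 2 * B = expR (ln (2 * B)) by rewrite lnK ?posrE.
rewrite nm_e2pi E -expRD -[leRHS]expR0 ler_expR.
by move: h; lra.
Qed.

Lemma cvgP_cvto (u : nat -> C) l : ((u : nat -> C^o) @ \oo --> (l : C^o))%classic <-> cvto u l.
Proof.
split.
  move=> /cvgrPdist_lt H e e0; have [|n0 _ Hn] := H e%:C; first by rewrite ltcR.
  exists n0 => n /Hn; rewrite /= -nmE ltcR nm_subC//.
move=> H; apply/cvgrPdist_lt => e e0.
have e1 : e = (complex.Re e)%:C by case: e e0 => x y; rewrite ltcE /= => /andP[/eqP -> _].
have [|n0 Hn] := H (complex.Re e); first by rewrite -ltcR -e1.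
by exists n0 => // n /= /Hn; rewrite -nmE e1 ltcR /= nm_subC.
Qed.

(** [is_fourier_expansion] only asks for convergence of ordinary partial sums. Bounded partial sums
    at one height give a geometric bound on the coefficients, hence absolute convergence at greater
    heights, where [qs_uniq] applies. *)
Lemma fourier_exp_uniq (N : int) (f : C -> C) (c : int -> C) (a : nat -> C) (K B Y : R) : 0 <= K -> 0 < B ->
  (forall n, nm (a n) <= K * B ^+ n) ->
  (forall z, Y < complex.Im z -> hasum (fun n : nat => a n * e2pi ((n%:R + N%:~R) * z)) (f z)) ->
  is_fourier_expansion N f c -> forall k : nat, c (N + k%:Z) = a k.
Proof.
move=> K0 B0 Ha H [_ [Y' Hc]] k.
pose b n := c (N + n%:Z) - a n.
pose y0 := Num.max Y Y' + 1.
have Y0 : Y < y0 by rewrite ltr_pwDr// le_max lexx.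
have Y'0 : Y' < y0 by rewrite ltr_pwDr// le_max lexx orbT.
have P z : Y < complex.Im z -> Y' < complex.Im z -> cvto (fun n => \sum_(k < n) b k * e2pi (k%:R * z)) 0.
  move=> z1 z2; have h1 := hasum_nat_cvto (H z z1).
  have h2 : cvto _ _ := proj1 (cvgP_cvto _ _) (Hc z z2).
  have := cvtoZ (e2pi (N%:~R * z))^-1 (cvtoD h2 (cvtoZ (-1) h1)).
  rewrite mulN1r subrr mulr0; apply: cvto_ext => n.
  rewrite mulN1r -sumrB mulr_sumr; apply: eq_bigr => i _.
  have -> : (N + i%:Z)%:~R * z = (i%:R + N%:~R) * z by rewrite rmorphD /= addrC.
  by rewrite -mulrBl e2pi_shift mulrCA e2piMn mulKf ?e2pi_neq0.
have [M HM] := cvto_bounded (P (0 +i* y0) Y0 Y'0).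
pose q := nm (e2pi (0 +i* y0)).
have q0 : 0 < q by rewrite nm_gt0 e2pi_neq0.
have M0 : 0 <= M by apply: le_trans (HM 0%N); exact: nm_ge0.
have Hb n : nm (b n) <= (2 * M) * q^-1 ^+ n.
  rewrite exprVn ler_pdivlMr ?exprn_gt0//.
  have := nmB (\sum_(k < n.+1) b k * e2pi (k%:R * (0 +i* y0))) (\sum_(k < n) b k * e2pi (k%:R * (0 +i* y0))).
  rewrite big_ord_recr /= addrAC subrr add0r nmM e2piMn nmX -/q => h.
  by apply: le_trans h _; have := HM n; have := HM n.+1; rewrite big_ord_recr /= e2piMn; lra.
have qi : 0 < q^-1 by rewrite invr_gt0.
have [Y2 HY2] := nm_q_small qi.
have M2 : 0 <= 2 * M by rewrite mulr_ge0.
apply/eqP; rewrite -subr_eq0; apply/eqP; rewrite -/(b k).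
apply: (@qs_uniq b (2 * M) q^-1 (Num.max y0 Y2) M2 qi Hb) => z.
rewrite gt_max => /andP[z1 z2].
have [s hs] := smb_hasum (smb_bound_q M2 qi Hb (HY2 _ z2)).
have -> // : 0 = s.
by apply: cvto_uniq (P z (lt_trans Y0 z1) (lt_trans Y'0 z1)) (hasum_nat_cvto hs).
Qed.

Lemma fourier_coefE (N : int) (f : C -> C) (a : nat -> C) (K B Y : R) : 0 <= K -> 0 < B ->
  (forall n, nm (a n) <= K * B ^+ n) ->
  (forall z, Y < complex.Im z -> hasum (fun n : nat => a n * e2pi ((n%:R + N%:~R) * z)) (f z)) ->
  forall k : nat, fourier_coef N f (N + k%:Z) = a k.
Proof.
move=> K0 B0 Ha H k; rewrite /fourier_coef; case: xgetP => [c _ Hc|].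
  exact: fourier_exp_uniq K0 B0 Ha H Hc k.
move=> /(_ (fun n => if n < N then 0 else a `|n - N|%N)) []; split=> [n ->//|].
exists Y => z z0; apply/cvgP_cvto; apply: cvto_ext (hasum_nat_cvto (H z z0)) => n.
apply: eq_bigr => i _; rewrite ltNge lerDl /= addrAC subrr add0r /=.
by rewrite rmorphD /= [in RHS]addrC.
Qed.

Lemma qser_fourier (N : int) f a : qser N%:~R a f ->
  forall k : nat, fourier_coef N f (N + k%:Z) = a k.
Proof.
move=> [Ha Hf]; have [K [K0 HK]] := rdec_bound Ha.
exact: (@fourier_coefE N f a K 2 0 K0 _ HK).
Qed.

Definition rho : C := (- (1 / 2)) +i* (Num.sqrt 3 / 2).

Lemma Im_rho : 0 < complex.Im rho.
Proof. by rewrite /= divr_gt0// sqrtr_gt0. Qed.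

Lemma rho_S : - rho^-1 = rho + 1.
Proof.
have r0 : rho != 0 by apply/eqP => E; have := Im_rho; rewrite E /= ltxx.
apply: (mulIf r0); rewrite mulNr mulVf//.
have s3 : Num.sqrt 3 ^+ 2 = 3 :> R by rewrite sqr_sqrtr.
apply: complex_ext; rewrite !(ReM, ImM, ReD, ImD) /=; move: s3; move: (Num.sqrt 3) => s s3.
  have : s * s = 3 by rewrite -expr2. 
  lra.
lra.
Qed.

Lemma Im_Ninv (z : C) : complex.Im (- z^-1) = complex.Im z / nm z ^+ 2.
Proof. by rewrite nm_sqr; case: z => x y /=; rewrite ?mulNr opprK. Qed.

Lemma Im_Ninv_gt0 (z : C) : 0 < complex.Im z -> 0 < complex.Im (- z^-1).
Proof.
move=> z0; rewrite Im_Ninv divr_gt0// exprn_gt0// nm_gt0.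
by apply/eqP => E; rewrite E /= ltxx in z0.
Qed.

(** Every term integrates to a periodic one except that of exponent 0, whose primitive is linear; so
    [a N] is the increment over one period. *)
Lemma qser_prim (W : C -> C) a (N : nat) : qser (- N%:R) a W -> exists F : C -> C,
  (forall z, 0 < complex.Im z -> cder (fun z => F z + a N * z) z (W z)) /\
  (forall z (n : int), 0 < complex.Im z -> F (z + n%:~R) = F z).
Proof.
move=> HW; pose A n := if n == N then 0 else a n / (tpi R * (n%:R - N%:R)).
have t0 := tpi_neq0 R.
have HA : rdec A.
  apply: rdec_le HW.1 => n; rewrite /A; case: eqP => [_|/eqP nN]; first by rewrite nm0 nm_ge0.
  rewrite nmM nmV ler_piMr ?nm_ge0// invf_le1 ?nm_gt0; last first.
    by rewrite mulf_neq0// subr_eq0 eqr_nat.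
  rewrite nmM -[1]mulr1 ler_pM//.
    have := @pi_ge2 R => p2; rewrite (_ : nm (tpi R) = 2 * pi); first by lra.
    by rewrite /nm /= expr0n add0r sqrtr_sqr gtr0_norm// mulr_gt0// pi_gt0.
  rewrite -!(rmorph_nat (intr : int -> C)) -rmorphB /= nm_int.
  rewrite -[1]/(1%:~R) ler_int -gtz0_ge1 normr_gt0 subr_eq0 eqr_nat//.
have HF := qsumP (- N%:R) HA; set F := qsum _ _ in HF.
exists F; split=> [z z0|z n z0].
  have h : qser (- N%:R) (fun n => tpi R * (n%:R + - N%:R) * A n) (fun z => W z + - a N * 1).
    apply: qser_coef (qserD HW (qserZ (- a N) (qser_const N))) => n; rewrite /A.
    case: eqP => [->|/eqP nN]; first by rewrite mulr1 subrr mulr0.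
    by rewrite mulr0 addr0 mulrCA mulfV ?mulr1// mulf_neq0// subr_eq0 eqr_nat.
  have := cderD (qser_cder HF h z0) (cderZ (a N) (cder_id z)).
  by apply: cder_eq; ring.
have z1 : 0 < complex.Im (z + n%:~R) by rewrite intC ImD addr0.
apply: hasum_uniq (HF.2 _ z1) _; apply: hasum_ext (HF.2 _ z0) => k; congr (_ * _).
rewrite mulrDr e2piD -[k%:R](rmorph_nat (intr : int -> C)) -[N%:R](rmorph_nat (intr : int -> C)).
by rewrite -rmorphB -rmorphM /= e2pi_int mulr1.
Qed.

(* The primitive of W takes equal values at rho and -1/rho = rho + 1. *)

Lemma const_term0 (W : C -> C) a (N : nat) : qser (- N%:R) a W ->
  (forall z, 0 < complex.Im z -> W (- z^-1) = z ^+ 2 * W z) -> a N = 0.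
Proof.
move=> HW HS; have [F [DG FT]] := qser_prim HW; pose G z := F z + a N * z.
have SIm := Im_Ninv_gt0.
have D0 z : 0 < complex.Im z -> cder (fun z => G (- z^-1) - G z) z 0.
  move=> z0; have zn : z != 0 by apply/eqP => E; rewrite E /= ltxx in z0.
  have := cderB (cder_comp (cderN (cder_inv zn)) (DG _ (SIm _ z0))) (DG z z0).
  apply: cder_eq; rewrite HS// opprK; field; exact: zn.
(* The weight 2 law makes [G (- z^-1) - G z] constant, and at the fixed point i it vanishes. *)
have E : G (- rho^-1) - G rho = G (- 'i^-1) - G 'i.
  apply: (@cder0_cst R (fun z => G (- z^-1) - G z) 'i rho) => t /andP[t0' t1]; apply: D0.
  rewrite ImD ImM ImD ImN /= subr0 mul0r addr0.
  have := Im_rho; rewrite /= => r0.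
  have : 0 <= t * (Num.sqrt 3 / 2) by rewrite mulr_ge0// ltW.
  have [->|tn1] := eqVneq t 1; first by lra.
  have : t < 1 by rewrite lt_neqAle tn1.
  lra.
have i1 : - 'i^-1 = 'i :> C by apply: complex_ext => /=; field.
move: E; rewrite i1 subrr rho_S /G (FT rho 1 Im_rho).
by move=> E; have : a N = 0 by rewrite -[RHS]E; ring.
Qed.

Lemma qser_twist (al be : C) a f : qser al a f -> qser (al + be) a (fun z => e2pi (be * z) * f z).
Proof.
move=> [Ha H]; split=> // z z0; apply: hasum_ext (hasumZ (e2pi (be * z)) (H z z0)) => n.
by rewrite mulrCA -e2piD; congr (_ * e2pi _); ring.
Qed.

(* If b m is the first nonzero coefficient of phi, then D * J ^+ m * phi has weight 2 and
   constant term d 0 * j 0 ^+ m * b m. *)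
Lemma weight0_vanish (D J : C -> C) (d j : nat -> C) : qser (- 1) d D -> qser (- 1) j J ->
  d 0%N != 0 -> j 0%N != 0 ->
  (forall z, 0 < complex.Im z -> D (- z^-1) = z ^+ 2 * D z) ->
  (forall z, 0 < complex.Im z -> J (- z^-1) = J z) ->
  forall (phi : C -> C) (b : nat -> C), qser 1 b phi ->
  (forall z, 0 < complex.Im z -> phi (- z^-1) = phi z) ->
  (forall n, b n = 0) /\ (forall z, 0 < complex.Im z -> phi z = 0).
Proof.
move=> HD HJ d0 j0 SD SJ phi b Hb Sphi.
have Z n : b n = 0.
  elim: n {-2}n (leqnn n) => [|n IH] m mn; last first.
    have Zi i : (i < m)%N -> b i = 0 by move=> im; apply: IH; rewrite -ltnS (leq_trans im).
    move: Zi; clear IH mn n; move=> Zi.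
    have [j' [HJ' j'0]] := qserX m HJ.
    have h := qserM (qserM HD HJ') (qser_strip Zi Hb).
    have h0 : - 1 + m%:R * - 1 + (1 + m%:R) = - 0%:R :> C by ring.
    have := const_term0 (qser_al h0 h) _.
    rewrite /cauchy !big_ord1 /= !subnn j'0 addn0 => E.
    have /eqP : d 0%N * j 0%N ^+ m * b m = 0.
      by apply: E => z z0; rewrite SD// SJ// Sphi// !mulrA.
    by rewrite !mulf_eq0 (negbTE d0) expf_eq0 (negbTE j0) andbF /= => /eqP.
  move: mn; rewrite leqn0 => /eqP ->.
  have h := qserM HD Hb; have h0 : - 1 + 1 = - 0%:R :> C by ring.
  have := const_term0 (qser_al h0 h) _; rewrite /cauchy big_ord1 /= => E.
  have /eqP : d 0%N * b 0%N = 0 by apply: E => z z0; rewrite SD// Sphi// mulrA.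
  by rewrite mulf_eq0 (negbTE d0) => /eqP.
split=> // z z0; apply: hasum_uniq (Hb.2 z z0) _.
by apply: hasum_ext (hasum0 _) => n; rewrite Z mul0r.
Qed.

Lemma qser_T (al : C) a f z : e2pi al = 1 -> qser al a f -> 0 < complex.Im z -> f (z + 1) = f z.
Proof.
move=> al1 [_ H] z0; have z1 : 0 < complex.Im (z + 1) by rewrite ImD addr0.
apply: hasum_uniq (H _ z1) _; apply: hasum_ext (H _ z0) => n.
by rewrite mulrDr mulr1 e2piD [e2pi (_ + al)]e2piD e2pi_nat al1 !mulr1.
Qed.

Lemma qser_Tn (al : C) a f z (n : int) : e2pi al = 1 -> qser al a f -> 0 < complex.Im z -> f (z + n%:~R) = f z.
Proof.
move=> al1 H z0.
have P k w : 0 < complex.Im w -> f (w + k%:R) = f w.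
  move=> w0; elim: k => [|k IH]; first by rewrite addr0.
  rewrite -addn1 natrD addrA (qser_T al1 H)// natC ImD /= addr0//.
case: n => n; first exact: P.
rewrite NegzE rmorphN /= -[in RHS](subrK n.+1%:R z) P// natC -rmorphN ImD /= addr0//.
Qed.

Lemma qser_bound (al : C) a f (y : R) : 0 < y -> qser al a f -> exists M : R, 0 <= M /\
  forall z, y <= complex.Im z -> nm (f z) <= M * nm (e2pi (al * z)).
Proof.
move=> y0 [Ha H]; have y1 : 0 < complex.Im (0 +i* y) by [].
have [M HM] := Ha _ (nm_q_lt1 y1); exists M; split=> [|z zy]; first exact: bsum_ge0 HM.
have z0 : 0 < complex.Im z by exact: lt_le_trans zy.
rewrite mulrC; apply: (hasum_bound (H z z0)) (bsumZ (nm_ge0 _) HM) => n.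
rewrite e2pi_shift 2!nmM nmX mulrCA ler_wpM2l ?nm_ge0// ler_wpM2l ?nm_ge0//.
rewrite lerXn2r ?nnegrE ?nm_ge0// !nm_e2pi ler_expR lerN2 /=.
by rewrite ler_wpM2l// mulr_ge0// pi_ge0.
Qed.

End QSeries.

(** * Partitions and the pentagonal number theorem *)

Section Partitions.

(* box l b s counts the decreasing sequences of length l with entries at most b and sum s. *)

Fixpoint box (l b s : nat) : nat :=
  if l is l'.+1 then (\sum_(i < b.+1 | i <= s) box l' i (s - i))%N else (s == 0%N).

Lemma card_tuple_box (k l b s : nat) : (b <= k)%N ->
  #|[set t : l.-tuple 'I_k.+1 | path geq b [seq val i | i <- t] && (\sum_(i <- t) val i == s)%N]| = box l b s.
Proof.
elim: l b s => [|l IH] b s bk /=.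
  rewrite -sum1dep_card (eq_bigl (fun _ => s == 0%N)) => [|t]; last first.
    by rewrite tuple0 /= big_nil eq_sym.
  case: (s == 0%N); last by rewrite big_pred0.
  by rewrite sum1_card card_tuple expn0.
rewrite -sum1dep_card.
pose h (x : 'I_k.+1 * l.-tuple 'I_k.+1) : l.+1.-tuple 'I_k.+1 := [tuple of x.1 :: x.2].
have hb : {on [pred t | true], bijective h}.
  exists (fun t => (thead t, [tuple of behead t])) => [[i t] _|t _]; rewrite /h /=.
    by rewrite theadE; congr (_, _); apply: val_inj.
  by apply/esym/tuple_eta.
rewrite (reindex h); last first.
  by exists (fun t => (thead t, [tuple of behead t])) => [[i t] _|t _]; rewrite /h /=;
    [rewrite theadE; congr (_, _); apply: val_inj|apply/esym/tuple_eta].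
rewrite (eq_bigl (fun x : 'I_k.+1 * l.-tuple 'I_k.+1 => ((x.1 <= b) && (x.1 <= s))%N &&
   (path geq x.1 [seq val i | i <- x.2] && (\sum_(i <- x.2) val i == s - x.1)%N))); last first.
  move=> [i t] /=; rewrite big_cons /=; case: (leqP i b) => ib //=.
  case: (leqP i s) => is_ /=; last first.
    by apply/negP => /andP[_ /eqP E]; move: is_; rewrite -E ltnNge leq_addr.
  by congr (_ && _); rewrite -{1}(subnKC is_) eqn_add2l.
rewrite -(pair_big_dep (fun i : 'I_k.+1 => ((i <= b) && (i <= s))%N)
   (fun (i : 'I_k.+1) (t : l.-tuple 'I_k.+1) => path geq i [seq val i | i <- t] && (\sum_(i <- t) val i == s - i)%N)
   (fun _ _ => 1%N)) /=.
transitivity (\sum_(i < k.+1 | ((i <= b) && (i <= s))%N) box l i (s - i)).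
  apply: eq_bigr => i _; rewrite -IH ?sum1dep_card//.
  by rewrite -ltnS ltn_ord.
rewrite (big_ord_widen_cond k.+1 (fun i => (i <= s)%N) (fun i => box l i (s - i))); last by rewrite ltnS.
by apply: eq_bigl => i; rewrite andbC ltnS.
Qed.

Lemma partition_box n : partition_number n = box n n n.
Proof.
rewrite /partition_number -(@card_tuple_box n n n n (leqnn n)).
have P (t : n.-tuple 'I_n.+1) : path geq n [seq val i | i <- t] = sorted geq [seq val i | i <- t].
  rewrite path_sortedE; last by move=> x y z /= h1 h2; exact: leq_trans h2 h1.
  suff -> : all (geq n) [seq val i | i <- t] by [].
  by apply/allP => x /mapP[i _ ->] /=; rewrite -ltnS ltn_ord.
apply: eq_card => t; rewrite !inE /= P.
by apply/idP/idP; rewrite in_setE.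
Qed.

Lemma box_0 l b : box l b 0 = 1%N.
Proof.
elim: l b => //= l IH b.
rewrite (bigD1 ord0)//= subn0 IH big1 ?addn0// => i /andP[i0 /eqP ie].
by case: ie; apply: val_inj => /=; apply/eqP; rewrite -leqn0.
Qed.

Lemma boxS l b s : box l.+1 b.+1 s = (box l.+1 b s + (if b.+1 <= s then box l b.+1 (s - b.+1) else 0))%N.
Proof.
rewrite /= [LHS]big_mkcond big_ord_recr /= -big_mkcond /=; congr (_ + _)%N.
Qed.

Lemma box_b0 l s : box l 0 s = (s == 0%N).
Proof.
elim: l s => //= l IH s; rewrite big_mkcond big_ord1 /= subn0 IH//.
Qed.

Lemma box_stable l m b s : (s <= l)%N -> (s <= m)%N -> box l b s = box m b s.
Proof.
elim: b l m s => [|b IHb] l m s; first by rewrite !box_b0.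
elim: s {-2}s (leqnn s) l m => [|n IHn] s sn l m sl sm.
  by move: sn; rewrite leqn0 => /eqP ->; rewrite !box_0.
case: l m sl sm => [|l] [|m] sl sm //.
- by move: sl; rewrite leqn0 => /eqP ->; rewrite !box_0.
- by move: sm; rewrite leqn0 => /eqP ->; rewrite !box_0.
rewrite !boxS (IHb l.+1 m.+1)//; congr (_ + _)%N; case: leqP => // bs.
apply: IHn; lia.
Qed.

Lemma box_wide l b s : (s <= b)%N -> box l b s = box l s s.
Proof.
case: l => // l; elim: b => [|b IH]; first by rewrite leqn0 => /eqP ->.
rewrite leq_eqVlt => /orP[/eqP -> //|]; rewrite ltnS => sb; rewrite -(IH sb).
by rewrite boxS ltnNge sb /= addn0.
Qed.

(* partitions of s with parts at most b *)
Definition gp (b s : nat) := box s b s.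

Lemma gpS b s : gp b.+1 s = (gp b s + (if b.+1 <= s then gp b.+1 (s - b.+1) else 0))%N.
Proof.
rewrite /gp; case: s => [|s]; first by rewrite /= addn0.
rewrite boxS; congr (_ + _)%N; case: leqP => // bs; apply: box_stable; lia.
Qed.

Lemma gp0 s : gp 0 s = (s == 0%N). Proof. exact: box_b0. Qed.

Lemma gp_partition n s : (s <= n)%N -> gp n s = partition_number s.
Proof. by move=> sn; rewrite partition_box /gp box_wide. Qed.

End Partitions.

(** * Euler's pentagonal number theorem in finite form *)

Section Pentagonal.
Variable K : comNzRingType.
Implicit Type x : {poly K}.

Definition dprod (s N : nat) : {poly K} := \prod_(s.+1 <= k < N.+1) (1 - 'X^k).

Lemma dprodNN N : dprod N N = 1. Proof. by rewrite /dprod big_geq. Qed.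

Lemma dprodSr s N : (s <= N)%N -> dprod s N.+1 = dprod s N * (1 - 'X^(N.+1)).
Proof. by move=> sN; rewrite /dprod big_nat_recr. Qed.

Lemma dprodSl s N : (s < N)%N -> dprod s N = (1 - 'X^(s.+1)) * dprod s.+1 N.
Proof. by move=> sN; rewrite /dprod big_nat_recl// [in RHS]big_add1 /=. Qed.

(* Shanks's finite form of Euler's pentagonal number theorem. *)
Definition shanks (N : nat) : {poly K} :=
  \sum_(s < N.+1) (-1) ^+ s * dprod s N * 'X^(s * N + 'C(s.+1, 2)).

(** The factor [1 - 'X^(N.+1)] gained by [dprod s N.+1] and the factor [1 - 'X^(s.+1)] split off
    from [dprod s N] telescope. Only two powers survive, with exponents k(3k+1)/2 and k(3k-1)/2 for
    k = N + 1. *)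
Lemma shanksS N : shanks N.+1 = shanks N +
  (-1) ^+ N.+1 * ('X^(N.+1 * N.+1 + 'C(N.+2, 2)) + 'X^(N.+1 * N.+1 + 'C(N.+1, 2))).
Proof.
rewrite /shanks big_ord_recr /= dprodNN mulr1 mulrDr addrA [in RHS]addrAC; congr (_ + _).
have -> : \sum_(i < N.+1) (-1) ^+ i * dprod i N.+1 * 'X^(i * N.+1 + 'C(i.+1, 2)) =
  \sum_(i < N.+1) (-1) ^+ i * dprod i N * 'X^(i * N.+1 + 'C(i.+1, 2)) -
  \sum_(i < N.+1) (-1) ^+ i * dprod i N * 'X^(i.+1 * N.+1 + 'C(i.+1, 2)) :> {poly K}.
  rewrite -sumrB; apply: eq_bigr => i _; rewrite dprodSr; last by rewrite -ltnS.
  rewrite mulSn -addnA (exprD _ N.+1); move: ('X^(i * _ + _)) ('X^(N.+1)) (dprod _ _) ((-1) ^+ i) => x1 x2 x3 x4; ring.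
rewrite [X in _ - X]big_ord_recr /= dprodNN mulr1 opprD addrA.
rewrite exprS mulN1r mulNr; congr (_ - _).
apply/eqP; rewrite subr_eq; apply/eqP.
rewrite big_ord_recl [X in _ = X + _]big_ord_recl -addrA; congr (_ + _).
rewrite -big_split /=; apply: eq_bigr => i _.
rewrite /bump /= add1n (@dprodSl i N)//.
have -> : (i.+1 * N.+1 + 'C(i.+1, 2) = i.+1 * N + 'C(i.+2, 2))%N by rewrite [in RHS]binS bin1; lia.
have -> : (i.+1 * N.+1 + 'C(i.+2, 2) = i.+1 + (i.+1 * N + 'C(i.+2, 2)))%N by lia.
by rewrite exprD exprS; ring.
Qed.

Lemma shanks_sum N : shanks N = 1 + \sum_(k < N)
  (-1) ^+ k.+1 * ('X^(k.+1 * k.+1 + 'C(k.+2, 2)) + 'X^(k.+1 * k.+1 + 'C(k.+1, 2))).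
Proof.
elim: N => [|N IH].
  by rewrite /shanks big_ord1 big_ord0 addr0 dprodNN /= expr0 !mulr1.
by rewrite shanksS IH big_ord_recr /= addrA.
Qed.

(** For s >= 1 the power of X in the s-th term already exceeds N. *)
Lemma shanks_low N i : (i <= N)%N -> (shanks N)`_i = (dprod 0 N)`_i.
Proof.
move=> iN; rewrite /shanks big_ord_recl expr0 mul1r mul0n /= bin_small// expr0 mulr1 coefD.
rewrite coef_sum big1 ?addr0// => j _; rewrite coefMXn ifT//.
rewrite /bump /= add1n binS bin1; nia.
Qed.

Lemma gp_gen N M s : (s <= M)%N ->
  (dprod 0 N * \poly_(j < M.+1) (gp N j)%:R)`_s = (s == 0%N)%:R :> K.
Proof.
elim: N s => [|N IH] s sM.
  by rewrite dprodNN mul1r coef_poly ltnS sM gp0.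
rewrite dprodSr// -mulrA -(IH s sM) !coefM; apply: eq_bigr => i _; congr (_ * _).
have jM : (s - i < M.+1)%N by rewrite ltnS (leq_trans (leq_subr _ _)).
move: (s - i)%N jM => j jM.
rewrite mulrBl mul1r coefB coefXnM !coef_poly jM gpS natrD.
rewrite ltnS; case: (ltnP N j) => jN; last by rewrite addr0 subr0.
by rewrite (leq_ltn_trans (leq_subr _ _) jM) addrK.
Qed.

End Pentagonal.

(** * The character modulo 12 and the coefficients of eta and its inverse *)

Section Pent.
Variable R : realType.
Local Notation C := R[i].

(** The character (12/.) as an explicit function on all integers; [kronecker12] identifies it with
    the Kronecker symbol at positive arguments. *)
Definition chi (l : int) : int :=
  let r := (l %% 12)%Z in
  if (r == 1) || (r == 11) then 1 else if (r == 5) || (r == 7) then -1 else 0.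

Lemma chi_mod (l m : int) : (l = m %[mod 12])%Z -> chi l = chi m.
Proof. by rewrite /chi => ->. Qed.

Lemma chiN l : chi (- l) = chi l.
Proof.
rewrite /chi; have : (0 <= (l %% 12)%Z < 12)%R by rewrite modz_ge0// ltz_pmod.
have : ((- l) %% 12 = (- (l %% 12)%Z) %% 12)%Z by rewrite modzNm.
move: (l %% 12)%Z => m -> /andP[m0 m1].
case: m m0 m1 => // m _; do 12 (case: m => [//|m]); lia.
Qed.

Lemma chi_small (j : nat) (k : nat) : (j < 6)%N -> chi (6 * k + j)%N%:Z =
  if j == 1%N then (-1) ^+ k else if j == 5%N then (-1) ^+ k.+1 else 0.
Proof.
move=> j6; elim: k => [|k IH]; first by do 6 (case: j j6 => [//|j] j6).
have -> : (-1) ^+ k.+2 = - (-1) ^+ k.+1 :> int by rewrite [LHS]exprS mulN1r.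
have -> : (-1) ^+ k.+1 = - (-1) ^+ k :> int by rewrite exprS mulN1r.
have E : chi (6 * k.+1 + j)%N%:Z = - chi (6 * k + j)%N%:Z.
  have -> : (6 * k.+1 + j)%N%:Z = (6 * k + j)%N%:Z + 6 by lia.
  move: (6 * k + j)%N%:Z => l; rewrite /chi -modzDml.
  have : (0 <= (l %% 12)%Z < 12)%R by rewrite modz_ge0// ltz_pmod.
  move: (l %% 12)%Z => m /andP[m0 m1].
  by case: m m0 m1 => // m _; do 12 (case: m => [//|m]); lia.
rewrite E IH; case: ifP => _; first by [].
case: ifP => _; last by rewrite oppr0.
by rewrite exprS mulN1r.
Qed.

Lemma chi_sqr l : chi l != 0 -> (24 %| l ^+ 2 - 1)%Z.
Proof.
move=> h; have : (12 %| l ^+ 2 - (l %% 12)%Z ^+ 2)%Z.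
  rewrite subr_sqr dvdz_mulr// {1}(divz_eq l 12) addrK dvdz_mull//.
have E := divz_eq l 12; move: h; rewrite /chi.
have : (0 <= (l %% 12)%Z < 12)%R by rewrite modz_ge0// ltz_pmod.
move: (l %/ 12)%Z (l %% 12)%Z E => k m -> /andP[m0 m1] h _.
have -> : (k * 12 + m) ^+ 2 - 1 = 24 * (6 * k ^+ 2 + k * m) + (m ^+ 2 - 1) by ring.
rewrite rpredD ?dvdz_mulr//.
by case: m m0 m1 h => // m _; do 12 (case: m => [//|m]); lia.
Qed.

(* The coefficient of q^i in prod (1 - q^k): the theta series of chi, regrouped by l^2 = 24 i + 1. *)
Definition pentc (i : nat) : C :=
  \sum_(l < 6 * i.+1) if (l ^ 2 == 24 * i + 1)%N then (chi l%:Z)%:~R else 0.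

Lemma sum_mod6 (V : nmodType) (F : nat -> V) M :
  \sum_(l < 6 * M) F l = \sum_(k < M) \sum_(j < 6) F (6 * k + j)%N.
Proof.
rewrite -(big_mkord xpredT); elim: M => [|M IH]; first by rewrite muln0 big_geq// big_ord0.
rewrite big_ord_recr /= -IH mulnS addnC.
rewrite (@big_cat_nat _ _ _ (6 * M))//=; last by rewrite leq_addr.
congr (_ + _); rewrite -{1}[(6 * M)%N]add0n big_addn addKn big_mkord.
by apply: eq_bigr => j _; rewrite addnC.
Qed.

Lemma bin2_double k : ('C(k.+1, 2) * 2 = k.+1 * k)%N.
Proof. elim: k => [//|k IH]; rewrite binS bin1; lia. Qed.

Lemma sum_ord_small (V : nmodType) (G : nat -> V) (i N : nat) : (i <= N)%N ->
  (forall k, (i <= k)%N -> G k = 0) -> \sum_(k < N) G k = \sum_(k < i) G k.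
Proof.
move=> iN H; rewrite (big_ord_widen N G iN) [RHS]big_mkcond; apply: eq_bigr => k _.
by case: ltnP => // /H.
Qed.

(** The nonnegative l prime to 6 are 6k+1 and 6k+5; there l^2 = 24 i + 1 holds with i = k(3k+1)/2
    and i = (k+1)(3k+2)/2, the two families of pentagonal numbers. *)
Lemma pentc_shanks N i : (i <= N)%N -> pentc i = (@shanks C N)`_i.
Proof.
move=> iN; rewrite shanks_sum /pentc.
rewrite (sum_mod6 (fun l => if (l ^ 2 == 24 * i + 1)%N then (chi l%:Z)%:~R else 0)).
rewrite coefD coef1 coef_sum.
have b2 := bin2_double.
have E k : \sum_(j < 6) (if ((6 * k + j) ^ 2 == 24 * i + 1)%N then (chi (6 * k + j)%N%:Z)%:~R else 0) =
   (if (i == k * k + 'C(k.+1, 2))%N then (-1) ^+ k else 0) +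
   (if (i == k.+1 * k.+1 + 'C(k.+1, 2))%N then (-1) ^+ k.+1 else 0) :> C.
  have h1 : ((6 * k + 1) ^ 2 = 24 * (k * k + 'C(k.+1, 2)) + 1)%N by rewrite -mulnn; have := b2 k; nia.
  have h5 : ((6 * k + 5) ^ 2 = 24 * (k.+1 * k.+1 + 'C(k.+1, 2)) + 1)%N by rewrite -mulnn; have := b2 k; nia.
  rewrite (eq_bigr (fun j : 'I_6 => if ((6 * k + j) ^ 2 == 24 * i + 1)%N then
    (if j == 1%N :> nat then (-1) ^+ k else if j == 5%N :> nat then (-1) ^+ k.+1 else 0) else 0 : C)); last first.
    move=> j _; rewrite chi_small//; case: ifP => // _; case: ifP => _; first by rewrite rmorphXn rmorphN.
    by case: ifP => // _; rewrite rmorphXn rmorphN.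
  rewrite !big_ord_recl big_ord0 /= /bump /= !addnE /= h1 h5.
  have e a b : (24 * a + 1 == 24 * b + 1)%N = (b == a) by rewrite eqn_add2r eqn_mul2l /= eq_sym.
  by rewrite !e !if_same !add0r !addr0.
rewrite (eq_bigr _ (fun (k : 'I_i.+1) _ => E k)) big_split /=.
rewrite big_ord_recl /= bin_small// addn0 mul0n addrAC -[LHS]addrA.
have -> : (if i == 0%N then 1 else 0) = (i == 0%N)%:R :> C by case: eqP.
congr (_ + _).
rewrite addrC [X in _ + X]big_ord_recr /= (_ : (i == _) = false) ?addr0; last by apply/eqP; lia.
rewrite -big_split /= (@sum_ord_small _ (fun k => ((-1) ^+ k.+1 * ('X^(k.+1 * k.+1 + 'C(k.+2, 2)) +
   'X^(k.+1 * k.+1 + 'C(k.+1, 2))) : {poly C})`_i) i N)//.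
  apply: eq_bigr => k _; rewrite -[-1 : {poly C}]polyCN -polyC_exp coefCM coefD !coefXn /bump /= add1n.
  by case: (i == _); case: (i == _); rewrite ?mulrDr ?mulr1 ?mulr0.
move=> k ik; rewrite -[-1 : {poly C}]polyCN -polyC_exp coefCM coefD !coefXn.
have -> : (i == k.+1 * k.+1 + 'C(k.+2, 2))%N = false by apply/eqP; lia.
have -> : (i == k.+1 * k.+1 + 'C(k.+1, 2))%N = false by apply/eqP; lia.
by rewrite addr0 mulr0.
Qed.

Lemma pent_cauchy_delta n :
  cauchy pentc (fun k => (partition_number k)%:R) n = (if n == 0%N then 1 else 0).
Proof.
have -> : (if n == 0%N then 1 else 0) = (n == 0%N)%:R :> C by case: eqP.
rewrite -(@gp_gen C n n n (leqnn n)) coefM /cauchy; apply: eq_bigr => i _.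
rewrite (@pentc_shanks n)// ?shanks_low//; try by rewrite -ltnS.
by rewrite coef_poly ltnS leq_subr gp_partition ?leq_subr.
Qed.

Lemma pentc0 : pentc 0 = 1.
Proof.
by have := pent_cauchy_delta 0; rewrite /cauchy big_ord1 partition_box /= mulr1.
Qed.

Lemma nm_chi l : nm ((chi l)%:~R : C) <= 1.
Proof. by rewrite /chi; do 2 (case: ifP => _; first by rewrite ?rmorphN ?nmN nm1); rewrite nm0. Qed.

Lemma rdec_bound1 (a : nat -> C) (k : nat) (M : R) : (forall n, nm (a n) <= M * n.+1%:R ^+ k) -> rdec a.
Proof.
move=> H; have M0 : 0 <= M by have := le_trans (nm_ge0 _) (H 0%N); rewrite expr1n mulr1.
move=> r r01; have [s Hs] := smb_poly_geom k r01.
have r0 : 0 <= r by case/andP: r01.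
have : rdec (fun n => M%:C * (if n is n'.+1 then n.+1%:R ^+ k else 1)).
  apply: rdecZ; apply/rdec_shift => {r r01 s Hs r0} r r01.
  have : smb (fun n : nat => 3 ^+ k * (n.+1%:R ^+ k * r ^+ n)) .
    apply: smbZ; first by rewrite exprn_ge0.
    have [r0|r0] := eqVneq r 0.
      exists 1; have := @smb_single R nat 0%N 1 ler01; apply: bsum_le => -[|n]; rewrite r0 ?expr0 ?expr1n ?mulr1//.
      by rewrite exprS mul0r mulr0.
    case/andP: (r01) => rr0 r1; have rp : 0 < r by rewrite lt_def r0.
    have := smbZ (_ : 0 <= r^-1) (smb_inj (@succn_inj) (smb_poly_geom k r01)); rewrite invr_ge0 rr0 => /(_ isT).
    by apply: smb_le => n /=; rewrite exprS (mulrCA (_ ^+ k)) mulKf.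
  apply: smb_le => n; rewrite nmX nm_nat mulrA ler_wpM2r ?exprn_ge0//; first by case/andP: r01.
  by rewrite -exprMn lerXn2r ?nnegrE ?mulr_ge0// -natrM ler_nat; lia.
move=> /(_ r r01); apply: smb_le => n; rewrite ler_wpM2r ?exprn_ge0//; apply: le_trans (H n) _.
rewrite nmM nm_real ger0_norm// ler_wpM2l//; case: n => [|n]; first by rewrite expr1n nm1.
by rewrite nmX nm_nat.
Qed.

Lemma pentc_rdec : rdec pentc.
Proof.
apply: (@rdec_bound1 _ 1 6) => n; rewrite expr1 /pentc; apply: le_trans (nm_sum _ _) _.
apply: (@le_trans _ _ (\sum_(l < 6 * n.+1) 1)).
  by apply: ler_sum => l _; case: ifP => _; rewrite ?nm_chi ?nm0.
by rewrite sumr_const card_ord natrM.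
Qed.

(** Allowing parts of size b+1 multiplies the generating function by 1/(1-x) with x = r^(b+1), and x
    <= r gives 1/(1-x) <= exp(x/(1-r)). For truncated sums the product becomes the inequality
    [TE]. *)
Lemma gp_bound (r : R) (b M : nat) : 0 <= r < 1 ->
  \sum_(s < M) (gp b s)%:R * r ^+ s <= expR ((\sum_(k < b) r ^+ k.+1) / (1 - r)).
Proof.
move=> /andP[r0 r1]; have r1' : 0 < 1 - r by rewrite subr_gt0.
have P b' n : 0 <= (gp b' n)%:R * r ^+ n by rewrite mulr_ge0 ?exprn_ge0.
elim: b => [|b IH].
  rewrite big_ord0 mul0r expR0; case: M => [|M]; first by rewrite big_ord0.
  rewrite big_ord_recl gp0 eqxx mul1r expr0 big1 ?addr0// => i _.
  by rewrite gp0 /bump /= mul0r.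
set T := \sum_(s < M) _; set x := r ^+ b.+1.
have x0 : 0 <= x by rewrite exprn_ge0.
have xr : x <= r by rewrite /x exprS ler_piMr// exprn_ile1// ltW.
have TE : T <= \sum_(s < M) (gp b s)%:R * r ^+ s + x * T.
  have TE0 : T = \sum_(s < M) (gp b s)%:R * r ^+ s + \sum_(s < M | (b.+1 <= s)%N)
      (gp b.+1 (s - b.+1))%:R * r ^+ (s - b.+1) * x.
    rewrite /T (eq_bigr (fun s : 'I_M => (gp b s)%:R * r ^+ s +
    (if (b.+1 <= s)%N then (gp b.+1 (s - b.+1))%:R * r ^+ (s - b.+1) * x else 0))); last first.
    move=> s _; rewrite gpS natrD mulrDl; congr (_ + _); case: ifP => h; last by rewrite mul0r.
    by rewrite -mulrA -exprD subnK.
    by rewrite big_split /= -big_mkcond.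
  rewrite [leLHS]TE0 lerD2l mulrC /T mulr_suml.
  rewrite -(big_mkord (fun s => (b.+1 <= s)%N) (fun s => (gp b.+1 (s - b.+1))%:R * r ^+ (s - b.+1) * x)).
  rewrite -[X in _ <= X](big_mkord xpredT (fun s => (gp b.+1 s)%:R * r ^+ s * x)).
  have [Mb|bM] := leqP M b.+1.
    rewrite big_nat_cond big1 ?sumr_ge0// => [i _|i /andP[/andP[_ iM] bi]]; first by rewrite mulr_ge0.
    by move: (leq_trans iM Mb); rewrite ltnNge bi.
  rewrite (@big_cat_nat _ _ _ b.+1)//=; last exact: ltnW.
  rewrite big_nat_cond big_pred0 ?add0r; last by move=> i; apply/negP => /andP[/andP[_ h1] h2]; lia.
  rewrite big_nat_cond (eq_bigl (fun i => (b.+1 <= i < M)%N && true)) -?big_nat_cond; last first.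
    by move=> i; case: (b.+1 <= i)%N; rewrite ?andbT.
  rewrite -{1}[b.+1]add0n big_addn (@big_cat_nat _ _ _ (M - b.+1) 0 M)//= ?leq_subr//.
  rewrite [leLHS](eq_bigr (fun s => (gp b.+1 s)%:R * r ^+ s * x)); last by move=> i _; rewrite addnK.
  by rewrite lerDl sumr_ge0// => i _; rewrite mulr_ge0.
have T0 : 0 <= T by rewrite sumr_ge0.
rewrite big_ord_recr /= mulrDl expRD -/x.
have h1 : T * (1 - x) <= expR ((\sum_(k < b) r ^+ k.+1) / (1 - r)) by rewrite mulrBr mulr1; lra.
have x1 : 0 < 1 - x by rewrite subr_gt0; lra.
have h2 : 1 <= (1 - x) * expR (x / (1 - r)).
  have h3 : 1 + x / (1 - r) <= expR (x / (1 - r)) by exact: expR_ge1Dx.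
  have h4 : x <= x / (1 - r) * (1 - x) by rewrite mulrAC ler_pdivlMr// ler_wpM2l//; lra.
  apply: le_trans (ler_wpM2l (ltW x1) h3); lra.
apply: (@le_trans _ _ (T * ((1 - x) * expR (x / (1 - r))))); first by rewrite ler_peMr.
by rewrite mulrA ler_wpM2r ?expR_ge0.
Qed.

Lemma part_rdec : rdec (fun n => (partition_number n)%:R : C).
Proof.
move=> r r01; case/andP: (r01) => r0 r1; have r1' : 0 < 1 - r by rewrite subr_gt0.
exists (expR ((1 - r)^-1 / (1 - r))); apply: bsum_nat => [n|n]; first by rewrite mulr_ge0 ?nm_ge0 ?exprn_ge0.
have := @gp_bound r n n r01.
rewrite (eq_bigr (fun i : 'I_n => nm ((partition_number i)%:R : C) * r ^+ i)); last first.
  by move=> i _; rewrite nm_nat gp_partition// ltnW.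
move/le_trans; apply; rewrite ler_expR ler_wpM2r ?invr_ge0 ?(ltW r1')//.
apply: le_trans (bsum_ord n (bsum_geom r01)); apply: ler_sum => i _.
by rewrite exprS ler_piMl ?exprn_ge0// ltW.
Qed.

End Pent.

(** * The eta function *)

Section Eta.
Variable R : realType.
Local Notation C := R[i].

Lemma neq0i : 'i%C != 0 :> C.
Proof. by rewrite eq_complex /= oner_eq0 andbF. Qed.

Lemma inv_i : 'i%C^-1 = - 'i%C :> C.
Proof. by apply: (mulfI neq0i); rewrite mulfV ?neq0i// mulrN -expr2 sqr_i opprK. Qed.

(** Fixes the sign: over the right half-plane this is the square root with positive real part. *)
Definition csqrt (w : C) : C := if 0 < complex.Re (sqrtc w) then sqrtc w else - sqrtc w.

Lemma sqr_csqrt w : csqrt w ^+ 2 = w.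
Proof. by rewrite /csqrt; case: ifP => _; rewrite ?sqrrN sqr_sqrtc. Qed.

Lemma Re_csqrt w : 0 < complex.Re w -> 0 < complex.Re (csqrt w).
Proof.
rewrite -{1}(sqr_sqrtc w) /csqrt expr2 ReM => h; case: ifP => // /negbT; rewrite -leNgt => h2.
rewrite ReN oppr_gt0 lt_neqAle h2 andbT; apply/eqP => E.
by move: h; rewrite E mul0r sub0r oppr_gt0 ltNge -expr2 sqr_ge0.
Qed.

(* The square roots s, with positive real part, of the points of the right half-plane. *)
Definition cone (s : C) := 0 < complex.Re s /\ 0 < complex.Re (s ^+ 2).

Lemma cone_csqrt w : 0 < complex.Re w -> cone (csqrt w).
Proof. by move=> w0; split; rewrite ?sqr_csqrt// Re_csqrt. Qed.

Lemma cone_neq0 s : cone s -> s != 0.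
Proof. by move=> [h _]; apply/eqP => E; rewrite E ltxx in h. Qed.

Lemma cone_ReIm s : cone s -> - complex.Re s < complex.Im s /\ complex.Im s < complex.Re s.
Proof. by case=> h1; rewrite expr2 ReM => h2; split; nra. Qed.

Lemma hasum_fiber (I : choiceType) (f : I -> C) (h : I -> nat) (A : nat -> {fset I}) s :
  (forall i, f i != 0 -> i \in A (h i)) -> hasum f s ->
  hasum (fun n => \sum_(i <- A n) if h i == n then f i else 0) s.
Proof.
move=> HA Hf; pose F (x : nat * I) := if h x.2 == x.1 then f x.2 else 0.
apply: (@hasum_sigma R _ _ F).
  have hi : injective (fun i : I => (h i, i)) by move=> i j [].
  apply/(@hasum_inj _ _ _ _ _ _ hi); last by apply: hasum_ext Hf => i; rewrite /F /= eqxx.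
  by move=> [n i] H; rewrite /F /=; case: eqP => // E; case: (H i); rewrite E.
move=> n; apply: (@hasum_fin R I (A n) (fun j => F (n, j))) => i; rewrite /F /=.
by case: eqP => // <-; have := HA i; case: eqP => // _ /(_ isT) ->.
Qed.

Lemma hasum_fold (f : int -> C) s : hasum f s ->
  hasum (fun k : nat => if k == 0%N then f 0 else f k%:Z + f (- k%:Z)) s.
Proof.
move=> /(@hasum_fiber int f absz (fun n => [fset n%:Z; - n%:Z]%fset)) H.
apply: hasum_ext (H _) => [n|i _]; last first.
  by rewrite !inE; case: i => n /=; rewrite ?eqxx// NegzE eqxx orbT.
case: n => [|n]; first by rewrite oppr0 fsetUid big_seq_fset1 eqxx.
rewrite big_fsetU1 ?big_seq_fset1 /= ?eqxx//.
by rewrite inE.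
Qed.

Lemma hasum_mod (k : nat) (f : int -> C) (S : nat -> C) : (0 < k)%N ->
  (forall r, (r < k)%N -> hasum (fun t : int => f (r%:Z + k%:Z * t)) (S r)) ->
  hasum f (\sum_(r < k) S r).
Proof.
move=> k0 H; have k0' : k%:Z != 0 by rewrite -lt0n.
pose g (r : 'I_k) (l : int) := if (l %% k%:Z)%Z == r%:Z then f l else 0.
have Hg (r : 'I_k) : hasum (g r) (S r).
  have inj : injective (fun t : int => r%:Z + k%:Z * t).
    by move=> t t' /addrI /(mulfI k0').
  apply/(@hasum_inj _ _ _ _ _ _ inj).
    move=> l Hl; rewrite /g; case: eqP => // E; case: (Hl (l %/ k%:Z)%Z).
    by rewrite {2}(divz_eq l k%:Z) E addrC mulrC.
  apply: hasum_ext (H r (ltn_ord r)) => t; rewrite /g /=.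
  by rewrite addrC mulrC modzMDl modz_small ?eqxx//= ltz_nat ltn_ord.
apply: hasum_ext (hasum_sum (index_enum 'I_k) Hg) => l.
have lk : (`|(l %% k%:Z)%Z| < k)%N by have := modz_ge0 l k0'; have := ltz_pmod l (_ : 0 < k%:Z); lia.
rewrite (bigD1 (Ordinal lk))//= {1}/g /= gez0_abs ?modz_ge0// eqxx big1 ?addr0// => r rl.
rewrite /g; case: eqP => // E; case/eqP: rl; apply: val_inj => /=; rewrite E//.
Qed.

Lemma e2pi_sqr (l : int) (z : C) : e2pi (l%:~R ^+ 2 * z) = e2pi z ^+ (`|l| ^ 2).
Proof.
have E : l ^+ 2 = (`|l| ^ 2)%N%:Z by rewrite -mulnn; lia.
by rewrite -e2piMn -rmorphXn /= E.
Qed.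

Lemma smb_theta (x : int -> C) (K : R) (z : C) : (forall l, nm (x l) <= K) -> 0 < complex.Im z ->
  smb (fun l : int => nm (x l * e2pi (l%:~R ^+ 2 * z))).
Proof.
move=> HK z0; have K0 : 0 <= K by apply: le_trans (HK 0); exact: nm_ge0.
have q01 := nm_q_lt1 z0; case/andP: (q01) => q0 q1.
apply: (@smb_int _ _ (fun n : nat => K * nm (e2pi z) ^+ n)) => [n|n|]; rewrite ?nm_ge0//.
  rewrite nmM; apply: ler_pM; rewrite ?nm_ge0// e2pi_sqr nmX.
  rewrite ler_wiXn2l//; first exact: ltW.
  by case: (absz n) => // k; rewrite -mulnn leq_pmulr.
by apply: smbZ => //; exact: smb_geom.
Qed.

Definition eta (z : C) : C := qsum (24^-1) (@pentc R) z.

Lemma eta_qser : qser 24^-1 (@pentc R) eta.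
Proof. exact/qsumP/pentc_rdec. Qed.

(** The opposite indices l and -l contribute equally, whence the factor 2. *)
Lemma eta_theta z : 0 < complex.Im z ->
  hasum (fun l : int => (chi l)%:~R * e2pi (l%:~R ^+ 2 * (z / 24))) (2 * eta z).
Proof.
move=> z0; have z24 : 0 < complex.Im (z / 24).
  rewrite (_ : 24^-1 = (24^-1 : R)%:C); last by rewrite fmorphV rmorph_nat.
  by rewrite ImM /= mulr0 add0r mulr_gt0// invr_gt0.
pose f (l : int) : C := (chi l)%:~R * e2pi (l%:~R ^+ 2 * (z / 24)).
have [s hs] := smb_hasum (smb_theta (fun l => nm_chi R l) z24).
suff -> : 2 * eta z = s by [].
have fN l : f (- l) = f l by rewrite /f chiN rmorphN sqrrN.
have h1 := hasum_fold hs.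
pose g (k : nat) := if k == 0%N then f 0 else f k%:Z + f (- k%:Z).
pose h (k : nat) := ((k ^ 2 - 1) %/ 24)%N.
pose A (n : nat) := seq_fset tt (iota 0 (6 * n.+1)).
have gE k : g k != 0 -> (k ^ 2 = 24 * h k + 1)%N.
  have [c0|/chi_sqr] := eqVneq (chi k%:Z) 0.
    rewrite /g fN /f; case: (eqVneq k 0%N) => [_|_]; first by rewrite /chi /= mul0r eqxx.
    by rewrite c0 !mul0r addr0 eqxx.
  case: k => [|k] // h2 _; rewrite /h mulnC divnK; last first.
    by move: h2; rewrite (_ : k.+1%:Z ^+ 2 - 1 = (k.+1 ^ 2 - 1)%N%:Z)// -mulnn; nia.
  by rewrite subnK// -mulnn.
have := @hasum_fiber nat g h A s _ h1; move=> /(_ _) h2.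
have {}h2 := h2 _; apply: esym; apply: (hasum_uniq (h2 _)) => {h2}.
  move=> k /gE kE; rewrite /A seq_fsetE mem_iota /= add0n.
  by rewrite -ltn_sqr kE -mulnn; nia.
apply: hasum_ext (hasumZ 2 (eta_qser.2 _ z0)) => n.
rewrite /A sum_seq_fset ?iota_uniq// (_ : iota _ _ = index_iota 0 (6 * n.+1)); last by rewrite /index_iota subn0.
rewrite big_mkord /pentc mulr_suml mulr_sumr; apply: eq_bigr => l _.
case: (eqVneq (g l) 0) => [g0|/gE lE].
  rewrite g0 if_same; case: eqP => [lE|_]; last by rewrite mul0r mulr0.
  have [c0|c0] := eqVneq (chi l%:Z) 0; first by rewrite c0 mul0r mulr0.
  move/eqP: g0; rewrite /g; case: (eqVneq (l : nat) 0%N) => [l0|_]; first by rewrite l0 in lE; lia.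
  rewrite fN -mulr2n mulrn_eq0 /= mulf_eq0 (negbTE (e2pi_neq0 _)) orbF intr_eq0.
  by rewrite (negbTE c0).
rewrite lE eqn_add2r eqn_mul2l /= ; case: eqP => [hl|_]; last by rewrite mul0r mulr0.
rewrite /g; case: (eqVneq (l : nat) 0%N) => [l0|_]; first by rewrite l0 in lE; lia.
have -> : f l%:Z + f (- l%:Z) = 2 * f l%:Z by rewrite fN; ring.
rewrite /f; congr (_ * (_ * e2pi _)).
by rewrite -pmulrn -natrX lE hl natrD natrM; field.
Qed.

Definition ieta (z : C) : C := qsum (- 24^-1) (fun n => (partition_number n)%:R) z.

Lemma ieta_qser : qser (- 24^-1) (fun n => (partition_number n)%:R) ieta.
Proof. exact/qsumP/part_rdec. Qed.

Lemma eta_ieta z : 0 < complex.Im z -> eta z * ieta z = 1.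
Proof.
move=> z0; have h := (qserM eta_qser ieta_qser).2 z z0.
apply: hasum_uniq h _; have := (qser_e2pi 0).2 z z0; rewrite mul0r e2pi0.
by apply: hasum_ext => n; rewrite pent_cauchy_delta subrr.
Qed.

Lemma eta_neq0 z : 0 < complex.Im z -> eta z != 0.
Proof. by move/eta_ieta => h; apply/eqP => E; move/eqP: h; rewrite E mul0r eq_sym oner_eq0. Qed.

Lemma ietaE z : 0 < complex.Im z -> ieta z = (eta z)^-1.
Proof. by move=> z0; rewrite -[LHS]mul1r -(mulVf (eta_neq0 z0)) -mulrA eta_ieta// mulr1. Qed.

Lemma qser_mulTn (al : C) a f z (n : int) : qser al a f -> 0 < complex.Im z ->
  f (z + n%:~R) = e2pi (al * n%:~R) * f z.
Proof.
move=> [_ H] z0; have z1 : 0 < complex.Im (z + n%:~R) by rewrite intC ImD addr0.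
apply: hasum_uniq (H _ z1) _; apply: hasum_ext (hasumZ _ (H _ z0)) => k.
rewrite mulrDr e2piD (mulrDl _ _ n%:~R) [e2pi (k%:R * _ + _)]e2piD.
have -> : k%:R * n%:~R = (k%:Z * n)%:~R :> C by rewrite rmorphM.
by rewrite e2pi_int mul1r; ring.
Qed.

Definition gaussS (a : int) (c : nat) (m : int) : C :=
  \sum_(l < 12 * c) (chi l%:Z)%:~R * e2pi ((a%:~R * l%:R ^+ 2 + 2 * l%:R * m%:~R) / (24 * c%:R)).

Let s12 : C := (Num.sqrt 12)%:C.

Lemma s12_sqr : s12 ^+ 2 = 12.
Proof. by rewrite /s12 -rmorphXn /= sqr_sqrtr// rmorph_nat. Qed.

Lemma s12_neq0 : s12 != 0.
Proof. by apply/eqP => E; have /eqP := s12_sqr; rewrite E expr0n eq_sym pnatr_eq0. Qed.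

Lemma Im_cusp (a : int) (c : nat) s : (0 < c)%N -> cone s ->
  0 < complex.Im (a%:~R / c%:R + 'i%C / (c%:R ^+ 2 * s ^+ 2)).
Proof.
move=> c0 [_ s2]; have s0 : s ^+ 2 != 0 by apply/eqP => E; rewrite E ltxx in s2.
rewrite intC natC -rmorphXn -fmorphV -rmorphM ImD /= add0r invfM -fmorphV mulrCA.
rewrite ImM /= mul0r addr0 ImM /= mul0r add0r mul1r Re_inv.
by rewrite mulr_gt0 ?invr_gt0 ?exprn_gt0 ?ltr0n// divr_gt0// exprn_gt0// nm_gt0.
Qed.

Lemma eta_cusp (a : int) (c : nat) (s : C) : (0 < c)%N -> cone s ->
  hasum (fun m : int => s / s12 * (cexp (- (pi%:C * m%:~R ^+ 2 * s ^+ 2 / 12)) * gaussS a c m))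
    (2 * eta (a%:~R / c%:R + 'i%C / (c%:R ^+ 2 * s ^+ 2))).
Proof.
move=> c0 cs; have s0 := cone_neq0 cs; have z0 := Im_cusp a c0 cs; set z := (_ / _ + _) in z0 *.
have cn : c%:R != 0 :> C by rewrite pnatr_eq0 -lt0n.
have d0 := s12_neq0.
have hR1 : 0 < complex.Re (s / s12).
  by rewrite /s12 -fmorphV ReM /= mulr0 subr0 mulr_gt0 ?invr_gt0 ?sqrtr_gt0//; case: cs.
have hR2 : 0 < complex.Re ((s / s12) ^+ 2).
  rewrite expr_div_n s12_sqr natC -fmorphV ReM /= mulr0 subr0 mulr_gt0 ?invr_gt0//; by case: cs.
have /choice[S HS] (r : nat) := theta_poisson (r%:R / (12 * c%:R)) hR1 hR2.
pose g (r : nat) : C := (chi r%:Z)%:~R * e2pi (a%:~R * r%:R ^+ 2 / (24 * c%:R)).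
have h1 : hasum (fun l : int => (chi l)%:~R * e2pi (l%:~R ^+ 2 * (z / 24))) (\sum_(r < 12 * c) g r * S r).
  apply: (@hasum_mod (12 * c) _ (fun r => g r * S r)) => [|r _]; first by rewrite muln_gt0.
  apply: hasum_ext (hasumZ (g r) (HS r).2) => t.
  have -> : chi (r%:Z + (12 * c)%N%:Z * t) = chi r%:Z.
    by apply: chi_mod; rewrite addrC PoszM -mulrA mulrC modzMDl.
  rewrite /g -(mulrA (chi _)%:~R); congr (_ * _).
  have -> : cexp (- (pi%:C / (s / s12) ^+ 2 * (t%:~R + (r%:R / (12 * c%:R))%:C) ^+ 2)) =
     e2pi ((12 * c%:R * t%:~R + r%:R) ^+ 2 * ('i%C / (24 * c%:R ^+ 2 * s ^+ 2))) :> C.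
    rewrite e2piE; congr cexp; rewrite expr_div_n s12_sqr rmorphM fmorphV rmorphM !rmorph_nat /=.
    rewrite (_ : tpi R = 2 * pi%:C * 'i%C); last first.
      by rewrite /tpi; apply: complex_ext; rewrite !(ReM, ImM) /=; ring.
    rewrite [RHS](_ : _ = 'i%C ^+ 2 * (2 * pi%:C * (12 * c%:R * t%:~R + r%:R) ^+ 2 / (24 * c%:R ^+ 2 * s ^+ 2))); last by ring.
    by rewrite sqr_i; field; rewrite s0 cn.
  rewrite -e2piD.
  have -> : (r%:Z + (12 * c)%N%:Z * t)%:~R = 12 * c%:R * t%:~R + r%:R :> C.
    by rewrite rmorphD rmorphM /= -!pmulrn natrM addrC.
  have -> : (12 * c%:R * t%:~R + r%:R) ^+ 2 * (z / 24) =
     (a%:~R * r%:R ^+ 2 / (24 * c%:R) + (12 * c%:R * t%:~R + r%:R) ^+ 2 * ('i%C / (24 * c%:R ^+ 2 * s ^+ 2)))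
     + (a * t * r%:Z + 6 * a * c%:Z * t ^+ 2)%:~R.
    have -> : (a * t * r%:Z + 6 * a * c%:Z * t ^+ 2)%:~R =
        a%:~R * t%:~R * r%:R + 6 * a%:~R * c%:R * t%:~R ^+ 2 :> C.
      by rewrite !(rmorphD, rmorphM, rmorphXn).
    rewrite /z; field.
    by rewrite s0 cn.
  by rewrite e2piDint.
rewrite (hasum_uniq (eta_theta z0) h1).
have := hasum_sum (index_enum 'I_(12 * c)) (fun r : 'I_(12 * c) => hasumZ (g r) (HS r).1).
apply: hasum_ext => m; rewrite /gaussS !mulr_sumr; apply: eq_bigr => r _.
have -> : (a%:~R * r%:R ^+ 2 + 2 * r%:R * m%:~R) / (24 * c%:R) =
   a%:~R * r%:R ^+ 2 / (24 * c%:R) + m%:~R * (r%:R / (12 * c%:R))%:C :> C.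
  by rewrite rmorphM fmorphV rmorphM !rmorph_nat /=; field.
rewrite e2piD /g expr_div_n s12_sqr (mulrA _ (s ^+ 2)).
move: (e2pi _) (e2pi _) (cexp _) => x1 x2 x3; ring.
Qed.

Lemma eta_line (d : int) (c : nat) (s : C) : (0 < c)%N -> cone s ->
  hasum (fun m : int => (chi m)%:~R * e2pi (- (m%:~R ^+ 2 * d%:~R / (24 * c%:R))) * cexp (- (pi%:C * m%:~R ^+ 2 * s ^+ 2 / 12)))
    (2 * eta (- (d%:~R / c%:R) + 'i%C * s ^+ 2)) /\ 0 < complex.Im (- (d%:~R / c%:R) + 'i%C * s ^+ 2).
Proof.
move=> c0 [_ s2].
have z0 : 0 < complex.Im (- (d%:~R / c%:R) + 'i%C * s ^+ 2).
  by rewrite intC natC -fmorphV -rmorphM -rmorphN ImD ImM /= !(mul0r, add0r, mul1r).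
have cn : c%:R != 0 :> C by rewrite pnatr_eq0 -lt0n.
split=> //; apply: hasum_ext (eta_theta z0) => m; rewrite -mulrA; congr (_ * _).
have -> : cexp (- (pi%:C * m%:~R ^+ 2 * s ^+ 2 / 12)) = e2pi (m%:~R ^+ 2 * ('i%C * s ^+ 2 / 24)).
  rewrite e2piE; congr cexp; rewrite (_ : tpi R = 2 * pi%:C * 'i%C); last first.
    by rewrite /tpi; apply: complex_ext; rewrite !(ReM, ImM) /=; ring.
  rewrite [RHS](_ : _ = 'i%C ^+ 2 * (2 * pi%:C * m%:~R ^+ 2 * s ^+ 2 / 24)); last by ring.
  by rewrite sqr_i; field.
by rewrite -e2piD; congr e2pi; field.
Qed.

(** Up to a constant the character is its own Fourier transform modulo 12. This is checked residue
    by residue after reducing powers of w = e(1/12) with w^4 = w^2 - 1. *)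
Lemma gaussS_01 m : gaussS 0 1 m = (chi m)%:~R * gaussS 0 1 1.
Proof.
pose w : C := e2pi (1 / 12).
have w12 : w ^+ 12 = 1 by rewrite -e2piMn (_ : 12%:R * (1 / 12) = 1 :> C) ?e2pi1//; field.
have w4 : w ^+ 4 = w ^+ 2 - 1.
  have : (w ^+ 6 - 1) * (w ^+ 6 + 1) = 0 by rewrite -[RHS](subrr 1) -{3}w12; ring.
  have wn k : (0 < k < 12)%N -> w ^+ k != 1.
    move=> k12; apply/eqP; rewrite -e2piMn (_ : k%:R * (1 / 12) = (k%:R / 12)%:C) => [/e2pi_eq1 [j]|]; last first.
      by rewrite rmorphM fmorphV !rmorph_nat mul1r.
    move=> /(congr1 (fun x => x * 12)); rewrite divfK// => E.
    have /eqP : (k%:Z)%:~R = (j * 12)%:~R :> R by rewrite rmorphM -E.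
    by rewrite eqr_int => /eqP; lia.
  move/eqP; rewrite mulf_eq0 subr_eq0 (negbTE (wn 6 isT)) //= => /eqP h.
  have : (w ^+ 2 + 1) * (w ^+ 4 - w ^+ 2 + 1) = 0 by rewrite -h; ring.
  move/eqP; rewrite mulf_eq0 => /orP[/eqP h2|/eqP h2].
    have e4 : w ^+ 4 = (w ^+ 2 + 1) * (w ^+ 2 - 1) + 1 by ring.
    by case/eqP: (wn 4%N isT); rewrite e4 h2 mul0r add0r.
  by rewrite -[LHS]subr0 -h2; ring.
have H (M : nat) : gaussS 0 1 M%:Z = w ^+ M - w ^+ (5 * M) - w ^+ (7 * M) + w ^+ (11 * M).
  have E (l : nat) : e2pi ((0%:~R * l%:R ^+ 2 + 2 * l%:R * (M%:Z)%:~R) / (24 * 1%:R)) = w ^+ (l * M).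
    by rewrite -e2piMn natrM; congr e2pi; rewrite -pmulrn; field.
  rewrite /gaussS (eq_bigr (fun l : 'I_(12 * 1) => (chi l%:Z)%:~R * w ^+ (l * M))); last by move=> l _; rewrite E.
  rewrite !big_ord_recl big_ord0 /= /bump /= !addnE /= /chi /=.
  by rewrite !mul0r !rmorphN /= !mul1r !mulN1r !add0r !addr0 mul1n !addrA.
have mo : gaussS 0 1 m = gaussS 0 1 (`|(m %% 12)%Z|)%N%:Z.
  rewrite gez0_abs ?modz_ge0//; apply: eq_bigr => l _; congr (_ * _).
  rewrite {1}(divz_eq m 12) rmorphD rmorphM /= -[RHS](@e2piDint _ _ (l%:Z * (m %/ 12)%Z)); congr e2pi.
  by rewrite rmorphM /=; field.
rewrite mo (H 1%N) H !muln1.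
have -> : chi m = chi (`|(m %% 12)%Z|)%N%:Z by apply: chi_mod; rewrite gez0_abs ?modz_ge0// modz_mod.
have lt12 : (`|(m %% 12)%Z| < 12)%N by have := modz_ge0 m (isT : 12 != 0 :> int); have := ltz_pmod m (isT : 0 < 12 :> int); lia.
move: (absz _) lt12 => k k12.
have wm n : w ^+ n = w ^+ (n %% 12) by rewrite {1}(divn_eq n 12) exprD mulnC exprM w12 expr1n mul1r.
have w5 : w ^+ 5 = w ^+ 3 - w by rewrite exprS w4; ring.
have w6 : w ^+ 6 = - 1 by rewrite exprS w5 mulrBr -exprS -expr2 w4; ring.
have w7 : w ^+ 7 = - w by rewrite exprS w6; ring.
have w8 : w ^+ 8 = - w ^+ 2 by rewrite exprS w7; ring.
have w9 : w ^+ 9 = - w ^+ 3 by rewrite exprS w8; ring.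
have w10 : w ^+ 10 = 1 - w ^+ 2 by rewrite exprS w9 mulrN -exprS w4; ring.
have w11 : w ^+ 11 = w - w ^+ 3 by rewrite exprS w10; ring.
rewrite !(wm (_ * k)%N).
have -> : ((5 * k) %% 12 = nth 0 [:: 0; 5; 10; 3; 8; 1; 6; 11; 4; 9; 2; 7] k)%N.
  by do 12 (case: k k12 => [//|k] k12).
have -> : ((7 * k) %% 12 = nth 0 [:: 0; 7; 2; 9; 4; 11; 6; 1; 8; 3; 10; 5] k)%N.
  by do 12 (case: k k12 => [//|k] k12).
have -> : ((11 * k) %% 12 = nth 0 [:: 0; 11; 10; 9; 8; 7; 6; 5; 4; 3; 2; 1] k)%N.
  by do 12 (case: k k12 => [//|k] k12).
do 12 (case: k k12 => [_|k k12]; first by rewrite /chi /= ?rmorphN ?(w4, w5, w6, w7, w8, w9, w10, w11) ?expr0 ?expr1; ring).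
by [].
Qed.

(** The value, sign included, follows from comparing the two expansions of eta at z = i, where eta
    does not vanish. *)
Lemma gaussS_011 : gaussS 0 1 1 = s12.
Proof.
have c1 : cone 1 by split; rewrite ?expr1n /=.
have h1 := eta_cusp 0 (ltn0Sn 0) c1.
have [h2 z0] := eta_line 0 (ltn0Sn 0) c1.
have e1 : 0%:~R / 1%:R + 'i%C / (1%:R ^+ 2 * 1 ^+ 2) = 'i%C :> C by rewrite !expr1n mulr1 !divr1 add0r.
have e2 : - (0%:~R / 1%:R) + 'i%C * 1 ^+ 2 = 'i%C :> C by rewrite !expr1n mulr1 mul0r oppr0 add0r.
rewrite e1 in h1; rewrite e2 in h2 z0.
have h3 := hasumZ (gaussS 0 1 1 / s12) h2.
have E : 2 * eta 'i%C = gaussS 0 1 1 / s12 * (2 * eta 'i%C).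
  apply: (hasum_uniq h1); apply: hasum_ext h3 => m.
  by rewrite (gaussS_01 m) mulr0 mul0r oppr0 e2pi0 mulr1; ring.
have n0 : 2 * eta 'i%C != 0 by rewrite mulf_neq0 ?eta_neq0.
move: E; rewrite -{1}[2 * eta 'i%C]mul1r => /(mulIf n0) E.
by rewrite -[RHS]mul1r E divfK ?s12_neq0.
Qed.

Lemma eta_S s : cone s -> eta ('i%C / s ^+ 2) = s * eta ('i%C * s ^+ 2).
Proof.
move=> cs; have h1 := eta_cusp 0 (ltn0Sn 0) cs.
have [h2 _] := eta_line 0 (ltn0Sn 0) cs.
rewrite !expr1n mul1r mul0r add0r in h1; rewrite mul0r oppr0 add0r in h2.
have n2 : 2 != 0 :> C by [].
apply: (mulfI n2); rewrite mulrCA; apply: (hasum_uniq h1).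
apply: hasum_ext (hasumZ s h2) => m.
rewrite gaussS_01 gaussS_011 mulr0 mul0r oppr0 e2pi0 mulr1; have := s12_neq0; move: s12 => v v0; field.
exact: v0.
Qed.

Lemma eta_Tn z (n : int) : 0 < complex.Im z -> eta (z + n%:~R) = e2pi (n%:~R / 24) * eta z.
Proof. by move=> z0; rewrite (qser_mulTn n eta_qser z0) (mulrC 24^-1). Qed.

Lemma sqrM3 (x y z : C) : (x * (y * z)) ^+ 2 = x ^+ 2 * y ^+ 2 * z ^+ 2.
Proof. by ring. Qed.

Lemma cusp_fin (k t w s y z e : C) : w != 0 -> k * (t * (w * s)) * z = w * y ->
  e * y = e * (k * t) * s * z.
Proof.
move=> w0 h; have -> : y = k * (t * s) * z by apply: (mulfI w0); rewrite -h; ring.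
by ring.
Qed.

Lemma cusp_sq (i a b s v : C) : a != 0 -> b != 0 -> s != 0 ->
  i * b / a * (- i * (a * v / (b * s ^+ 2))) * s ^+ 2 = - i ^+ 2 * v.
Proof. by move=> a0 b0 s0; field; rewrite a0 b0 s0. Qed.

(** Euclid's algorithm on the denominator c: a translation reduces a modulo c, and z -> -1/z passes
    to the smaller denominator. Only the modulus of [k] is recorded, its phase being recovered by
    [gauss_eta]. The invariant function [J] is carried along so that both transformation laws refer
    to the same points. *)
Lemma eta_modular (J : C -> C) : (forall z (n : int), 0 < complex.Im z -> J (z + n%:~R) = J z) ->
  (forall z, 0 < complex.Im z -> J (- z^-1) = J z) ->
  forall (c : nat) (a d : int), (0 < c)%N -> (c%:Z %| a * d - 1)%Z ->
  exists k : C, nm k ^+ 2 = c%:R /\ forall s, cone s ->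
    eta (a%:~R / c%:R + 'i%C / (c%:R ^+ 2 * s ^+ 2)) = k * s * eta (- (d%:~R / c%:R) + 'i%C * s ^+ 2) /\
    J (a%:~R / c%:R + 'i%C / (c%:R ^+ 2 * s ^+ 2)) = J (- (d%:~R / c%:R) + 'i%C * s ^+ 2).
Proof.
move=> JT JS c; elim: c {-2}c (leqnn c) => [|N IH] c cN a d c0 ad; first by case: c cN c0 ad.
have red (a' a0 : int) (q : int) : a' = a0 + q * c%:Z -> forall s, cone s ->
   eta (a'%:~R / c%:R + 'i%C / (c%:R ^+ 2 * s ^+ 2)) = e2pi (q%:~R / 24) * eta (a0%:~R / c%:R + 'i%C / (c%:R ^+ 2 * s ^+ 2)) /\
   J (a'%:~R / c%:R + 'i%C / (c%:R ^+ 2 * s ^+ 2)) = J (a0%:~R / c%:R + 'i%C / (c%:R ^+ 2 * s ^+ 2)).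
  move=> -> s cs; have z0 := Im_cusp a0 c0 cs.
  rewrite (_ : (a0 + q * c)%:~R / c%:R + _ = a0%:~R / c%:R + 'i%C / (c%:R ^+ 2 * s ^+ 2) + q%:~R); last first.
    rewrite rmorphD rmorphM /= mulrDl [_ * c%:~R / _]mulfK; first by ring.
    by rewrite pnatr_eq0 -lt0n.
  by rewrite eta_Tn// JT.
have [c1|c1] := eqVneq c 1%N.
  subst c; exists (e2pi (a%:~R / 24) * e2pi (d%:~R / 24)); split.
    by rewrite -e2piD -mulrDl -rmorphD /= intC natC -fmorphV -rmorphM /= nm_e2pi_real expr1n.
  move=> s cs; have [|-> ->] := red a 0 a _ s cs; first by rewrite add0r mulr1.
  have [_ z1] := eta_line 0 (ltn0Sn 0) cs; have [_ z2] := eta_line d (ltn0Sn 0) cs.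
  move: z1 z2; rewrite mul0r oppr0 !add0r divr1 => z1 z2.
  have e1 : 'i%C * s ^+ 2 = - d%:~R + 'i%C * s ^+ 2 + d%:~R by ring.
  rewrite !expr1n mul1r eta_S//; split.
    by rewrite {1}e1 eta_Tn//; ring.
  rewrite -[RHS](JT _ d)// -e1 -[RHS]JS//; congr J.
  by rewrite (invfM 'i%C) -mulNr inv_i opprK.
have cn : c%:Z != 0 by rewrite -lt0n.
pose q := (a %/ c%:Z)%Z; pose a0 := `|(a %% c%:Z)%Z|%N.
have a0E : a0%:Z = (a %% c%:Z)%Z by rewrite gez0_abs// modz_ge0.
have aE : a = a0%:Z + q * c%:Z by rewrite a0E addrC -divz_eq.
have a0c : (a0 < c)%N by have := ltz_pmod a (_ : 0 < c%:Z); rewrite -a0E ltz_nat; apply; rewrite ltz_nat.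
have ad0 : (c%:Z %| a0%:Z * d - 1)%Z.
  rewrite (_ : _ - 1 = a * d - 1 + - (q * d) * c%:Z); last by rewrite aE; ring.
  by rewrite rpredD// dvdz_mull.
have a00 : (0 < a0)%N.
  rewrite lt0n; apply/eqP => E; move: ad0; rewrite E mul0r sub0r dvdzE /= dvdn1.
  by rewrite (negbTE c1).
have /dvdzP[b bE] := ad0.
(* Under y -> -1/y the cusp a0/c becomes -c/a0, of smaller denominator, and b is the entry with a0 d
   - b c = 1. *)
have [||k [kn Hk]] := IH a0 _ (- c%:Z) b a00.
- by rewrite -ltnS (leq_trans a0c).
- by apply/dvdzP; exists (- d); rewrite mulNr mulrC -bE; ring.
(* The square root of i c / a0 with argument pi/4; it is the factor between the parameter [s'] of
   the smaller denominator and [w * s]. *)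
pose t : C := (1 + 'i%C) * (Num.sqrt (c%:R / (2 * a0%:R)))%:C.
have cR : 0 < c%:R :> R by rewrite ltr0n.
have aR : 0 < a0%:R :> R by rewrite ltr0n.
have cC : c%:R != 0 :> C by rewrite pnatr_eq0 -lt0n.
have aC : a0%:R != 0 :> C by rewrite pnatr_eq0 -lt0n.
have rt0 : 0 < Num.sqrt (c%:R / (2 * a0%:R)) :> R by rewrite sqrtr_gt0 divr_gt0// mulr_gt0.
have t2 : t ^+ 2 = 'i%C * c%:R / a0%:R.
  rewrite /t exprMn -rmorphXn /= sqr_sqrtr; last by rewrite divr_ge0// ltW// mulr_gt0.
  rewrite rmorphM fmorphV rmorphM !rmorph_nat /=.
  rewrite (_ : (1 + 'i%C) ^+ 2 = 1 + 2 * 'i%C + 'i%C ^+ 2); last by ring.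
  by rewrite sqr_i; field.
exists (e2pi (q%:~R / 24) * (k * t)); split.
  have qn : nm (e2pi (q%:~R / 24 : C)) = 1.
    by rewrite intC natC -fmorphV -rmorphM /= nm_e2pi_real.
  rewrite nmM qn mul1r (nmM k t) exprMn kn -nmX t2 (nmM _ a0%:R^-1) (nmM 'i%C) nmV !nm_nat.
  have -> : nm ('i%C : C) = 1 by rewrite /nm /= expr0n expr1n add0r sqrtr1.
  by rewrite mul1r mulrCA mulfV ?mulr1// gt_eqF.
move=> s cs; have [-> ->] := red a a0%:Z q aE s cs.
have [_ z0] := eta_line d c0 cs; set z := (- _ + _) in z0 *.
have y0 := Im_cusp a0%:Z c0 cs; set y := (_ / _ + _) in y0 *.
have s0 := cone_neq0 cs.
have bC : b%:~R * c%:R = a0%:R * d%:~R - 1 :> C.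
  by have := congr1 (fun x : int => x%:~R : C) bE; rewrite rmorphB !rmorphM /= => <-.
have i0 := neq0i.
have i2 := sqr_i R.
pose s2 := s ^+ 2 + 'i%C / (a0%:R * c%:R).
have s2R : 0 < complex.Re s2.
  rewrite /s2 -natrM natC -fmorphV ReD [X in _ + X]ReM /= mulr0 mul0r subrr addr0; by case: cs.
have cs' := cone_csqrt s2R; set s' := csqrt s2 in cs'.
have ss : s' ^+ 2 = s2 := sqr_csqrt s2.
have wR : 0 < complex.Re (- 'i%C * y).
  by rewrite ReM /= !mulN1r mulNr ?oppr0 ?mul0r ?sub0r ?oppr0 ?add0r ?mul1r ?opprK //; lra.
have cw := cone_csqrt wR; set w := csqrt _ in cw.
have ww : w ^+ 2 = - 'i%C * y := sqr_csqrt _.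
have yE : y = a0%:R * s2 / (c%:R * s ^+ 2).
  rewrite /y /s2 mulrDr mulrDl -pmulrn; field; by rewrite s0 aC cC.
have w0 := cone_neq0 cw; have s'0 := cone_neq0 cs'.
have s2n : s2 != 0 by rewrite -ss expf_neq0.
have [H1 H2] := Hk s' cs'.
have zE : - (b%:~R / a0%:R) + 'i%C * s' ^+ 2 = z.
  have -> : 'i%C * s' ^+ 2 = 'i%C * s ^+ 2 + 'i%C ^+ 2 / (a0%:R * c%:R) by rewrite ss /s2; ring.
  rewrite i2 /z.
  have -> : b%:~R = (a0%:R * d%:~R - 1) / c%:R :> C by rewrite -bC mulfK.
  by field; rewrite cC aC.
have yV : (- c%:Z)%:~R / a0%:R + 'i%C / (a0%:R ^+ 2 * s' ^+ 2) = - y^-1.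
  have iE : 'i%C = (s2 - s ^+ 2) * (a0%:R * c%:R) by rewrite /s2 addrAC subrr add0r divfK ?mulf_neq0.
  rewrite ss yE rmorphN /= iE; move: s2n; clear -s0 cC aC; move: s2 => v v0.
  have -> : (c%:Z)%:~R = c%:R :> C by [].
  by field; rewrite s0 v0 cC aC.
rewrite zE yV in H1 H2.
have y1 : 'i%C / w ^+ 2 = - y^-1.
  by rewrite ww invfM mulrA invrN mulrN mulfV// mulN1r.
have y2 : 'i%C * w ^+ 2 = y by rewrite ww mulrA mulrN -expr2 i2 opprK mul1r.
have := eta_S cw; rewrite y1 y2 H1 => E; split; last by rewrite -(JS y)// H2.
(* Both sides have the same square. The opposite sign is impossible: points of [cone] have argument
   strictly between -pi/4 and pi/4, so [(1 - 'i) * s'] and [w * s] both have positive real part. *)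
have sE : s' = t * (w * s).
  have : s' ^+ 2 = (t * (w * s)) ^+ 2.
    rewrite sqrM3 ww t2 ss yE cusp_sq// i2 opprK mul1r.
    by [].
  move/eqP; rewrite eqf_sqr => /orP[/eqP //|/eqP h]; exfalso.
  have [s1 s3] := cone_ReIm cs'; have [w1 w2] := cone_ReIm cw; have [s4 s5] := cone_ReIm cs.
  have h1 : 0 < complex.Re (w * s) by rewrite ReM; case: cw => r1 _; case: cs => r2 _; nra.
  have : complex.Re ((1 - 'i%C) * s') = - (2 * Num.sqrt (c%:R / (2 * a0%:R)) * complex.Re (w * s)).
    rewrite h /t (_ : _ * _ = - (2 * (Num.sqrt (c%:R / (2 * a0%:R)))%:C * (w * s))); last first.
      rewrite (_ : _ * _ = - ((1 - 'i%C ^+ 2) * (Num.sqrt (c%:R / (2 * a0%:R)))%:C * (w * s))); last by ring.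
      by rewrite i2; ring.
    move: (Num.sqrt _) => v; have -> : 2 * v%:C = (2 * v)%:C :> C by rewrite rmorphM rmorph_nat.
    by move: (w * s) => u; rewrite ReN ReM /= mul0r subr0.
  have -> : complex.Re ((1 - 'i%C) * s') = complex.Re s' + complex.Im s' by case: (s') => x9 y9 /=; ring.
  move=> h2.
  have : 0 < 2 * Num.sqrt (c%:R / (2 * a0%:R)) * complex.Re (w * s) by rewrite !mulr_gt0.
  rewrite -oppr_lt0 -h2; lra.
by apply: (cusp_fin _ w0); rewrite -sE.
Qed.

(** Grouping by m^2 gives a q-series, from which only [x m + x (- m)] can be read off; evenness then
    gives [x m]. *)
Lemma theta_uniq (x : int -> C) (K : R) : (forall m, nm (x m) <= K) -> (forall m, x (- m) = x m) ->
  (forall w, 0 < complex.Re w -> hasum (fun m : int => x m * cexp (- (pi%:C * m%:~R ^+ 2 * w / 12))) 0) ->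
  forall m, x m = 0.
Proof.
move=> HK xN H.
have K0 : 0 <= K by apply: le_trans (HK 0); exact: nm_ge0.
pose g (k : nat) := if k == 0%N then x 0 else x k%:Z + x (- k%:Z).
have gK k : nm (g k) <= 2 * K.
  rewrite /g; case: ifP => _; first by apply: le_trans (HK _) _; lra.
  by apply: le_trans (nmD _ _) _; have := HK k%:Z; have := HK (- k%:Z); lra.
pose b (n : nat) := \sum_(k < n.+1) if (k ^ 2 == n)%N then g k else 0.
have B0 n : b n = 0.
  apply: (@qs_uniq R b (2 * K) 2 0) => [|//|{}n|z z0].
  - by rewrite mulr_ge0.
  - rewrite /b; apply: le_trans (nm_sum _ _) _.
    apply: (@le_trans _ _ (\sum_(k < n.+1) 2 * K)).
      by apply: ler_sum => k _; case: ifP => _; rewrite ?gK ?nm0 ?mulr_ge0.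
    rewrite sumr_const card_ord -[_ *+ _]mulr_natr ler_wpM2l ?mulr_ge0//.
    by rewrite -natrX ler_nat ltn_expl.
  pose w : C := - (24 * 'i%C * z).
  have wR : 0 < complex.Re w.
    have -> : complex.Re w = 24 * complex.Im z by rewrite /w natC; case: (z) => p q /=; ring.
    by rewrite mulr_gt0.
  have h1 := hasum_fold (H w wR).
  have e m : cexp (- (pi%:C * m%:~R ^+ 2 * w / 12)) = e2pi (m%:~R ^+ 2 * z).
    rewrite e2piE; congr cexp; rewrite (_ : tpi R = 2 * pi%:C * 'i%C) /w; last first.
      by rewrite /tpi; apply: complex_ext; rewrite !(ReM, ImM) /=; ring.
    by field.
  have := @hasum_fiber nat _ (fun k => (k ^ 2)%N) (fun n => seq_fset tt (iota 0 n.+1)) _ _ h1.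
  move=> h2; apply: hasum_ext (h2 _) => [k|k _]; last first.
    by rewrite seq_fsetE mem_iota /= add0n ltnS -mulnn; case: k => // k; exact: leq_pmulr.
  rewrite sum_seq_fset ?iota_uniq// (_ : iota _ _ = index_iota 0 k.+1); last by rewrite /index_iota subn0.
  rewrite big_mkord /b mulr_suml; apply: eq_bigr => l _; case: eqP => [lk|_]; last by rewrite mul0r.
  rewrite /g; case: eqP => [l0|_]; rewrite !e.
    by rewrite -lk l0 expr0n.
  have -> : k%:R = l%:~R ^+ 2 :> C by rewrite -[(l%:Z)%:~R]/(l%:R) -natrX lk.
  by rewrite rmorphN sqrrN -mulrDl.
have H1 (k : nat) : x k%:Z = 0.
  have := B0 (k ^ 2)%N; rewrite /b.
  have kk : (k < (k ^ 2).+1)%N by rewrite ltnS -mulnn; case: k => // k; exact: leq_pmulr.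
  rewrite (bigD1 (Ordinal kk))//= eqxx big1 ?addr0 => [|l lk]; last first.
    by rewrite eqn_sqr; case: eqP => // E; case/eqP: lk; apply: val_inj.
  rewrite /g; case: eqP => [->//|_]; rewrite xN -mulr2n -mulr_natl => /eqP.
  by rewrite mulf_eq0 => /orP[|/eqP //]; rewrite pnatr_eq0.
case=> k; first exact: H1.
by rewrite NegzE xN H1.
Qed.

Lemma gaussSN a c m : (0 < c)%N -> gaussS a c (- m) = gaussS a c m.
Proof.
move=> c0; have N0 : (0 < 12 * c)%N by rewrite muln_gt0.
have cn : c%:R != 0 :> C by rewrite pnatr_eq0 -lt0n.
case E : (12 * c)%N N0 => [//|N] _; rewrite /gaussS E.
pose h (l : nat) : C := (chi l%:Z)%:~R * e2pi ((a%:~R * l%:R ^+ 2 + 2 * l%:R * m%:~R) / (24 * c%:R)).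
rewrite big_ord_recl [RHS]big_ord_recl /= !mul0r; congr (_ + _).
rewrite (reindex_inj rev_ord_inj) /=; apply: eq_bigr => l _.
rewrite /bump /= !add1n -subSn// subSS.
have lN := ltn_ord l.
have chE : chi (N - l)%N%:Z = chi l.+1%:Z.
  rewrite -chiN; apply: chi_mod; have -> : - (N - l)%N%:Z = l.+1%:Z + (- c%:Z) * 12 by lia.
  by rewrite addrC modzMDl.
rewrite chE; congr (_ * _).
have -> : (N - l)%:R = 12 * c%:R - l.+1%:R :> C.
  have h1 : (N - l)%:R + l.+1%:R = (12 * c)%:R :> C.
    by rewrite -natrD E addnS subnK// ltnW.
  by rewrite -[LHS](addrK l.+1%:R) h1 natrM.
rewrite -[LHS](@e2piDint _ _ (a * l.+1%:Z - 6 * a * c%:Z + m)); congr e2pi.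
have -> : (a * l.+1%:Z - 6 * a * c%:Z + m)%:~R = a%:~R * l.+1%:R - 6 * a%:~R * c%:R + m%:~R :> C.
  by rewrite !(rmorphD, rmorphM, rmorphN).
rewrite rmorphN; move: (l.+1%:R : C) => x; field.
exact: cn.
Qed.

(* Poisson summation expands eta near the cusp a/c as a theta series whose coefficients are the
   gaussS a c m; the hypothesis gives a second expansion, and the coefficients must agree. *)
Lemma gauss_eta (c : nat) (a d : int) (k : C) : (0 < c)%N ->
  (forall s, cone s -> eta (a%:~R / c%:R + 'i%C / (c%:R ^+ 2 * s ^+ 2)) = k * s * eta (- (d%:~R / c%:R) + 'i%C * s ^+ 2)) ->
  forall m, gaussS a c m = s12 * k * (chi m)%:~R * e2pi (- (m%:~R ^+ 2 * d%:~R / (24 * c%:R))).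
Proof.
move=> c0 H m.
pose y (m : int) := k * (chi m)%:~R * e2pi (- (m%:~R ^+ 2 * d%:~R / (24 * c%:R))).
pose x (m : int) := gaussS a c m / s12 - y m.
suff : x m = 0.
  move=> /eqP; rewrite subr_eq0 /y => /eqP E.
  by rewrite -2!mulrA (mulrA k) -E mulrC divfK ?s12_neq0.
have d0 := s12_neq0.
have cn : c%:R != 0 :> C by rewrite pnatr_eq0 -lt0n.
have e1 (r : R) : nm (e2pi r%:C) = 1 by exact: nm_e2pi_real.
apply: (@theta_uniq x ((12 * c)%:R / nm s12 + nm k)) => {m} [m|m|w wR].
- apply: le_trans (nmB _ _) _; rewrite nmM nmV; apply: lerD.
    rewrite ler_wpM2r ?invr_ge0 ?nm_ge0//; apply: le_trans (nm_sum _ _) _.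
    rewrite -[X in _ <= X%:R]card_ord -sumr_const; apply: ler_sum => l _.
    rewrite nmM; apply: le_trans (_ : 1 * 1 <= 1); last by rewrite mulr1.
    apply: ler_pM; rewrite ?nm_ge0 ?nm_chi//.
    rewrite (_ : _ / _ = ((a%:~R * l%:R ^+ 2 + 2 * l%:R * m%:~R) / (24 * c%:R) : R)%:C) ?e1//.
    by rewrite !(rmorphM, rmorphD, rmorphXn, fmorphV, rmorph_nat, rmorph_int).
  rewrite /y -mulrA nmM ler_piMr ?nm_ge0// nmM -[leRHS]mulr1 ler_pM ?nm_ge0 ?nm_chi//.
  rewrite (_ : - _ = (- (m%:~R ^+ 2 * d%:~R / (24 * c%:R)) : R)%:C) ?e1//.
  by rewrite !(rmorphN, rmorphM, rmorphD, rmorphXn, fmorphV, rmorph_nat, rmorph_int).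
- by rewrite /x /y gaussSN// chiN rmorphN sqrrN.
pose s := csqrt w; have cs : cone s := cone_csqrt wR.
have sw : s ^+ 2 = w := sqr_csqrt w.
have s0 := cone_neq0 cs.
have h1 := eta_cusp a c0 cs; have [h2 _] := eta_line d c0 cs.
have := hasumZ s^-1 (hasumB h1 (hasumZ (k * s) h2)).
rewrite H// (_ : 2 * _ - _ = 0) ?mulr0; last by ring.
apply: hasum_ext => m; rewrite /x /y -sw.
move: (cexp _) (e2pi _) (gaussS _ _ _) (chi m) => x1 x2 x3 x4; field.
by rewrite d0 s0.
Qed.

End Eta.

(** * Eisenstein series and the j-invariant *)

Section Eisenstein.
Variable R : realType.
Local Notation C := R[i].

Lemma unordered_sumE (I : choiceType) (A : set I) (f : I -> C) s :
  hasum (fun i => if i \in A then f i else 0) s -> unordered_sum A f = s.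
Proof.
have FF : ProperFilter (@summability.totally I) := summability.totally_filter.
move=> H; rewrite /unordered_sum /summability.sum; apply: (@cvg_lim C^o); first exact: norm_hausdorff.
apply/cvgrPdist_lt => e e0.
have e1 : e = (complex.Re e)%:C by case: e e0 => x y; rewrite ltcE /= => /andP[/eqP -> _].
have [|B HB] := H (complex.Re e); first by rewrite -ltcR -e1.
exists B => // D /= BD; rewrite e1 -nmE ltcR nm_subC.
have := HB D BD; rewrite /summability.partial_sum /patch.
by rewrite (big_seq_fsetE _ _ xpredT).
Qed.

(** The product on the left splits sums over the lattice into two one-dimensional sums, uniformly in
    a half-strip. *)
Lemma lattice_bound (X y0 : R) : 0 < y0 -> exists K : R, 0 < K /\
  forall z : C, `|complex.Re z| <= X -> y0 <= complex.Im z -> forall m n : int, (m, n) != (0, 0) ->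
  (`|m|%N.+1)%:R * (`|n|%N.+1)%:R <= K * nm (m%:~R * z + n%:~R) ^+ 2.
Proof.
move=> y00; exists (3 * (2 + (2 * X ^+ 2 + 1) / y0 ^+ 2)).
have y2 : 0 < y0 ^+ 2 by rewrite exprn_gt0.
have q0 : 0 <= (2 * X ^+ 2 + 1) / y0 ^+ 2 by rewrite divr_ge0 ?(ltW y2)// addr_ge0// mulr_ge0// sqr_ge0.
split=> [|z zX zy m n mn]; first lra.
rewrite nm_sqr !intC !(ReD, ImD, ReM, ImM) /= !mul0r !subr0 !addr0.
have X0 : 0 <= X by apply: le_trans zX; exact: normr_ge0.
have x2 : complex.Re z ^+ 2 <= X ^+ 2 by rewrite -(real_normK (num_real _)) lerXn2r ?nnegrE.
have yy : y0 ^+ 2 <= complex.Im z ^+ 2 by rewrite lerXn2r ?nnegrE ?(ltW y00) ?(le_trans (ltW y00) zy).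
have -> : (`|m|%N.+1)%:R = `|m%:~R| + 1 :> R by rewrite absz_norm -natr1.
have -> : (`|n|%N.+1)%:R = `|n%:~R| + 1 :> R by rewrite absz_norm -natr1.
have mn1 : 1 <= (m%:~R ^+ 2 + n%:~R ^+ 2 : R).
  by rewrite -!rmorphXn -rmorphD /= -[1]/(1%:~R) ler_int; move: mn; rewrite xpair_eqE; nia.
have int_sq (k : int) : `|k%:~R| <= k%:~R ^+ 2 :> R.
  by rewrite -rmorphXn -intr_norm ler_int; nia.
have m1 := int_sq m; have n1 := int_sq n.
move: mn1 m1 n1; rewrite -(real_normK (num_real m%:~R)) -(real_normK (num_real n%:~R)).
have h1 : n%:~R ^+ 2 <= 2 * (m%:~R * complex.Re z + n%:~R) ^+ 2 + 2 * (m%:~R ^+ 2 * complex.Re z ^+ 2) :> R.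
  have := sqr_ge0 (m%:~R * complex.Re z + (m%:~R * complex.Re z + n%:~R)); lra.
have h2 : m%:~R ^+ 2 * y0 ^+ 2 <= (m%:~R * complex.Im z) ^+ 2 :> R.
  by rewrite exprMn ler_wpM2l ?sqr_ge0.
have h3 : m%:~R ^+ 2 * complex.Re z ^+ 2 <= m%:~R ^+ 2 * X ^+ 2 :> R by rewrite ler_wpM2l ?sqr_ge0.
rewrite -(real_normK (num_real (m%:~R : R))) in h1 h2 h3.
rewrite -[n%:~R ^+ 2](real_normK (num_real (n%:~R : R))) in h1.
have := normr_ge0 (m%:~R : R); have := normr_ge0 (n%:~R : R).
set a := (_ * complex.Re z + _) ^+ 2 in h1 *; set b := (_ * complex.Im z) ^+ 2 in h2 *.
move: `|m%:~R| `|n%:~R| h1 h2 h3 => M N h1 h2 h3 N0 M0 mn1 m1 n1.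
have a0 : 0 <= a := sqr_ge0 _; have b0 : 0 <= b := sqr_ge0 _.
have h4 : M ^+ 2 <= b / y0 ^+ 2 by rewrite ler_pdivlMr.
have h5 : M ^+ 2 * X ^+ 2 <= b / y0 ^+ 2 * X ^+ 2 by rewrite ler_wpM2r ?sqr_ge0.
have h6 : (M + 1) * (N + 1) <= 3 * (M ^+ 2 + N ^+ 2) by have := sqr_ge0 (M - N); nra.
apply: le_trans h6 _; rewrite -mulrA ler_wpM2l//.
rewrite [leRHS](_ : _ = 2 * a + 2 * b + (2 * (b / y0 ^+ 2 * X ^+ 2) + b / y0 ^+ 2) + a * ((2 * X ^+ 2 + 1) / y0 ^+ 2)); last first.
  by field; rewrite gt_eqF.
have : 0 <= a * ((2 * X ^+ 2 + 1) / y0 ^+ 2) by rewrite mulr_ge0.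
lra.
Qed.

Definition lat (k : nat) (z : C) (w : int * int) : C :=
  if w \in [set w : int * int | w != (0, 0)]%classic then (w.1%:~R * z + w.2%:~R) ^- k else 0.

Lemma latE k z w : lat k z w = if w == (0, 0) then 0 else (w.1%:~R * z + w.2%:~R) ^- k.
Proof.
rewrite /lat; case: ifP => [|/negbT]; rewrite (in_setE, notin_setE) /=.
  by move=> /negbTE ->.
by case: eqP.
Qed.

Lemma lat_neq0 (z : C) (m n : int) : 0 < complex.Im z -> (m, n) != (0, 0) -> m%:~R * z + n%:~R != 0.
Proof.
move=> z0 mn; have [K [K0 H]] := lattice_bound `|complex.Re z| z0.
have := H z (lexx _) (lexx _) m n mn; apply: contraTneq => ->.
by rewrite nm0 expr0n mulr0 -ltNge mulr_gt0.
Qed.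

Lemma smb_lat (k : nat) z : 0 < complex.Im z -> smb (fun w => nm (lat (2 * k.+2) z w)).
Proof.
move=> z0; have [K [K0 H]] := lattice_bound `|complex.Re z| z0.
have := smbZ (_ : 0 <= K ^+ k.+2) (smb_zw_int2 R); rewrite exprn_ge0 ?(ltW K0)// => /(_ isT).
apply: smb_le => -[m n]; rewrite latE; case: (boolP ((m, n) == (0, 0))) => [_|mn].
  by rewrite nm0 mulr_ge0 ?exprn_ge0 ?mulr_ge0 ?zw_ge0 ?(ltW K0).
have h := H z (lexx _) (lexx _) m n mn.
rewrite nmV nmX exprM /=; set t := nm _ ^+ 2 in h *.
have P : 0 < (`|m|%N.+1)%:R * (`|n|%N.+1)%:R :> R by rewrite mulr_gt0.
have t0 : 0 < t by rewrite -(pmulr_rgt0 _ K0); exact: lt_le_trans h.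
apply: (@le_trans _ _ (K ^+ k.+2 * ((`|m|%N.+1)%:R ^- k.+2 * (`|n|%N.+1)%:R ^- k.+2))).
  have -> : K ^+ k.+2 * ((`|m|%N.+1)%:R ^- k.+2 * (`|n|%N.+1)%:R ^- k.+2) =
     (K / ((`|m|%N.+1)%:R * (`|n|%N.+1)%:R)) ^+ k.+2 :> R by rewrite expr_div_n [in RHS]exprMn [in RHS]invfM.
  rewrite -exprVn lerXn2r ?nnegrE ?invr_ge0 ?divr_ge0 ?(ltW P) ?(ltW t0) ?(ltW K0)//.
  by rewrite ler_pdivlMr// ler_pdivrMl// (mulrC t).
by rewrite ler_wpM2l ?exprn_ge0 ?(ltW K0)// ler_pM ?zw_ge ?invr_ge0 ?exprn_ge0.
Qed.

Definition sigma (k n : nat) : nat := (\sum_(m < n.+1) \sum_(j < n.+1)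
  if [&& 0 < m, 0 < j & m * j == n] then j ^ k else 0)%N.

Lemma sigma0 k : sigma k 0 = 0%N.
Proof. by rewrite /sigma big_ord1 big_ord1. Qed.

Lemma sigma1 k : sigma k 1 = 1%N.
Proof. by rewrite /sigma !big_ord_recl !big_ord0 /= exp1n. Qed.

Lemma sigma2 k : sigma k 2 = (1 + 2 ^ k)%N.
Proof. by rewrite /sigma !big_ord_recl !big_ord0 /= exp1n !addn0 add0n addnC. Qed.

(* 2 zeta(k) *)
Definition zsum (k : nat) : C := xget 0 [set s | hasum (fun n : int => if n == 0 then 0 else n%:~R ^- k) s]%classic.

Definition eis_coef (k n : nat) : C :=
  if n == 0%N then zsum k else 2 * (- tpi R) ^+ k / k.-1`!%:R * (sigma k.-1 n)%:R.

Lemma eis_rdec k : rdec (eis_coef k).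
Proof.
set K := nm (2 * (- tpi R) ^+ k / k.-1`!%:R).
apply: (@rdec_bound1 R _ k.+2 (nm (zsum k) + K)) => -[|n].
  by rewrite expr1n mulr1 /eis_coef /= lerDl nm_ge0.
rewrite /eis_coef /= nmM nm_nat -/K.
apply: (@le_trans _ _ (K * n.+2%:R ^+ k.+2)); last first.
  by rewrite mulrDl lerDr mulr_ge0 ?nm_ge0.
rewrite ler_wpM2l ?nm_ge0// -natrX ler_nat /sigma.
apply: (@leq_trans (\sum_(m < n.+2) \sum_(j < n.+2) n.+2 ^ k)); last first.
  by rewrite !sum_nat_const !card_ord -!expnS.
apply: leq_sum => m _; apply: leq_sum => j _; case: ifP => // _.
apply: (@leq_trans (n.+2 ^ k.-1)); first by case: (k.-1) => // e; rewrite leq_exp2r// ltnW.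
by rewrite leq_pexp2l// leq_pred.
Qed.

(** A Lambert series summed in two orders: along n = m j it yields divisor sums, along rows m it
    meets Lipschitz's formula. *)
Lemma sum_qmj (k : nat) (z : C) : (0 < k)%N -> 0 < complex.Im z ->
  exists S, [/\ hasum (fun n => (sigma k n)%:R * e2pi (n%:R * z)) S &
  forall g : nat -> C, g 0%N = 0 -> (forall m, (0 < m)%N -> hasum (fun j : nat => j%:R ^+ k * e2pi (j%:R * (m%:R * z))) (g m)) ->
    hasum g S].
Proof.
move=> k0 z0; pose F (x : nat * nat) : C :=
  if (0 < x.1)%N then x.2%:R ^+ k * e2pi (x.2%:R * (x.1%:R * z)) else 0.
pose r := nm (e2pi z); have r01 := nm_q_lt1 z0; have r0 : 0 < r by rewrite nm_gt0 e2pi_neq0.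
have sF : smb (fun x => nm (F x)).
  have := smbZ (_ : 0 <= r^-1) (smb_prod _ _ (smb_geom r01) (smb_poly_geom k r01)).
  rewrite invr_ge0 (ltW r0) => /(_ isT (fun n => exprn_ge0 n (ltW r0))).
  have P n : 0 <= n%:R ^+ k * r ^+ n by rewrite mulr_ge0 ?exprn_ge0// ltW.
  move=> /(_ P); apply: smb_le => -[m j]; rewrite /F /=; case: m => [|m] /=.
    by rewrite nm0 !mulr_ge0 ?invr_ge0 ?exprn_ge0// ltW.
  case: j => [|j]; first by rewrite expr0n; case: (k) k0 => // k' _; rewrite mul0r nm0 !mulr_ge0 ?invr_ge0 ?exprn_ge0// ltW.
  rewrite nmM nmX nm_nat mulrA -natrM e2piMn nmX -/r.
  rewrite (exprS r m) -(mulrA r) mulKf ?gt_eqF// mulrCA -exprD ler_wpM2l ?exprn_ge0//.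
  rewrite ler_wiXn2l ?(ltW r0)//; first by rewrite ltW//; case/andP: r01.
  nia.
have [S hS] := smb_hasum sF; exists S; split; last first.
  move=> g g0 Hg; apply: (hasum_sigma hS) => -[|m]; rewrite /F /=; last exact: Hg.
  by rewrite g0; exact: hasum0.
have := @hasum_fiber R _ F (fun x => (x.1 * x.2)%N) (fun n => prodfs (seq_fset tt (iota 0 n.+1)) (seq_fset tt (iota 0 n.+1))) S _ hS.
move=> h; apply: hasum_ext (h _) => [n|[m j]]; last first.
  rewrite in_prodfs !seq_fsetE !mem_iota [(m, j).1]/= [(m, j).2]/= !leq0n !add0n !ltnS /F /=.
  case: m => [|m]; rewrite ?eqxx//=; case: j => [|j]; last by move=> _; rewrite leq_pmulr// leq_pmull.
  by rewrite expr0n; case: (k) k0 => // k' _; rewrite mul0r eqxx.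
rewrite sum_prodfs sum_seq_fset ?iota_uniq// (_ : iota _ _ = index_iota 0 n.+1); last by rewrite /index_iota subn0.
rewrite big_mkord /sigma natr_sum mulr_suml; apply: eq_bigr => m _.
rewrite sum_seq_fset ?iota_uniq//.
rewrite big_mkord natr_sum mulr_suml; apply: eq_bigr => j _.
rewrite /F /=; case: (posnP m) => [->|m0] /=; first by rewrite if_same mul0r.
case: (posnP j) => [->|j0] /=.
  by rewrite expr0n; case: (k) k0 => // k' _; rewrite !mul0r if_same.
case: eqP => [mj|_]; last by rewrite mul0r.
have -> : n%:R = j%:R * m%:R :> C by rewrite -natrM mulnC mj.
by rewrite natrX mulrA.
Qed.

Lemma eisenstein_hasum k z : 0 < complex.Im z -> hasum (lat (2 * k.+2) z) (eisenstein_sum (2 * k.+2) z).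
Proof.
move=> z0; have [s hs] := smb_hasum (smb_lat k z0).
by rewrite /eisenstein_sum (unordered_sumE hs).
Qed.

Lemma eisenstein_qser k : qser 0 (eis_coef (2 * k.+2)) (eisenstein_sum (2 * k.+2)).
Proof.
split=> [|z z0]; first exact: eis_rdec.
set K := (2 * k.+2)%N; have K0 : (0 < K.-1)%N by [].
have KS : K = K.-1.+1 by [].
have hE := eisenstein_hasum k z0.
have pos (m : nat) : (0 < m)%N -> exists S, hasum (fun n : int => lat K z (m%:Z, n)) ((- tpi R) ^+ K / K.-1`!%:R * S) /\
    hasum (fun j : nat => j%:R ^+ K.-1 * e2pi (j%:R * (m%:R * z))) S.
  move=> m0; have mz : 0 < complex.Im (m%:R * z) by rewrite natC ImM /= mul0r addr0 mulr_gt0// ltr0n.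
  have [S [h1 h2]] := lipschitz K0 mz.
  have c0 : (- tpi R) ^+ K.-1.+1 / K.-1`!%:R != 0.
    by rewrite mulf_neq0 ?expf_neq0 ?oppr_eq0 ?tpi_neq0// invr_eq0 pnatr_eq0 -lt0n fact_gt0.
  exists (((- tpi R) ^+ K.-1.+1 / K.-1`!%:R)^-1 * S); split.
    rewrite KS mulVKf//; apply: hasum_ext h1 => n; rewrite latE xpair_eqE /=.
    by rewrite (_ : (m%:Z == 0) = false)//; apply/eqP; lia.
  by apply: hasum_ext (hasumZ _ h2) => j; rewrite mulKf.
pose inner (m : int) : C := xget 0 [set s | hasum (fun n : int => lat K z (m, n)) s]%classic.
have innerP m s : hasum (fun n : int => lat K z (m, n)) s -> inner m = s.
  move=> h; rewrite /inner; case: xgetP => [y _ /(hasum_uniq h) //|/(_ s)]; by case.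
have latN m n : lat K z (- m, - n) = lat K z (m, n).
  rewrite !latE !xpair_eqE !oppr_eq0; case: ifP => // _.
  by rewrite /= !rmorphN mulNr -opprD exprNn /K mul2n -addnn exprD -expr2 sqrr_sign mul1r.
have hin m : hasum (fun n : int => lat K z (m, n)) (inner m).
  have : exists s, hasum (fun n : int => lat K z (m, n)) s.
    exact: smb_hasum (smb_fst m (smb_lat k z0)).
  by case=> s h; rewrite (innerP _ _ h).
have inN m : inner (- m) = inner m.
  apply: innerP; apply/(@hasum_bij _ _ _ (fun n : int => - n)); first by exists (fun n : int => - n) => x; rewrite opprK.
  by apply: hasum_ext (hin m) => n; rewrite /= latN.
have h1 := hasum_fold (hasum_sigma hE hin).
have z0E : inner 0 = zsum K.
  have E n : lat K z (0, n) = if n == 0 then 0 else n%:~R ^- K by rewrite latE xpair_eqE eqxx /= mul0r add0r.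
  rewrite /inner /zsum; congr (xget _ _); apply/seteqP; split=> s; apply: hasum_ext => n; by rewrite E.
have [S [hS HS]] := sum_qmj K0 z0.
pose cst := 2 * (- tpi R) ^+ K / K.-1`!%:R; pose X := (- tpi R) ^+ K / K.-1`!%:R.
have cX T : X * T + X * T = cst * T by rewrite /cst -(mulrA 2) -/X; move: X => x; ring.
have [S' hS'] : exists S', hasum (fun m : nat => if m == 0%N then 0 else inner m%:Z + inner (- m%:Z)) S'.
  exists (eisenstein_sum K z - inner 0).
  have d0 := @hasum_fin R nat [fset 0%N]%fset (fun n => if n == 0%N then inner 0 else 0).
  rewrite big_seq_fset1 eqxx in d0; have {}d0 := d0 _.
  apply: hasum_ext (hasumB h1 (d0 _)) => [n|n]; last by rewrite inE => /negbTE ->.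
  by case: eqP => _; rewrite ?subrr ?subr0.
have cst0 : cst != 0.
  apply: mulf_neq0; first by rewrite mulf_neq0 ?expf_neq0 ?oppr_eq0 ?tpi_neq0.
  by rewrite invr_eq0 pnatr_eq0 -lt0n fact_gt0.
have hg : hasum (fun m : nat => cst^-1 * (if m == 0%N then 0 else inner m%:Z + inner (- m%:Z))) S.
  apply: HS => [|m m0]; first by rewrite mulr0.
  have [T [t1 t2]] := pos m m0; rewrite (gtn_eqF m0) inN (innerP _ _ t1).
  by rewrite -/X cX mulKf.
have d0 := @hasum_fin R nat [fset 0%N]%fset (fun n => if n == 0%N then inner 0 else 0).
rewrite big_seq_fset1 eqxx in d0.
have d1 : forall i : nat, i \notin [fset 0%N]%fset -> (if i == 0%N then inner 0 else 0) = 0.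
  by move=> n; rewrite inE => /negbTE ->.
have tot : eisenstein_sum K z = inner 0 + cst * S.
  apply: (hasum_uniq h1); apply: hasum_ext (hasumD (d0 d1) (hasumZ cst hg)) => n.
  by rewrite mulVKf//; case: eqP => _; rewrite ?addr0 ?add0r.
have hh := hasumD (d0 d1) (hasumZ cst hS); rewrite tot; move: hh; apply: hasum_ext => n.
rewrite /eis_coef addr0; case: eqP => [->|_]; last by rewrite add0r -/cst mulrA.
by rewrite sigma0 mul0r mulr0 addr0 mul0r e2pi0 mulr1 z0E.
Qed.

Lemma eisenstein_S k (z : C) : 0 < complex.Im z ->
  eisenstein_sum (2 * k.+2) (- z^-1) = z ^+ (2 * k.+2) * eisenstein_sum (2 * k.+2) z.
Proof.
move=> z0; have z1 := Im_Ninv_gt0 z0; have zn : z != 0 by apply/eqP => E; rewrite E /= ltxx in z0.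
apply: (hasum_uniq (eisenstein_hasum k z1)).
apply/(@hasum_bij _ _ _ (fun w : int * int => (w.2, - w.1))).
  by exists (fun w : int * int => (- w.2, w.1)) => -[m n]; rewrite /= opprK.
apply: hasum_ext (hasumZ (z ^+ (2 * k.+2)) (eisenstein_hasum k z0)) => -[m n] /=.
rewrite !latE /= !xpair_eqE oppr_eq0 (andbC (n == 0)); case: ifP => [_|mn]; first by rewrite mulr0.
have -> : n%:~R * - z^-1 + (- m)%:~R = - ((m%:~R * z + n%:~R) / z) by rewrite rmorphN; field.
by rewrite [(- _) ^+ _]exprM sqrrN -exprM expr_div_n invf_div.
Qed.

Lemma zsum_neq0 k : zsum (2 * k.+2) != 0.
Proof.
set K := (2 * k.+2)%N.
pose g (n : int) : R := if n == 0 then 0 else n%:~R ^- K.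
have g0 n : 0 <= g n by rewrite /g; case: eqP => // _; rewrite invr_ge0 /K exprM exprn_ge0// sqr_ge0.
have [s hs] : exists s, hasum (fun n : int => if n == 0 then 0 else n%:~R ^- K : C) s.
  have i1 : 0 < complex.Im ('i%C : C) by rewrite /= ltr01.
  have [s hs] := smb_hasum (smb_fst (0 : int) (smb_lat k i1)).
  exists s; apply: hasum_ext hs => n.
  by rewrite latE xpair_eqE eqxx /= mul0r add0r.
rewrite /zsum; case: xgetP => [y _ hy|/(_ s)]; last by case.
apply/eqP => y0; move: hy; rewrite y0 => hy.
have [A HA] := hy _ (ltr01 : (0 : R) < 1).
have := HA _ (fsubsetUl A [fset (1 : int)]%fset).
rewrite subr0 (eq_bigr (fun n => (g n)%:C)) => [|n _]; last first.
  by rewrite /g; case: eqP => // _; rewrite fmorphV rmorphXn /= -intC.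
rewrite -rmorph_sum /= nm_real ger0_norm ?sumr_ge0//.
rewrite (big_fsetD1 (1 : int)) ?inE ?eqxx ?orbT//= {1}/g /= expr1n invr1.
by rewrite ltNge lerDl sumr_ge0.
Qed.

(* f = e(al z) (1 + x q + y q^2 + ...) *)
Definition low (al : C) (f : C -> C) (x y : C) :=
  exists a, [/\ qser al a f, a 0%N = 1, a 1%N = x & a 2%N = y].

Lemma lowM al be f g x y x' y' : low al f x y -> low be g x' y' ->
  low (al + be) (fun z => f z * g z) (x + x') (y + x * x' + y').
Proof.
move=> [a [Ha a0 a1 a2]] [b [Hb b0 b1 b2]]; exists (cauchy a b); split; first exact: qserM.
- by rewrite /cauchy big_ord1 /= a0 b0 mulr1.
- by rewrite /cauchy !big_ord_recl big_ord0 /= /bump /= a0 b0 a1 b1; ring.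
by rewrite /cauchy !big_ord_recl big_ord0 /= /bump /= !addnE /= a0 b0 a1 b1 a2 b2; ring.
Qed.

Lemma low_ext al be f g x y x' y' : al = be -> (forall z, 0 < complex.Im z -> f z = g z) -> x = x' -> y = y' ->
  low al f x y -> low be g x' y'.
Proof.
move=> -> E -> -> [a [Ha a0 a1 a2]]; exists a; split=> //; exact: qser_ext Ha.
Qed.

Definition eis (k : nat) (z : C) := (zsum (2 * k.+2))^-1 * eisenstein_sum (2 * k.+2) z.

Definition eisx (k : nat) : C := 2 * tpi R ^+ (2 * k.+2) / (2 * k.+2).-1`!%:R / zsum (2 * k.+2).

Lemma eis_low k : low 0 (eis k) (eisx k) ((1 + 2 ^ (2 * k.+2).-1)%:R * eisx k).
Proof.
exists (fun n => (zsum (2 * k.+2))^-1 * eis_coef (2 * k.+2) n); split.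
- exact/qserZ/eisenstein_qser.
- by rewrite /eis_coef /= mulVf// zsum_neq0.
- by rewrite /eis_coef /= sigma1 mulr1 /eisx exprNn exprM sqrrN !expr1n mul1r mulrC.
by rewrite /eis_coef /= sigma2 /eisx exprNn exprM sqrrN !expr1n mul1r mulrC mulrAC mulrC.
Qed.

Lemma eis_S k z : 0 < complex.Im z -> eis k (- z^-1) = z ^+ (2 * k.+2) * eis k z.
Proof. by move=> z0; rewrite /eis eisenstein_S// mulrCA. Qed.

Lemma ieta_low : low (- 24^-1) (@ieta R) 1 2.
Proof.
exists (fun n => (partition_number n)%:R); split; first exact: ieta_qser.
- by rewrite partition_box.
- by rewrite partition_box (boxS 0 0 1) box_b0.
rewrite partition_box (boxS 1 1 2 : box 2 2 2 = (box 2 1 2 + box 1 2 0)%N).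
rewrite (boxS 1 0 2 : box 2 1 2 = (box 2 0 2 + box 1 1 1)%N).
by rewrite (boxS 0 0 1 : box 1 1 1 = (box 1 0 1 + box 0 1 0)%N) !box_b0 !box_0.
Qed.

Lemma ieta24_low : low (- 1) (fun z => ieta z ^+ 24) 24 324.
Proof.
have h2 := lowM ieta_low ieta_low; have h3 := lowM h2 ieta_low.
have h6 := lowM h3 h3; have h12 := lowM h6 h6; have h24 := lowM h12 h12.
apply: low_ext h24 => [|z _| |]; [by field|by ring|by ring|by ring].
Qed.

Lemma ieta24_S (z : C) : 0 < complex.Im z -> ieta (- z^-1) ^+ 24 = z ^- 12 * ieta z ^+ 24.
Proof.
move=> z0; have z1 := Im_Ninv_gt0 z0.
have wR : 0 < complex.Re (- 'i%C * z).
  have -> : complex.Re (- 'i%C * z) = complex.Im z by case: (z) => x y /=; ring.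
  by [].
have cw := cone_csqrt wR; set w := csqrt _ in cw.
have ww : w ^+ 2 = - 'i%C * z := sqr_csqrt _.
have i2 := sqr_i R.
have zn : z != 0 by apply/eqP => E; rewrite E /= ltxx in z0.
have := eta_S cw; rewrite ww.
have -> : 'i%C / (- 'i%C * z) = - z^-1 by rewrite invfM mulrA invrN mulrN mulfV ?neq0i// mulN1r.
have -> : 'i%C * (- 'i%C * z) = z by rewrite mulrA mulrN -expr2 i2 opprK mul1r.
move=> E; rewrite !ietaE// E invfM exprMn; congr (_ * _).
rewrite exprVn; congr (_^-1); rewrite (exprM w 2 12) ww exprMn (_ : (- 'i%C) ^+ 12 = 1) ?mul1r//.
by rewrite (exprM _ 2 6) sqrrN i2 -signr_odd expr0.
Qed.

Lemma eis4_S (z : C) : 0 < complex.Im z -> eis 0 (- z^-1) = z ^+ 4 * eis 0 z.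
Proof. exact: eis_S. Qed.

Lemma eis6_S (z : C) : 0 < complex.Im z -> eis 1 (- z^-1) = z ^+ 6 * eis 1 z.
Proof. exact: eis_S. Qed.

Lemma Im_neq0 (z : C) : 0 < complex.Im z -> z != 0.
Proof. by move=> z0; apply/eqP => E; rewrite E /= ltxx in z0. Qed.

Lemma wt14 (z a b d : C) : z != 0 -> z ^+ 4 * a * (z ^+ 4 * a) * (z ^+ 6 * b) * (z ^- 12 * d) = z ^+ 2 * (a * a * b * d).
Proof. by move=> z0; field. Qed.

Lemma wt26 (z a b d : C) : z != 0 ->
  z ^+ 4 * a * (z ^+ 4 * a) * (z ^+ 4 * a) * (z ^+ 4 * a) * (z ^+ 4 * a) * (z ^+ 6 * b) * (z ^- 12 * d) * (z ^- 12 * d) =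
  z ^+ 2 * (a * a * a * a * a * b * d * d).
Proof. by move=> z0; field. Qed.

Lemma wt12 (z a b d : C) : z != 0 ->
  z ^+ 4 * a * (z ^+ 4 * a) * (z ^+ 4 * a) * (z ^- 12 * d) + -1 * (z ^+ 6 * b * (z ^+ 6 * b) * (z ^- 12 * d)) + - 1728 * 1 =
  a * a * a * d + -1 * (b * b * d) + - 1728 * 1.
Proof. by move=> z0; field. Qed.

Let x4 := eisx 0.
Let x6 := eisx 1.

(** No zeta value is known at this point. The forms E4^2 E6 / Delta and E4^5 E6 / Delta^2 have
    weight 2, so their constant terms vanish. The first gives x6 = -24 - 2 x4; inserted in the
    second, it cancels the quadratic terms and leaves 3 x4 = 720. *)
Lemma eisx_rel : x4 = 240 /\ x6 = - 504.
Proof.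
have e4 := eis_low 0; have e6 := eis_low 1; have d := ieta24_low.
have w1 := lowM (lowM (lowM e4 e4) e6) d.
have w2 := lowM (lowM (lowM (lowM (lowM (lowM (lowM e4 e4) e4) e4) e4) e6) d) d.
have [a [Ha _ a1 _]] := w1; have [b [Hb _ _ b2]] := w2.
have r1 : a 1%N = 0.
  apply: (@const_term0 R _ a 1%N (qser_al _ Ha)) => [|z z0]; first by ring.
  by rewrite (eis4_S z0) (eis6_S z0) (ieta24_S z0) wt14 ?Im_neq0.
have r2 : b 2%N = 0.
  apply: (@const_term0 R _ b 2%N (qser_al _ Hb)) => [|z z0]; first by ring.
  by rewrite (eis4_S z0) (eis6_S z0) (ieta24_S z0) wt26 ?Im_neq0.
rewrite a1 in r1; rewrite b2 in r2.
rewrite -/x4 -/x6 in r1 r2.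
have y6 : x6 = - 24 - 2 * x4 by rewrite -[LHS]subr0 -[X in _ - X]r1; ring.
have t4 : x4 = 240.
  move: r2; rewrite y6 (_ : (1 + 2 ^ (2 * 2).-1)%N = 9%N)// (_ : (1 + 2 ^ (2 * 3).-1)%N = 33%N)// => r2.
  have n3 : 3 != 0 :> C by rewrite pnatr_eq0.
  apply: (mulfI n3); apply/eqP; rewrite -subr_eq0 -r2; apply/eqP; ring.
by rewrite y6 t4; split=> //; ring.
Qed.

(** E4^3 / Delta with Delta = eta^24, for which expansion and invariance are immediate; [modular_jE]
    identifies it with the quotient in terms of g2 and g3. *)
Definition jinv (z : C) := eis 0 z ^+ 3 * ieta z ^+ 24.

Lemma jinv_S z : 0 < complex.Im z -> jinv (- z^-1) = jinv z.
Proof.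
move=> z0; have zn := Im_neq0 z0.
by rewrite /jinv (eis4_S z0) (ieta24_S z0) exprMn -exprM mulrACA mulfV ?mul1r ?expf_neq0.
Qed.

Lemma jinv_low : exists y, low (- 1) jinv 744 y.
Proof.
have e4 := eis_low 0; have [x _] := eisx_rel.
have h := lowM (lowM (lowM e4 e4) e4) ieta24_low; eexists; apply: low_ext h; first by ring.
- by move=> z _; rewrite /jinv; ring.
- by rewrite -/x4 x; ring.
reflexivity.
Qed.

Lemma jinv_qser : exists a, qser (- 1) a jinv /\ a 0%N = 1.
Proof. by have [y [a [Ha a0 _ _]]] := jinv_low; exists a. Qed.

Lemma jinv_T z (n : int) : 0 < complex.Im z -> jinv (z + n%:~R) = jinv z.
Proof.
move=> z0; have [a [Ha _]] := jinv_qser.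
by apply: (qser_Tn _ _ Ha) => //; rewrite e2piN e2pi1 invr1.
Qed.

(** The invariant function (E4^3 - E6^2)/Delta - 1728 has zero coefficients at q^-1 and q^0, so
    [weight0_vanish] applies, with E4^2 E6 / Delta as the weight 2 form. *)
Lemma eis46 z : 0 < complex.Im z -> (eis 0 z ^+ 3 - eis 1 z ^+ 2) * ieta z ^+ 24 = 1728.
Proof.
have e4 := eis_low 0; have e6 := eis_low 1; have d := ieta24_low.
have [X4 X6] := eisx_rel.
have [a [Ha a0 a1 _]] := lowM (lowM (lowM e4 e4) e4) d.
have [b [Hb b0 b1 _]] := lowM (lowM e6 e6) d.
have [w [Hw w0 _ _]] := lowM (lowM (lowM e4 e4) e6) d.
have [j [Hj j0]] := jinv_qser.
have al2 : 0 + 0 + - 1 = 0 + 0 + 0 + - 1 :> C by ring.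
have al1 : - 1%:R = 0 + 0 + 0 + - 1 :> C by ring.
have h := qserD (qserD Ha (qserZ (-1) (qser_al al2 Hb))) (qserZ (-1728) (qser_al al1 (@qser_const R 1))).
have {}h := qser_strip (N := 2) _ h.
have E : forall i, (i < 2)%N -> a i + -1 * b i + -1728 * (if i == 1%N then 1 else 0) = 0.
  case=> [|[|]]//= _; first by rewrite a0 b0; ring.
  by rewrite a1 b1 -/x4 -/x6 X4 X6; ring.
have {}h := h E; move=> z0.
have al3 : 0 + 0 + 0 + - 1 + 2%:R = 1 :> C by ring.
have al4 : 0 + 0 + 0 + - 1 = - 1 :> C by ring.
have [||||_ V] := @weight0_vanish R _ jinv w j (qser_al al4 Hw) Hj _ _ _ jinv_S _ _ (qser_al al3 h) _.
- by rewrite w0 oner_eq0.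
- by rewrite j0 oner_eq0.
- by move=> v v0; rewrite (eis4_S v0) (eis6_S v0) (ieta24_S v0) wt14 ?Im_neq0.
- by move=> v v0; rewrite (eis4_S v0) (eis6_S v0) (ieta24_S v0) wt12 ?Im_neq0.
by have := V z z0 => V0; apply/eqP; rewrite -subr_eq0 -V0; apply/eqP; ring.
Qed.

Lemma modular_jE z : 0 < complex.Im z -> modular_j R z = jinv z.
Proof.
move=> z0; have [X4 X6] := eisx_rel; have E := eis46 z0.
pose A := zsum 4; pose B := zsum 6; pose p := tpi R ^+ 2.
have A0 : A != 0 := zsum_neq0 0; have B0 : B != 0 := zsum_neq0 1.
have p0 : p != 0 by rewrite expf_neq0 ?tpi_neq0.
(* Conversely the zeta values 2 zeta(4) and 2 zeta(6) are read off from the coefficients 240 and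
   -504. *)
have AE : A = p ^+ 2 / 720.
  have h : 2 * p ^+ 2 / 6 / A = 240 by rewrite -X4 /x4 /eisx /p -exprM.
  have -> : A = 2 * p ^+ 2 / 6 / (2 * p ^+ 2 / 6 / A) by field; rewrite A0 p0.
  by rewrite h; field.
have BE : B = - (p ^+ 3 / (2520 * 12)).
  have h : 2 * p ^+ 3 / 120 / B = - 504 by rewrite -X6 /x6 /eisx /p -exprM.
  have -> : B = 2 * p ^+ 3 / 120 / (2 * p ^+ 3 / 120 / B) by field; rewrite B0 p0.
  by rewrite h; field.
have g2 : eisenstein_sum 4 z = A * eis 0 z by rewrite /eis mulVKf.
have g3 : eisenstein_sum 6 z = B * eis 1 z by rewrite /eis mulVKf.
have i0 : ieta z ^+ 24 != 0 by rewrite expf_neq0// ietaE// invr_eq0 eta_neq0.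
rewrite /modular_j g2 g3 /jinv.
have F : eis 0 z ^+ 3 - eis 1 z ^+ 2 = 1728 / ieta z ^+ 24 by rewrite -E mulfK.
have -> : (60 * (A * eis 0 z)) ^+ 3 - 27 * (140 * (B * eis 1 z)) ^+ 2 = (60 * A) ^+ 3 * (eis 0 z ^+ 3 - eis 1 z ^+ 2).
  by rewrite AE BE; field.
rewrite F; field.
by rewrite A0 ietaE// invr_eq0 eta_neq0.
Qed.

Lemma qser_pad N (al : C) b f : qser (al + N%:R) b f ->
  qser al (fun n => if (n < N)%N then 0 else b (n - N)%N) f.
Proof.
elim: N al => [|N IH] al H.
  by apply: (qser_coef _ (qser_al _ H)) => [n|]; rewrite ?subn0 ?addr0.
have e : al + N.+1%:R = al + 1 + N%:R by rewrite -addrA nat1r.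
have {}IH := IH _ (qser_al e H).
apply: (proj2 (qser_shift _ _ _)); first by [].
by apply: (qser_coef _ IH) => n; rewrite ltnS subSS.
Qed.

(** Elimination: j^(N-K-1)/eta begins exactly at the next coefficient to be removed, so subtracting
    a multiple of it leaves the earlier ones intact. *)
Lemma faber (N K : nat) : (K <= N)%N -> exists (P : {poly C}) a,
  [/\ qser (- N%:R - 24^-1) a (fun z => P.[jinv z] * ieta z), a 0%N = 1 &
     forall i, (0 < i <= K)%N -> a i = 0].
Proof.
have [j [Hj j0]] := jinv_qser.
have base M : exists b, qser (- M%:R - 24^-1) b (fun z => jinv z ^+ M * ieta z) /\ b 0%N = 1.
  have [j' [Hj' j'0]] := qserX M Hj; exists (cauchy j' (fun n => (partition_number n)%:R)); split.
    by apply: (qser_al _ (qserM Hj' (@ieta_qser R))); rewrite mulrN1.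
  by rewrite /cauchy big_ord1 /= j'0 j0 expr1n partition_box mulr1.
elim: K => [|K IH] KN.
  have [b [Hb b0]] := base N; exists 'X^N, b; split=> //; last by case.
  by apply: qser_ext Hb => z _; rewrite hornerXn.
have [P [a [Ha a0 aK]]] := IH (ltnW KN); have [b [Hb b0]] := base (N - K.+1)%N.
have e : - (N - K.+1)%:R - 24^-1 = - N%:R - 24^-1 + K.+1%:R :> C by rewrite natrB//; ring.
have Hp := qser_pad (qser_al e Hb).
exists (P - a K.+1 *: 'X^(N - K.+1)); eexists; split.
- apply: (qser_ext _ (qserD Ha (qserZ (- a K.+1) Hp))) => z _.
  by rewrite hornerD hornerN hornerZ hornerXn; ring.
- by rewrite /= a0 mulr0 addr0.
move=> i /andP[i0]; rewrite leq_eqVlt => /orP[/eqP ->|iK] /=.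
  by rewrite ltnn subnn b0 mulr1 subrr.
by rewrite iK mulr0 addr0 aK// i0.
Qed.

End Eisenstein.

(** * Exact formulas for the coefficients of P(j)/eta *)

Section Horocycle.
Variable R : realType.
Local Notation C := R[i].

Definition hexp (al be : R) (s : C) : C := (al ^+ 2)%:C / s ^+ 2 + (be ^+ 2)%:C * s ^+ 2.

(* Primitive of s^-4 exp (al^2/s^2 + be^2 s^2), from the derivatives of erfi (be s +- al/s) and of s^-1 exp. *)
Definition hprim (al be : R) (s : C) : C :=
  (2 * al%:C ^+ 2)^-1 * (be%:C * (cexp (- (2 * al%:C * be%:C)) * erfi (be%:C * s + al%:C / s) +
      cexp (2 * al%:C * be%:C) * erfi (be%:C * s - al%:C / s))
    - (cexp (2 * al%:C * be%:C) * erfi (be%:C * s - al%:C / s) -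
       cexp (- (2 * al%:C * be%:C)) * erfi (be%:C * s + al%:C / s)) / (2 * al%:C)
    - s^-1 * cexp (hexp al be s)).

Lemma cder_hprim (al be : R) (s : C) : 0 < al -> s != 0 ->
  cder (hprim al be) s (s ^- 4 * cexp (hexp al be s)).
Proof.
move=> al0 s0; have an : al%:C != 0 :> C by rewrite -nm_gt0 nm_real normr_gt0 gt_eqF.
have d1 : cder (fun s : C => be%:C * s + al%:C / s) s (be%:C - al%:C / s ^+ 2).
  have := cderD (cderZ be%:C (cder_id s)) (cderZ al%:C (cder_inv s0)).
  by apply: cder_eq; ring.
have d2 : cder (fun s : C => be%:C * s - al%:C / s) s (be%:C + al%:C / s ^+ 2).
  have := cderB (cderZ be%:C (cder_id s)) (cderZ al%:C (cder_inv s0)).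
  by apply: cder_eq; ring.
have dX : cder (hexp al be) s (2 * (be ^+ 2)%:C * s - 2 * (al ^+ 2)%:C / s ^+ 3).
  have s20 : s ^+ 2 != 0 by rewrite expf_neq0.
  have := cderD (cderZ (al ^+ 2)%:C (@cderV R (fun w => w ^+ 2) s _ s20 (cderX 1 s))) (cderZ (be ^+ 2)%:C (cderX 1 s)).
  by apply: cder_eq; rewrite expr1; field.
have D1 := cderZ (cexp (- (2 * al%:C * be%:C))) (cder_comp d1 (cder_erfi _)).
have D2 := cderZ (cexp (2 * al%:C * be%:C)) (cder_comp d2 (cder_erfi _)).
have D3 := cderM (cder_inv s0) (cder_cexp_comp dX).
have D4 := cderZ (2 * al%:C)^-1 (cderB D2 D1).
have := cderZ (2 * al%:C ^+ 2)^-1 (cderB (cderB (cderZ be%:C (cderD D1 D2)) D4) D3).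
have e1 : cexp (- (2 * al%:C * be%:C)) * cexp ((be%:C * s + al%:C / s) ^+ 2) = cexp (hexp al be s).
  by rewrite -cexpD; congr cexp; rewrite /hexp !rmorphXn /=; field.
have e2 : cexp (2 * al%:C * be%:C) * cexp ((be%:C * s - al%:C / s) ^+ 2) = cexp (hexp al be s).
  by rewrite -cexpD; congr cexp; rewrite /hexp !rmorphXn /=; field.
move=> h; apply: cder_ext (cder_eq _ h) => [w|].
  by rewrite /hprim (mulrC _ (2 * al%:C)^-1).
rewrite !(mulrA (cexp _) (cexp _)) e1 e2 !rmorphXn /=; move: (cexp _) => x; field.
by rewrite s0 an.
Qed.

(** The limit of [hprim] when s^2 runs to infinity along a vertical line, up to the sign of the
    imaginary part. *)
Definition hlim (al be : R) : C := (2 * al%:C ^+ 2)^-1 * (be%:C * (cexp (- (2 * al%:C * be%:C)) + cexp (2 * al%:C * be%:C))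
    - (cexp (2 * al%:C * be%:C) - cexp (- (2 * al%:C * be%:C))) / (2 * al%:C)) * erfi_lim R.

Lemma erfi_lim_sg (K e : R) : 0 < e -> exists Y : R, 0 < Y /\ forall u : C,
  complex.Re (u ^+ 2) <= K -> Y <= `|complex.Im u| ->
  nm (erfi u - (if 0 < complex.Im u then 1 else -1) * erfi_lim R) < e.
Proof.
move=> e0; have [Y1 [Y10 H1]] := erfi_cvg K e0; have [Y2 [Y20 H2]] := erfi_cvgN K e0.
exists (Num.max Y1 Y2); split=> [|u uK]; first by rewrite lt_max Y10.
rewrite ge_max => /andP[h1 h2]; case: (ltP 0 (complex.Im u)) => u0.
  by rewrite mul1r; apply: H1 => //; rewrite gtr0_norm in h1.
by rewrite mulN1r opprK; apply: H2 => //; rewrite ler0_norm// in h2; lra.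
Qed.

Lemma csqrt_ImRe (w : C) : 0 < complex.Re w ->
  let s := csqrt w in [/\ complex.Im s ^+ 2 = (nm w - complex.Re w) / 2,
    (0 < complex.Im s) = (0 < complex.Im w) & nm s ^+ 2 = nm w].
Proof.
move=> w0 s; have sw : s ^+ 2 = w := sqr_csqrt w; have s0 := Re_csqrt w0; rewrite -/s in s0.
have e1 : complex.Re w = complex.Re s ^+ 2 - complex.Im s ^+ 2 by rewrite -sw expr2 ReM -!expr2.
have e2 : complex.Im w = 2 * complex.Re s * complex.Im s by rewrite -sw expr2 ImM; ring.
have e3 : nm s ^+ 2 = nm w by rewrite -nmX sw.
split=> //; last by rewrite e2 pmulr_rgt0// mulr_gt0.
by rewrite -e3 nm_sqr e1; field.
Qed.

Lemma hprim_alg (k b t x1 x2 l E1 E2 g r : C) :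
  k * (b * (E1 * x1 + E2 * x2) - (E2 * x2 - E1 * x1) / t - r) - g * (k * (b * (E1 + E2) - (E2 - E1) / t) * l) =
  k * (b * (E1 * (x1 - g * l) + E2 * (x2 - g * l)) - (E2 * (x2 - g * l) - E1 * (x1 - g * l)) / t - r).
Proof. by ring. Qed.

Lemma hprim_bd (b t x1 x2 E1 E2 r : C) (dl : R) : nm x1 <= dl -> nm x2 <= dl -> nm r <= dl ->
  nm (b * (E1 * x1 + E2 * x2) - (E2 * x2 - E1 * x1) * t - r) <= ((nm E1 + nm E2) * (nm b + nm t) + 1) * dl.
Proof.
move=> h1 h2 h3.
have B1 : nm (E1 * x1) <= nm E1 * dl by rewrite nmM ler_wpM2l// nm_ge0.
have B2 : nm (E2 * x2) <= nm E2 * dl by rewrite nmM ler_wpM2l// nm_ge0.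
apply: le_trans (nmB _ _) _; rewrite [leRHS]mulrDl mul1r; apply: lerD => //.
apply: le_trans (nmB _ _) _; rewrite [nm (b * _)]nmM [nm (_ * t)]nmM.
have C1 : nm (E1 * x1 + E2 * x2) <= (nm E1 + nm E2) * dl.
  by apply: le_trans (nmD _ _) _; rewrite mulrDl lerD.
have C2 : nm (E2 * x2 - E1 * x1) <= (nm E1 + nm E2) * dl.
  by apply: le_trans (nmB _ _) _; rewrite mulrDl addrC lerD.
have D1 := ler_wpM2l (nm_ge0 b) C1; have D2 := ler_wpM2r (nm_ge0 t) C2.
by clear -D1 D2; lra.
Qed.

(** On the line Re w = y the squares of [be * s + al / s] and [be * s - al / s] have bounded real
    part, while the imaginary parts of both arguments grow with the sign of Im w; this is the region
    where [erfi] converges. The remaining term is divided by s and tends to 0. *)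
Lemma hprim_lim (al be y e : R) : 0 < al -> 0 < be -> 0 < y -> 0 < e -> exists X : R, forall w : C,
  complex.Re w = y -> X <= `|complex.Im w| ->
  nm (hprim al be (csqrt w) - (if 0 < complex.Im w then 1 else -1) * hlim al be) < e.
Proof.
move=> al0 be0 y0 e0.
set E1 := cexp (- (2 * al%:C * be%:C)) : C; set E2 := cexp (2 * al%:C * be%:C) : C.
pose k0 : R := nm ((2 * al%:C ^+ 2)^-1 : C).
pose K : R := k0 * ((nm E1 + nm E2) * (be + (2 * al)^-1) + 1).
have n1 := nm_ge0 E1; have n2 := nm_ge0 E2; have k00 : 0 <= k0 := nm_ge0 _.
have ai : 0 < (2 * al)^-1 by rewrite invr_gt0 mulr_gt0.
have K0 : 0 <= K by rewrite mulr_ge0// addr_ge0// mulr_ge0// addr_ge0// ltW.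
pose dl := e / (K + 1); have dl0 : 0 < dl by rewrite divr_gt0//; lra.
have Kdl : K * dl < e.
  have K1 : 0 < K + 1 by clear -K0; lra.
  by rewrite /dl mulrCA gtr_pMr// ltr_pdivrMr// mul1r; clear; lra.
have [Y [Y0 HY]] := erfi_lim_sg (be ^+ 2 * y + al ^+ 2 / y + 2 * al * be) dl0.
pose Q := expR (be ^+ 2 * y + al ^+ 2 / y); have Q0 : 0 < Q := expR_gt0 _.
pose T := (Y + al) / be + Q / dl + 1.
have T1 : 0 < (Y + al) / be by rewrite divr_gt0//; lra.
have T2 : 0 < Q / dl by rewrite divr_gt0.
exists (y + 2 * T ^+ 2) => w wy wX; set s := csqrt w.
have w0 : 0 < complex.Re w by rewrite wy.
have [i1 i2 i3] := csqrt_ImRe w0; rewrite -/s in i1 i2 i3.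
have sw : s ^+ 2 = w := sqr_csqrt w.
have Ts : T <= `|complex.Im s|.
  rewrite -ler_sqr ?nnegrE//; last by rewrite /T; lra.
  by rewrite real_normK ?num_real// i1; have := Im_nm w; lra.
have ns : T <= nm s := le_trans Ts (Im_nm s).
have s0 : s != 0 by rewrite -nm_gt0; rewrite /T in ns; lra.
have nsi : nm s^-1 <= 1 by rewrite nmV invf_le1; rewrite /T in ns; lra.
have wn : w != 0 by rewrite -sw expf_neq0.
have Rw : complex.Re w^-1 <= y^-1.
  rewrite Re_inv wy ler_pdivrMr ?exprn_gt0 ?nm_gt0// mulrC ler_pdivlMr// -expr2 nm_sqr wy.
  by rewrite lerDl sqr_ge0.
set sg := (if _ then 1 else -1).
have Hu (a : R) : a = al \/ a = - al -> nm (erfi (be%:C * s + a%:C / s) - sg * erfi_lim R) < dl.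
  move=> aE; have a2 : a ^+ 2 = al ^+ 2 by case: aE => ->; rewrite ?sqrrN.
  have ab : a * be <= al * be by case: aE => ->//; rewrite ler_wpM2r ?(ltW be0)//; lra.
  set u := be%:C * s + a%:C / s.
  have ImuE : complex.Im u = be * complex.Im s + a * complex.Im s^-1.
    by rewrite /u ImD !ImM /= !mul0r !addr0.
  have aI : `|a * complex.Im s^-1| <= al.
    rewrite normrM; apply: (@le_trans _ _ (`|a| * 1)).
      by rewrite ler_wpM2l// (le_trans (Im_nm _)).
    by rewrite mulr1; case: aE => ->; rewrite ?normrN gtr0_norm.
  have bT : Y + al <= be * T.
    rewrite /T -addrA mulrDr mulrC divfK ?gt_eqF// lerDl mulr_ge0 ?(ltW be0)//; clear -T2; lra.
  have [aI1 aI2] : - al <= a * complex.Im s^-1 /\ a * complex.Im s^-1 <= al by move: aI; rewrite ler_norml => /andP.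
  have sgE : sg = if 0 < complex.Im u then 1 else -1 :> C.
    rewrite /sg -i2 ImuE; case: (ltP 0 (complex.Im s)) => h.
      rewrite gtr0_norm// in Ts; have := ler_wpM2l (ltW be0) Ts => h1.
      by rewrite ifT//; clear -h1 bT aI1 Y0; lra.
    rewrite ler0_norm// in Ts; have := ler_wpM2l (ltW be0) Ts => h1.
    by rewrite ifN// -leNgt; clear -h1 bT aI2 Y0; lra.
  rewrite sgE; apply: HY.
    rewrite (_ : u ^+ 2 = (be ^+ 2)%:C * w + (a ^+ 2)%:C * w^-1 + (2 * (a * be))%:C); last first.
      by rewrite /u -sw !(rmorphM, rmorphXn, rmorph_nat) /=; field.
    rewrite !ReD !ReM /= !mul0r !subr0 wy a2.
    have h1 := ler_wpM2l (sqr_ge0 al) Rw; clear -h1 ab; lra.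
  rewrite ImuE; case: (ltP 0 (complex.Im s)) => h.
    rewrite gtr0_norm// in Ts; have := ler_wpM2l (ltW be0) Ts => h1.
    by apply: le_trans (ler_norm _); clear -h1 bT aI1; lra.
  rewrite ler0_norm// in Ts; have := ler_wpM2l (ltW be0) Ts => h1.
  by apply: le_trans (_ : - (be * complex.Im s + a * complex.Im s^-1) <= _); [clear -h1 bT aI2; lra|rewrite -normrN ler_norm].
have H1 := Hu al (or_introl erefl); have H2 := Hu (- al) (or_intror erefl).
rewrite rmorphN mulNr in H2.
set r1 := _ - _ in H1; set r2 := _ - _ in H2.
have H3 : nm (s^-1 * cexp (hexp al be s)) <= dl.
  rewrite nmM nm_cexp nmV mulrC ler_pdivrMr; last by rewrite nm_gt0.
  apply: (@le_trans _ _ Q).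
    rewrite /Q ler_expR /hexp sw ReD !ReM /= !mul0r !subr0 wy.
    by rewrite addrC lerD2l ler_wpM2l ?sqr_ge0.
  apply: (@le_trans _ _ (dl * T)); last by rewrite ler_wpM2l// ltW.
  rewrite /T mulrDr mulr1 mulrDr [dl * (Q / dl)]mulrC divfK ?gt_eqF//.
  have T3 : 0 < dl * ((Y + al) / be) by rewrite mulr_gt0.
  by clear - dl0 T3; lra.
set r3 := s^-1 * _ in H3.
have -> : hprim al be s - sg * hlim al be = (2 * al%:C ^+ 2)^-1 *
   (be%:C * (E1 * r1 + E2 * r2) - (E2 * r2 - E1 * r1) / (2 * al%:C) - r3).
  rewrite /hprim /hlim -/E1 -/E2 -/r3 /r1 /r2.
  exact: hprim_alg.
rewrite nmM -/k0.
apply: le_lt_trans Kdl.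
rewrite /K -mulrA ler_wpM2l//.
have nb : nm (be%:C : C) = be by rewrite nm_real gtr0_norm.
have na : nm ((2 * al%:C)^-1 : C) = (2 * al)^-1.
  by rewrite nmV (nmM 2) (nm_nat R 2) nm_real gtr0_norm.
have := @hprim_bd be%:C (2 * al%:C)^-1 r1 r2 E1 E2 r3 dl (ltW H1) (ltW H2) H3.
by rewrite nb na.
Qed.

(** The two points are joined by going up by N, across and down. There the derivative is at most
    4A/N^2, and the sides have lengths N, at most 3N and N, which adds up to the constant 20.
    Independence of the path is the existence of the primitive [F]. *)
Lemma contour0 (F F' : C -> C) (q y0 A : R) (z0 : C) : 0 < y0 -> complex.Im z0 = y0 -> 0 <= A ->
  (forall z, y0 <= complex.Im z -> cder F z (F' z)) ->
  (forall z, y0 <= complex.Im z -> 1 <= nm (z + q%:C) -> nm (F' z) <= A / nm (z + q%:C) ^+ 2) ->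
  cvto (fun n => F (z0 + n.+1%:R) - F (z0 - n%:R)) 0.
Proof.
move=> y00 z0y A0 DF HF e e0.
have [n1 Hn1] := natr_gt (Num.max (20 * (A + 1) / e) (2 * (`|complex.Re z0| + `|q|) + 2)).
exists n1 => n nn1; rewrite subr0.
have nR : n1%:R <= n%:R :> R by rewrite ler_nat.
have h1 : 20 * (A + 1) / e < n%:R by apply: lt_le_trans nR; apply: le_lt_trans Hn1; rewrite le_max lexx.
have h2 : 2 * (`|complex.Re z0| + `|q|) + 2 < n%:R.
  by apply: lt_le_trans nR; apply: le_lt_trans Hn1; rewrite le_max lexx orbT.
have x0 := normr_ge0 (complex.Re z0); have q0 := normr_ge0 q.
set N : R := n%:R in h1 h2 *; have N2 : 2 < N by lra.
pose p1 := z0 + n.+1%:R; pose p4 := z0 - n%:R; pose v : C := 0 +i* N.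
have [xl xu] : - `|complex.Re z0| <= complex.Re z0 /\ complex.Re z0 <= `|complex.Re z0|.
  by have := lexx `|complex.Re z0|; rewrite ler_norml => /andP.
have [ql qu] : - `|q| <= q /\ q <= `|q| by have := lexx `|q|; rewrite ler_norml => /andP.
have fin z : y0 <= complex.Im z -> N / 2 <= nm (z + q%:C) -> exists l, cder F z l /\ nm l <= 4 * A / N ^+ 2.
  move=> zy zq; exists (F' z); split; first exact: DF.
  apply: le_trans (HF z zy _) _; first lra.
  have np : 0 < nm (z + q%:C) by lra.
  rewrite ler_pdivrMr ?exprn_gt0// mulrAC ler_pdivlMr ?exprn_gt0//; last lra.
  have : (N / 2) ^+ 2 <= nm (z + q%:C) ^+ 2 by rewrite lerXn2r ?nnegrE; lra.
  by move/(ler_wpM2l A0); lra.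
have b1 : nm (F (p1 + v) - F p1) <= 4 * A / N.
  have := @cmvt R F p1 (p1 + v) (4 * A / N ^+ 2) _.
  rewrite addrAC subrr add0r (_ : nm v = N); last by rewrite /nm /= expr0n add0r sqrtr_sqr ger0_norm//; lra.
  move=> H; apply: le_trans (H _) _; last by apply/eqW; field; lra.
  move=> t /andP[t0 t1]; apply: fin.
    rewrite !(ImD, ImM) natC /= !(addr0, mul0r, add0r) z0y lerDl mulr_ge0//; lra.
  apply: le_trans (Re_nm _); rewrite !(ReD, ReM) natC /= !(mulr0, mul0r, subr0, addr0).
  have n1E : n.+1%:R = N + 1 :> R by rewrite -natr1.
  by rewrite n1E ger0_norm; lra.
have b2 : nm (F (p4 + v) - F p4) <= 4 * A / N.
  have := @cmvt R F p4 (p4 + v) (4 * A / N ^+ 2) _.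
  rewrite addrAC subrr add0r (_ : nm v = N); last by rewrite /nm /= expr0n add0r sqrtr_sqr ger0_norm//; lra.
  move=> H; apply: le_trans (H _) _; last by apply/eqW; field; lra.
  move=> t /andP[t0 t1]; apply: fin.
    rewrite !(ImD, ImN, ImM) natC /= !(addr0, mul0r, add0r, subr0, oppr0) z0y lerDl mulr_ge0//; lra.
  apply: le_trans (Re_nm _); rewrite !(ReD, ReN, ReM) natC /= !(mulr0, mul0r, subr0, addr0).
  rewrite ler0_norm -/N; lra.
have b3 : nm (F (p1 + v) - F (p4 + v)) <= 12 * A / N.
  have := @cmvt R F (p4 + v) (p1 + v) (4 * A / N ^+ 2) _.
  have -> : p1 + v - (p4 + v) = (2 * N + 1)%:C.
    by rewrite /p1 /p4 -natr1 rmorphD rmorphM rmorph_nat /N rmorph_nat /=; ring.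
  rewrite nm_real ger0_norm; last lra.
  move=> H; apply: le_trans (H _) _.
    move=> t /andP[t0 t1]; apply: fin.
      rewrite !(ImD, ImN, ImM) natC /= !(mulr0, addr0, mul0r, add0r, subr0, oppr0) z0y lerDl; lra.
    apply: le_trans (Im_nm _); rewrite !(ImD, ImN, ImM) natC /= !(mulr0, addr0, mul0r, add0r, subr0, oppr0).
    rewrite ger0_norm z0y; lra.
  have -> : 12 * A / N = 4 * A / N ^+ 2 * (3 * N) by field; lra.
  by rewrite ler_wpM2l ?divr_ge0 ?sqr_ge0 ?mulr_ge0//; lra.
have -> : F p1 - F p4 = - (F (p1 + v) - F p1) + (F (p4 + v) - F p4) + (F (p1 + v) - F (p4 + v)) by ring.
apply: le_lt_trans (nmD _ _) _; apply: le_lt_trans (lerD (nmD _ _) (lexx _)) _; rewrite nmN.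
apply: (@le_lt_trans _ _ (20 * A / N)).
  have -> : 20 * A / N = 4 * A / N + 4 * A / N + 12 * A / N by field; lra.
  by rewrite !lerD.
rewrite ltr_pdivrMr; last lra.
move: h1; rewrite ltr_pdivrMr// mulrC; lra.
Qed.

End Horocycle.

(** * Moebius transformations and their action on eta and j *)

Section Mobius.
Variable R : realType.
Local Notation C := R[i].

Definition mob (a b c d : int) (z : C) : C := (a%:~R * z + b%:~R) / (c%:~R * z + d%:~R).

Lemma Re_int (k : int) : complex.Re (k%:~R : C) = k%:~R.
Proof. by rewrite intC. Qed.

Lemma Im_int (k : int) : complex.Im (k%:~R : C) = 0.
Proof. by rewrite intC. Qed.

Lemma lin_neq0 (z : C) (a b c d : int) : 0 < complex.Im z -> a * d - b * c = 1 -> c%:~R * z + d%:~R != 0.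
Proof.
move=> z0 e; apply: lat_neq0 => //; apply/eqP => -[c0 d0].
by move: e; rewrite c0 d0 !mulr0 subrr.
Qed.

Lemma Im_mob (z : C) (a b c d : int) : 0 < complex.Im z -> a * d - b * c = 1 ->
  complex.Im (mob a b c d z) = complex.Im z / nm (c%:~R * z + d%:~R) ^+ 2.
Proof.
move=> z0 e; have v0 := lin_neq0 z0 e; have := Im_Ninv (c%:~R * z + d%:~R).
rewrite /mob ImM Re_inv ImN => /(congr1 -%R); rewrite opprK => ->.
set v := nm _ ^+ 2; rewrite !(ImD, ReD, ImM, ReM) !(Re_int, Im_int) !mul0r !subr0 !addr0.
move/(congr1 (fun k : int => k%:~R : R)): e; rewrite intrB !intrM => e.
have -> : complex.Im z / v = complex.Im z * (a%:~R * d%:~R - b%:~R * c%:~R) / v by rewrite e mulr1.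
by ring.
Qed.

Lemma Im_mob_gt0 (z : C) (a b c d : int) : 0 < complex.Im z -> a * d - b * c = 1 ->
  0 < complex.Im (mob a b c d z).
Proof.
by move=> z0 e; rewrite (Im_mob z0 e) divr_gt0// exprn_gt0// nm_gt0 (lin_neq0 z0 e).
Qed.

Lemma cder_mob (z : C) (a b c d : int) : 0 < complex.Im z -> a * d - b * c = 1 ->
  cder (mob a b c d) z ((c%:~R * z + d%:~R) ^- 2).
Proof.
move=> z0 e; have v0 := lin_neq0 z0 e.
have D (k l : int) : cder (fun w : C => k%:~R * w + l%:~R) z k%:~R.
  by apply: cder_eq (cderD (cderZ k%:~R (cder_id z)) (cder_cst l%:~R z)); rewrite mulr1 addr0.
have := cderM (D a b) (@cderV R _ z c%:~R v0 (D c d)).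
apply: cder_eq.
move/(congr1 (fun k : int => k%:~R : C)): e; rewrite intrB !intrM => e.
transitivity ((a%:~R * d%:~R - b%:~R * c%:~R) / (c%:~R * z + d%:~R) ^+ 2); first by field.
by rewrite e mul1r.
Qed.

Lemma mobN (a b c d : int) z : mob (- a) (- b) (- c) (- d) z = mob a b c d z.
Proof. by rewrite /mob !intrN !mulNr -!opprD invrN mulrNN. Qed.

Lemma mob_T (a b c d k : int) (z : C) : c%:~R * z + d%:~R != 0 ->
  mob (a + k * c) (b + k * d) c d z = mob a b c d z + k%:~R.
Proof. by move=> v0; rewrite /mob !intrD !intrM; field. Qed.

Lemma mob_S (a b c d : int) z : z != 0 -> mob b (- a) d (- c) z = mob a b c d (- z^-1).
Proof.
move=> z0; rewrite /mob !intrN.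
have -> : a%:~R * - z^-1 + b%:~R = (b%:~R * z - a%:~R) / z by field.
have -> : c%:~R * - z^-1 + d%:~R = (d%:~R * z - c%:~R) / z by field.
by rewrite invf_div mulrA divfK.
Qed.

Lemma mob_shift (a b c d t : int) z : mob a (b + a * t) c (d + c * t) z = mob a b c d (z + t%:~R).
Proof. by rewrite /mob !intrD !intrM; congr (_ / _); ring. Qed.

(** The parameter s of [eta_modular]: z = -d/c + i s^2, while the image of z is a/c + i/(c^2
    s^2). *)
Definition hs (d : int) (c : nat) (z : C) : C := csqrt (- 'i%C * (z + d%:~R / c%:R)).

Lemma Re_hs (d : int) (c : nat) (z : C) : (0 < c)%N ->
  complex.Re (- 'i%C * (z + d%:~R / c%:R)) = complex.Im z /\
  complex.Im (- 'i%C * (z + d%:~R / c%:R)) = - (complex.Re z + d%:~R / c%:R).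
Proof.
move=> c0; have -> : d%:~R / c%:R = (d%:~R / c%:R)%:C :> C by rewrite rmorphM fmorphV /= intC natC.
by rewrite ReM ImM ReD ImD /=; split; ring.
Qed.

Lemma hsP (d : int) (c : nat) (z : C) : (0 < c)%N -> 0 < complex.Im z ->
  cone (hs d c z) /\ 'i%C * hs d c z ^+ 2 = z + d%:~R / c%:R.
Proof.
move=> c0 z0; split; first by apply: cone_csqrt; rewrite (Re_hs _ _ c0).1.
by rewrite /hs sqr_csqrt mulrA mulrN -expr2 sqr_i opprK mul1r.
Qed.

Lemma hs_line (d : int) (c : nat) (z : C) : (0 < c)%N -> 0 < complex.Im z ->
  - (d%:~R / c%:R) + 'i%C * hs d c z ^+ 2 = z.
Proof. by move=> c0 z0; rewrite (hsP d c0 z0).2 addrC addrK. Qed.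

Lemma hs_cusp (a b d : int) (c : nat) (z : C) : (0 < c)%N -> 0 < complex.Im z -> a * d - b * c = 1 ->
  a%:~R / c%:R + 'i%C / (c%:R ^+ 2 * hs d c z ^+ 2) = mob a b c d z.
Proof.
move=> c0 z0 e; have [co e2] := hsP d c0 z0; have s0 := cone_neq0 co.
have c0' : c%:R != 0 :> C by rewrite pnatr_eq0 -lt0n.
have v0 := lin_neq0 z0 e; rewrite -pmulrn in v0.
have e3 : hs d c z ^+ 2 = - 'i%C * (z + d%:~R / c%:R) by rewrite /hs sqr_csqrt.
have i0 := neq0i R.
have vc : z + d%:~R / c%:R != 0.
  by rewrite -[z](mulKf c0') (mulrC _^-1) -mulrDl mulf_neq0// invr_neq0.
rewrite e3 /mob -pmulrn.
have -> : 'i%C / (c%:R ^+ 2 * (- 'i%C * (z + d%:~R / c%:R))) = - (c%:R * (c%:R * z + d%:~R))^-1.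
  by field; rewrite v0 c0' i0.
move/(congr1 (fun k : int => k%:~R : C)): e; rewrite intrB !intrM -pmulrn => e.
have {1}-> : (c%:R * (c%:R * z + d%:~R))^-1 = (a%:~R * d%:~R - b%:~R * c%:R) / (c%:R * (c%:R * z + d%:~R)) :> C by rewrite e mul1r.
by field; rewrite v0.
Qed.

Lemma nm_eta_mob_pos (a b d : int) (c : nat) (z : C) : (0 < c)%N -> 0 < complex.Im z -> a * d - b * c = 1 ->
  nm (eta (mob a b c d z)) ^+ 2 = nm (c%:R * z + d%:~R) * nm (eta z) ^+ 2 /\ jinv (mob a b c d z) = jinv z.
Proof.
move=> c0 z0 e; have [co e2] := hsP d c0 z0.
have dv : (c%:Z %| a * d - 1)%Z by rewrite -e opprB addrC subrK dvdz_mull.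
have [k [nk H]] := eta_modular (@jinv_T R) (@jinv_S R) c0 dv.
have [] := H _ co; rewrite (hs_cusp c0 z0 e) (hs_line _ c0 z0) => -> ->; split=> //.
have c0' : c%:R != 0 :> C by rewrite pnatr_eq0 -lt0n.
have e4 : nm (hs d c z) ^+ 2 = nm (c%:R * z + d%:~R) / c%:R.
  have -> : nm (c%:R * z + d%:~R) / c%:R = nm ((c%:R * z + d%:~R) / c%:R) by rewrite nmM nmV nm_nat.
  rewrite -nmX mulrDl mulrAC mulfV// mul1r -e2 (nmM 'i%C).
  by rewrite [nm 'i%C](_ : _ = 1) ?mul1r// /nm /= expr0n add0r expr1n sqrtr1.
rewrite (nmM (k * _)) (nmM k) !exprMn nk e4 mulrC (mulrC c%:R) divfK 1?mulrC//.
by rewrite pnatr_eq0 -lt0n.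
Qed.

(** Moduli are free of the multiplier and suffice for the convergence estimates. *)
Lemma nm_eta_mob (a b c d : int) (z : C) : 0 < complex.Im z -> a * d - b * c = 1 ->
  nm (eta (mob a b c d z)) ^+ 2 = nm (c%:~R * z + d%:~R) * nm (eta z) ^+ 2 /\ jinv (mob a b c d z) = jinv z.
Proof.
move=> z0 e; case: (ltgtP c 0) => [c0|c0|c0].
- have [n cE] : exists n : nat, c = - n%:Z by exists `|c|%N; rewrite ltz0_abs ?opprK.
  have n0 : (0 < n)%N by move: c0; rewrite cE oppr_lt0.
  have e' : - a * - d - - b * n%:Z = 1 by rewrite -e cE mulrNN mulrN mulNr.
  have [h1 h2] := nm_eta_mob_pos n0 z0 e'.
  have mE : mob (- a) (- b) n%:Z (- d) z = mob a b c d z by rewrite -(mobN a b) cE opprK.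
  rewrite mE in h1 h2; split=> //; rewrite h1 cE; congr (_ * _).
  by rewrite -nmN opprD -mulNr !intrN opprK pmulrn.
- have [n cE] : exists n : nat, c = n%:Z by exists `|c|%N; rewrite gtz0_abs.
  rewrite cE in c0 e *; exact: nm_eta_mob_pos.
move: e; rewrite c0 mulr0 subr0 => e; have : (d == 1) || (d == -1).
  by have := congr1 absz e; rewrite abszM => /eqP; rewrite muln_eq1 => /andP[_]; lia.
have P b' : nm (eta (mob 1 b' 0 1 z)) ^+ 2 = nm (0%:~R * z + 1%:~R) * nm (eta z) ^+ 2 /\ jinv (mob 1 b' 0 1 z) = jinv z.
  rewrite /mob !mul1r !mul0r add0r divr1 jinv_T// eta_Tn// nmM nm1 mul1r.
  split=> //; rewrite [b'%:~R / 24](_ : _ = (b'%:~R / 24)%:C) ?nm_e2pi_real ?mul1r//.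
  by rewrite rmorphM fmorphV rmorph_nat /= intC.
case/orP => /eqP d1; rewrite d1.
  have -> : a = 1 by move: e; rewrite d1 mulr1.
  exact: P.
have -> : a = -1 by move: e; rewrite d1; lia.
by rewrite -[b]opprK -(mobN _ _ 0) !opprK oppr0 mul0r add0r intrN nmN -[1%:~R]add0r -[X in X + _](mul0r z); apply: P.
Qed.

End Mobius.

(** * Summation over the bottom rows of SL_2(Z) *)

Section CosetSum.
Variable R : realType.
Local Notation C := R[i].
Local Notation rho := (rho R).

Lemma Im_rho1 : 0 < complex.Im (rho + 1).
Proof. by rewrite ImD /= addr0; have := Im_rho R. Qed.

Lemma bezout_indep (a b a' b' c d : int) : a * d - b * c = 1 -> a' * d - b' * c = 1 ->
  exists k, a' = a + k * c /\ b' = b + k * d.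
Proof.
move=> e e'; exists (a * b' - b * a').
have -> : a + (a * b' - b * a') * c = a * (1 - (a' * d - b' * c)) + a' * (a * d - b * c) by ring.
have -> : b + (a * b' - b * a') * d = b * (1 - (a' * d - b' * c)) + b' * (a * d - b * c) by ring.
by rewrite e e' subrr !mulr0 !mulr1 !add0r.
Qed.

Lemma coprimez_bezout (c d : int) : coprimez c d <-> exists v : int * int, v.1 * d - v.2 * c = 1.
Proof.
split=> [/coprimezP[[u v] /= e]|[[u v] /= e]]; first by exists (v, - u); rewrite /= mulNr opprK addrC.
by apply/coprimezP; exists (- v, u); rewrite /= mulNr addrC.
Qed.

Definition bezv (w : int * int) : int * int := xget (0, 0) [set v | v.1 * w.2 - v.2 * w.1 = 1]%classic.

Lemma bezvP (w : int * int) : coprimez w.1 w.2 -> (bezv w).1 * w.2 - (bezv w).2 * w.1 = 1.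
Proof. by case/coprimez_bezout => v vP; rewrite /bezv; case: xgetP => // /(_ v). Qed.

Section Sum.
Variables (H : C -> C) (bet : C) (K : R).
Hypothesis HT : forall z (n : int), 0 < complex.Im z -> H (z + n%:~R) = H z + bet * n%:~R.
Hypothesis K0 : 0 <= K.
Hypothesis HD : forall a b c d : int, a * d - b * c = 1 ->
  nm (H (mob a b c d (rho + 1)) - H (mob a b c d rho)) <= K * (zw R `|c| * zw R `|d|).

(** The choice of top row is immaterial: another one translates both points by the same integer,
    which adds the same multiple of [bet] to both values of [H]. *)
Definition hdiff (w : int * int) : C :=
  if coprimez w.1 w.2 then H (mob (bezv w).1 (bezv w).2 w.1 w.2 (rho + 1)) -
    H (mob (bezv w).1 (bezv w).2 w.1 w.2 rho) else 0.

Lemma hdiffE (a b c d : int) : a * d - b * c = 1 ->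
  hdiff (c, d) = H (mob a b c d (rho + 1)) - H (mob a b c d rho).
Proof.
move=> e; have cp : coprimez c d by apply/coprimez_bezout; exists (a, b).
rewrite /hdiff /= cp; have := @bezvP (c, d) cp; case: (bezv _) => a' b' /= e'.
have [k [-> ->]] := bezout_indep e e'.
rewrite !mob_T ?(lin_neq0 _ e) ?Im_rho1 ?Im_rho//.
by rewrite !HT ?(Im_mob_gt0 _ e) ?Im_rho1 ?Im_rho//; ring.
Qed.

Lemma smb_hdiff : smb (fun w => nm (hdiff w)).
Proof.
apply: smb_le (smbZ K0 (smb_zw_int2 R)) => -[c d] /=.
case: (boolP (coprimez c d)) => [/coprimez_bezout[[a b] /= e]|cp].
  by rewrite (hdiffE e) HD.
by rewrite /hdiff /= (negbTE cp) nm0 !mulr_ge0 ?zw_ge0.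
Qed.

(* The substitution z -> -1/z exchanges rho and rho + 1, so the sum of hdiff equals its opposite. *)
Lemma hdiff_S (c d : int) : hdiff (d, - c) = - hdiff (c, d).
Proof.
case: (boolP (coprimez c d)) => [/coprimez_bezout[[a b] /= e]|cp]; last first.
  by rewrite /hdiff /= coprimezN coprimez_sym (negbTE cp) oppr0.
have e' : b * - c - - a * d = 1 by rewrite mulrN mulNr opprK addrC.
have r0 : rho != 0 by rewrite Im_neq0 ?Im_rho.
have r1 : rho + 1 != 0 by rewrite Im_neq0 ?Im_rho1.
rewrite (hdiffE e) (hdiffE e') !mob_S// rho_S opprB.
by rewrite (_ : - (rho + 1)^-1 = rho)// -rho_S invrN invrK opprK.
Qed.

Lemma hdiff_N (c d : int) : hdiff (- c, - d) = hdiff (c, d).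
Proof.
case: (boolP (coprimez c d)) => [/coprimez_bezout[[a b] /= e]|cp]; last first.
  by rewrite /hdiff /= coprimezN coprimeNz (negbTE cp).
by rewrite (hdiffE e) (@hdiffE (- a) (- b)) ?mulrNN// !mobN.
Qed.

Lemma hasum_hdiff : hasum hdiff 0.
Proof.
have [s hs] := smb_hasum smb_hdiff; suff -> : 0 = s by [].
have bj : bijective (fun w : int * int => (w.2, - w.1)).
  by exists (fun w : int * int => (- w.2, w.1)) => -[c d] /=; rewrite opprK.
have := (hasum_bij hdiff s bj).2 hs => h1.
have h2 : hasum (fun w => - hdiff w) s by apply: hasum_ext h1 => -[c d] /=; rewrite hdiff_S.
have := hasum_uniq h2 (hasumN hs) => /eqP; rewrite -subr_eq0 opprK -mulr2n -mulr_natl mulf_eq0 pnatr_eq0 /= => /eqP.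
by [].
Qed.

Definition hrow (c : int) : C := xget 0 [set s | hasum (fun d => hdiff (c, d)) s]%classic.

Lemma hrowP c : hasum (fun d => hdiff (c, d)) (hrow c).
Proof.
have [s hs] := smb_hasum (smb_fst c smb_hdiff).
by rewrite /hrow; case: xgetP => // /(_ s).
Qed.

Lemma hrowN c : hrow (- c) = hrow c.
Proof.
have bj : bijective (fun d : int => - d) by exists (fun d : int => - d) => d; rewrite opprK.
have := (hasum_bij _ _ bj).2 (hrowP (- c)) => h.
apply: (hasum_uniq h); apply: hasum_ext (hrowP c) => d /=.
by rewrite hdiff_N.
Qed.

Lemma hrow0 : hrow 0 = 2 * bet.
Proof.
apply: (hasum_uniq (hrowP 0)).
have e1 : (1 : int) * 1 - 0 * 0 = 1 by [].
have m1 z : mob 1 0 0 1 z = z by rewrite /mob mul0r add0r mul1r addr0 divr1.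
have D1 : hdiff (0, 1) = bet.
  rewrite (hdiffE e1) !m1; have := @HT rho 1 (Im_rho R) => ->.
  by rewrite mulr1 addrC addKr.
have D2 : hdiff (0, -1) = bet by rewrite -[0]oppr0 hdiff_N.
have -> : 2 * bet = \sum_(d <- [fset (1 : int); -1]%fset) hdiff (0, d).
  by rewrite big_fsetU1 ?inE// big_seq_fset1 D1 D2 mulr_natl mulr2n.
apply: hasum_fin => d; rewrite !inE => dn; rewrite /hdiff /= coprimezE absz0 /coprime gcd0n.
by case: ifP => //; move: dn; lia.
Qed.

Lemma coset_sum (jump : nat -> nat -> C) :
  (forall c r : nat, (0 < c)%N -> coprime c r -> exists a b : int, a * r%:Z - b * c%:Z = 1 /\
    cvto (fun n => H (mob a b c r (rho + n.+1%:R)) - H (mob a b c r (rho - n%:R))) (jump c r)) ->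
  hasum (fun c : nat => if c == 0%N then 0 else \sum_(r < c | coprime c r) jump c r) (- bet).
Proof.
move=> HJ.
have h1 := hasum_fold (hasum_sigma hasum_hdiff hrowP).
(* The rows c and -c contribute equally, and the two rows (0, 1) and (0, -1) contribute [bet] each;
   halving removes both redundancies. *)
have h2 := hasumZ 2^-1 h1; rewrite mulr0 in h2.
have h3 : hasum (fun c : nat => if c == 0%N then bet else 0) bet.
  have := @hasum_fin R _ [fset 0%N]%fset (fun c : nat => if c == 0%N then bet else 0).
  by rewrite big_seq_fset1; apply=> c; rewrite inE => /negbTE ->.
have := hasumB h2 h3; rewrite sub0r; apply: hasum_ext => -[|c'] /=; first by rewrite hrow0 mulKf ?subrr// pnatr_eq0.
set c := c'.+1; have c0 : (0 < c)%N by [].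
rewrite subr0 hrowN.
have -> : hrow c = \sum_(r < c | coprime c r) jump c r; last first.
  by move: (\sum_(r < c | _) _) => x; field.
apply: (hasum_uniq (hrowP c)); rewrite big_mkcond /=.
apply: (@hasum_mod R c _ (fun r => if coprime c r then jump c r else 0)) => // r rc.
case: ifP => cp; last first.
  apply: (@hasum_ext R int (fun=> 0)); last exact: hasum0.
  move=> t; rewrite /hdiff /= coprimezE /=.
  rewrite (_ : coprime c `|r%:Z + c%:Z * t| = coprime c r) ?cp//.
  have := coprimezE c (r%:Z + c%:Z * t); rewrite /= => <-.
  by rewrite /coprimez addrC mulrC gcdzMDl -/(coprimez _ _) coprimezE.
have [a [b [e HJ1]]] := HJ c r c0 cp.
have eT t : a * (r%:Z + c%:Z * t) - (b + a * t) * c%:Z = 1 by rewrite -e; ring.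
pose g (t : int) : C := H (mob a b c r (rho + t%:~R)).
have Dt t : hdiff (c%:Z, r%:Z + c%:Z * t) = g (t + 1) - g t.
  by rewrite (hdiffE (eT t)) !mob_shift /g intrD -addrA (addrC 1).
have [s hs] : exists s, hasum (fun t : int => hdiff (c%:Z, r%:Z + c%:Z * t)) s.
  apply: smb_hasum; apply: (@smb_inj _ _ _ (fun t : int => (c%:Z, r%:Z + c%:Z * t)) (fun w => nm (hdiff w))) => //; last exact: smb_hdiff.
  by move=> t t' [] /addrI /(mulfI _)-> //; rewrite eqz_nat -lt0n.
suff -> : jump c r = s by [].
apply: (cvto_uniq HJ1); apply: cvto_ext (hasum_int_cvto hs) => n.
rewrite (eq_bigr _ (fun t _ => Dt t)) sum_zrange_tele /g -!pmulrn intrN.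
by [].
Qed.

End Sum.
End CosetSum.

(** * The jump of the primitive at a cusp and the exact formula *)

Section Jump.
Variable R : realType.
Local Notation C := R[i].
Local Notation rho := (rho R).

Lemma Im_realM (k : R) (z : C) : complex.Im (k%:C * z) = k * complex.Im z.
Proof. by rewrite ImM /= mul0r addr0. Qed.

Lemma cder_csqrt (w : C) : 0 < complex.Re w -> cder (@csqrt R) w (2 * csqrt w)^-1.
Proof.
move=> w0; have s0 := Re_csqrt w0; set s := csqrt w in s0 *.
have sn : s != 0 by apply: contraTneq s0 => ->; rewrite ltxx.
exists ((2 * nm s)^-1 * (complex.Re s ^+ 2)^-1), (complex.Re w); split=> // h hw.
have w'0 : 0 < complex.Re (w + h).
  by have := Re_nm h; rewrite ReD ler_norml => /andP[]; lra.
set s' := csqrt (w + h); have s'0 : 0 < complex.Re s' := Re_csqrt w'0.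
have e : h = (s' - s) * (s' + s) by rewrite -subr_sqr !sqr_csqrt addrC addKr.
have p0 : complex.Re s <= nm (s' + s).
  by apply: le_trans (Re_nm _); rewrite ReD ger0_norm; lra.
have pn : s' + s != 0 by rewrite -nm_gt0; lra.
have -> : s' - s - h * (2 * s)^-1 = - h ^+ 2 / (2 * s * (s' + s) ^+ 2) by rewrite e; field; rewrite pn sn.
rewrite (nmM _ _^-1) nmN nmX nmV (nmM (2 * s)) (nmM 2) (nm_nat R 2) nmX mulrC invfM.
rewrite ler_wpM2r ?exprn_ge0 ?nm_ge0// ler_wpM2l ?invr_ge0 ?mulr_ge0 ?nm_ge0//.
by rewrite lef_pV2 ?posrE ?exprn_gt0 ?nm_gt0// lerXn2r// ?nnegrE ?nm_ge0// ltW.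
Qed.

Lemma cder_hs (d : int) (c : nat) (z : C) : (0 < c)%N -> 0 < complex.Im z ->
  cder (hs d c) z ((2 * hs d c z)^-1 * - 'i%C).
Proof.
move=> c0 z0; apply: (@cder_comp _ (@csqrt R) (fun z => - 'i%C * (z + d%:~R / c%:R))); last first.
  by apply: cder_csqrt; rewrite (Re_hs _ _ c0).1.
by apply: cder_eq (cderZ _ (cderD (cder_id z) (cder_cst _ z))); rewrite addr0 mulr1.
Qed.

Definition Psi (x : R) : R := (expR x + expR (- x)) / 2 - (expR x - expR (- x)) / (2 * x).

Lemma scale_half (i : C) (x y : R) : x%:C * (i * y%:C / 2) = i * (x * (y / 2))%:C.
Proof. by rewrite !rmorphM fmorphV rmorph_nat /=; ring. Qed.

(** Here 2 al be is the argument x of [Psi], so 2 al = x / be and the bracket in [hlim] is 2 be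
    times [Psi x]. The factor sqrt pi of [erfi_lim] becomes [sqrt 12 * u]. *)
Lemma hlim_Psi (c : nat) (m M : R) : (0 < c)%N -> 0 < m -> 0 < M ->
  let u := Num.sqrt (pi / 12) in
  hlim (u * Num.sqrt M / c%:R) (m * u) =
    'i%C * (Num.sqrt 12 * m * c%:R ^+ 2 / (2 * M) * Psi (pi * m * Num.sqrt M / (6 * c%:R)))%:C.
Proof.
move=> c0 m0 M0 u; rewrite /hlim erfi_lim_eq -complexiE.
have c0' : 0 < c%:R :> R by rewrite ltr0n.
have u0 : 0 < u by rewrite sqrtr_gt0 divr_gt0 ?pi_gt0.
have t0 : 0 < Num.sqrt M by rewrite sqrtr_gt0.
have u2 : u ^+ 2 = pi / 12 by rewrite sqr_sqrtr// divr_ge0 ?pi_ge0.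
have t2 : Num.sqrt M ^+ 2 = M by rewrite sqr_sqrtr// ltW.
have -> : Num.sqrt pi = Num.sqrt 12 * u :> R by rewrite /u -sqrtrM// mulrC divfK.
set x := pi * m * Num.sqrt M / (6 * c%:R).
have xE : 2 * (u * Num.sqrt M / c%:R) * (m * u) = x.
  have -> : 2 * (u * Num.sqrt M / c%:R) * (m * u) = 2 * u ^+ 2 * m * Num.sqrt M / c%:R by field; lra.
  by rewrite u2 /x; field; lra.
have -> : 2 * (u * Num.sqrt M / c%:R)%:C * (m * u)%:C = x%:C by rewrite -xE !rmorphM /= rmorph_nat.
rewrite -(rmorphN _ x) /= !cexp_real.
set al := u * Num.sqrt M / c%:R.
have al2 : al ^+ 2 = u ^+ 2 * M / c%:R ^+ 2 by rewrite /al !exprMn exprVn t2.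
rewrite -/al in xE; have x0 : 0 < x by rewrite /x divr_gt0 ?mulr_gt0 ?pi_gt0.
clearbody al x u.
have -> : (2 * (al%:C : C) ^+ 2)^-1 = ((2 * (u ^+ 2 * M / c%:R ^+ 2))^-1)%:C.
  by rewrite -al2 fmorphV rmorphM rmorphXn /= rmorph_nat.
have -> : 2 * (al%:C : C) = (x / (m * u))%:C by rewrite -xE mulfK ?rmorphM ?rmorph_nat//; nra.
rewrite -!(rmorphD, rmorphB, rmorphM, fmorphV) /=.
set X := expR x; set Y := expR (- x).
rewrite scale_half; congr (_ * _%:C).
by rewrite /Psi -/X -/Y; clearbody X Y; field; rewrite !gt_eqF.
Qed.

Lemma mul_conjc (k : C) : k * conjc k = (nm k ^+ 2)%:C.
Proof.
rewrite nm_sqr; case: k => x y; apply: complex_ext; rewrite ?ReM ?ImM /=; ring.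
Qed.

Lemma chi_unit (m n0 : nat) : (m ^ 2 = 24 * n0 + 1)%N -> chi m%:Z ^+ 2 = 1.
Proof.
move=> e; have -> : chi m%:Z = chi (m %% 12)%N%:Z.
  by apply: chi_mod; rewrite /= -modz_nat modz_mod.
have : ((m %% 12) ^ 2 %% 12 = 1)%N by rewrite modnXm e; lia.
have : (m %% 12 < 12)%N by rewrite ltn_mod.
by case: (m %% 12)%N => [|[|[|[|[|[|[|[|[|[|[|[|//]]]]]]]]]]]].
Qed.

Lemma jump_alg (i X k s g c Y ph E : C) : i ^+ 2 = -1 -> s != 0 -> k != 0 -> c != 0 -> X * Y = ph * E ->
  X * ((k * s)^-1 * g) * (c * (i * s ^+ 2)) ^- 2 -
    2 * i * - (k^-1 * c ^- 2 * ph) * (s ^- 4 * E * ((2 * s)^-1 * - i)) =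
  - (X * (k^-1 * c ^- 2) * s ^- 5 * (g - Y)).
Proof.
move=> i2 s0 k0 c0 e.
have -> : (c * (i * s ^+ 2)) ^- 2 = - (c ^- 2 * s ^- 4).
  by rewrite (exprMn 2 c) (exprMn 2 i) i2 mulN1r mulrN invrN -exprM invfM.
have -> : 2 * i * - (k^-1 * c ^- 2 * ph) * (s ^- 4 * E * ((2 * s)^-1 * - i)) =
   i ^+ 2 * (k^-1 * c ^- 2) * s ^- 5 * (ph * E) by field; rewrite s0 k0 c0.
by rewrite i2 -e; field; rewrite s0 k0 c0.
Qed.

Lemma far_bounds (X X0 x a q n1 n : R) : X0 + a + q + 1 < n1 -> n1 <= n -> 0 <= q -> 0 <= X0 ->
  X <= X0 -> - a <= x -> x <= a ->
  [/\ - (x + (n + 1) + q) <= 0, X <= `|- (x + (n + 1) + q)|, 0 < - (x - n + q) & X <= - (x - n + q)].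
Proof.
move=> h1 h2 h3 h4 h5 h6 h7; have h8 : 0 <= x + (n + 1) + q by lra.
by split; rewrite ?normrN ?(ger0_norm h8); lra.
Qed.

Definition minv (c r : nat) : nat := ((egcdn r c).1 %% c)%N.

Lemma minvP (c r : nat) : (0 < c)%N -> coprime c r -> (minv c r * r = 1 %[mod c])%N.
Proof.
move=> c0 cp; rewrite /minv modnMml; case: (posnP r) => [r0|r0].
  by move: cp; rewrite r0 /coprime gcdn0 => /eqP ->; rewrite !modn1.
by case: egcdnP => // u v e _ /=; rewrite e gcdnC (eqP cp) modnMDl.
Qed.

Lemma minv_coprime (c r : nat) : (0 < c)%N -> coprime c r -> coprime c (minv c r).
Proof.
move=> c0 cp; have : coprime c (minv c r * r) by rewrite -coprime_modr minvP// coprime_modr coprimen1.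
by rewrite coprimeMr => /andP[].
Qed.

Lemma minv_bezout (c r : nat) : (0 < c)%N -> coprime c r -> exists q : int, (minv c r)%:Z * r%:Z - q * c%:Z = 1.
Proof.
move=> c0 cp; have e := minvP c0 cp.
have /eqP : ((minv c r * r)%N%:Z %% c = 1%:Z %% c)%Z by rewrite !modz_nat e.
rewrite eqz_mod_dvd => /dvdzP[q e0]; exists q.
by rewrite -e0 PoszM opprB addrC subrK.
Qed.

Lemma minvK (c r : nat) : (0 < c)%N -> coprime c r -> (r < c)%N -> minv c (minv c r) = r.
Proof.
move=> c0 cp rc; have cp' := minv_coprime c0 cp.
have e1 := minvP c0 cp; have e2 := minvP c0 cp'.
rewrite -[RHS](modn_small rc) -[LHS](@modn_small _ c) ?ltn_pmod//.
rewrite -[in LHS](muln1 (minv c (minv c r))) -modnMmr -e1 modnMmr mulnA -modnMml e2 modnMml mul1n.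
by [].
Qed.

Lemma sum_minv (c : nat) (f : nat -> C) : (0 < c)%N ->
  \sum_(r < c | coprime c r) f (minv c r) = \sum_(r < c | coprime c r) f r.
Proof.
move=> c0; pose h (r : 'I_c) : 'I_c := if coprime c r then Ordinal (ltn_pmod (egcdn r c).1 c0) else r.
have hE (r : 'I_c) : coprime c r -> h r = minv c r :> nat by move=> cp; rewrite /h cp.
have hC (r : 'I_c) : coprime c (h r) = coprime c r.
  by case: (boolP (coprime c r)) => cp; [rewrite hE// minv_coprime|rewrite /h (negbTE cp) (negbTE cp)].
have hK : involutive h.
  move=> r; case: (boolP (coprime c r)) => cp; last by rewrite {2}/h (negbTE cp) /h (negbTE cp).
  by apply: val_inj; rewrite /= hE ?hC// hE// minvK.
rewrite [RHS](reindex_inj (inv_inj hK)) /=; apply: eq_big => r; first by rewrite hC.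
by move=> cp; rewrite hE.
Qed.

Section WithData.
Variables (n0 N0 m M : nat) (P : {poly C}) (a : nat -> C).
Hypothesis qa : qser (- n0%:R - 24^-1) a (fun z => P.[jinv z] * ieta z).
Hypothesis a0 : a 0%N = 1.
Hypothesis a1 : forall i, (0 < i <= n0)%N -> a i = 0.
Hypothesis m2 : (m ^ 2 = 24 * n0 + 1)%N.
Hypothesis MN : (M + 1 = 24 * N0)%N.
Hypothesis M0 : (0 < M)%N.

Definition wtg (z : C) : C := P.[jinv z] * ieta z.
(** The exponents of [wtg] lie in -m^2/24 + Z. Since m^2 + M = 24 (n0 + N0), the twist makes them
    integral and moves the coefficient [a (n0 + N0)] to exponent 0. *)
Definition wth (z : C) : C := e2pi (- (M%:R / 24) * z) * wtg z.

Lemma m_gt0 : (0 < m)%N.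
Proof. by rewrite -(ltn_exp2r 0 m (isT : 0 < 2)%N) m2 addn1. Qed.

Lemma wth_qser : qser (- (n0 + N0)%:R) a wth.
Proof.
have ME : M%:R = 24 * N0%:R - 1 :> C by rewrite -natrM -MN natrD addrK.
by apply: qser_al (qser_twist (- (M%:R / 24)) qa); rewrite ME natrD; field.
Qed.

Lemma al_m2 : - n0%:R - 24^-1 = - (m%:R ^+ 2 / 24) :> C.
Proof. by rewrite -natrX m2 natrD natrM; field. Qed.

Lemma wtg_tail (y : R) : 0 < y -> exists K : R, 0 <= K /\ forall z, y <= complex.Im z ->
  nm (wtg z - e2pi (- (m%:R ^+ 2 / 24) * z)) <= K.
Proof.
move=> y0; rewrite -al_m2.
have q1 := qserD qa (qserZ (- 1) (qser_e2pi (- n0%:R - 24^-1))).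
have q2 : qser (- n0%:R - 24^-1 + n0.+1%:R) (fun n => a (n0.+1 + n)%N + - 1 * (if (n0.+1 + n)%N == 0%N then 1 else 0))
    (fun z => wtg z + - 1 * e2pi ((- n0%:R - 24^-1) * z)).
  apply: qser_strip q1 => -[_|i]; first by rewrite a0 mulr1 subrr.
  by rewrite ltnS => ii; rewrite a1//= mulr0 addr0.
have [K [K0 HK]] := qser_bound y0 q2; exists K; split=> // z zy.
rewrite -[- e2pi _]mulN1r; apply: le_trans (HK z zy) _; rewrite -[leRHS]mulr1 ler_wpM2l//.
have -> : - n0%:R - 24^-1 + n0.+1%:R = (23 / 24)%:C :> C.
  by rewrite -natr1 rmorphM fmorphV !rmorph_nat; field.
rewrite nm_e2pi ImM /= mul0r addr0 expR_le1 oppr_le0 !mulr_ge0 ?pi_ge0//; lra.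
Qed.

Lemma nm_wth_mob (p q r s : int) (z : C) : 0 < complex.Im z -> p * s - q * r = 1 ->
  nm (wth (mob p q r s z)) = expR (2 * pi * (M%:R / 24) * complex.Im (mob p q r s z)) *
     nm (wtg z) / Num.sqrt (nm (r%:~R * z + s%:~R)).
Proof.
move=> z0 e; have [e1 e2] := nm_eta_mob z0 e; have w0 := Im_mob_gt0 z0 e.
have e3 : nm (eta (mob p q r s z)) = Num.sqrt (nm (r%:~R * z + s%:~R)) * nm (eta z).
  apply/(@pexpIrn _ 2); rewrite ?nnegrE ?mulr_ge0 ?nm_ge0 ?sqrtr_ge0//.
  by rewrite e1 exprMn (sqr_sqrtr (nm_ge0 (_ + _))).
rewrite /wth /wtg e2 (nmM (e2pi _)) (nmM P.[_]) (nmM P.[_]) !ietaE// !nmV e3 nm_e2pi.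
have -> : complex.Im (- (M%:R / 24) * mob p q r s z) = - (M%:R / 24) * complex.Im (mob p q r s z).
  have -> : - (M%:R / 24) = (- (M%:R / 24))%:C :> C by rewrite rmorphN rmorphM fmorphV !rmorph_nat.
  by rewrite ImM /= mul0r addr0.
rewrite invfM mulNr mulrN opprK -!mulrA; congr (_ * (_ * _)).
by rewrite mulrC.
Qed.

(** The chain rule contributes the power -2 of |r z + s| and the weight of 1/eta another -1/2. By
    [lattice_bound] the exponent 5/2 is shared between r and s as 5/4 each, which is the summable
    weight [zw]. *)
Lemma wth_diff_bound (H : C -> C) : (forall z, 0 < complex.Im z -> cder H z (wth z)) ->
  exists K : R, 0 <= K /\ forall p q r s : int, p * s - q * r = 1 ->
  nm (H (mob p q r s (rho + 1)) - H (mob p q r s rho)) <= K * (zw R `|r| * zw R `|s|).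
Proof.
move=> DH; pose y := complex.Im rho; have y0 : 0 < y := Im_rho R.
have [K0 [K00 HK0]] := lattice_bound 1 y0.
have [M1 [M10 HM1]] := qser_bound y0 qa.
pose B1 := M1 * expR (2 * pi * (n0%:R + 24^-1) * y).
pose B2 := expR (2 * pi * (M%:R / 24) * (y * K0)).
pose B3 := Num.sqrt (Num.sqrt K0) ^+ 5.
have B10 : 0 <= B1 by rewrite mulr_ge0 ?expR_ge0.
have B30 : 0 <= B3 by rewrite exprn_ge0 ?sqrtr_ge0.
exists (B2 * B1 * B3); split; first by rewrite !mulr_ge0 ?expR_ge0.
move=> p q r s e.
have := @cmvt R (fun z => H (mob p q r s z)) rho (rho + 1) (B2 * B1 * B3 * (zw R `|r| * zw R `|s|)).
rewrite (_ : rho + 1 - rho = 1) 1?addrC ?addKr// nm1 mulr1; apply => t /andP[t0 t1].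
rewrite mulr1; set z := rho + t%:C.
have zy : complex.Im z = y by rewrite /z ImD /= addr0.
have z0 : 0 < complex.Im z by rewrite zy.
have zx : `|complex.Re z| <= 1 by rewrite /z ReD /= ler_norml; lra.
exists (wth (mob p q r s z) * (r%:~R * z + s%:~R) ^- 2); split.
  by apply: cder_comp (cder_mob z0 e) (DH _ _); exact: Im_mob_gt0.
have nz : (r, s) != (0, 0) by apply/eqP => -[r0 s0]; move: e; rewrite r0 s0 !mulr0 subrr.
have HL := HK0 z zx (eqW (esym zy)) r s nz.
set v := nm (r%:~R * z + s%:~R) in HL; have v0 : 0 < v by rewrite nm_gt0 (lin_neq0 z0 e).
set X := _%:R * _%:R in HL.
have X1 : 1 <= X by rewrite /X -natrM ler1n muln_gt0.
rewrite (nmM (wth _)) nm_wth_mob// -/v nmV nmX -/v (Im_mob z0 e) -/v zy.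
have gB : nm (wtg z) <= B1.
  apply: le_trans (HM1 z _) _; first by rewrite zy.
  rewrite /B1 ler_wpM2l// nm_e2pi.
  have -> : - n0%:R - 24^-1 = (- (n0%:R + 24^-1))%:C :> C by rewrite rmorphN rmorphD fmorphV !rmorph_nat opprD.
  by rewrite Im_realM zy mulNr mulrN opprK mulrA.
have v2 : X / K0 <= v ^+ 2 by rewrite ler_pdivrMr// mulrC.
have v2i : (v ^+ 2)^-1 <= K0.
  rewrite invf_ple ?posrE ?exprn_gt0// -div1r; apply: le_trans v2.
  by rewrite ler_wpM2r// invr_ge0 ltW.
have eB : expR (2 * pi * (M%:R / 24) * (y / v ^+ 2)) <= B2.
  have p0 : 0 <= 2 * pi * (M%:R / 24) :> R by rewrite !mulr_ge0 ?pi_ge0 ?invr_ge0.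
  by rewrite ler_expR (ler_wpM2l p0)// ler_wpM2l// ltW.
have -> : expR (2 * pi * (M%:R / 24) * (y / v ^+ 2)) * nm (wtg z) / Num.sqrt v * (v ^+ 2)^-1 =
   expR (2 * pi * (M%:R / 24) * (y / v ^+ 2)) * nm (wtg z) * (Num.sqrt v ^+ 5)^-1.
  rewrite -mulrA; congr (_ * _); rewrite -invfM; congr (_^-1).
  by rewrite -{2}(sqr_sqrtr (ltW v0)) -exprM -exprS.
rewrite -(mulrA (B2 * B1)); apply: ler_pM.
- by rewrite mulr_ge0 ?expR_ge0 ?nm_ge0.
- by rewrite invr_ge0 exprn_ge0 ?sqrtr_ge0.
- by apply: ler_pM => //; rewrite ?expR_ge0 ?nm_ge0.
have -> : Num.sqrt v = Num.sqrt (Num.sqrt (v ^+ 2)) by rewrite sqrtr_sqr gtr0_norm.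
have -> : zw R `|r| * zw R `|s| = (Num.sqrt (Num.sqrt X) ^+ 5)^-1.
  by rewrite /zw -invfM -exprMn /X !sqrtrM// ?sqrtr_ge0.
rewrite ler_pdivlMr ?exprn_gt0 ?sqrtr_gt0 ?sqrtr_gt0//; last lra.
rewrite mulrC ler_pdivrMr ?exprn_gt0 ?sqrtr_gt0 ?sqrtr_gt0 ?exprn_gt0//.
rewrite /B3 -exprMn lerXn2r ?nnegrE ?mulr_ge0 ?sqrtr_ge0//.
rewrite -!sqrtrM ?sqrtr_ge0 ?(ltW K00)//.
by rewrite ler_wsqrtr// ler_wsqrtr.
Qed.

Definition jumpv (c : nat) (p : int) : C :=
  - (2 * m%:R / (M%:R * c%:R) * (chi m%:Z)%:~R * (Psi (pi * m%:R * Num.sqrt M%:R / (6 * c%:R)))%:C *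
     (e2pi (- (M%:R * p%:~R / (24 * c%:R))) * conjc (gaussS R p c m%:Z))).

Section OneJump.
Variables (H : C -> C) (c : nat) (p q : int) (r : nat) (k : C).
Hypothesis DH : forall z, 0 < complex.Im z -> cder H z (wth z).
Hypothesis c0 : (0 < c)%N.
Hypothesis e : p * r%:Z - q * c%:Z = 1.
Hypothesis nk : nm k ^+ 2 = c%:R.
Hypothesis HK : forall s, cone s ->
    eta (p%:~R / c%:R + 'i%C / (c%:R ^+ 2 * s ^+ 2)) = k * s * eta (- (r%:Z%:~R / c%:R) + 'i%C * s ^+ 2) /\
    jinv (p%:~R / c%:R + 'i%C / (c%:R ^+ 2 * s ^+ 2)) = jinv (- (r%:Z%:~R / c%:R) + 'i%C * s ^+ 2).

Let u : R := Num.sqrt (pi / 12).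
Let al : R := u * Num.sqrt M%:R / c%:R.
Let be : R := m%:R * u.
Let ph : C := e2pi ((m%:R ^+ 2 * r%:R - M%:R * p%:~R) / (24 * c%:R)).
Let K1 : C := - (k^-1 * c%:R ^- 2 * ph).
Let S (z : C) : C := hs r%:Z c z.
Let w (z : C) : C := mob p q c r z.
Let E1 (z : C) : C := e2pi (- (M%:R / 24) * w z).
(** The leading term of [wtg] is integrated exactly by [hprim]; what it leaves of [H] near the cusp
    has a derivative of order |z|^(-5/2) and so contributes no jump. *)
Let rem (z : C) : C := H (w z) - 2 * 'i%C * K1 * hprim al be (S z).
Let rem' (z : C) : C := - (E1 z * (k^-1 * c%:R ^- 2) * S z ^- 5 * (wtg z - e2pi (- (m%:R ^+ 2 / 24) * z))).

Lemma kap_neq0 : k != 0.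
Proof. apply/eqP => e0; move: nk; rewrite e0 nm0 expr0n /= => /esym/eqP.
by rewrite pnatr_eq0 gtn_eqF. Qed.

Lemma den_neq0 : c%:R != 0 :> C.
Proof. by rewrite pnatr_eq0 -lt0n. Qed.

Lemma scale_gt0 : 0 < u.
Proof. by rewrite sqrtr_gt0 divr_gt0 ?pi_gt0. Qed.

Lemma al_gt0 : 0 < al.
Proof. by rewrite /al divr_gt0 ?mulr_gt0 ?scale_gt0 ?sqrtr_gt0 ?ltr0n. Qed.

Lemma be_gt0 : 0 < be.
Proof. by rewrite /be mulr_gt0 ?ltr0n ?m_gt0 ?scale_gt0. Qed.

Lemma phase_eq z : 0 < complex.Im z ->
  E1 z * e2pi (- (m%:R ^+ 2 / 24) * z) = ph * cexp (hexp al be (S z)).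
Proof.
move=> z0; have [cS e3] := hsP r%:Z c0 z0; have s0 := cone_neq0 cS.
rewrite /E1 /ph -e2piD !e2piE -cexpD; congr cexp.
rewrite /w -(hs_cusp c0 z0 e) -{2}(hs_line r%:Z c0 z0) -/(S z); rewrite -/(S z) in s0.
have ti : tpi R = 2 * pi%:C * 'i%C.
  by apply: complex_ext; rewrite /= ?mulr0 ?mul0r ?subr0 ?addr0 ?mulr1; ring.
have u2 : u ^+ 2 = pi / 12 by rewrite sqr_sqrtr// divr_ge0 ?pi_ge0.
have a2 : (al ^+ 2)%:C = pi%:C * M%:R / (12 * c%:R ^+ 2) :> C.
  rewrite /al !exprMn exprVn u2 (sqr_sqrtr (ler0n R M)).
  by rewrite !rmorphM !fmorphV rmorphXn /= !rmorph_nat; field; rewrite den_neq0.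
have b2 : (be ^+ 2)%:C = m%:R ^+ 2 * pi%:C / 12 :> C.
  by rewrite /be !exprMn u2 rmorphM rmorphXn rmorphM fmorphV /= !rmorph_nat mulrA.
rewrite /hexp a2 b2 ti -pmulrn.
have i2 : 'i%C * 'i%C = -1 :> C by rewrite -expr2 sqr_i.
move: (S z) s0 (pi%:C) (p%:~R : C) => s s0 P0 p0.
have -> : 2 * P0 * 'i%C * (- (M%:R / 24) * (p0 / c%:R + 'i%C / (c%:R ^+ 2 * s ^+ 2)) + - (m%:R ^+ 2 / 24) * (- (r%:R / c%:R) + 'i%C * s ^+ 2)) =
  2 * P0 * 'i%C * ((m%:R ^+ 2 * r%:R - M%:R * p0) / (24 * c%:R)) -
  ('i%C * 'i%C) * (P0 * M%:R / (12 * c%:R ^+ 2) / s ^+ 2 + m%:R ^+ 2 * P0 / 12 * s ^+ 2).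
  by field; rewrite s0 den_neq0.
by rewrite i2 mulN1r opprK.
Qed.

Lemma cder_rem z : 0 < complex.Im z -> cder rem z (rem' z).
Proof.
move=> z0; have [cS e3] := hsP r%:Z c0 z0; have s0 := cone_neq0 cS; have w0 := Im_mob_gt0 z0 e.
have D1 := cder_comp (cder_mob z0 e) (DH w0).
have D2 := cder_comp (cder_hs r%:Z c0 z0) (cder_hprim be al_gt0 s0).
apply: cder_eq (cderB D1 (cderZ (2 * 'i%C * K1) D2)).
have e4 : wth (w z) = E1 z * ((k * S z)^-1 * wtg z).
  have [H1 H2] := HK cS; move: H1 H2; rewrite (hs_cusp c0 z0 e) (hs_line _ c0 z0) -/(w z) -/(S z) => H1 H2.
  rewrite /wth /wtg -/(E1 z) H2 !ietaE//; congr (_ * _).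
  by rewrite H1 invfM mulrCA.
rewrite -/(w z) e4 -/(S z).
have -> : c%:~R * z + r%:~R = c%:R * ('i%C * S z ^+ 2).
  by rewrite e3 mulrDr mulrCA mulfV ?den_neq0// mulr1 -!pmulrn.
by apply: jump_alg (phase_eq z0); rewrite ?sqr_i ?den_neq0 ?kap_neq0.
Qed.

Lemma nm_S2 z : 0 < complex.Im z -> nm (S z) ^+ 2 = nm (z + (r%:R / c%:R)%:C).
Proof.
move=> z0; have [_ e3] := hsP r%:Z c0 z0; have -> : (r%:R / c%:R)%:C = r%:~R / c%:R :> C.
  by rewrite rmorphM fmorphV !rmorph_nat /= -pmulrn.
rewrite -e3 (nmM 'i%C) [nm 'i%C](_ : _ = 1) ?mul1r ?nmX// /nm /= expr0n add0r expr1n sqrtr1.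
by [].
Qed.

Lemma rem_bound : exists A : R, 0 <= A /\ forall z, complex.Im rho <= complex.Im z ->
  1 <= nm (z + (r%:R / c%:R)%:C) -> nm (rem' z) <= A / nm (z + (r%:R / c%:R)%:C) ^+ 2.
Proof.
have y0 := Im_rho R; have [K [K0 HKt]] := wtg_tail y0.
exists (expR (2 * pi * (M%:R / 24) / complex.Im rho) * nm (k^-1 * c%:R ^- 2) * K); split.
  by rewrite !mulr_ge0 ?expR_ge0 ?nm_ge0.
move=> z zy z1; have z0 : 0 < complex.Im z by apply: lt_le_trans zy.
have s2 := nm_S2 z0; rewrite -s2 in z1 *.
have s1 : 1 <= nm (S z) by rewrite -ler_sqr ?nnegrE ?nm_ge0// expr1n.
rewrite nmN (nmM (_ * S z ^- 5)) (nmM (_ * (k^-1 * _))) (nmM (E1 z)) [leRHS]mulrAC.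
rewrite ler_pM ?mulr_ge0 ?nm_ge0//; last exact: HKt.
rewrite ler_pM ?mulr_ge0 ?nm_ge0//; last first.
  rewrite nmV nmX -exprM lef_pV2 ?posrE ?exprn_gt0//; try lra.
  by rewrite ler_weXn2l.
rewrite ler_wpM2r ?nm_ge0// /E1 nm_e2pi.
have -> : - (M%:R / 24) = (- (M%:R / 24))%:C :> C by rewrite rmorphN rmorphM fmorphV !rmorph_nat.
rewrite Im_realM mulNr mulrN opprK ler_expR -mulrA ler_wpM2l ?mulr_ge0 ?pi_ge0//.
have p24 : 0 <= M%:R / 24 :> R by rewrite divr_ge0.
rewrite (ler_wpM2l p24)//.
rewrite /w (Im_mob z0 e).
have h : complex.Im z <= nm (c%:~R * z + r%:~R).
  apply: le_trans (Im_nm _); rewrite ImD ImM !(Re_int, Im_int) mul0r !addr0.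
  apply: le_trans (ler_norm _); rewrite ler_peMl ?(ltW z0)//.
  by rewrite -pmulrn ler1n.
have h2 : complex.Im z ^+ 2 <= nm (c%:~R * z + r%:~R) ^+ 2 by rewrite lerXn2r ?nnegrE ?nm_ge0 ?(ltW z0).
have n0' : 0 < nm (c%:~R * z + r%:~R) := lt_le_trans z0 h.
rewrite ler_pdivrMr ?exprn_gt0// mulrC ler_pdivlMr//.
apply: le_trans h2; rewrite expr2 ler_wpM2l// ltW//.
Qed.

Lemma rem_lim : cvto (fun n => rem (rho + n.+1%:R) - rem (rho - n%:R)) 0.
Proof.
have [A [A0 HA]] := rem_bound.
apply: (@contour0 R rem rem' (r%:R / c%:R) (complex.Im rho) A rho) => //; first exact: Im_rho.
by move=> z zy; apply: cder_rem; apply: lt_le_trans zy; apply: Im_rho.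
Qed.

(** As Re z grows, the imaginary part of [S z ^+ 2] goes to minus infinity; so the right end
    contributes [- hlim] and the left end [hlim]. *)
Lemma hprim_jump : cvto (fun n => hprim al be (S (rho + n.+1%:R)) - hprim al be (S (rho - n%:R))) (- (2 * hlim al be)).
Proof.
move=> eps eps0; have y0 := Im_rho R.
have e20 : 0 < eps / 2 by lra.
have [X HX] := hprim_lim al_gt0 be_gt0 y0 e20.
have [n1 Hn1] := natr_gt (`|X| + `|complex.Re rho| + r%:R / c%:R + 1).
exists n1 => n nn1.
have nR : n1%:R <= n%:R :> R by rewrite ler_nat.
have q0 : 0 <= r%:R / c%:R :> R by rewrite divr_ge0.
have [_ xu] : True /\ X <= `|X| by split=> //; rewrite ler_norm.
have X0 : 0 <= `|X| := normr_ge0 _.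
have [xl1 xu1] : - `|complex.Re rho| <= complex.Re rho /\ complex.Re rho <= `|complex.Re rho|.
  by have := lexx `|complex.Re rho|; rewrite ler_norml => /andP.
have I0 n' : complex.Im (n'%:R : C) = 0 by rewrite natC.
have R0 n' : complex.Re (n'%:R : C) = n'%:R by rewrite natC.
have n1E : n.+1%:R = n%:R + 1 :> R by rewrite -natr1.
have qE : r%:Z%:~R / c%:R = r%:R / c%:R :> R by rewrite -pmulrn.
have [b1 b2 b3 b4] := far_bounds Hn1 nR q0 X0 xu xl1 xu1.
have A1 : nm (hprim al be (S (rho + n.+1%:R)) + hlim al be) < eps / 2.
  have [r1 r2] := Re_hs r%:Z (rho + n.+1%:R) c0; rewrite ImD I0 addr0 in r1.
  rewrite ReD R0 qE n1E in r2.
  have := HX _ r1; rewrite r2 ifN -?leNgt//.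
  by rewrite mulN1r opprK; apply.
have A2 : nm (hprim al be (S (rho - n%:R)) - hlim al be) < eps / 2.
  have [r1 r2] := Re_hs r%:Z (rho - n%:R) c0; rewrite ImD ImN I0 oppr0 addr0 in r1.
  rewrite ReD ReN R0 qE in r2.
  have := HX _ r1; rewrite r2 ifT//.
  by rewrite mul1r; apply; apply: le_trans (ler_norm _).
have -> : hprim al be (S (rho + n.+1%:R)) - hprim al be (S (rho - n%:R)) - - (2 * hlim al be) =
  (hprim al be (S (rho + n.+1%:R)) + hlim al be) - (hprim al be (S (rho - n%:R)) - hlim al be) by ring.
by apply: le_lt_trans (nmB _ _) _; apply: lt_le_trans (ltrD A1 A2) _; rewrite -splitr.
Qed.

(** From |k|^2 = c the factor 1/k is conj k / c, and [gauss_eta] rewrites conj k by a conjugate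
    Gauss sum; the unknown multiplier disappears. The factor (12/m) may be inserted twice because
    its square is 1. *)
Lemma jump_value : 2 * 'i%C * K1 * - (2 * hlim al be) = jumpv c p.
Proof.
have GE := gauss_eta c0 (fun s cs => (HK cs).1) m%:Z.
have kJ : conjc k = c%:R / k.
  by apply: (mulfI kap_neq0); rewrite mul_conjc nk mulrC divfK ?kap_neq0// rmorph_nat.
have M0' : 0 < M%:R :> R by rewrite ltr0n.
have m0' : 0 < m%:R :> R by rewrite ltr0n m_gt0.
rewrite /jumpv GE /al /be (hlim_Psi c0 m0' M0').
have conjM (x y : C) : conjc (x * y) = conjc x * conjc y by rewrite rmorphM.
rewrite (conjM (_ * _ * _)) (conjM (_ * _)) (conjM _ k) kJ conj_e2pi.
have conjI (j : int) : conjc (j%:~R : C) = j%:~R by rewrite intC conjc_real.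
have conjN (j : nat) : conjc (j%:R : C) = j%:R by rewrite natC conjc_real.
rewrite conjc_real conjI.
have -> : conjc (- (m%:~R ^+ 2 * r%:~R / (24 * c%:R)) : C) = - (m%:R ^+ 2 * r%:R / (24 * c%:R)).
  have -> : - (m%:~R ^+ 2 * r%:~R / (24 * c%:R)) = (- (m%:R ^+ 2 * r%:R / (24 * c%:R)))%:C :> C.
    by rewrite rmorphN !rmorphM fmorphV !rmorphM /= !rmorph_nat -!pmulrn.
  by rewrite conjc_real rmorphN !rmorphM fmorphV !rmorphM /= !rmorph_nat.
have phE : e2pi (- (M%:R * p%:~R / (24 * c%:R))) * e2pi (- - (m%:R ^+ 2 * r%:R / (24 * c%:R))) = ph.
  by rewrite -e2piD; congr e2pi; field; rewrite den_neq0.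
set E2 := e2pi (- - _) in phE *; set E3 := e2pi _ in phE *.
have chi2 : (chi m%:Z)%:~R ^+ 2 = 1 :> C by rewrite -rmorphXn /= (chi_unit m2).
have M0C : M%:R != 0 :> C by rewrite pnatr_eq0 -lt0n.
rewrite /K1 -phE; clearbody E2 E3; move: (Psi _) => psi.
rewrite !(rmorphM, fmorphV, rmorphXn) /= !rmorph_nat.
have i2 : 'i%C * 'i%C = -1 :> C by rewrite -expr2 sqr_i.
move: (psi%:C) ((Num.sqrt 12)%:C) => ps s12.
have -> : 2 * 'i%C * - (k^-1 * c%:R ^- 2 * (E3 * E2)) * - (2 * ('i%C * (s12 * m%:R * c%:R ^+ 2 * (2 * M%:R)^-1 * ps))) =
  ('i%C * 'i%C) * (2 * m%:R * s12 / (M%:R * k) * ps * (E3 * E2)) by field; rewrite kap_neq0 den_neq0 M0C.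
have -> : - (2 * m%:R / (M%:R * c%:R) * (chi m%:Z)%:~R * ps * (E3 * (s12 * (c%:R / k) * (chi m%:Z)%:~R * E2))) =
  - ((chi m%:Z)%:~R ^+ 2 * (2 * m%:R * s12 / (M%:R * k) * ps * (E3 * E2))) by field; rewrite kap_neq0 den_neq0 M0C.
by rewrite chi2 i2 mulN1r mul1r.
Qed.

Lemma one_jump : cvto (fun n => H (w (rho + n.+1%:R)) - H (w (rho - n%:R))) (jumpv c p).
Proof.
have := cvtoD rem_lim (cvtoZ (2 * 'i%C * K1) hprim_jump); rewrite add0r jump_value.
by apply: cvto_ext => n; rewrite /rem; ring.
Qed.

End OneJump.

(* Kloosterman sums for the multiplier of 1/eta, which gauss_eta writes with Gauss sums. *)
Definition kloos (M m c : nat) : C :=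
  \sum_(p < c | coprime c p) e2pi (- (M%:R * p%:R / (24 * c%:R))) * conjc (gaussS R p%:Z c m%:Z).

Theorem rademacher : hasum (fun c : nat => if c == 0%N then 0 else
    2 * m%:R / (M%:R * c%:R) * (chi m%:Z)%:~R * (Psi (pi * m%:R * Num.sqrt M%:R / (6 * c%:R)))%:C * kloos M m c)
  (a (n0 + N0)%N).
Proof.
have [F [F1 F2]] := qser_prim wth_qser; set bet := a _ in F1 *.
pose H z := F z + bet * z.
have HT z (n : int) : 0 < complex.Im z -> H (z + n%:~R) = H z + bet * n%:~R.
  by move=> z0; rewrite /H F2// mulrDr addrA.
have [K [K0 HK]] := wth_diff_bound F1.
have HJ (c r : nat) : (0 < c)%N -> coprime c r -> exists p q : int, p * r%:Z - q * c%:Z = 1 /\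
    cvto (fun n => H (mob p q c r (rho + n.+1%:R)) - H (mob p q c r (rho - n%:R))) (jumpv c (minv c r)%:Z).
  move=> c0 cp; have [q e] := minv_bezout c0 cp.
  exists (minv c r)%:Z, q; split=> //.
  have dv : (c%:Z %| (minv c r)%:Z * r%:Z - 1)%Z by rewrite -e opprB addrC subrK dvdz_mull.
  have [k [nk Hk]] := eta_modular (@jinv_T R) (@jinv_S R) c0 dv.
  exact: (one_jump F1 c0 e nk Hk).
have := hasumN (coset_sum HT K0 HK HJ); rewrite opprK; apply: hasum_ext => -[|c'] /=; first by rewrite oppr0.
set c := c'.+1; have c0 : (0 < c)%N by [].
(* The rows are indexed by d = r but the jump involves its inverse p modulo c; inversion permutes
   the residues prime to c. *)
rewrite (sum_minv (fun r : nat => jumpv c r%:Z) c0) -sumrN /kloos mulr_sumr.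
by apply: eq_bigr => p _; rewrite /jumpv opprK -pmulrn.
Qed.

End WithData.
End Jump.

(** * The Fourier expansion of F23 *)

Section CountRoots.

Lemma count_spaced (l k : nat) (P : pred nat) : (0 < l)%N ->
  (forall b b', P b -> P b' -> b = b' %[mod l]) -> (count P (iota 0 (k * l)) <= k)%N.
Proof.
move=> l0 H; rewrite -size_filter -(size_map (fun b => b %/ l)%N) -[leqRHS](size_iota 0).
apply: uniq_leq_size.
  rewrite map_inj_in_uniq ?filter_uniq ?iota_uniq// => b b'.
  rewrite !mem_filter => /andP[Pb _] /andP[Pb' _] e.
  by rewrite (divn_eq b l) (divn_eq b' l) e (H b b').
move=> y /mapP[b]; rewrite mem_filter !mem_iota /= add0n => /andP[_ bk] ->.
by rewrite add0n ltn_divLR.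
Qed.

Lemma eqn_mod_lcm (m n b b' : nat) : b = b' %[mod m] -> b = b' %[mod n] -> b = b' %[mod lcmn m n].
Proof.
wlog le : b b' / (b <= b')%N.
  by move=> W h1 h2; case/orP: (leq_total b b') => h; [|symmetry]; apply: W.
move=> /eqP h1 /eqP h2; apply/eqP.
rewrite eq_sym eqn_mod_dvd// in h1; rewrite eq_sym eqn_mod_dvd// in h2.
by rewrite eq_sym eqn_mod_dvd// dvdn_lcm h1 h2.
Qed.

Definition root23 (A b : nat) : bool := (24 * A %| b ^ 2 + 23)%N.

(** If b and b1 are both roots, A divides (b - b1)(b + b1), with 12A - b1 standing for -b1. The
    factors g and A/g of A in the two brackets are almost coprime: a common divisor divides 2b,
    hence 4 b^2 and 4 * 23 = 92. *)
Lemma gcd_cofactor (A b1 b : nat) : (0 < A)%N -> (b1 <= 12 * A)%N -> root23 A b1 -> root23 A b ->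
  let g := gcdn A (b + (12 * A - b1)) in
  [/\ (g %| b + (12 * A - b1))%N, (A %/ g %| b + b1)%N & (A <= 92 * lcmn g (A %/ g))%N].
Proof.
move=> A0 b1A r1 r2 g; have [e be] : exists e, (b1 + e = 12 * A)%N by exists (12 * A - b1)%N; rewrite subnKC.
have -> : (12 * A - b1 = e)%N by rewrite -be addKn.
have gE : g = gcdn A (b + e) by rewrite /g -be addKn.
have g0 : (0 < g)%N by rewrite gcdn_gt0 A0.
have gA : (g %| A)%N by rewrite dvdn_gcdl.
have gt : (g %| b + e)%N by rewrite gE dvdn_gcdr.
have dA (x : nat) : root23 A x -> (A %| x ^ 2 + 23)%N by apply: dvdn_trans; rewrite dvdn_mull.
have At : (A %| (b + e) * (b + b1))%N.
  rewrite -(@dvdn_addl (b1 ^ 2 + 23)) ?dA//.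
  rewrite (_ : (b + e) * (b + b1) + (b1 ^ 2 + 23) = b ^ 2 + 23 + (b1 + e) * (b + b1))%N; last by ring.
  by rewrite be dvdn_add ?dA// dvdn_mulr// dvdn_mull.
have Ag : (A %/ g %| b + b1)%N.
  have cp : coprime (A %/ g) ((b + e) %/ g) 
    by rewrite /coprime -(eqn_pmul2l g0) muln1 muln_gcdr mulnC divnK// mulnC divnK// -gE.
  rewrite -(Gauss_dvdr _ cp) -(@dvdn_pmul2r g)// divnK// mulnAC divnK//.
split=> //; rewrite -{1}(divnK gA) mulnC -muln_lcm_gcd mulnC leq_mul2r; apply/orP; right.
set d := gcdn g _; have dg : (d %| g)%N := dvdn_gcdl _ _; have dA' : (d %| A %/ g)%N := dvdn_gcdr _ _.
have dAA : (d %| A)%N := dvdn_trans dg gA.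
have d2 : (d %| 2 * b)%N.
  rewrite -(@dvdn_addl (b1 + e)); last by rewrite be dvdn_mull.
  rewrite (_ : 2 * b + (b1 + e) = (b + e) + (b + b1))%N; last by ring.
  by rewrite dvdn_add ?(dvdn_trans dg gt) ?(dvdn_trans dA' Ag).
have : (d %| 92)%N.
  have d4 : (d %| 4 * b ^ 2)%N.
    have -> : (4 * b ^ 2 = (2 * b) * (2 * b))%N by rewrite mulnACA (mulnn b).
    by rewrite dvdn_mulr.
  rewrite -(dvdn_addr _ d4).
  rewrite (_ : 4 * b ^ 2 + 92 = 4 * (b ^ 2 + 23))%N; last by ring.
  by rewrite dvdn_mull// (dvdn_trans dAA (dA _ r2)).
by apply: dvdn_leq.
Qed.

Definition nroots (A : nat) : nat := count (root23 A) (iota 0 (12 * A)).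

Lemma count_fibers (T : eqType) (D s : seq T) (P : pred T) (f : T -> T) :
  (forall x, x \in s -> P x -> f x \in D) ->
  (count P s <= \sum_(g <- D) count (fun x => P x && (f x == g)) s)%N.
Proof.
elim: s => [|x s IH] H; first by rewrite big1.
rewrite /= big_split /=; apply: leq_add; last by apply: IH => y ys; apply: H; rewrite inE ys orbT.
case: (boolP (P x)) => //= Px; have := H x (mem_head _ _) Px.
by move=> /(big_rem _) -> /=; rewrite eqxx leq_addr.
Qed.

(** After fixing one root, the roots with a given gcd g agree modulo lcm(g, A/g) >= A/92, so at most
    12 * 92 = 1104 of them lie below 12A. *)
Lemma nroots_divisors (A : nat) : (0 < A)%N -> (nroots A <= 1104 * size (divisors A))%N.
Proof.
move=> A0; case: (boolP (has (root23 A) (iota 0 (12 * A)))) => [/hasP[b1]|]; last first.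
  by rewrite has_count -leqNgt /nroots; lia.
rewrite mem_iota add0n => /andP[_ /ltnW b1A] r1.
pose f b := gcdn A (b + (12 * A - b1)).
apply: leq_trans (@count_fibers _ (divisors A) _ _ f _) _.
  by move=> x _ _; rewrite -dvdn_divisors// dvdn_gcdl.
rewrite -sum1_size big_distrr /= !big_seq; apply: leq_sum => g; rewrite -dvdn_divisors// muln1 => gA.
case: (boolP (has (fun x => root23 A x && (f x == g)) (iota 0 (12 * A)))) => [/hasP[b2 _ /andP[r2 /eqP fg]]|]; last first.
  by rewrite has_count -leqNgt; lia.
have [_ _ le] := gcd_cofactor A0 b1A r1 r2; rewrite -/(f b2) fg in le.
have l0 : (0 < lcmn g (A %/ g))%N by move: le A0; case: (lcmn _ _) => //; rewrite muln0; lia.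
apply: leq_trans (count_spaced 1104 l0 (P := fun x => root23 A x && (f x == g)) _); last first.
  move=> b b' /andP[rb /eqP fb] /andP[rb' /eqP fb'].
  have [h1 h2 _] := gcd_cofactor A0 b1A r1 rb; have [h3 h4 _] := gcd_cofactor A0 b1A r1 rb'.
  rewrite -/(f b) fb in h1 h2; rewrite -/(f b') fb' in h3 h4.
  apply: eqn_mod_lcm; apply/eqP.
    by rewrite -(eqn_modDr (12 * A - b1)); move: h1 h3; rewrite /dvdn => /eqP -> /eqP ->.
  by rewrite -(eqn_modDr b1); move: h2 h4; rewrite /dvdn => /eqP -> /eqP ->.
have -> : (1104 * lcmn g (A %/ g) = 12 * A + (1104 * lcmn g (A %/ g) - 12 * A))%N by lia.
by rewrite iotaD count_cat leq_addr.
Qed.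

Lemma size_divisors (A s : nat) : (0 < A)%N -> (A < s.+1 ^ 2)%N -> (size (divisors A) <= 2 * s)%N.
Proof.
move=> A0 As; rewrite -(count_predC (fun g => g <= s)%N (divisors A)) mul2n -addnn.
have Dp g : g \in divisors A -> (0 < g)%N by rewrite -dvdn_divisors// => /dvdn_gt0 ->.
apply: leq_add.
  rewrite -size_filter -[leqRHS](size_iota 1); apply: uniq_leq_size; rewrite ?filter_uniq ?divisors_uniq// => g.
  by rewrite mem_filter mem_iota => /andP[gs /Dp g0]; rewrite g0 add1n ltnS.
rewrite -size_filter -(size_map (fun g => A %/ g)%N) -[leqRHS](size_iota 1).
apply: uniq_leq_size.
  rewrite map_inj_in_uniq ?filter_uniq ?divisors_uniq// => g g'.
  rewrite !mem_filter -!dvdn_divisors// => /andP[_ gA] /andP[_ gA'] e.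
  have [u0 v0] : (0 < g)%N /\ (0 < g')%N by rewrite !(dvdn_gt0 A0).
  have q0 : (0 < A %/ g)%N by rewrite divn_gt0// dvdn_leq.
  by apply/eqP; rewrite -(eqn_pmul2l q0) {2}e !divnK.
move=> y /mapP[g]; rewrite mem_filter -dvdn_divisors//= -ltnNge => /andP[sg gA] ->.
have g0 : (0 < g)%N by rewrite (dvdn_gt0 A0).
rewrite mem_iota divn_gt0// (dvdn_leq A0 gA) /= add1n ltn_divLR//.
by apply: leq_trans As _; rewrite -mulnn leq_mul2l sg orbT.
Qed.

(** For fixed n the factor [Psi] is O(1/A^2). The trivial count 12A would leave a harmonic series;
    with a count O(A^(1/2)) the series converges. *)
Lemma nroots_sqrt (R : realType) : exists k : nat,
  forall A : nat, (0 < A)%N -> (nroots A)%:R <= k%:R * Num.sqrt A%:R :> R.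
Proof.
have [k Hk] : exists k, forall A, (0 < A)%N -> (nroots A <= k * size (divisors A))%N.
  by exists 1104; apply: nroots_divisors.
exists (k * 2)%N => A A0; pose s := Num.truncn (Num.sqrt (A%:R : R)).
have sq0 := sqrtr_ge0 (A%:R : R); have /andP[h1 h2] := truncn_itv sq0; rewrite -/s in h1 h2.
have As : (A < s.+1 ^ 2)%N.
  by rewrite -(ltr_nat R) natrX -[ltLHS]sqr_sqrtr// ltrXn2r// nnegrE.
have := leq_trans (Hk A A0) (leq_mul (leqnn k) (size_divisors A0 As)).
by rewrite -(ler_nat R) => /le_trans; apply; rewrite mulnA natrM ler_wpM2l.
Qed.

Lemma sqrt_le_pow (R : realType) (x : R) : 1 <= x -> Num.sqrt x <= Num.sqrt (Num.sqrt x) ^- 5 * x ^+ 2.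
Proof.
move=> x1; have x0 : 0 <= x by apply: le_trans x1.
have w1 := sqrt_ge1 (sqrt_ge1 x1); set w := Num.sqrt (Num.sqrt x) in w1 *.
have e1 : Num.sqrt x = w ^+ 2 by rewrite sqr_sqrtr// sqrtr_ge0.
have e2 : x = w ^+ 4 by rewrite -(sqr_sqrtr x0) e1 -exprM.
have w0 : 0 < w by apply: lt_le_trans w1.
rewrite e1 e2 -exprM mulrC ler_pdivlMr ?exprn_gt0// -exprD.
by rewrite ler_weXn2l.
Qed.

Lemma nroots_zw (R : realType) : exists K : R, 0 <= K /\
  forall A : nat, (nroots A.+1)%:R / A.+1%:R ^+ 2 <= K * zw R A.
Proof.
have [k Hk] := nroots_sqrt R; exists k%:R; split=> // A.
rewrite ler_pdivrMr ?exprn_gt0 ?ltr0n//; apply: le_trans (Hk _ (ltn0Sn A)) _.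
by rewrite -[leRHS]mulrA ler_wpM2l// /zw sqrt_le_pow// ler1n.
Qed.

End CountRoots.

(** * An upper bound for the kernel Psi *)

Section PsiBound.
Variable R : realType.

Lemma is_derive_expN (x : R) : is_derive x 1 (fun x => expR (- x)) (- expR (- x)).
Proof.
have h : is_derive x 1 (fun x : R => - x) (- 1) by apply: is_deriveN.
have d : is_derive x 1 (fun x => expR (- x)) (expR (- x) * -1).
  exact: (@is_derive1_comp _ (@expR R) (fun x => - x) x _ _ (is_derive_expR (- x)) h).
by apply: is_derive_eq d _; rewrite mulrN1.
Qed.

Lemma Psi_num_ge0 (x : R) : 0 <= x -> 0 <= x * (expR x + expR (- x)) - (expR x - expR (- x)).
Proof.
pose f (x : R) := x * (expR x + expR (- x)) - (expR x - expR (- x)).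
apply: (@mvt_ge0 R f (fun x => x * (expR x - expR (- x)))) => [|y|y y0].
- by rewrite /f mul0r oppr0 subrr subr0.
- have d1 := is_derive_expR y; have d2 := is_derive_expN y.
  have d3 := is_deriveD d1 d2; have d4 := is_deriveB d1 d2.
  have d5 := is_deriveB (is_deriveM (is_derive_id y 1) d3) d4.
  have d6 : is_derive y 1 f _ := d5; apply: is_derive_eq d6 _.
  change (y * (expR y - expR (- y)) + (expR y + expR (- y)) * 1 - (expR y - - expR (- y)) = y * (expR y - expR (- y))).
  by ring.
- by rewrite mulr_ge0// subr_ge0 ler_expR; lra.
Qed.

Lemma Psi_num_le (x : R) : 0 <= x ->
  0 <= 2 * x ^+ 3 * expR x - (x * (expR x + expR (- x)) - (expR x - expR (- x))).
Proof.
pose f (x : R) := 2 * x ^+ 3 * expR x - (x * (expR x + expR (- x)) - (expR x - expR (- x))).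
apply: (@mvt_ge0 R f (fun x => 6 * x ^+ 2 * expR x + 2 * x ^+ 3 * expR x - x * (expR x - expR (- x)))) => [|y|y y0].
- by rewrite /f expr0n mulr0 !mul0r oppr0 subrr !subr0.
- have d1 := is_derive_expR y; have d2 := is_derive_expN y.
  have d3 := is_deriveD d1 d2; have d4 := is_deriveB d1 d2.
  have d5 := is_deriveB (is_deriveM (is_derive_id y 1) d3) d4.
  have d7 := is_deriveM (is_deriveZ 2 (is_deriveX 3 (is_derive_id y (1 : R)))) d1.
  have d6 : is_derive y 1 f _ := is_deriveB d7 d5; apply: is_derive_eq d6 _.
  change (2 * y ^+ 3 * expR y + expR y * (2 * (3 * y ^+ 2 * 1)) -
    (y * (expR y - expR (- y)) + (expR y + expR (- y)) * 1 - (expR y - - expR (- y))) =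
    6 * y ^+ 2 * expR y + 2 * y ^+ 3 * expR y - y * (expR y - expR (- y))).
  by ring.
have e1 : 1 - 2 * y <= expR (- (2 * y)) by have := expR_ge1Dx (- (2 * y)); lra.
have e2 : expR (- y) = expR y * expR (- (2 * y)) by rewrite -expRD; congr expR; ring.
have e0 := expR_gt0 y.
have e3 : expR y - expR (- y) <= 2 * y * expR y by rewrite e2; nra.
have h1 := ler_wpM2l y0 e3.
have h2 : 0 <= 2 * y ^+ 3 * expR y by rewrite !mulr_ge0 ?exprn_ge0// ltW.
have h3 : 0 <= y ^+ 2 * expR y by rewrite mulr_ge0 ?sqr_ge0// ltW.
lra.
Qed.

(** The quadratic vanishing at 0 is what counts: the argument is of order 1/c for large c. *)
Lemma Psi_bound (x : R) : 0 < x -> `|Psi x| <= x ^+ 2 * expR x.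
Proof.
move=> x0; have h1 := Psi_num_ge0 (ltW x0); have h2 := Psi_num_le (ltW x0).
have -> : Psi x = (x * (expR x + expR (- x)) - (expR x - expR (- x))) / (2 * x).
  by rewrite /Psi; field; lra.
rewrite ger0_norm ?divr_ge0//; last lra.
rewrite ler_pdivrMr; last lra.
by rewrite (_ : x ^+ 2 * expR x * (2 * x) = 2 * x ^+ 3 * expR x); [lra|ring].
Qed.

End PsiBound.

(** * Quadratic forms of discriminant -23 and their roots *)

Section FormSide.
Variable R : realType.
Local Notation C := R[i].

(** With a = 6(A+1) the discriminant forces 24(A+1)c = b^2 + 23; if the division is not exact, the
    rounded triple is not in [forms] and contributes nothing. *)
Definition hform (j : nat * int) : Defs.form :=
  ((6 * j.1.+1)%N%:Z, j.2, ((j.2 ^+ 2 + 23) %/ (24 * j.1.+1)%N%:Z)%Z).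

Lemma hform_inj : injective hform.
Proof. by move=> [A b] [A' b'] [] h -> _; congr (_, _); lia. Qed.

Lemma hformP (Q : Defs.form) (r : int) : forms R 6 (-23) r Q -> exists j, hform j = Q.
Proof.
case: Q => -[a b] c [pd /= disc d6 br].
have a0 : 0 < a.
  have := pd 1 0; rewrite /= expr1n mulr1 expr0n /= !mulr0 !addr0 ltr0z; apply.
  by apply/eqP => -[] /eqP; rewrite oner_eq0.
have [A Aa] : exists A : nat, a = (6 * A.+1)%N%:Z.
  by case/dvdzP: d6 => q e; exists (`|q|.-1)%N; lia.
exists (A, b); rewrite /hform /= -Aa; congr (_, _, _).
have -> : b ^+ 2 + 23 = c * (24 * A.+1)%N%:Z.
  have h : b ^+ 2 = 4 * a * c - 23 by rewrite -[LHS](subrK (4 * a * c)) disc addrC.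
  by rewrite h subrK Aa !PoszM; ring.
by rewrite mulzK.
Qed.

Lemma forms_hform (A : nat) (b r : int) :
  (hform (A, b) \in forms R 6 (-23) r) = ((24 * A.+1)%N %| b ^+ 2 + 23)%Z && (b == r %[mod 12])%Z.
Proof.
apply/idP/idP => [|/andP[dv /eqP br]].
  move/set_mem => -[_ /= disc _ br]; apply/andP; split; last exact/eqP.
  apply/dvdzP; exists ((b ^+ 2 + 23) %/ (24 * A.+1)%N%:Z)%Z; move: disc; set c := (_ %/ _)%Z.
  move=> disc; have : b ^+ 2 = 4 * (6 * A.+1)%N%:Z * c - 23 by rewrite -disc; ring.
  by move=> ->; rewrite !PoszM; ring.
have e : ((b ^+ 2 + 23) %/ (24 * A.+1)%N%:Z)%Z * (24 * A.+1)%N%:Z = b ^+ 2 + 23 by rewrite divzK.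
have disc : b ^+ 2 - 4 * (6 * A.+1)%N%:Z * ((b ^+ 2 + 23) %/ (24 * A.+1)%N%:Z)%Z = -23.
  move: e; set c := (_ %/ _)%Z => e; have -> : b ^+ 2 = c * (24 * A.+1)%N%:Z - 23 by rewrite e addrK.
  by rewrite !PoszM; ring.
apply/mem_set; split => //=; last by rewrite PoszM dvdz_mulr.
move: disc; set c := (_ %/ _)%Z => disc x y xy /=.
set a := (6 * A.+1)%N in disc *.
have a0 : 0 < a%:~R :> R by rewrite ltr0z.
have disc' : (b%:~R ^+ 2 + 23 : R) = 4 * a%:~R * c%:~R.
  move/(congr1 (fun k : int => k%:~R : R)): disc; rewrite intrB !intrM intrN => h.
  lra.
rewrite -(pmulr_rgt0 _ (_ : 0 < 4 * a%:~R)); last by rewrite mulr_gt0.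
have -> : 4 * a%:~R * (a%:~R * x ^+ 2 + b%:~R * x * y + c%:~R * y ^+ 2) =
   (2 * a%:~R * x + b%:~R * y) ^+ 2 + 23 * y ^+ 2 :> R.
  have -> : 4 * a%:~R * (a%:~R * x ^+ 2 + b%:~R * x * y + c%:~R * y ^+ 2) =
    4 * a%:~R ^+ 2 * x ^+ 2 + 4 * a%:~R * b%:~R * x * y + (4 * a%:~R * c%:~R) * y ^+ 2 :> R by ring.
  by rewrite -disc'; ring.
have [y0|y0] := eqVneq y 0; last first.
  by rewrite ltr_wpDl ?sqr_ge0// mulr_gt0// exprn_even_gt0.
rewrite y0 !mulr0 addr0 expr0n mulr0 addr0 exprn_even_gt0//=.
have x0 : x != 0 by apply: contra xy => /eqP ->; rewrite y0.
by apply: mulf_neq0 => //; apply: mulf_neq0; rewrite ?gt_eqF.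
Qed.

Definition dl (A : nat) : R := Num.sqrt 23 / (6 * A.+1%:R).
(** The distance from z to the root of the form in the upper half-plane; the root in the lower
    half-plane differs from it by i times [dl]. *)
Definition hroot (A b : nat) (z : C) : C := z + b%:R / (12 * A.+1%:R) - (0 +i* dl A) / 2.
Definition xAn (A n : nat) : R := pi * n%:R * dl A.

Lemma dl_gt0 A : 0 < dl A.
Proof. by rewrite divr_gt0 ?sqrtr_gt0 ?mulr_gt0 ?ltr0n. Qed.

Lemma dl_sqr A : dl A ^+ 2 = 23 / (36 * A.+1%:R ^+ 2).
Proof. by rewrite expr_div_n sqr_sqrtr// exprMn (_ : 6 ^+ 2 = 36)//; ring. Qed.

Lemma dl_le A : dl A <= 5 / 6.
Proof.
have h : Num.sqrt 23 <= 5 :> R.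
  rewrite (_ : 5 = Num.sqrt (5 ^+ 2)); last by rewrite sqrtr_sqr ger0_norm.
  by rewrite ler_wsqrtr//; lra.
have h1 : 1 <= A.+1%:R :> R by rewrite ler1n.
rewrite ler_pdivrMr; last lra.
by apply: le_trans h _; lra.
Qed.

Lemma iscale (x : R) : (0 +i* x) = 'i%C * x%:C :> C.
Proof. by apply: complex_ext; rewrite ?ReM ?ImM /=; ring. Qed.

Lemma form_factor (A b : nat) (t : int) (z : C) : root23 A.+1 b ->
  form_eval (hform (A, b%:Z + 12 * A.+1%:Z * t)) z 1 =
  6 * A.+1%:R * ((hroot A b z + t%:~R) * (hroot A b z + (0 +i* dl A) + t%:~R)).
Proof.
rewrite /root23 => rt; set B := b%:Z + 12 * A.+1%:Z * t; rewrite /hform /=.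
have dv : ((24 * A.+1)%N %| B ^+ 2 + 23)%Z.
  rewrite (_ : B ^+ 2 + 23 = (24 * A.+1)%N%:Z * (b%:Z * t + 6 * A.+1%:Z * t ^+ 2) + (b ^ 2 + 23)%N%:Z).
    by apply: rpredD; [exact: dvdz_mulr|exact: rt].
  by rewrite /B -(mulnn b) !(PoszD, PoszM); ring.
have e := divzK dv; move: e; set c := (_ %/ _)%Z => /(congr1 (fun k : int => k%:~R : C)).
have A0 : A.+1%:R != 0 :> C by rewrite pnatr_eq0.
rewrite intrM intrD rmorphXn /= => e.
have cE : c%:~R = (B%:~R ^+ 2 + 23) / (24 * A.+1%:R) :> C.
  by rewrite -e -pmulrn natrM mulfK// mulf_neq0// pnatr_eq0.
have BE : B%:~R = b%:R + 12 * A.+1%:R * t%:~R :> C by rewrite /B intrD !intrM.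
rewrite cE BE -pmulrn natrM /hroot iscale.
have d2 : 'i%C ^+ 2 * (dl A)%:C ^+ 2 = - (23 / (36 * A.+1%:R ^+ 2)) :> C.
  rewrite -rmorphXn /= dl_sqr sqr_i mulN1r rmorphM fmorphV rmorphM rmorphXn /= !rmorph_nat.
  by [].
move: (dl A)%:C d2 => d d2.
have -> : 6 * A.+1%:R * ((z + b%:R / (12 * A.+1%:R) - 'i%C * d / 2 + t%:~R) *
    (z + b%:R / (12 * A.+1%:R) - 'i%C * d / 2 + 'i%C * d + t%:~R)) =
  6 * A.+1%:R * ((z + b%:R / (12 * A.+1%:R) + t%:~R) ^+ 2 - 'i%C ^+ 2 * d ^+ 2 / 4) :> C by field.
by rewrite d2; field.
Qed.

(** The heights of the two roots produce e^x and e^(-x) with x = pi n [dl]; the part linear in n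
    gives cosh x, the constant part sinh x / x. *)
Lemma lip_term (A b n : nat) (z : C) :
  ((2 * pi%:C) ^+ 2)^-1 * (6 * A.+1%:R) ^- 2 *
  ((tpi R ^+ 2 / (0 +i* dl A) ^+ 2 * n%:R + 2 * tpi R / (0 +i* dl A) ^+ 3) * e2pi (n%:R * hroot A b z) +
   (tpi R ^+ 2 / (0 +i* dl A) ^+ 2 * n%:R - 2 * tpi R / (0 +i* dl A) ^+ 3) * e2pi (n%:R * (hroot A b z + (0 +i* dl A)))) =
  2 * n%:R / 23 * (Psi (xAn A n))%:C * e2pi (n%:R * b%:R / (12 * A.+1%:R)) * e2pi (n%:R * z).
Proof.
have A0 : A.+1%:R != 0 :> C by rewrite pnatr_eq0.
have d0 : (dl A)%:C != 0 :> C by rewrite -nm_gt0 nm_real normr_gt0 gt_eqF ?dl_gt0.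
have p0 : pi%:C != 0 :> C by rewrite -nm_gt0 nm_real normr_gt0 gt_eqF ?pi_gt0.
have i0 := neq0i R; have i2 := sqr_i R.
have tE : tpi R = 2 * 'i%C * pi%:C.
  by rewrite /tpi iscale rmorphM rmorph_nat /= mulrA (mulrC 'i%C).
have xC : (xAn A n)%:C = pi%:C * n%:R * (dl A)%:C :> C.
  by rewrite /xAn (rmorphM _ _ (dl A)) (rmorphM _ pi) /= rmorph_nat.
have xCN : (- xAn A n)%:C = - (pi%:C * n%:R * (dl A)%:C) :> C by rewrite rmorphN /= xC.
pose E := e2pi (n%:R * b%:R / (12 * A.+1%:R)) * e2pi (n%:R * z) : C.
have e1 : e2pi (n%:R * hroot A b z) = E * (expR (xAn A n))%:C.
  rewrite /E -e2piD -cexp_real !e2piE -cexpD; congr cexp.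
  rewrite tE /hroot iscale xC.
  have -> : 2 * 'i%C * pi%:C * (n%:R * (z + b%:R / (12 * A.+1%:R) - 'i%C * (dl A)%:C / 2)) =
    2 * 'i%C * pi%:C * (n%:R * b%:R / (12 * A.+1%:R) + n%:R * z) - 'i%C ^+ 2 * pi%:C * n%:R * (dl A)%:C by field.
  by rewrite i2; ring.
have e2 : e2pi (n%:R * (hroot A b z + (0 +i* dl A))) = E * (expR (- xAn A n))%:C.
  rewrite /E -e2piD -cexp_real !e2piE -cexpD; congr cexp.
  rewrite xCN tE /hroot iscale.
  have -> : 2 * 'i%C * pi%:C * (n%:R * (z + b%:R / (12 * A.+1%:R) - 'i%C * (dl A)%:C / 2 + 'i%C * (dl A)%:C)) =
    2 * 'i%C * pi%:C * (n%:R * b%:R / (12 * A.+1%:R) + n%:R * z) + 'i%C ^+ 2 * pi%:C * n%:R * (dl A)%:C by field.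
  by rewrite i2; ring.
rewrite e1 e2 -[RHS]mulrA -/E tE iscale.
have [->|n0] := eqVneq n 0%N.
  have -> : xAn A 0 = 0 by rewrite /xAn mulr0 mul0r.
  by rewrite oppr0 !mulr0 !mul0r add0r sub0r mulNr addrC addNr mulr0.
have nC : n%:R != 0 :> C by rewrite pnatr_eq0.
have d2 : (dl A)%:C ^+ 2 = 23 / (36 * A.+1%:R ^+ 2) :> C.
  by rewrite -rmorphXn /= dl_sqr rmorphM fmorphV rmorphM rmorphXn /= !rmorph_nat.
have PE : (Psi (xAn A n))%:C = ((expR (xAn A n))%:C + (expR (- xAn A n))%:C) / 2 -
    ((expR (xAn A n))%:C - (expR (- xAn A n))%:C) / (2 * (pi%:C * n%:R * (dl A)%:C)) :> C.
  by rewrite -xC /Psi !(rmorphB, rmorphD, rmorphM, fmorphV) /= !rmorph_nat.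
rewrite PE; clear e1 e2; clearbody E; move: (expR _)%:C (expR _)%:C => X Y.
clear PE xC xCN tE.
move: A.+1%:R A0 n%:R nC pi%:C p0 (dl A)%:C d0 d2 => a A0 k nC p p0 d d0 d2.
have -> : (2 * 'i%C * p) ^+ 2 / ('i%C * d) ^+ 2 * k + 2 * (2 * 'i%C * p) / ('i%C * d) ^+ 3 =
   4 * p ^+ 2 / d ^+ 2 * k + ('i%C ^+ 2)^-1 * (4 * p / d ^+ 3) by field; rewrite d0 i0.
have -> : (2 * 'i%C * p) ^+ 2 / ('i%C * d) ^+ 2 * k - 2 * (2 * 'i%C * p) / ('i%C * d) ^+ 3 =
   4 * p ^+ 2 / d ^+ 2 * k - ('i%C ^+ 2)^-1 * (4 * p / d ^+ 3) by field; rewrite d0 i0.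
rewrite i2 invrN invr1.
have -> : 2 * k / 23 = 2 * k / (36 * a ^+ 2 * d ^+ 2) :> C.
  by rewrite d2; field; rewrite A0.
by field; rewrite d0 p0 A0 nC.
Qed.

End FormSide.

(** * Rearrangement of F23 into a Fourier series *)

Section FExpansion.
Variable R : realType.
Local Notation C := R[i].

Definition okb (p : nat * nat) : bool := (p.2 < 12 * p.1.+1)%N && root23 p.1.+1 p.2.

Lemma count_iota_lt (P : pred nat) m n :
  (count (fun i => (i < m)%N && P i) (iota 0 n) <= count P (iota 0 m))%N.
Proof.
rewrite -!size_filter; apply: uniq_leq_size; first by rewrite filter_uniq ?iota_uniq.
by move=> i; rewrite !mem_filter !mem_iota /= !add0n => /andP[/andP[-> ->]].
Qed.

Lemma sum_if_count (P : pred nat) (c : R) n :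
  \sum_(i < n) (if P i then c else 0) = (count P (iota 0 n))%:R * c.
Proof.
rewrite -(big_mkord xpredT (fun i => if P i then c else 0)) -big_mkcond /= big_const_seq iter_addr_0.
by rewrite /index_iota subn0 mulr_natl.
Qed.

Lemma smb_okb : smb (fun p => if okb p then (p.1.+1%:R ^+ 2)^-1 else 0 : R).
Proof.
have [K [K0 HK]] := nroots_zw R.
apply: (@smb_pair R _ _ _ (fun A => (nroots A.+1)%:R / A.+1%:R ^+ 2)).
- by move=> p; case: ifP => // _; rewrite invr_ge0 exprn_ge0.
- move=> A; apply: bsum_nat => [n|n]; first by case: ifP => // _; rewrite invr_ge0 exprn_ge0.
  have -> : \sum_(i < n) (if okb (A, i : nat) then ((A, i : nat).1.+1%:R ^+ 2)^-1 else 0) =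
    \sum_(i < n) (if okb (A, i : nat) then (A.+1%:R ^+ 2)^-1 else 0) :> R by [].
  rewrite (sum_if_count (fun i => okb (A, i))) ler_wpM2r ?invr_ge0 ?exprn_ge0// ler_nat.
  exact: count_iota_lt.
- exact: smb_le HK (smbZ K0 (smb_zw R)).
Qed.

Lemma iscale_half (x : R) : (0 +i* x) / 2 = 0 +i* (x / 2) :> C.
Proof. by rewrite (iscale x) (iscale (x / 2)) rmorphM fmorphV rmorph_nat /= mulrA. Qed.

Definition fcoef (n : nat) (p : nat * nat) : C :=
  if okb p then (chi p.2%:Z)%:~R * (2 * n%:R / 23 * (Psi (xAn R p.1 n))%:C *
    e2pi (n%:R * p.2%:R / (12 * p.1.+1%:R))) else 0.

(** Since [dl] is at most 5/6, the exponential growth in n of the terms is at most [r0 ^+ n],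
    uniformly in A. *)
Let r0 : R := expR (pi * (5 / 6)).

Lemma fcoef_bound n p : nm (fcoef n p) <=
  (if okb p then (p.1.+1%:R ^+ 2)^-1 else 0) * (pi ^+ 2 / 18 * (n%:R ^+ 3 * r0 ^+ n)).
Proof.
rewrite /fcoef; case: ifP => _; last by rewrite nm0 mul0r.
have [->|n0] := eqVneq n 0%N; first by rewrite mulr0 !mul0r mulr0 nm0 expr0n /= !(mul0r, mulr0).
have n0' : 0 < n%:R :> R by rewrite ltr0n lt0n.
have A0 : 0 < p.1.+1%:R :> R by rewrite ltr0n.
have eR : nm (e2pi (n%:R * p.2%:R / (12 * p.1.+1%:R)) : C) = 1.
  by rewrite (_ : _ / _ = (n%:R * p.2%:R / (12 * p.1.+1%:R))%:C) ?nm_e2pi_real// !rmorphM fmorphV rmorphM /= !rmorph_nat.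
rewrite (nmM (chi _)%:~R) (nmM (_ * _%:C)) eR mulr1 (nmM (2 * n%:R / 23)).
have -> : nm (2 * n%:R / 23 : C) = 2 * n%:R / 23.
  rewrite (_ : 2 * n%:R / 23 = (2 * n%:R / 23)%:C) ?nm_real ?ger0_norm ?divr_ge0 ?mulr_ge0//.
  by rewrite !rmorphM fmorphV /= !rmorph_nat.
rewrite nm_real.
have x0 : 0 < xAn R p.1 n by rewrite /xAn !mulr_gt0 ?pi_gt0 ?dl_gt0.
have PB := Psi_bound x0.
have eB : expR (xAn R p.1 n) <= r0 ^+ n.
  rewrite /r0 -expRM_natl ler_expR /xAn -mulrA [leRHS]mulrCA.
  by rewrite ler_wpM2l ?pi_ge0// ler_wpM2l// dl_le.
have e0 : 0 <= 2 * n%:R / 23 :> R by rewrite divr_ge0 ?mulr_ge0.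
apply: (@le_trans _ _ (1 * (2 * n%:R / 23 * (xAn R p.1 n ^+ 2 * r0 ^+ n)))).
  apply: ler_pM => //; rewrite ?nm_ge0 ?mulr_ge0 ?nm_chi// ler_wpM2l//.
  by apply: le_trans PB _; rewrite ler_wpM2l// sqr_ge0.
rewrite mul1r /xAn (exprMn _ _ (dl R p.1)) dl_sqr; apply: eqW.
by move: (r0 ^+ n) => r; field; rewrite ?gt_eqF.
Qed.

Lemma smb_fcoef n : smb (fun p => nm (fcoef n p)).
Proof.
have h : 0 <= pi ^+ 2 / 18 * (n%:R ^+ 3 * r0 ^+ n) :> R.
  by rewrite !mulr_ge0 ?exprn_ge0 ?expR_ge0 ?pi_ge0 ?invr_ge0.
by apply: smb_le (smbZ h smb_okb) => p; rewrite mulrC; apply: fcoef_bound.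
Qed.

Definition cF23 (n : nat) : C := xget 0 [set s | hasum (fcoef n) s]%classic.

Lemma cF23P n : hasum (fcoef n) (cF23 n).
Proof.
by have [s hs] := smb_hasum (smb_fcoef n); rewrite /cF23; case: xgetP => // /(_ s).
Qed.

Lemma cF23_bound : exists K B : R, [/\ 0 <= K, 0 < B & forall n, nm (cF23 n) <= K * B ^+ n].
Proof.
have [M HM] := smb_okb; have M0 := bsum_ge0 HM.
have p0 : 0 <= pi ^+ 2 / 18 :> R by rewrite divr_ge0// sqr_ge0.
exists (pi ^+ 2 / 18 * M), (8 * r0); split=> [||n]; rewrite ?(mulr_ge0 p0)// ?mulr_gt0 ?expR_gt0//.
have h : 0 <= pi ^+ 2 / 18 * (n%:R ^+ 3 * r0 ^+ n) :> R.
  by rewrite mulr_ge0// mulr_ge0 ?exprn_ge0 ?expR_ge0.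
apply: le_trans (hasum_bound (cF23P n) (fun p => fcoef_bound n p) _) _.
  by apply: bsum_le (bsumZ h HM) => p; rewrite mulrC.
rewrite mulrAC ler_wpM2l ?(mulr_ge0 p0)//.
rewrite exprMn ler_wpM2r ?exprn_ge0 ?expR_ge0//.
have -> : 8 = 2 ^+ 3 :> R by ring.
rewrite exprAC; apply: lerXn2r; rewrite ?nnegrE ?exprn_ge0//.
by rewrite -natrX ler_nat; apply: ltnW; apply: ltn_expl.
Qed.

Lemma im_bounds (y d : R) : 1 < y -> d <= 5 / 6 -> 0 < d -> 1 / 2 <= y - d / 2 /\ 1 / 2 <= y - d / 2 + d.
Proof. by move=> *; split; lra. Qed.

Lemma exp_bound (y : R) : 1 < y -> pi * (5 / 6) - 2 * pi * y < 0.
Proof. by have p0 := pi_gt0 R => y1; nra. Qed.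

Lemma inv_bound (K w a v1 v2 : R) : 0 < K -> 1 <= w -> 0 < a -> 0 < v1 ^+ 2 -> 0 < v2 ^+ 2 ->
  2 * w <= K * v1 ^+ 2 -> 2 * w <= K * v2 ^+ 2 ->
  ((6 * a * (v2 * v1)) ^+ 2)^-1 <= 36^-1 * (K / 2) ^+ 2 * ((a ^+ 2)^-1 * w ^- 2).
Proof.
move=> K0 w1 a0 p1 p2 H1 H2; have w0 : 0 <= 2 * w by lra.
have := ler_pM w0 w0 H1 H2.
rewrite (_ : K * v1 ^+ 2 * (K * v2 ^+ 2) = K ^+ 2 * (v1 * v2) ^+ 2); last by ring.
move=> H; have v0 : 0 < (v1 * v2) ^+ 2 by rewrite exprMn mulr_gt0.
have -> : 36^-1 * (K / 2) ^+ 2 * ((a ^+ 2)^-1 * w ^- 2) = (36 * a ^+ 2)^-1 * (K ^+ 2 / (2 * w * (2 * w))).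
  by field; rewrite ?gt_eqF//; lra.
have -> : ((6 * a * (v2 * v1)) ^+ 2)^-1 = (36 * a ^+ 2)^-1 * ((v1 * v2) ^+ 2)^-1.
  by rewrite -invfM; congr (_^-1); ring.
rewrite ler_wpM2l ?invr_ge0 ?mulr_ge0 ?exprn_ge0 ?(ltW a0)//.
have ww : 0 < 2 * w * (2 * w) by rewrite mulr_gt0//; lra.
by rewrite ler_pdivlMr// mulrC ler_pdivrMr.
Qed.

Section Point.
Variable z : C.
Hypothesis z1 : (1 : R) < complex.Im z.

Let Qv (x : nat * nat * int) : C :=
  form_eval (hform (x.1.1, x.1.2%:Z + 12 * x.1.1.+1%:Z * x.2)) z 1 ^- 2.
Let G (x : nat * nat * int) : C := if okb x.1 then Qv x else 0.

(** All zeros of the forms have height at most 5/12, so above height 1 both linear factors keep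
    imaginary part at least 1/2. *)
Lemma hroot_bounds A b : (b < 12 * A.+1)%N ->
  [/\ `|complex.Re (hroot A b z)| <= `|complex.Re z| + 1, 1 / 2 <= complex.Im (hroot A b z) &
  1 / 2 <= complex.Im (hroot A b z + (0 +i* dl R A))].
Proof.
move=> bA; have d1 := dl_le R A; have d0 := dl_gt0 R A.
have q0 : 0 <= b%:R / (12 * A.+1%:R) :> R by rewrite divr_ge0 ?mulr_ge0.
have q1 : b%:R / (12 * A.+1%:R) <= 1 :> R.
  by rewrite ler_pdivrMr ?mul1r -?natrM ?ler_nat ?ltr0n// ltnW.
have E : hroot A b z = (complex.Re z + b%:R / (12 * A.+1%:R)) +i* (complex.Im z - dl R A / 2).
  have qC : b%:R / (12 * A.+1%:R) = (b%:R / (12 * A.+1%:R))%:C :> C.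
    by rewrite !rmorphM fmorphV rmorphM /= !rmorph_nat.
  have hC : (0 +i* dl R A) / 2 = 0 +i* (dl R A / 2).
    exact: iscale_half.
  rewrite /hroot qC hC; move: (b%:R / _) (dl R A / 2) => x y.
  by case: (z) => u v; apply: complex_ext => /=; ring.
have [i1 i2] := im_bounds z1 d1 d0.
rewrite E /=; split=> //.
by apply: le_trans (ler_normD _ _) _; rewrite lerD2l ger0_norm.
Qed.

Lemma smb_G : smb (fun x => nm (G x)).
Proof.
have h2 : (0 : R) < 1 / 2 by lra.
have [K [K0 HK]] := lattice_bound (`|complex.Re z| + 1) h2.
have c0 : 0 <= 36^-1 * (K / 2) ^+ 2 by rewrite mulr_ge0 ?sqr_ge0 ?invr_ge0.
apply: smb_le (smbZ c0 (smb_prod _ _ smb_okb (smb_zw_int R))).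
- move=> [[A b] t] /=; rewrite /G /=; case: ifP => [ok|_]; last by rewrite nm0 mul0r mulr0.
  have [bA rt] : (b < 12 * A.+1)%N /\ root23 A.+1 b := andP ok.
  have [b1 b2 b3] := hroot_bounds bA.
  have -> : Qv (A, b, t) = form_eval (hform (A, b%:Z + 12 * A.+1%:Z * t)) z 1 ^- 2 by [].
  rewrite form_factor// nmV nmX (nmM (6 * _)) (nmM (hroot _ _ _ + _)) (nmM 6) !(nm_nat R).
  have n1 : ((1, t) : int * int) != (0, 0) by [].
  have b4 : `|complex.Re (hroot A b z + (0 +i* dl R A))| <= `|complex.Re z| + 1 by rewrite ReD /= addr0.
  have H1 := HK _ b4 b3 1 t n1; have H2 := HK _ b1 b2 1 t n1; rewrite !mulr1z !mul1r in H1; rewrite !mulr1z !mul1r in H2.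
  set v1 := nm (_ + _ + _) in H1 *; set v2 := nm (_ + _) in H2 *.
  have v10 : 0 <= v1 := nm_ge0 _; have v20 : 0 <= v2 := nm_ge0 _.
  set w : R := `|t|%N.+1%:R in H1 H2 *; have w1 : 1 <= w by rewrite ler1n.
  have p1 : 0 < v1 ^+ 2 by rewrite -(pmulr_rgt0 _ K0); apply: lt_le_trans H1; rewrite mulr_gt0.
  have p2 : 0 < v2 ^+ 2 by rewrite -(pmulr_rgt0 _ K0); apply: lt_le_trans H2; rewrite mulr_gt0.
  have A0 : 0 < A.+1%:R :> R by rewrite ltr0n.
  have z2 : w ^- 2 <= zw R `|t| by apply: zw_ge.
  apply: le_trans (_ : 36^-1 * (K / 2) ^+ 2 * ((A.+1%:R ^+ 2)^-1 * w ^- 2) <= _); last first.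
    by rewrite ler_wpM2l// ler_wpM2l// invr_ge0 exprn_ge0.
  by apply: inv_bound.
- by move=> p; case: ifP => // _; rewrite invr_ge0 exprn_ge0.
- by move=> t; apply: zw_ge0.
Qed.

Let h1 (j : nat * int) : nat * nat * int :=
  ((j.1, `|(j.2 %% (12 * j.1.+1)%N%:Z)%Z|%N), (j.2 %/ (12 * j.1.+1)%N%:Z)%Z).

Lemma split_mod (A : nat) (b : int) :
  `|(b %% (12 * A.+1)%N%:Z)%Z|%N%:Z + 12 * A.+1%:Z * (b %/ (12 * A.+1)%N%:Z)%Z = b.
Proof. by rewrite gez0_abs ?modz_ge0// addrC mulrC -PoszM -divz_eq. Qed.

Lemma h1_inj : injective h1.
Proof.
by move=> [A b] [A' b'] [] /= <- e1 e2; rewrite -(split_mod A b) e1 e2 split_mod.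
Qed.

Let fr (r : int) (Q : Defs.form) : C := if Q \in forms R 6 (-23) r then form_eval Q z 1 ^- 2 else 0.
Let gr (r : nat) (x : nat * nat * int) : C := if (x.1.2 == r %[mod 12])%N then G x else 0.

Lemma fr_gr (r : nat) j : fr r%:Z (hform j) = gr r (h1 j).
Proof.
case: j => A b; rewrite /fr /gr /G /h1 /okb /Qv /= split_mod forms_hform.
set b0 := absz _; have bE : b = b0%:Z + 12 * A.+1%:Z * (b %/ (12 * A.+1)%N%:Z)%Z by rewrite split_mod.
have b0A : (b0 < 12 * A.+1)%N by rewrite -ltz_nat gez0_abs ?modz_ge0// ltz_pmod.
have -> : ((24 * A.+1)%N %| b ^+ 2 + 23)%Z = root23 A.+1 b0.
  rewrite bE; set t := (_ %/ _)%Z.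
  rewrite (_ : (b0%:Z + 12 * A.+1%:Z * t) ^+ 2 + 23 = (24 * A.+1)%N%:Z * (b0%:Z * t + 6 * A.+1%:Z * t ^+ 2) + (b0 ^ 2 + 23)%N%:Z).
    by rewrite rpredDl ?dvdz_mulr.
  by rewrite -(mulnn b0) !(PoszD, PoszM); ring.
have -> : (b == r%:Z %[mod 12])%Z = (b0 == r %[mod 12])%N.
  have -> : (b = b0%:Z %[mod 12])%Z by rewrite {1}bE -mulrA addrC (mulrC 12) modzMDl.
  by rewrite !modz_nat.
by rewrite b0A /=; case: (_ == _); rewrite ?andbT ?andbF.
Qed.

Lemma hasum_fr (r : nat) : exists s, hasum (gr r) s /\ f2 r%:Z z = ((2 * pi%:C) ^+ 2)^-1 * s.
Proof.
have [s hs] : exists s, hasum (gr r) s.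
  apply: smb_hasum; apply: smb_le smb_G => x; rewrite /gr; case: ifP => // _.
  by rewrite nm0 nm_ge0.
exists s; split=> //; rewrite /f2; congr (_ * _); apply: unordered_sumE.
apply/(@hasum_inj R _ _ _ _ _ hform_inj).
  move=> Q HQ; rewrite ifN//; apply/negP => /set_mem/hformP[j /HQ]; exact.
apply: (@hasum_ext R _ (gr r \o h1)); first by move=> j /=; rewrite -fr_gr.
apply/(@hasum_inj R _ _ _ _ _ h1_inj) => //.
move=> [[A b] t] Hx; rewrite /gr /G /=; case: ifP => // _; rewrite /okb; case: ifP => // /andP[/= bA _].
exfalso; apply: (Hx (A, b%:Z + 12 * A.+1%:Z * t)); rewrite /h1 /= -[12 * A.+1%:Z]/((12 * A.+1)%N%:Z).
have e : ((b%:Z + (12 * A.+1)%N%:Z * t) %/ (12 * A.+1)%N%:Z)%Z = t.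
  by rewrite addrC mulrC divzMDl// divz_small ?addr0//.
congr (_, _, _) => //.
by rewrite addrC mulrC modzMDl modz_small.
Qed.

Lemma chi_split (b : nat) : (chi b%:Z)%:~R =
  (if (b == 1 %[mod 12])%N then 1 else 0) - (if (b == 5 %[mod 12])%N then 1 else 0)
  - (if (b == 7 %[mod 12])%N then 1 else 0) + (if (b == 11 %[mod 12])%N then 1 else 0) :> C.
Proof.
have -> : chi b%:Z = chi (b %% 12)%N%:Z.
  by apply: chi_mod; rewrite /= -modz_nat modz_mod.
have : (b %% 12 < 12)%N by rewrite ltn_mod.
by case: (b %% 12)%N => [|[|[|[|[|[|[|[|[|[|[|[|//]]]]]]]]]]]] _; rewrite /= ?(subr0, addr0, sub0r, add0r, oppr0).
Qed.

Lemma hasum_F23 : hasum (fun x => ((2 * pi%:C) ^+ 2)^-1 * ((chi x.1.2%:Z)%:~R * G x)) (F23 R z).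
Proof.
have [s1 [hs1 e1]] := hasum_fr 1; have [s5 [hs5 e5]] := hasum_fr 5.
have [s7 [hs7 e7]] := hasum_fr 7; have [s11 [hs11 e11]] := hasum_fr 11.
rewrite F23E e1 e5 e7 e11 -!mulrBr -mulrDr.
apply: hasumZ; apply: hasum_ext (hasumD (hasumB (hasumB hs1 hs5) hs7) hs11) => x.
rewrite chi_split /gr; move: (G x) => y.
by case: ifP; case: ifP; case: ifP; case: ifP => *; ring.
Qed.

Lemma F23_expansion : hasum (fun n => cF23 n * e2pi (n%:R * z)) (F23 R z).
Proof.
have z0 : 0 < complex.Im z by apply: lt_trans z1.
pose F (x : nat * nat * nat) : C := fcoef x.2 x.1 * e2pi (x.2%:R * z).
have row p : exists S, hasum (fun t => ((2 * pi%:C) ^+ 2)^-1 * ((chi p.2%:Z)%:~R * G (p, t))) S /\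
    hasum (fun n => F (p, n)) S.
  rewrite /G /=; case: (boolP (okb p)) => ok; last first.
    exists 0; split; first by apply: (@hasum_ext R int (fun=> 0)); [move=> t; rewrite !mulr0|exact: hasum0].
    apply: (@hasum_ext R nat (fun=> 0)); last exact: hasum0.
    by move=> n; rewrite /F /fcoef /= (negbTE ok) mul0r.
  case: p ok => A b ok; have [bA rt] : (b < 12 * A.+1)%N /\ root23 A.+1 b := andP ok; have [_ b2 b3] := hroot_bounds bA.
  have d0 : (0 +i* dl R A) != 0 :> C by rewrite iscale mulf_neq0 ?neq0i// -nm_gt0 nm_real normr_gt0 gt_eqF ?dl_gt0.
  have u1 : 0 < complex.Im (hroot A b z) by lra.
  have u2 : 0 < complex.Im (hroot A b z + (0 +i* dl R A)) by lra.
  have [S [L1 L2]] := lipschitz_form d0 u1 u2.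
  exists ((chi b%:Z)%:~R * (((2 * pi%:C) ^+ 2)^-1 * (6 * A.+1%:R) ^- 2 * S)); split.
    have := hasumZ ((chi b%:Z)%:~R * (((2 * pi%:C) ^+ 2)^-1 * (6 * A.+1%:R) ^- 2)) L1; rewrite -[X in hasum _ X]mulrA.
    apply: hasum_ext => t.
    have -> : Qv (A, b, t) = form_eval (hform (A, b%:Z + 12 * A.+1%:Z * t)) z 1 ^- 2 by [].
    rewrite form_factor// (exprMn 2 (6 * _)) (invfM ((6 * _) ^+ 2)) /=.
    by rewrite [RHS]mulrCA !mulrA.
  have := hasumZ ((chi b%:Z)%:~R * (((2 * pi%:C) ^+ 2)^-1 * (6 * A.+1%:R) ^- 2)) L2; rewrite -[X in hasum _ X]mulrA.
  apply: hasum_ext => n; rewrite -[LHS]mulrA lip_term /F /fcoef /= ok.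
  by rewrite -!mulrA.
pose g p : C := xget 0 [set S | hasum (fun t => ((2 * pi%:C) ^+ 2)^-1 * ((chi p.2%:Z)%:~R * G (p, t))) S]%classic.
have gP p : hasum (fun t => ((2 * pi%:C) ^+ 2)^-1 * ((chi p.2%:Z)%:~R * G (p, t))) (g p).
  by have [S [h _]] := row p; rewrite /g; case: xgetP => // /(_ S).
have hg := hasum_sigma hasum_F23 gP.
have gF p : hasum (fun n => F (p, n)) (g p).
  by have [S [h h']] := row p; rewrite (hasum_uniq (gP p) h).
(* Above height 1 the decay of q^n beats the growth [r0 ^+ n], so the double series over forms and n
   converges absolutely and may be exchanged. *)
have r1 : 0 <= r0 * nm (e2pi z) < 1.
  rewrite mulr_ge0 ?expR_ge0 ?nm_ge0//= nm_e2pi /r0 -expRD expR_lt1.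
  exact: exp_bound.
apply: (@hasum_exch R _ _ F g) hg => //; last first.
  by move=> n; have := hasumZ (e2pi (n%:R * z)) (cF23P n); rewrite [X in hasum _ X]mulrC; apply: hasum_ext => p; rewrite /F mulrC.
have p18 : 0 <= pi ^+ 2 / 18 :> R by rewrite divr_ge0// sqr_ge0.
apply: smb_le (smb_prod _ _ smb_okb (smbZ p18 (smb_poly_geom 3 r1))).
- move=> [p n] /=; rewrite /F nmM /= e2piMn nmX; apply: le_trans (ler_wpM2r _ (fcoef_bound n p)) _.
    by rewrite exprn_ge0 ?nm_ge0.
  by apply: eqW; rewrite exprMn !mulrA.
- by move=> p; case: ifP => // _; rewrite invr_ge0 exprn_ge0.
- by move=> n; rewrite mulr_ge0// mulr_ge0 ?exprn_ge0//; case/andP: r1.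
Qed.

End Point.

Lemma cF23_0 : cF23 0 = 0.
Proof.
apply: (hasum_uniq (cF23P 0)); apply: (@hasum_ext R _ (fun=> 0)); last exact: hasum0.
by move=> p; rewrite /fcoef; case: ifP => // _; rewrite mulr0 !mul0r mulr0.
Qed.

Lemma fourier_F23 (n : nat) : (0 < n)%N -> fourier_coef 1 (F23 R) n%:Z = cF23 n.
Proof.
case: n => // n _; have [K [B [K0 B0 HB]]] := cF23_bound.
have -> : n.+1%:Z = 1 + n%:Z :> int by rewrite intS.
apply: (@fourier_coefE R 1 (F23 R) (fun n => cF23 n.+1) (K * B) B 1) => //.
- by rewrite mulr_ge0// ltW.
- by move=> k; rewrite -mulrA -exprS.
move=> z z1; have := F23_expansion z1 => h.
apply: (@hasum_ext R _ (fun n => cF23 n.+1 * e2pi (n.+1%:R * z))) => [k|].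
  by rewrite -natr1.
by apply/(@hasum_shift R (fun n => cF23 n * e2pi (n%:R * z))) => //; rewrite cF23_0 mul0r.
Qed.

Definition salie (c n : nat) : C :=
  \sum_(l < 12 * c | root23 c l) (chi l%:Z)%:~R * e2pi (n%:R * l%:R / (12 * c%:R)).

Lemma cF23_salie (n : nat) : hasum (fun c : nat => if c == 0%N then 0 else
   2 * n%:R / 23 * (Psi (pi * n%:R * Num.sqrt 23 / (6 * c%:R)))%:C * salie c n) (cF23 n).
Proof.
apply/hasum_shift => //=; apply: (hasum_sigma (cF23P n)) => A.
have xE : pi * n%:R * Num.sqrt 23 / (6 * A.+1%:R) = xAn R A n by rewrite /xAn /dl mulrA.
rewrite xE /salie mulr_sumr.
apply: (@hasum_ext R _ (fun b : nat => if (b < 12 * A.+1)%N then fcoef n (A, b) else 0)).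
  by move=> b; case: ifP => // bA; rewrite /fcoef /okb /= bA.
have -> : \sum_(l < 12 * A.+1 | root23 A.+1 l) 2 * n%:R / 23 * (Psi (xAn R A n))%:C *
    ((chi l%:Z)%:~R * e2pi (n%:R * l%:R / (12 * A.+1%:R))) =
    \sum_(b <- seq_fset tt (iota 0 (12 * A.+1))) if (b < 12 * A.+1)%N then fcoef n (A, b) else 0.
  rewrite sum_seq_fset ?iota_uniq// big_mkcond (_ : iota 0 (12 * A.+1) = index_iota 0 (12 * A.+1)) ?big_mkord; last by rewrite /index_iota subn0.
  apply: eq_bigr => l _; rewrite ltn_ord /fcoef /okb /= ltn_ord /=; case: ifP => // _.
  by rewrite mulrCA mulrA.
apply: hasum_fin => b; rewrite seq_fsetE mem_iota add0n /= => /negbTE ->.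
by [].
Qed.

End FExpansion.

(** * Kronecker symbols *)

Section Kronecker.

(** A product over a range that does not depend on n, with valuations as exponents, makes
    multiplicativity immediate. *)
Lemma kronecker_big (a : int) (n N : nat) : (0 < n < N)%N ->
  kronecker a n = \prod_(q <- iota 0 N) kronecker_prime a q ^+ logn q n.
Proof.
move=> /andP[n0 nN]; rewrite /kronecker gtn_eqF// prime_decompE big_map /=.
have -> : \prod_(q <- iota 0 N) kronecker_prime a q ^+ logn q n =
    \prod_(q <- [seq q <- iota 0 N | q \in primes n]) kronecker_prime a q ^+ logn q n.
  rewrite big_filter [RHS]big_mkcond /=; apply: eq_bigr => q _.
  by case: ifP => //; rewrite -logn_gt0 lt0n => /negbFE/eqP ->; rewrite expr0.
apply: perm_big; apply: uniq_perm; rewrite ?primes_uniq ?filter_uniq ?iota_uniq// => q.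
rewrite mem_filter mem_iota add0n /=; case: (boolP (q \in primes n)) => //= qn.
rewrite mem_primes in qn; case/and3P: qn => _ _ qn.
by rewrite (leq_ltn_trans (dvdn_leq n0 qn) nN).
Qed.

Lemma kronecker_p (a : int) (p : nat) : prime p -> kronecker a p = kronecker_prime a p.
Proof.
move=> pp; rewrite /kronecker gtn_eqF ?prime_gt0// prime_decompE big_map primes_prime// big_seq1 /=.
by rewrite logn_prime// eqxx expr1.
Qed.

Lemma kronecker_mul (a : int) (m n : nat) : (0 < m)%N -> (0 < n)%N ->
  kronecker a (m * n) = kronecker a m * kronecker a n.
Proof.
move=> m0 n0; have mn0 : (0 < m * n)%N by rewrite muln_gt0 m0.
have mN : (m <= m * n)%N by rewrite leq_pmulr.
have nN : (n <= m * n)%N by rewrite leq_pmull.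
rewrite !(@kronecker_big a _ (m * n).+1) ?m0 ?n0 ?mn0 ?ltnS//= -big_split /=.
by apply: eq_bigr => q _; rewrite lognM// exprD.
Qed.

Lemma kronecker_1 (a : int) : kronecker a 1 = 1.
Proof. by rewrite /kronecker /= big_nil. Qed.

Lemma kronecker_mulp (a : int) (p k : nat) : prime p -> (0 < k)%N ->
  kronecker a (p * k) = kronecker_prime a p * kronecker a k.
Proof. by move=> pp k0; rewrite (kronecker_mul a (prime_gt0 pp) k0) (kronecker_p a pp). Qed.

End Kronecker.

(** * The symbols (12/.) and (-23/.) *)

Section Kronecker12.

Lemma chiM (a b : int) : chi (a * b) = chi a * chi b.
Proof.
have red (x : int) : exists k : nat, (k < 12)%N /\ (x = k%:Z %[mod 12])%Z.
  exists `|(x %% 12)%Z|%N; split; first by rewrite -ltz_nat gez0_abs ?modz_ge0// ltz_pmod.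
  by rewrite gez0_abs ?modz_ge0// modz_mod.
have [k [k12 ek]] := red a; have [l [l12 el]] := red b.
rewrite (chi_mod ek) (chi_mod el) (@chi_mod (a * b) (k * l)%N%:Z); last first.
  by rewrite PoszM -modzMml ek modzMml -modzMmr el modzMmr.
clear ek el; have H : all (fun k => all (fun l => chi (k * l)%N%:Z == chi k%:Z * chi l%:Z) (iota 0 12)) (iota 0 12) by vm_compute.
have kI : k \in iota 0 12 by rewrite mem_iota. have lI : l \in iota 0 12 by rewrite mem_iota.
by apply/eqP; exact: (allP (allP H k kI) l lI).
Qed.

Lemma chi1 : chi 1 = 1. Proof. by []. Qed.

Lemma prime_mod12 (p : nat) : prime p -> (3 < p)%N -> (p %% 12)%N \in [:: 1; 5; 7; 11]%N.
Proof.
move=> pp p3.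
have h2 : ~~ (2 %| p)%N by rewrite dvdn_prime2// ltn_eqF// (leq_trans _ p3).
have h3 : ~~ (3 %| p)%N by rewrite dvdn_prime2// ltn_eqF.
have e : p = (p %/ 12 * 12 + p %% 12)%N := divn_eq p 12.
have l12 : (p %% 12 < 12)%N by rewrite ltn_mod.
rewrite e dvdn_addr in h2; last by rewrite dvdn_mull.
rewrite e dvdn_addr in h3; last by rewrite dvdn_mull.
by move: h2 h3 l12; case: (p %% 12)%N => [|[|[|[|[|[|[|[|[|[|[|[|//]]]]]]]]]]]].
Qed.

Lemma chi_prime (p : nat) : prime p -> (3 < p)%N -> chi p%:Z = if (p %% 12)%N \in [:: 1; 11]%N then 1 else -1.
Proof.
move=> pp p3; have := prime_mod12 pp p3; have -> : chi p%:Z = chi (p %% 12)%N%:Z.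
  by apply: chi_mod; rewrite /= -modz_nat modz_mod.
by rewrite !inE => /or4P[]/eqP ->.
Qed.

Lemma sqz (x : nat) : x%:Z ^+ 2 = (x ^ 2)%N%:Z.
Proof. by rewrite -mulnn PoszM expr2. Qed.

Section FiniteField.
Variables (p : nat) (F : finFieldType).
Hypothesis pp : prime p.
Hypothesis p3 : (3 < p)%N.
Hypothesis pF : p \in [pchar F].
Hypothesis cardF : #|F| = (p ^ 2)%N.

Lemma natr_eq_mod (a b : nat) : (a%:R == b%:R :> F) = (a == b %[mod p])%N.
Proof.
wlog ab : a b / (a <= b)%N.
  by move=> W; case/orP: (leq_total a b) => h; [|rewrite eq_sym [RHS]eq_sym]; apply: W.
by rewrite eq_sym [RHS]eq_sym eqn_mod_dvd// (dvdn_pcharf pF) natrB// subr_eq0.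
Qed.

(** The field with p^2 elements contains the 12th roots of unity because 12 divides p^2 - 1 for
    every prime p > 3. *)
Lemma prim12 : exists z : F, 12.-primitive_root z.
Proof.
have p2 : (1 < p ^ 2)%N by rewrite -(exp1n 2) ltn_exp2r// prime_gt1.
have q0 : (0 < (p ^ 2).-1)%N by rewrite -subn1 subn_gt0.
have e1 : all ((p ^ 2).-1).-unity_root (enum (predC1 (0 : F))).
  apply/allP => x; rewrite mem_enum inE /= => x0; rewrite unity_rootE.
  by rewrite -(inj_eq (mulfI x0)) mulr1 -exprS prednK ?(ltnW p2)// -cardF expf_card.
have e2 : ((p ^ 2).-1 <= size (enum (predC1 (0%R : F))))%N by rewrite -cardE cardC1 cardF.
have /hasP[z _ zp] := has_prim_root q0 e1 (enum_uniq _) e2.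
exists (z ^+ ((p ^ 2).-1 %/ 12)); apply: dvdn_prim_root zp _ _.
rewrite -subn1 -eqn_mod_dvd ?(ltnW p2)// -modnXm.
by have := prime_mod12 pp p3; rewrite !inE => /or4P[]/eqP ->.
Qed.

(* 3 = (z + z^-1)^2 for a primitive 12th root of unity z, and Frobenius sends z to z^p. *)
Lemma sqrt3 : exists t : F, t ^+ 2 = 3 /\ t ^+ p = (chi p%:Z)%:~R * t.
Proof.
have [z zp] := prim12; have z12 := prim_expr_order zp.
have z6 : z ^+ 6 = -1.
  have : (z ^+ 6 - 1) * (z ^+ 6 + 1) == 0 by rewrite -subr_sqr -exprM z12 expr1n subrr.
  rewrite mulf_eq0 => /orP[|]; last by rewrite addr_eq0 => /eqP.
  by rewrite subr_eq0 -(prim_order_dvd zp).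
have z4 : z ^+ 4 = z ^+ 2 - 1.
  have : (z ^+ 2 + 1) * (z ^+ 4 - (z ^+ 2 - 1)) == 0.
    have -> : (z ^+ 2 + 1) * (z ^+ 4 - (z ^+ 2 - 1)) = z ^+ 6 + 1 by ring.
    by rewrite z6 addNr.
  rewrite mulf_eq0 => /orP[|]; last by rewrite subr_eq0 => /eqP.
  rewrite addr_eq0 => /eqP e; have : z ^+ 4 == 1 by rewrite (exprM z 2 2) e sqrrN expr1n.
  by rewrite -(prim_order_dvd zp).
have z11 : z ^+ 11 = - z ^+ 5 by rewrite (exprD z 5 6) z6 mulrN1.
have z7 : z ^+ 7 = - z by rewrite (exprD z 1 6) z6 mulrN1 expr1.
exists (z - z ^+ 5); split.
  have -> : (z - z ^+ 5) ^+ 2 = z ^+ 2 - 2 * z ^+ 6 + z ^+ 6 * z ^+ 4 by ring.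
  by rewrite z6 z4; ring.
have fr (x : F) : x ^+ p = pFrobenius_aut pF x by rewrite pFrobenius_autE.
have frB (x y : F) : (x - y) ^+ p = x ^+ p - y ^+ p by rewrite !fr; apply: (rmorphB (pFrobenius_aut pF)).
rewrite frB -exprM (chi_prime pp p3) -(expr_mod p z12) -(expr_mod (5 * p) z12) -modnMmr.
have := prime_mod12 pp p3; rewrite !inE => /or4P[]/eqP -> /=.
- by rewrite mul1r.
- by rewrite (_ : (5 * 5) %% 12 = 1)%N// expr1 mulN1r opprB.
- by rewrite (_ : (5 * 7) %% 12 = 11)%N// z7 z11 mulN1r opprB opprK addrC.
- by rewrite (_ : (5 * 11) %% 12 = 7)%N// z7 z11 mul1r opprK addrC.
Qed.

(** The polynomial X^p - X already has its full number of roots in the prime field. *)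
Lemma frob_fixed (t : F) : t ^+ p = t -> exists2 k : nat, (k < p)%N & t = k%:R.
Proof.
move=> tp; pose s := [seq k%:R | k <- iota 0 p] : seq F.
have fixn (k : nat) : (k%:R : F) ^+ p = k%:R by rewrite -(pFrobenius_autE pF) rmorph_nat.
have sz : size ('X^p - 'X : {poly F}) = p.+1.
  by rewrite size_polyDl size_polyXn// size_polyN size_polyX ltnS prime_gt1.
have q0 : 'X^p - 'X != 0 :> {poly F} by rewrite -size_poly_eq0 sz.
have rt (x : F) : x ^+ p = x -> root ('X^p - 'X) x by move=> e; rewrite rootE !hornerE e subrr.
have us : uniq s.
  rewrite map_inj_in_uniq ?iota_uniq// => a b; rewrite !mem_iota !add0n /= => ap bp /eqP.
  by rewrite natr_eq_mod !modn_small// => /eqP.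
case: (boolP (t \in s)) => [/mapP[k]|ts].
  by rewrite mem_iota add0n => kp ->; exists k.
have h : all (root ('X^p - 'X)) (t :: s).
  by rewrite /= (rt _ tp); apply/allP => x /mapP[k _ ->]; apply: rt.
have us' : uniq (t :: s) by rewrite /= ts us.
by have := max_poly_roots q0 h us'; rewrite sz /= size_map size_iota ltnn.
Qed.

Lemma ndvd23 (a b : nat) : ~~ (p %| 2 ^ a * 3 ^ b)%N.
Proof.
by rewrite Euclid_dvdM// !Euclid_dvdX// !dvdn_prime2// !gtn_eqF// (leq_trans _ p3).
Qed.

(** The element 2t is a square root of 12 which Frobenius multiplies by (12/p). If this sign is 1,
    then t lies in the prime field and 12 is a square; if it is -1, a square root of 12 in the prime
    field would force 4t = 0, so p would divide 48. *)
Lemma kronecker12_F : kronecker_prime 12 p = chi p%:Z.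
Proof.
have [t [t2 tp]] := sqrt3; have p2 : (2 < p)%N by apply: ltn_trans p3.
have sqE (x : nat) : (12 == x%:Z ^+ 2 %[mod p])%Z = (12%:R == x%:R ^+ 2 :> F).
  by rewrite sqz -natrX natr_eq_mod -[12]/(12%N%:Z) !modz_nat.
rewrite /kronecker_prime ifN; last by rewrite dvdzE /=; apply: (ndvd23 2 1).
rewrite gtn_eqF// chi_prime//; rewrite chi_prime// in tp; move: tp.
have t12 : (2 * t) ^+ 2 = 12%:R by rewrite exprMn t2; ring.
case: ifP => _ tp.
  rewrite mul1r in tp; have [k kp tk] := frob_fixed tp.
  rewrite ifT//; apply/hasP; exists ((2 * k) %% p)%N; first by rewrite mem_iota ltn_mod prime_gt0.
  rewrite sqE -t12 tk; apply/eqP; congr (_ ^+ 2); apply/eqP.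
  by rewrite -natrM natr_eq_mod modn_mod.
rewrite ifF//; apply/negP => /hasP[x _]; rewrite sqE -t12 -subr_eq0 subr_sqr mulf_eq0 => e.
have fixn (k : nat) : (k%:R : F) ^+ p = k%:R by rewrite -(pFrobenius_autE pF) rmorph_nat.
have e2 : (2 * t) ^+ p = 2 * t.
  case/orP: e; first by rewrite subr_eq0 => /eqP ->; rewrite fixn.
  rewrite addr_eq0 => /eqP ->; rewrite -(pFrobenius_autE pF) rmorphN; congr (- _).
  by rewrite -[RHS]fixn.
move: e2; rewrite exprMn tp fixn mulN1r mulrN => /eqP; rewrite -subr_eq0 -opprD oppr_eq0 => /eqP e3.
have : (48%N%:R : F) == 0.
  have -> : 48%N%:R = (2 * t + 2 * t) ^+ 2 :> F.
    rewrite (_ : (2 * t + 2 * t) ^+ 2 = 16 * t ^+ 2); last by ring.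
    by rewrite t2 -natrM.
  by rewrite e3 expr0n.
by rewrite -(dvdn_pcharf pF) (negbTE (ndvd23 4 1)).
Qed.

End FiniteField.

Lemma kronecker12_prime (p : nat) : prime p -> kronecker_prime 12 p = chi p%:Z.
Proof.
move=> pp; case: (leqP p 3) => [|p3].
  by move: pp; case: p => [|[|[|[|]]]].
have [F pF cF] := @pPrimePowerField p 2 pp isT.
exact: kronecker12_F pp p3 pF cF.
Qed.

Lemma kronecker12 (n : nat) : (0 < n)%N -> kronecker 12 n = chi n%:Z.
Proof.
elim/ltn_ind: n => n IH n0; case: (ltngtP n 1) => [|n1|->]; first by rewrite ltnS leqn0 gtn_eqF.
- have pp := pdiv_prime n1; have := divnK (pdiv_dvd n); rewrite mulnC => e.
  have q0 : (0 < n %/ pdiv n)%N by rewrite divn_gt0 ?pdiv_gt0// pdiv_leq.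
  by rewrite -e (kronecker_mulp 12 pp q0) (kronecker12_prime pp) PoszM chiM IH// ltn_Pdiv// prime_gt1.
by rewrite kronecker_1.
Qed.

Lemma affine_sum (V : nmodType) (p a b : nat) (f : nat -> V) : (0 < p)%N -> coprime p a ->
  \sum_(j < p) f ((b + a * j) %% p)%N = \sum_(x < p) f x.
Proof.
move=> p0 cp.
pose h (j : 'I_p) : 'I_p := Ordinal (ltn_pmod (b + a * j) p0).
have hi : injective h.
  move=> i j [] /eqP; rewrite eqn_modDl => /eqP e; apply: val_inj => /=.
  wlog ij : i j e / (i <= j)%N.
    by move=> W; case/orP: (leq_total i j) => ij; [|symmetry]; apply: W.
  move/esym/eqP: e; rewrite eqn_mod_dvd ?leq_mul2l ?ij ?orbT// -mulnBr Gauss_dvdr// => d.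
  have := dvdn_leq _ d; have := ltn_ord j; lia.
by rewrite [RHS](reindex_inj hi).
Qed.

Section MinusTwentyThree.
Variable p : nat.
Hypothesis pp : prime p.
Local Notation kp := (kronecker_prime (-23) p).

Lemma kp_cases : kp \in [:: 0; 1; -1].
Proof. by rewrite /kronecker_prime; do ?case: ifP. Qed.

Lemma kp_small : (p <= 3)%N -> kp = 1.
Proof. by move: pp; case: p => [|[|[|[|]]]]. Qed.

Lemma kp_23 : p = 23%N -> kp = 0.
Proof. by move=> ->. Qed.

Lemma dvd_small (y : nat) : (0 < y < 2 * p)%N -> (p %| y)%N = (y == p).
Proof.
move=> /andP[y0 yp]; apply/idP/eqP => [/dvdnP[k e]|->//]; subst y.
move: y0 yp; rewrite ltn_mul2r muln_gt0 => /andP[k0 _] /andP[_ k2].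
by rewrite (_ : k = 1%N) ?mul1n//; lia.
Qed.

Lemma sum_indicator (x0 : nat) : (x0 < p)%N -> (\sum_(x < p) (x == x0 :> nat) = 1)%N.
Proof.
move=> h; rewrite (bigD1 (Ordinal h))//= eqxx big1// => i /eqP ni.
by case: eqP => // e; case: ni; apply: val_inj.
Qed.

Lemma root_id (q x x0 : nat) : (x0 <= q)%N ->
  ((x + x0) * (x + (q - x0)) + (x0 ^ 2 + 23) = x ^ 2 + 23 + q * (x + x0))%N.
Proof. by move/subnKC; set u := (q - x0)%N => <-; ring. Qed.

Lemma root_count : (3 < p)%N -> (\sum_(x < p) (p %| x ^ 2 + 23)%N)%N%:Z = 1 + kp.
Proof.
move=> p3; rewrite /kronecker_prime.
have -> : (p %| -23)%Z = (p %| 23)%N by rewrite dvdzE.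
case: ifP => p23.
  suff -> : (\sum_(x < p) (p %| x ^ 2 + 23)%N = 1)%N by [].
  rewrite -[RHS](sum_indicator (prime_gt0 pp)); apply: eq_bigr => x _; congr nat_of_bool.
  rewrite dvdn_addl// Euclid_dvdX// andbT.
  case: (posnP x) => [->|x0]; first by rewrite dvdn0.
  by rewrite (gtnNdvd x0)// gtn_eqF.
have p2 : (p == 2) = false by rewrite gtn_eqF// (ltn_trans _ p3).
have hE (x : nat) : (-23 == x%:Z ^+ 2 %[mod p])%Z = (p %| x ^ 2 + 23)%N.
  rewrite eqz_mod_dvd (_ : -23 - x%:Z ^+ 2 = - (x ^ 2 + 23)%N%:Z); last by rewrite sqz PoszD; ring.
  by rewrite rpredN.
rewrite p2; case: ifP => [/hasP[x0]|/negbT/hasPn H]; last first.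
  rewrite big1 ?subrr// => x _; apply/eqP; rewrite eqb0 -hE; apply: H.
  by rewrite mem_iota add0n /=.
rewrite mem_iota add0n /= hE => x0p r0.
have x00 : (0 < x0)%N.
  by case: (posnP x0) => // e; move: r0; rewrite e add0n p23.
have H (x : 'I_p) : (p %| x ^ 2 + 23)%N = ((x == p - x0 :> nat) || (x == x0 :> nat))%N.
  have e : ((x + x0) * (x + (p - x0)) + (x0 ^ 2 + 23) = x ^ 2 + 23 + p * (x + x0))%N.
    by apply: root_id; apply: ltnW.
  have -> : (p %| x ^ 2 + 23)%N = (p %| (x + x0) * (x + (p - x0)))%N.
    have h1 : (p %| p * (x + x0))%N by rewrite dvdn_mulr.
    have h2 := dvdn_addl (x ^ 2 + 23) h1; rewrite -e in h2; rewrite -h2.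
    exact: (dvdn_addl _ r0).
  rewrite Euclid_dvdM// !dvd_small.
  - by congr (_ || _); apply/eqP/eqP; lia.
  - by have := ltn_ord x; lia.
  - by have := ltn_ord x; lia.
have -> : (\sum_(x < p) (p %| x ^ 2 + 23)%N = \sum_(x < p) ((x == p - x0 :> nat) + (x == x0 :> nat)))%N.
  apply: eq_bigr => x _; rewrite H; case: eqP => //= e1; case: eqP => //= e2.
  have e3 : (p = 2 * x0)%N by lia.
  have : (2 %| p)%N by rewrite e3 dvdn_mulr.
  by rewrite dvdn_prime2// eq_sym p2.
by rewrite big_split /= !sum_indicator//; lia.
Qed.

Lemma root_count_scaled (s : nat) : (3 < p)%N -> coprime p s ->
  (\sum_(x < p) (p %| x ^ 2 + 23 * s ^ 2)%N)%N%:Z = 1 + kp.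
Proof.
move=> p3 cp; rewrite -root_count//; congr Posz.
rewrite -(@affine_sum nat p s 0 (fun x => (p %| x ^ 2 + 23 * s ^ 2)%N : nat) (prime_gt0 pp) cp).
apply: eq_bigr => x _; congr nat_of_bool; rewrite add0n.
rewrite /dvdn -modnDml modnXm modnDml -/(dvdn _ _).
rewrite (_ : (s * x) ^ 2 + 23 * s ^ 2 = s ^ 2 * (x ^ 2 + 23))%N; last by ring.
by rewrite Gauss_dvdr// coprimeXr.
Qed.

End MinusTwentyThree.
End Kronecker12.

(** * Salie and Kloosterman sums *)

Section ExpSums.
Variable R : realType.
Local Notation C := R[i].

Definition ex (k : int) (N : nat) : C := e2pi (k%:~R / N%:R).

Lemma exD k l N : ex (k + l) N = ex k N * ex l N.
Proof. by rewrite /ex intrD mulrDl e2piD. Qed.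

Lemma ex_int (k : int) (N : nat) : (0 < N)%N -> ex (N%:Z * k) N = 1.
Proof.
move=> N0; rewrite /ex intrM mulrAC -pmulrn mulfV ?mul1r ?e2pi_int// pnatr_eq0 -lt0n.
by [].
Qed.

Lemma ex_per (k l : int) (N : nat) : (0 < N)%N -> ex (k + N%:Z * l) N = ex k N.
Proof. by move=> N0; rewrite exD ex_int// mulr1. Qed.

Lemma ex_scale (k : int) (g N : nat) : (0 < g)%N -> ex (g%:Z * k) (g * N) = ex k N.
Proof.
move=> g0; rewrite /ex intrM natrM invfM mulrACA -pmulrn mulfV ?mul1r// pnatr_eq0 -lt0n.
by [].
Qed.

Lemma exMn (k : int) (a N : nat) : ex (a%:Z * k) N = ex k N ^+ a.
Proof. by rewrite /ex intrM -mulrA -pmulrn e2piMn. Qed.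

Lemma ex_eq1 (k : int) (N : nat) : (0 < N)%N -> ex k N = 1 -> (N %| k)%Z.
Proof.
move=> N0; have N0' : N%:R != 0 :> R by rewrite pnatr_eq0 -lt0n.
have -> : ex k N = e2pi (k%:~R / N%:R)%:C by rewrite /ex rmorphM fmorphV rmorph_nat /= intC.
case/e2pi_eq1 => m e; apply/dvdzP; exists m; apply/eqP; rewrite -(eqr_int R) intrM -e -pmulrn.
by rewrite divfK.
Qed.

Lemma ex_orth (k : int) (N : nat) : (0 < N)%N ->
  \sum_(a < N) ex (a%:Z * k) N = if (N %| k)%Z then N%:R else 0.
Proof.
move=> N0; rewrite (eq_bigr _ (fun (a : 'I_N) _ => exMn k a N)); case: ifP => d.
  have -> : ex k N = 1 by case/dvdzP: d => q ->; rewrite mulrC ex_int.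
  by rewrite (eq_bigr (fun=> 1)) => [|i _]; rewrite ?expr1n// sumr_const card_ord.
have h : (ex k N - 1) * (\sum_(a < N) ex k N ^+ a) = 0.
  by rewrite -subrX1 -exMn ex_int// subrr.
apply/eqP; move/eqP: h; rewrite mulf_eq0 => /orP[|//].
by rewrite subr_eq0 => /eqP /(ex_eq1 N0); rewrite d.
Qed.

Lemma conj_ex k N : conjc (ex k N) = ex (- k) N.
Proof.
have E (l : int) : ex l N = e2pi (l%:~R / N%:R)%:C by rewrite /ex rmorphM fmorphV rmorph_nat /= intC.
by rewrite (E k) (E (- k)) conj_e2pi conjc_real -rmorphN /= intrN mulNr.
Qed.

Lemma sum_mul (V : nmodType) (a b : nat) (F : nat -> V) :
  \sum_(x < a * b) F x = \sum_(i < a) \sum_(j < b) F (i * b + j)%N.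
Proof.
elim: a => [|a IH]; first by rewrite !big_ord0.
rewrite big_ord_recr /= -IH mulSn addnC big_split_ord /=.
by [].
Qed.

Lemma sum_gcd (V : nmodType) (c : nat) (F : nat -> V) : (0 < c)%N ->
  \sum_(a < c) F a = \sum_(g <- divisors c) \sum_(a < c %/ g | coprime (c %/ g) a) F (g * a)%N.
Proof.
move=> c0; have -> : \sum_(a < c) F a = \sum_(a < c) \sum_(g <- divisors c) if gcdn c a == g then F a else 0.
  apply: eq_bigr => a _; rewrite -big_mkcond /= -big_filter.
  rewrite (_ : [seq g <- divisors c | gcdn c a == g] = [:: gcdn c a]) ?big_seq1//.
  have d : gcdn c a \in divisors c by rewrite -dvdn_divisors// dvdn_gcdl.
  rewrite (eq_filter (a2 := pred1 (gcdn c a))) ?filter_pred1_uniq ?divisors_uniq// => g /=.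
rewrite exchange_big /= !big_seq; apply: eq_bigr => g; rewrite -dvdn_divisors// => gc.
have g0 : (0 < g)%N := dvdn_gt0 c0 gc.
set c' := (c %/ g)%N; have cE : c = (c' * g)%N by rewrite divnK.
have -> : \sum_(a < c) (if gcdn c a == g then F a else 0) = \sum_(a < c' * g) if gcdn c a == g then F a else 0.
  by rewrite -cE.
rewrite (sum_mul c' g (fun a => if gcdn c a == g then F a else 0)) [RHS]big_mkcond /=.
apply: eq_bigr => i _; rewrite (bigD1 (Ordinal g0)) //= addn0 big1 ?addr0.
  by rewrite {1}cE -muln_gcdl -{2}[g]mul1n eqn_pmul2r// mulnC.
move=> j jn; case: eqP => // e; have : (g %| i * g + j)%N by rewrite -{1}e dvdn_gcdr.
rewrite dvdn_addr ?dvdn_mull// => /dvdn_leq; have j0 : (0 < j)%N.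
  by rewrite lt0n; apply: contra jn => /eqP j0; apply/eqP/val_inj.
by move=> /(_ j0); rewrite leqNgt ltn_ord.
Qed.

Lemma gauss_ex (p l m c : nat) :
  e2pi ((p%:Z%:~R * l%:R ^+ 2 + 2 * l%:R * (- m%:Z)%:~R) / (24 * c%:R)) =
   ex (p%:Z * (l ^ 2)%N%:Z - 2%:Z * (l%:Z * m%:Z)) (24 * c).
Proof.
rewrite /ex natrM intrB (intrM _ p%:Z) (intrM _ 2%:Z) (intrM _ l%:Z) intrN -!pmulrn natrX mulrN mulrA.
by [].
Qed.

Lemma phase_ex (M p c : nat) : e2pi (- (M%:R * p%:R / (24 * c%:R))) = ex (- (p%:Z * M%:Z)) (24 * c).
Proof. by rewrite /ex natrM intrN (intrM _ p%:Z) -!pmulrn mulNr (mulrC p%:R). Qed.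

Lemma kloosE (M m c : nat) : (0 < c)%N -> kloos R M m c =
  \sum_(p < c | coprime c p) \sum_(l < 12 * c)
     (chi l%:Z)%:~R * ex (2%:Z * (l%:Z * m%:Z) - p%:Z * (M + l ^ 2)%N%:Z) (24 * c).
Proof.
move=> c0; apply: eq_bigr => p _; rewrite -gaussSN// /gaussS rmorph_sum mulr_sumr; apply: eq_bigr => l _.
rewrite [X in X * _]phase_ex.
have cM (x y : C) : conjc (x * y) = conjc x * conjc y by rewrite rmorphM.
rewrite [X in _ * X]cM [X in _ * (_ * conjc X)]gauss_ex conj_ex mulrCA.
have -> : conjc ((chi l%:Z)%:~R : C) = (chi l%:Z)%:~R by rewrite intC conjc_real.
have H (k1 k2 k3 : int) (N : nat) : k1 + k2 = k3 -> ex k1 N * ex k2 N = ex k3 N by move=> <-; rewrite exD.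
rewrite (H _ _ (2%:Z * (l%:Z * m%:Z) - p%:Z * (M + l ^ 2)%N%:Z))//.
by rewrite PoszD mulrDr; move: (2%:Z * _) (p%:Z * M%:Z) => u v; rewrite opprB opprD [RHS]addrCA.
Qed.

(** By [gauss_eta] every Gauss sum in it contains the factor (12/m). *)
Lemma kloos0 (M m c : nat) : (0 < c)%N -> chi m%:Z = 0 -> kloos R M m c = 0.
Proof.
move=> c0 cm; rewrite /kloos big1// => p cp.
have [q e] := minv_bezout c0 cp.
have dv : (c%:Z %| p%:Z * (minv c p)%:Z - 1)%Z by rewrite mulrC -e opprB addrC subrK dvdz_mull.
have [k [nk Hk]] := eta_modular (@jinv_T R) (@jinv_S R) c0 dv.
by rewrite (gauss_eta c0 (fun s cs => (Hk s cs).1)) cm mulr0 mul0r conjc0 mulr0.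
Qed.

Lemma chi_per (l k : nat) : chi (l + 12 * k)%N%:Z = chi l%:Z.
Proof. by apply: chi_mod; rewrite PoszD PoszM addrC mulrC modzMDl. Qed.

Lemma dvdn_sqr_per (c l j S : nat) : (24 * c %| (l + 12 * c * j) ^ 2 + S)%N = (24 * c %| l ^ 2 + S)%N.
Proof.
rewrite (_ : (l + 12 * c * j) ^ 2 + S = 24 * c * (l * j + 6 * c * j ^ 2) + (l ^ 2 + S))%N; last by ring.
by rewrite dvdn_addr// dvdn_mulr.
Qed.

Definition vterm (c S t l : nat) : C :=
  if (24 * c %| l ^ 2 + S)%N then (chi l%:Z)%:~R * ex (t%:Z * l%:Z) (12 * c) else 0.

Definition vsum (c s t : nat) : C := \sum_(l < 12 * c) vterm c (23 * s ^ 2) t l.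

Lemma vterm_per (c S t l j : nat) : (0 < c)%N -> vterm c S t (l + 12 * c * j) = vterm c S t l.
Proof.
move=> c0; rewrite /vterm dvdn_sqr_per -mulnA chi_per; case: ifP => // _; congr (_ * _).
rewrite mulnA PoszD (_ : t%:Z * (l%:Z + (12 * c * j)%N%:Z) = t%:Z * l%:Z + (12 * c)%N%:Z * (t%:Z * j%:Z)) ?ex_per ?muln_gt0//.
by rewrite !PoszM; ring.
Qed.

Lemma vterm_mod (c S t l : nat) : (0 < c)%N -> vterm c S t (l %% (12 * c))%N = vterm c S t l.
Proof. move=> c0; rewrite -(vterm_per S t (l %% (12 * c)) (l %/ (12 * c)) c0).
by rewrite (mulnC (12 * c)%N) addnC -divn_eq. Qed.

Lemma salieE (c n : nat) : (0 < c)%N -> salie R c n = vsum c 1 n.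
Proof.
move=> c0; rewrite /salie /vsum big_mkcond; apply: eq_bigr => l _; rewrite /vterm /root23 exp1n muln1.
by case: ifP => // _; rewrite /ex natrM intrM -!pmulrn.
Qed.

(** Squares of integers prime to 6 are 1 modulo 24, so 23 s^2 + l^2 = 24 w whenever l contributes,
    and the sum over a detects whether c divides w. *)
Lemma sum_twist (c s n : nat) : (0 < c)%N -> chi s%:Z != 0 ->
  \sum_(a < c) \sum_(l < 12 * c) (chi l%:Z)%:~R * ex (2%:Z * (l%:Z * n%:Z) - a%:Z * (23 * s ^ 2 + l ^ 2)%N%:Z) (24 * c) =
  c%:R * vsum c s n.
Proof.
move=> c0 cs; rewrite exchange_big /= /vsum mulr_sumr; apply: eq_bigr => l _; rewrite -mulr_sumr /vterm.
have [cl|cl] := eqVneq (chi l%:Z) 0; first by rewrite cl !mul0r; case: ifP; rewrite ?mulr0.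
have d24 (x : nat) : chi x%:Z != 0 -> (24 %| x ^ 2 - 1)%N /\ (0 < x)%N.
  move=> cx; have x0 : (0 < x)%N by case: x cx.
  split=> //; have := chi_sqr cx; rewrite sqz -[1]/(1%N%:Z) subzn ?expn_gt0 ?x0//.
have [e1 s0] := d24 _ cs; have [e2 l0] := d24 _ cl.
have [w ew] : exists w, (23 * s ^ 2 + l ^ 2 = 24 * w)%N.
  case/dvdnP: e1 => u eu; case/dvdnP: e2 => v ev; exists (23 * u + v + 1)%N.
  have : (0 < s ^ 2)%N by rewrite expn_gt0 s0.
  have : (0 < l ^ 2)%N by rewrite expn_gt0 l0.
  lia.
rewrite ew addnC ew.
have tE (a : nat) : ex (2%:Z * (l%:Z * n%:Z) - a%:Z * (24 * w)%N%:Z) (24 * c) = ex (n%:Z * l%:Z) (12 * c) * ex (a%:Z * - w%:Z) c.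
  rewrite exD; congr (_ * _).
    have -> : (24 * c = 2 * (12 * c))%N by rewrite mulnA.
    by rewrite ex_scale// mulrC.
  by rewrite (_ : - (a%:Z * (24 * w)%N%:Z) = 24%N%:Z * (a%:Z * - w%:Z)) ?ex_scale// PoszM; ring.
rewrite (eq_bigr _ (fun (a : 'I_c) _ => tE a)) -mulr_sumr ex_orth//.
rewrite rpredN dvdzE /= dvdn_pmul2l//; case: ifP => _; last by rewrite !mulr0.
by rewrite [RHS]mulrCA [X in _ * X]mulrC (mulrC n%:Z).
Qed.

(* Detect divisibility by c with additive characters and sort them by their order. *)
Lemma vsum_kloos (c s n : nat) : (0 < c)%N -> chi s%:Z != 0 ->
  c%:R * vsum c s n = \sum_(g <- divisors c | (g %| n)%N) g%:R * kloos R (23 * s ^ 2) (n %/ g) (c %/ g).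
Proof.
move=> c0 cs; rewrite -sum_twist//.
rewrite (sum_gcd (fun a => \sum_(l < 12 * c) (chi l%:Z)%:~R *
  ex (2%:Z * (l%:Z * n%:Z) - a%:Z * (23 * s ^ 2 + l ^ 2)%N%:Z) (24 * c)) c0).
rewrite [RHS]big_mkcond /= !big_seq; apply: eq_bigr => g; rewrite -dvdn_divisors// => gc.
have g0 : (0 < g)%N := dvdn_gt0 c0 gc; have c'0 : (0 < c %/ g)%N by rewrite divn_gt0// dvdn_leq.
set c' := (c %/ g)%N in c'0 *; have cE : c = (g * c')%N by rewrite mulnC divnK.
rewrite kloosE// mulr_sumr -(fun_if (fun x => x)) .
transitivity (\sum_(a < c' | coprime c' a) (if (g %| n)%N then g%:R else 0) * \sum_(l < 12 * c')
   (chi l%:Z)%:~R * ex (2%:Z * (l%:Z * (n %/ g)%N%:Z) - a%:Z * (23 * s ^ 2 + l ^ 2)%N%:Z) (24 * c')); last first.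
  by case: ifP => gn //; rewrite big1// => a _; rewrite mul0r.
apply: eq_bigr => a _; rewrite cE.
have -> : (12 * (g * c') = g * (12 * c'))%N by ring.
rewrite (sum_mul g (12 * c') (fun l => (chi l%:Z)%:~R *
  ex (2%:Z * (l%:Z * n%:Z) - (g * a)%N%:Z * (23 * s ^ 2 + l ^ 2)%N%:Z) (24 * (g * c')))).
rewrite exchange_big /= mulr_sumr; apply: eq_bigr => l _.
(* The summation variable is written as 12 c' j + l; the only dependence on j is an additive
   character modulo g, whose sum detects g | n. *)
have tE (j : nat) : (chi (j * (12 * c') + l)%N%:Z)%:~R *
    ex (2%:Z * ((j * (12 * c') + l)%N%:Z * n%:Z) - (g * a)%N%:Z * (23 * s ^ 2 + (j * (12 * c') + l) ^ 2)%N%:Z) (24 * (g * c')) =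
    (chi l%:Z)%:~R * (ex (l%:Z * n%:Z) (g * (12 * c')) * ex (- (a%:Z * (23 * s ^ 2 + l ^ 2)%N%:Z)) (24 * c')) * ex (j%:Z * n%:Z) g.
  have -> : (j * (12 * c') + l = l + 12 * (j * c'))%N by ring.
  rewrite chi_per exD.
  have H (u v x y z t : C) : u = x * z -> v = y -> t * (u * v) = t * (x * y) * z by move=> -> ->; ring.
  apply: H; last first.
    rewrite (_ : 24 * (g * c') = g * (24 * c'))%N; last by ring.
    rewrite (_ : - ((g * a)%N%:Z * (23 * s ^ 2 + (l + 12 * (j * c')) ^ 2)%N%:Z) =
      g%:Z * (- (a%:Z * (23 * s ^ 2 + l ^ 2)%N%:Z) + (24 * c')%N%:Z * - (a%:Z * (j%:Z * l%:Z + 6 * c'%:Z * j%:Z ^+ 2)))).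
      by rewrite ex_scale ?ex_per ?muln_gt0.
    by rewrite -!mulnn !(PoszD, PoszM); ring.
  rewrite (_ : 24 * (g * c') = 2 * (12 * c' * g))%N; last by ring.
  rewrite ex_scale// (_ : (l + 12 * (j * c'))%N%:Z * n%:Z = l%:Z * n%:Z + (12 * c')%N%:Z * (j%:Z * n%:Z)).
    by rewrite exD ex_scale ?muln_gt0// (mulnC g).
  by rewrite !(PoszD, PoszM); ring.
rewrite (eq_bigr _ (fun (j : 'I_g) _ => tE j)) -mulr_sumr ex_orth// dvdzE /=.
case: ifP => gn; last by rewrite mulr0 mul0r.
rewrite mulrC; congr (_ * (_ * _)); rewrite exD; congr (_ * _).
have [n' nE] : exists n', n = (g * n')%N by exists (n %/ g)%N; rewrite mulnC divnK.
rewrite nE mulKn// (_ : l%:Z * (g * n')%N%:Z = g%:Z * (l%:Z * n'%:Z)); last by rewrite PoszM; ring.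
have -> : (24 * c' = 2 * (12 * c'))%N by rewrite mulnA.
by rewrite !ex_scale.
Qed.

Lemma vsum_1 (c s : nat) : (0 < c)%N -> chi s%:Z != 0 -> c%:R * vsum c s 1 = kloos R (23 * s ^ 2) 1 c.
Proof.
move=> c0 cs; rewrite vsum_kloos// (eq_bigl (fun g => g == 1%N)) => [|g]; last by rewrite dvdn1.
rewrite -big_filter filter_pred1_uniq ?divisors_uniq -?dvdn_divisors ?dvd1n// big_seq1.
by rewrite mul1r !divn1.
Qed.

End ExpSums.

(** * Hecke-type recursions for the sums over square roots *)

Section Recursion.
Variable R : realType.
Local Notation C := R[i].
Local Notation vsum := (@vsum R).
Local Notation vterm := (@vterm R).
Local Notation ex := (@ex R).
Local Notation kp := (kronecker_prime (-23)).

Lemma chi_dvd (p l : nat) : (1 < p <= 3)%N -> (p %| l)%N -> chi l%:Z = 0.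
Proof.
move=> p3 /dvdnP[k ->]; rewrite PoszM chiM.
have -> : chi p%:Z = 0 by move: p3; case: p => [|[|[|[|]]]].
by rewrite mulr0.
Qed.

Lemma chi_coprime (s : nat) : coprime s 6 -> chi s%:Z != 0.
Proof.
have H : all (fun r => coprime r 6 ==> (chi r%:Z != 0)) (iota 0 12) by vm_compute.
have r12 : (s %% 12)%N \in iota 0 12 by rewrite mem_iota ltn_pmod.
rewrite {1}(divn_eq s 12) (_ : 12 = 2 * 6)%N// mulnA coprime_sym /coprime gcdnMDl gcdnC.
move: (allP H _ r12) => /implyP h /h; congr (_ != 0); apply: chi_mod.
by rewrite !modz_nat modn_mod.
Qed.

Lemma chi_prime_sqr (p : nat) : prime p -> (3 < p)%N -> chi p%:Z * chi p%:Z = 1.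
Proof. by move=> pp p3; rewrite chi_prime//; case: ifP. Qed.

Lemma prime_ndvd24 (p : nat) : prime p -> (3 < p)%N -> coprime 24 p /\ coprime 12 p.
Proof.
move=> pp p3; split; rewrite coprime_sym prime_coprime//.
  rewrite (_ : 24 = 2 ^ 3 * 3)%N// Euclid_dvdM// Euclid_dvdX// !dvdn_prime2// !gtn_eqF//.
  exact: ltn_trans p3.
rewrite (_ : 12 = 2 ^ 2 * 3)%N// Euclid_dvdM// Euclid_dvdX// !dvdn_prime2// !gtn_eqF//.
exact: ltn_trans p3.
Qed.

Lemma dvd_6mul (p c : nat) : prime p -> (3 < p)%N -> (p %| 6 * c)%N -> (p %| c)%N.
Proof.
move=> pp p3; have [h _] := prime_ndvd24 pp p3; rewrite Gauss_dvdr// coprime_sym.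
by apply: coprime_dvdl h.
Qed.

Lemma ex_eq (k l : int) (M N : nat) : k = l -> M = N -> ex k M = ex l N.
Proof. by move=> -> ->. Qed.

(** Substituting p j for the summation variable on the right permutes the residues modulo 12c; p^2
    drops out of the congruence, and the character contributes (12/p), whose square is 1. *)
Lemma vsum_coprime (p c s n : nat) : prime p -> (3 < p)%N -> (0 < c)%N -> coprime p c ->
  vsum c s (p * n) = (chi p%:Z)%:~R * vsum c (p * s) n.
Proof.
move=> pp p3 c0 pc; have [c24 c12] := prime_ndvd24 pp p3.
have N0 : (0 < 12 * c)%N by rewrite muln_gt0.
rewrite {2}/vsum -(@affine_sum C (12 * c) p 0 (vterm c (23 * (p * s) ^ 2) n))//; last first.
  by rewrite coprimeMl c12 coprime_sym.
rewrite mulr_sumr; apply: eq_bigr => j _; rewrite add0n vterm_mod// /vterm.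
have -> : ((p * j) ^ 2 + 23 * (p * s) ^ 2 = p ^ 2 * (j ^ 2 + 23 * s ^ 2))%N by ring.
rewrite Gauss_dvdr ?coprimeXr ?coprimeMl ?c24 1?coprime_sym//.
case: ifP => _; last by rewrite mulr0.
rewrite (PoszM p j) chiM intrM mulrA (mulrA (chi p%:Z)%:~R) -intrM chi_prime_sqr// mul1r.
by rewrite (@ex_eq _ (n%:Z * (p * j)%N%:Z) _ (12 * c))// !PoszM mulrCA mulrA.
Qed.

(** Every g dividing c and p n also divides n, so p divides p n / g and each Kloosterman sum in
    [vsum_kloos] vanishes by [kloos0]. *)
Lemma vsum_small (p c s n : nat) : prime p -> (p <= 3)%N -> (0 < c)%N -> coprime p c -> chi s%:Z != 0 ->
  vsum c s (p * n) = 0.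
Proof.
move=> pp p3 c0 pc cs; have c0' : (c%:R : C) != 0 by rewrite pnatr_eq0 -lt0n.
apply: (mulfI c0'); rewrite vsum_kloos// mulr0 big_seq_cond big1// => g.
rewrite -dvdn_divisors// => /andP[gc gn]; have g0 := dvdn_gt0 c0 gc.
rewrite kloos0 ?mulr0// ?divn_gt0 ?(dvdn_leq c0)//.
apply: (@chi_dvd p); first by rewrite prime_gt1.
have gp : coprime g p by rewrite coprime_sym (coprime_dvdr gc).
by move: gn; rewrite Gauss_dvdr// => gn; rewrite -muln_divA// dvdn_mulr.
Qed.

(* Shifting l by 12 p D multiplies the sum by a nontrivial p-th root of unity. *)
Lemma vsum_zero (p D s : nat) : prime p -> (0 < D)%N -> vsum (p * (p * D)) (p * s) 1 = 0.
Proof.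
move=> pp D0; have p0 := prime_gt0 pp; set c := (p * (p * D))%N.
have c0 : (0 < c)%N by rewrite !muln_gt0 p0.
have N0 : (0 < 12 * c)%N by rewrite muln_gt0.
have z1 : ex 1 p - 1 != 0.
  rewrite subr_eq0; apply/eqP => /(ex_eq1 p0); rewrite dvdzE /= dvdn1 => /eqP p1.
  by rewrite p1 in pp.
have H : ex 1 p * vsum c (p * s) 1 = vsum c (p * s) 1.
  rewrite {2}/vsum -(@affine_sum C (12 * c) 1 (12 * (p * D)) (vterm c (23 * (p * s) ^ 2) 1))//; last first.
    exact: coprimen1.
  rewrite mulr_sumr; apply: eq_bigr => l _; rewrite vterm_mod// mul1n addnC /vterm.
  have [pl|pl] := boolP (p %| l)%N; last first.
    have F (x : nat) : ~~ (p %| x)%N -> (24 * c %| x ^ 2 + 23 * (p * s) ^ 2)%N = false.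
      move=> px; apply/negP => h; have : (p %| x ^ 2 + 23 * (p * s) ^ 2)%N.
        by apply: dvdn_trans h; rewrite /c dvdn_mull// dvdn_mulr.
      rewrite dvdn_addl ?Euclid_dvdX ?(negbTE px)//.
      by rewrite expnMn mulnCA dvdn_mulr// dvdn_exp.
    by rewrite !F ?mulr0// dvdn_addl// mulnCA dvdn_mulr.
  case/dvdnP: pl => x ->.
  have -> : (24 * c %| (x * p + 12 * (p * D)) ^ 2 + 23 * (p * s) ^ 2)%N =
    (24 * c %| (x * p) ^ 2 + 23 * (p * s) ^ 2)%N.
    rewrite -(dvdn_addr ((x * p) ^ 2 + 23 * (p * s) ^ 2) (dvdn_mulr (x + 6 * D) (dvdnn (24 * c)))).
    by congr (_ %| _)%N; rewrite /c; ring.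
  rewrite chi_per; case: ifP => _; last by rewrite mulr0.
  rewrite mulrCA; congr (_ * _).
  have -> : (1%N%:Z * (x * p + 12 * (p * D))%N%:Z = 1%N%:Z * (x * p)%N%:Z + (12 * (p * D))%N%:Z * 1)%R.
    by rewrite !PoszD !mul1r mulr1.
  rewrite exD mulrC; congr (_ * _); rewrite (_ : 12 * c = 12 * (p * D) * p)%N; last by rewrite /c; ring.
  by rewrite ex_scale// !muln_gt0 p0.
have : (ex 1 p - 1) * vsum c (p * s) 1 = 0 by rewrite mulrBl H mul1r subrr.
by move/eqP; rewrite mulf_eq0 (negbTE z1) => /eqP.
Qed.

(** The congruence forces p | l. With l = p i, a factor p cancels from both modulus and phase, and
    the remaining p in the congruence is prime to 24c. *)
Lemma vsum_one (p c s : nat) : prime p -> (3 < p)%N -> (0 < c)%N -> coprime p c ->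
  vsum (p * c) (p * s) 1 = (chi p%:Z)%:~R * vsum c s 1.
Proof.
move=> pp p3 c0 pc; have p0 := prime_gt0 pp; have [c24 c12] := prime_ndvd24 pp p3.
rewrite /vsum (_ : 12 * (p * c) = (12 * c) * p)%N; last by ring.
rewrite (sum_mul (12 * c) p (vterm (p * c) (23 * (p * s) ^ 2) 1)) mulr_sumr.
apply: eq_bigr => i _; rewrite (bigD1 (Ordinal p0))//= addn0 big1 ?addr0.
  rewrite /vterm (_ : (i * p) ^ 2 + 23 * (p * s) ^ 2 = p * (p * (i ^ 2 + 23 * s ^ 2)))%N; last by ring.
  rewrite (_ : 24 * (p * c) = p * (24 * c))%N; last by ring.
  rewrite dvdn_pmul2l// Gauss_dvdr ?coprimeMl ?c24 1?coprime_sym//.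
  case: ifP => _; last by rewrite mulr0.
  rewrite mulnC PoszM chiM intrM -mulrA; congr (_ * (_ * _)).
  rewrite (_ : 12 * (p * c) = p * (12 * c))%N; last by ring.
  by rewrite mulrCA ex_scale.
move=> j jn; rewrite /vterm; case: ifP => // h; exfalso.
have : (p %| (i * p + j) ^ 2 + 23 * (p * s) ^ 2)%N.
  by apply: dvdn_trans h; rewrite mulnCA dvdn_mulr.
rewrite dvdn_addl; last by rewrite expnMn mulnCA dvdn_mulr// dvdn_exp.
rewrite Euclid_dvdX// dvdn_addr ?dvdn_mull// andbT => /dvdn_leq; have j0 : (0 < j)%N.
  by rewrite lt0n; apply: contra jn => /eqP j0; apply/eqP/val_inj.
by move=> /(_ j0); rewrite leqNgt ltn_ord.
Qed.

Lemma kp_root (p x s : nat) : prime p -> (3 < p)%N -> p != 23%N -> coprime p s ->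
  (p %| x ^ 2 + 23 * s ^ 2)%N -> kp p = 1.
Proof.
move=> pp p3 p23 ps px; have p0 := prime_gt0 pp.
have nz : kp p != 0.
  rewrite /kronecker_prime dvdzE /= dvdn_prime2// (negbTE p23).
  by do ?case: ifP.
have := root_count_scaled pp p3 ps.
have xm : (p %| (x %% p) ^ 2 + 23 * s ^ 2)%N.
  by rewrite /dvdn -modnDml modnXm modnDml.
rewrite (bigD1 (Ordinal (ltn_pmod x p0)))//= xm; have := kp_cases p.
by rewrite !inE (negbTE nz) /= => /orP[/eqP -> //|/eqP ->]; rewrite PoszD subrr.
Qed.

(** These are the lifts of a solution modulo 24c to the modulus 24pc. For p prime to 6c they
    correspond to the square roots of -23 s^2 modulo p. For p | 6c the condition is linear in i: if
    p does not divide l it has one solution, and then the symbol is 1; p | l forces p = 23, where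
    the symbol is 0 and no lift exists because p does not divide s. *)
Lemma lift_count (p c s l : nat) : prime p -> (0 < c)%N -> coprime s (6 * (p * c)) -> chi l%:Z != 0 ->
  (24 * c %| l ^ 2 + 23 * s ^ 2)%N ->
  (\sum_(i < p) (24 * (p * c) %| (i * (12 * c) + l) ^ 2 + 23 * s ^ 2)%N)%N%:Z =
  if (p %| 6 * c)%N then kp p else 1 + kp p.
Proof.
move=> pp c0 sc cl /dvdnP[Q e]; have p0 := prime_gt0 pp.
have ps : coprime p s.
  by rewrite coprime_sym; apply: coprime_dvdr sc; rewrite mulnCA dvdn_mulr.
have E (i : nat) : ((i * (12 * c) + l) ^ 2 + 23 * s ^ 2 = 24 * c * (Q + l * i + 6 * c * i ^ 2))%N.
  by rewrite mulnDr mulnDr (mulnC (24 * c)%N Q) -e; ring.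
have [p6|p6] := boolP (p %| 6 * c)%N; last first.
  have p3 : (3 < p)%N.
    rewrite ltnNge; apply: contra p6 => p3; apply: dvdn_mulr.
    by move: pp p3; case: (p) => [|[|[|[|]]]].
  have [c24 c12] := prime_ndvd24 pp p3.
  have pc : coprime p c by rewrite prime_coprime//; apply: contra p6; exact: dvdn_mull.
  rewrite -(root_count_scaled pp p3 ps); congr Posz.
  rewrite -(@affine_sum nat p (12 * c) l (fun x => (p %| x ^ 2 + 23 * s ^ 2)%N : nat) p0); last first.
    by rewrite coprimeMr pc coprime_sym c12.
  apply: eq_bigr => i _; congr nat_of_bool.
  have -> : (p %| ((l + 12 * c * i) %% p) ^ 2 + 23 * s ^ 2)%N = (p %| (i * (12 * c) + l) ^ 2 + 23 * s ^ 2)%N.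
    by rewrite /dvdn -modnDml modnXm modnDml (mulnC _ (nat_of_ord i)) (addnC l).
  rewrite E (_ : 24 * (p * c) = 24 * c * p)%N ?dvdn_pmul2l ?muln_gt0//; last by ring.
  by rewrite [RHS]Gauss_dvdr// coprimeMr pc coprime_sym c24.
have -> : (\sum_(i < p) (24 * (p * c) %| (i * (12 * c) + l) ^ 2 + 23 * s ^ 2)%N)%N =
   (\sum_(i < p) (p %| (Q + l * i) %% p)%N)%N.
  apply: eq_bigr => i _; congr nat_of_bool.
  rewrite E (_ : 24 * (p * c) = 24 * c * p)%N ?dvdn_pmul2l ?muln_gt0//; last by ring.
  rewrite dvdn_addl; first by rewrite /dvdn modn_mod.
  by rewrite dvdn_mulr.
have [pl|pl] := boolP (p %| l)%N; last first.
  have pl' : coprime p l by rewrite prime_coprime.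
  rewrite (@affine_sum nat p l Q (fun x => (p %| x)%N : nat))//.
  rewrite (bigD1 (Ordinal p0))//= dvdn0 big1 => [|j jn]; last first.
    rewrite gtnNdvd// lt0n; apply: contra jn => /eqP j0; apply/eqP/val_inj.
    exact: j0.
  case: (leqP p 3) => p3; first by rewrite kp_small.
  have pc : (p %| c)%N.
    exact: dvd_6mul p6.
  have pr : (p %| l ^ 2 + 23 * s ^ 2)%N by rewrite e; do 2 apply: dvdn_mull.
  rewrite (@kp_root p l s)//; apply/eqP => p23; move: pr pl; rewrite {}p23.
  rewrite dvdn_addl; last by rewrite dvdn_mulr.
  by rewrite Euclid_dvdX// andbT => ->.
have p3 : (3 < p)%N.
  by rewrite ltnNge; apply: contra cl => p3; rewrite (@chi_dvd p)// p3 prime_gt1.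
have pc : (p %| c)%N.
  exact: dvd_6mul p6.
have ps' : ~~ (p %| s)%N by rewrite -prime_coprime.
have p23 : p = 23%N.
  have : (p %| l ^ 2 + 23 * s ^ 2)%N by rewrite e; do 2 apply: dvdn_mull.
  rewrite dvdn_addr ?Euclid_dvdX ?pl// Euclid_dvdM// Euclid_dvdX// (negbTE ps') orbF.
  by rewrite dvdn_prime2// => /eqP.
rewrite (kp_23 p23) big1// => i _.
rewrite /dvdn modn_mod -/(dvdn p _) dvdn_addl; last by rewrite dvdn_mulr.
case: (boolP (p %| Q)%N) => // pQ; exfalso.
have : (p ^ 2 %| l ^ 2 + 23 * s ^ 2)%N by rewrite e -mulnn; apply: dvdn_mul => //; apply: dvdn_mull.
rewrite dvdn_addr; last exact: dvdn_exp2r.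
rewrite -mulnn -p23 dvdn_pmul2l// Euclid_dvdX//.
by rewrite (negbTE ps').
Qed.

(** With the extra factor p in the frequency, the exponential and the character depend on l only
    modulo 12c, so the sum counts lifts. *)
Lemma vsum_dvd (p c s n : nat) : prime p -> (0 < c)%N -> coprime s (6 * (p * c)) ->
  vsum (p * c) s (p * n) = (if (p %| 6 * c)%N then kp p else 1 + kp p)%:~R * vsum c s n.
Proof.
move=> pp c0 sc; have p0 := prime_gt0 pp.
rewrite /vsum mulr_sumr (_ : 12 * (p * c) = p * (12 * c))%N; last by ring.
rewrite (sum_mul p (12 * c) (vterm (p * c) (23 * s ^ 2) (p * n))) exchange_big /=.
apply: eq_bigr => l _; rewrite {2}/vterm.
have E (i : nat) : vterm (p * c) (23 * s ^ 2) (p * n) (i * (12 * c) + l) =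
    (chi l%:Z)%:~R * ex (n%:Z * l%:Z) (12 * c) * (24 * (p * c) %| (i * (12 * c) + l) ^ 2 + 23 * s ^ 2)%N%:R.
  rewrite /vterm; case: ifP => _; last by rewrite mulr0.
  rewrite mulr1; congr (_ * _).
    by rewrite (_ : i * (12 * c) + l = l + 12 * (i * c))%N ?chi_per//; ring.
  rewrite (_ : 12 * (p * c) = p * (12 * c))%N; last by ring.
  rewrite PoszM -mulrA ex_scale// -(@ex_per R (n%:Z * l%:Z) (n%:Z * i%:Z) (12 * c)) ?muln_gt0//.
  by apply: ex_eq => //; rewrite PoszD (PoszM i); ring.
rewrite (eq_bigr _ (fun (i : 'I_p) _ => E i)) -mulr_sumr -natr_sum.
have [cl|cl] := eqVneq (chi l%:Z) 0; first by rewrite cl !mul0r if_same mulr0.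
case: (boolP (24 * c %| l ^ 2 + 23 * s ^ 2)%N) => h; last first.
  rewrite mulr0 big1 ?mulr0// => i _; case: (boolP (_ %| _)%N) => // h'; exfalso.
  move: h; rewrite -(dvdn_sqr_per c l i) => /negP; apply.
  rewrite (_ : l + 12 * c * i = i * (12 * c) + l)%N; last by ring.
  by apply: dvdn_trans h'; rewrite mulnCA dvdn_mull.
by rewrite mulrC; congr (_ * _); rewrite -(lift_count pp c0 sc cl h) -pmulrn.
Qed.

Definition tsum (c s n : nat) : C := \sum_(k <- divisors c | (k %| n)%N)
  (kronecker (-23) k)%:~R * (chi (n %/ k)%N%:Z)%:~R * vsum (c %/ k) (s * (n %/ k)) 1.

Lemma divisors_prime_mul (V : nmodType) (p c : nat) (F : nat -> V) : prime p -> (0 < c)%N ->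
  \sum_(k <- divisors (p * c)) F k =
  \sum_(k <- divisors c) F (p * k)%N + \sum_(k <- divisors c | ~~ (p %| k)%N) F k.
Proof.
move=> pp c0; have p0 := prime_gt0 pp; have pc0 : (0 < p * c)%N by rewrite muln_gt0 p0.
rewrite (bigID (fun k => p %| k)%N) /=; congr (_ + _).
  rewrite -[RHS](big_map (muln p) xpredT F) -big_filter; apply: perm_big; apply: uniq_perm.
  - by rewrite filter_uniq// divisors_uniq.
  - by rewrite map_inj_uniq ?divisors_uniq// => x y /eqP; rewrite eqn_pmul2l// => /eqP.
  move=> k; rewrite mem_filter -dvdn_divisors//; apply/andP/mapP => [[/dvdnP[k' ->]]|[k' + ->]].
    by rewrite mulnC dvdn_pmul2l// => h; exists k'; rewrite -?dvdn_divisors.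
  by rewrite -dvdn_divisors// => h; rewrite dvdn_mulr// dvdn_pmul2l.
rewrite -[LHS]big_filter -[RHS]big_filter; apply: perm_big; apply: uniq_perm; rewrite ?filter_uniq ?divisors_uniq//.
move=> k; rewrite !mem_filter -!dvdn_divisors//; case: (boolP (p %| k)%N) => //= pk.
by rewrite Gauss_dvdr// coprime_sym prime_coprime.
Qed.

(** Induction on n by removing its least prime factor p. The parameter s must vary because for p
    prime to c the prime moves into s. If p | c, the divisors of c divisible by p give (-23/p) times
    the sum for c/p and n/p; the others vanish when p | 6c/p and otherwise supply the 1 in 1 +
    (-23/p). *)
Theorem vsum_tsum (n c s : nat) : (0 < n)%N -> (0 < c)%N -> coprime s (6 * c) -> vsum c s n = tsum c s n.
Proof.
elim/ltn_ind: n c s => n IH c s n0 c0 sc.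
case: (ltngtP n 1) => [|n1|->]; first by rewrite ltnS leqn0 gtn_eqF.
  have pp := pdiv_prime n1; set p := pdiv n in pp *; have p0 := prime_gt0 pp.
  have [n' nE] : exists n', n = (p * n')%N by exists (n %/ p)%N; rewrite mulnC divnK// pdiv_dvd.
  have n'0 : (0 < n')%N by move: n0; rewrite nE muln_gt0 => /andP[].
  have n'n : (n' < n)%N by rewrite nE -{1}[n']mul1n ltn_pmul2r// prime_gt1.
  rewrite nE; have [pc|pc] := boolP (p %| c)%N; last first.
    have cp : coprime p c by rewrite prime_coprime.
    have ck k : k \in divisors c -> coprime k p.
      by rewrite -dvdn_divisors// => kc; rewrite coprime_sym (coprime_dvdr kc).
    case: (leqP p 3) => p3.
      rewrite vsum_small//; last by apply: chi_coprime; apply: coprime_dvdr sc; rewrite dvdn_mulr.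
      rewrite /tsum big_seq_cond big1// => k /andP[/ck kp kn].
      rewrite (@chi_dvd p) ?mulr0 ?mul0r ?prime_gt1//.
      by move: kn; rewrite Gauss_dvdr// => kn; rewrite -muln_divA// dvdn_mulr.
    rewrite vsum_coprime// IH//; last first.
      rewrite coprimeMl sc andbT coprimeMr cp andbT coprime_sym.
      have [+ _] := prime_ndvd24 pp p3.
      by apply: coprime_dvdl.
    rewrite /tsum mulr_sumr big_seq_cond [RHS]big_seq_cond.
    have cond k : (k \in divisors c) && (k %| p * n')%N = (k \in divisors c) && (k %| n')%N.
      by case: (boolP (k \in _)) => //= /ck kp; rewrite Gauss_dvdr.
    rewrite (eq_bigl _ _ cond); apply: eq_bigr => k /andP[_ kn].
    rewrite -muln_divA// PoszM chiM intrM.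
    rewrite (_ : s * (p * (n' %/ k)) = p * s * (n' %/ k))%N; last by rewrite mulnA (mulnC s).
    move: (vsum _ _ _) (_ %:~R) (_ %:~R : C) (_%:~R : C) => a1 a2 a3 a4; ring.
  case/dvdnP: pc => c1 cE; rewrite mulnC in cE; subst c.
  have c10 : (0 < c1)%N by move: c0; rewrite muln_gt0 => /andP[].
  rewrite vsum_dvd// IH//; last by apply: coprime_dvdr sc; rewrite mulnCA dvdn_mull.
  rewrite {2}/tsum [X in _ = X]big_mkcond /= divisors_prime_mul// -big_mkcond /= -big_mkcondr /=.
  set A := (X in _ = X + _); set B := (X in _ = _ + X).
  have -> : A = (kp p)%:~R * tsum c1 s n'.
    rewrite /A /tsum mulr_sumr big_seq_cond [RHS]big_seq_cond.
    apply: eq_big => k; first by rewrite dvdn_pmul2l.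
    move=> /andP[kc kn].
    have k0 : (0 < k)%N by apply: (dvdn_gt0 c10); rewrite dvdn_divisors.
    by rewrite kronecker_mulp// !divnMl// intrM -!mulrA.
  have [p6|p6] := boolP (p %| 6 * c1)%N.
    rewrite -[LHS]addr0; congr (_ + _); symmetry; rewrite /B big_seq_cond big1// => k.
    rewrite -dvdn_divisors// => /and3P[kc pk kn].
    have kp : coprime k p by rewrite coprime_sym prime_coprime.
    have kn' : (k %| n')%N by move: kn; rewrite Gauss_dvdr.
    case: (leqP p 3) => p3.
      by rewrite (@chi_dvd p) ?mulr0 ?mul0r ?prime_gt1// -muln_divA// dvdn_mulr.
    have pc : (p %| c1)%N.
      exact: dvd_6mul p6.
    have : (p %| c1 %/ k)%N by rewrite dvdn_divRL// Gauss_dvd 1?coprime_sym// pc kc.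
    (* Now p^2 divides the modulus p c1 / k and p divides the second argument, which is the
       situation of [vsum_zero]. *)
    case/dvdnP => D De; rewrite -!muln_divA// De.
    have D0 : (0 < D)%N.
      have : (0 < c1 %/ k)%N by rewrite divn_gt0 ?(dvdn_leq c10)// (dvdn_gt0 c10).
      by rewrite De muln_gt0 => /andP[].
    by rewrite (mulnC D) (mulnCA s) vsum_zero// mulr0.
  have p3 : (3 < p)%N.
    rewrite ltnNge; apply: contra p6 => p3; apply: dvdn_mulr.
    by move: pp p3; case: (p) => [|[|[|[|]]]].
  have pc : coprime p c1 by rewrite prime_coprime//; apply: contra p6; exact: dvdn_mull.
  rewrite intrD mulrDl addrC; congr (_ + _); rewrite mul1r /B /tsum big_seq_cond [RHS]big_seq_cond.
  have ck k : k \in divisors c1 -> coprime k p.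
    by rewrite -dvdn_divisors// => kc; rewrite coprime_sym (coprime_dvdr kc).
  apply: eq_big => k.
    case: (boolP (k \in _)) => //= /ck kp; rewrite Gauss_dvdr//.
    by rewrite -prime_coprime// coprime_sym kp.
  move=> /andP[kc kn]; have k0 : (0 < k)%N by apply: (dvdn_gt0 c10); rewrite dvdn_divisors.
  have kc' : (k %| c1)%N by rewrite dvdn_divisors.
  rewrite -!muln_divA// (mulnCA s) vsum_one//; last 2 first.
  - by rewrite divn_gt0// dvdn_leq.
  - by apply: coprime_dvdr pc; apply/dvdnP; exists k; rewrite mulnC divnK.
  rewrite PoszM chiM intrM.
  have : (chi p%:Z)%:~R * (chi p%:Z)%:~R = 1 :> C by rewrite -intrM chi_prime_sqr.
  move: (vsum _ _ _) (_ %:~R : C) (_ %:~R : C) (_%:~R : C) => a1 a2 a3 a4.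
  by move=> e; rewrite -[LHS]mul1r -e; ring.
rewrite /tsum (eq_bigl (fun g => g == 1%N)) => [|g]; last by rewrite dvdn1.
rewrite -big_filter filter_pred1_uniq ?divisors_uniq -?dvdn_divisors ?dvd1n// big_seq1.
by rewrite !divn1 muln1 kronecker_1 chi1 !mul1r.
Qed.

End Recursion.

(** * The two formulas *)

Section Final.
Variable R : realType.
Local Notation C := R[i].

Lemma sum_divisors_compl (V : nmodType) (n : nat) (F : nat -> V) : (0 < n)%N ->
  \sum_(m <- divisors n) F (n %/ m)%N = \sum_(k <- divisors n) F k.
Proof.
move=> n0; have inv m : m \in divisors n -> (n %/ (n %/ m))%N = m.
  by rewrite -dvdn_divisors// => mn; rewrite divnA// mulKn.
rewrite -(big_map (fun m => n %/ m)%N xpredT F); apply: perm_big; apply: uniq_perm; last 1 first.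
- move=> k; apply/mapP/idP => [[m + ->]|kn].
    by rewrite -!dvdn_divisors//; exact: dvdn_div.
  by exists (n %/ k)%N; rewrite ?inv// -dvdn_divisors// dvdn_div// dvdn_divisors.
- rewrite map_inj_in_uniq ?divisors_uniq// => x y /inv hx /inv hy e.
  by rewrite -hx e hy.
- exact: divisors_uniq.
Qed.

(** The term c of the series attached to m is placed at index c n/m: rescaling n and the modulus
    together leaves the argument of [Psi] unchanged, so contributions with the same index share this
    factor. *)
Lemma hasum_divisors (n : nat) (T : nat -> nat -> C) (A : nat -> C) : (0 < n)%N ->
  (forall m, m \in divisors n -> hasum (fun c => if c == 0%N then 0 else T m c) (A m)) ->
  hasum (fun c => if c == 0%N then 0 else \sum_(k <- divisors c | (k %| n)%N) T (n %/ k)%N (c %/ k)%N)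
    (\sum_(m <- divisors n) A m).
Proof.
move=> n0 H.
pose G m c := if (m \in divisors n) && ((0 < c) && (n %/ m %| c))%N then T m (c %/ (n %/ m))%N else 0.
have HG m : hasum (G m) (if m \in divisors n then A m else 0).
  rewrite /G; case: ifP => mn /=; last exact: hasum0.
  have mn' : (m %| n)%N by rewrite dvdn_divisors.
  have k0 : (0 < n %/ m)%N by rewrite divn_gt0 ?(dvdn_leq n0)// (dvdn_gt0 n0).
  apply/(@hasum_inj R _ _ (muln (n %/ m))) => [x y /eqP|c|].
  - by rewrite eqn_pmul2l// => /eqP.
  - move=> h; case: ifP => // /andP[_ /dvdnP[q e]]; case: (h q).
    by rewrite e mulnC.
  apply: hasum_ext (H m mn) => c /=; rewrite muln_gt0 k0 dvdn_mulr// andbT mulKn//.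
  by case: c.
rewrite (_ : \sum_(m <- divisors n) A m = \sum_(m <- divisors n) if m \in divisors n then A m else 0); last first.
  by rewrite !big_seq; apply: eq_bigr => m ->.
apply: hasum_ext (hasum_sum (divisors n) HG) => c.
have [->|cn] := eqVneq c 0%N; first by rewrite big1// => m _; rewrite /G andbF.
have c0 : (0 < c)%N by rewrite lt0n.
transitivity (\sum_(m <- divisors n) (if (n %/ m %| c)%N then T (n %/ (n %/ m))%N (c %/ (n %/ m))%N else 0)).
  rewrite !big_seq; apply: eq_bigr => m mn; rewrite /G mn c0 /=.
  have mn' : (m %| n)%N by rewrite dvdn_divisors.
  by rewrite (_ : (n %/ (n %/ m))%N = m)// divnA// mulKn.
rewrite (sum_divisors_compl (fun k => if (k %| c)%N then T (n %/ k)%N (c %/ k)%N else 0) n0).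
rewrite -!big_mkcond -big_filter -[RHS]big_filter /=; apply: perm_big; apply: uniq_perm; rewrite ?filter_uniq ?divisors_uniq//.
by move=> k; rewrite !mem_filter -!dvdn_divisors// andbC.
Qed.

Lemma chi_sqr_nat (m : nat) : chi m%:Z != 0 -> exists n0, (m ^ 2 = 24 * n0 + 1)%N.
Proof.
move=> cm; have m0 : (0 < m)%N by case: m cm.
have := chi_sqr cm; rewrite sqz -[1]/(1%N%:Z) subzn ?expn_gt0 ?m0// => /dvdnP[n0 e].
have {}e : (m ^ 2 - 1 = n0 * 24)%N by exact: e.
exists n0; have h : (0 < m ^ 2)%N by rewrite expn_gt0 m0.
lia.
Qed.

Lemma sqrt_part (m c : nat) : pi * 1%:R * Num.sqrt (23 * m ^ 2)%N%:R / (6 * c%:R) = pi * m%:R * Num.sqrt 23 / (6 * c%:R) :> R.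
Proof.
rewrite mulr1 natrM sqrtrM ?ler0n// natrX sqrtr_sqr ger0_norm ?ler0n//.
by rewrite (mulrC (Num.sqrt _)) mulrA.
Qed.

Lemma partition_hasum (m : nat) : chi m%:Z != 0 -> hasum (fun c : nat => if c == 0%N then 0 else
    2 / (23 * m%:R ^+ 2) * (Psi (pi * m%:R * Num.sqrt 23 / (6 * c%:R)))%:C * vsum R c m 1)
  (partition_number ((23 * m ^ 2 + 1) %/ 24))%:R.
Proof.
move=> cm; have [n0 e] := chi_sqr_nat cm; have m0 : (0 < m)%N by case: m cm e.
have MN : (23 * m ^ 2 + 1 = 24 * (23 * n0 + 1))%N by rewrite e; lia.
have M0 : (0 < 23 * m ^ 2)%N by rewrite muln_gt0 expn_gt0 m0.
rewrite MN mulKn//.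
have qa : qser (- 0%:R - 24^-1) (fun n => (partition_number n)%:R) (fun z => (1%:P : {poly C}).[jinv z] * ieta z).
  apply: qser_al (qser_ext _ (@ieta_qser R)) => [|z _]; first by rewrite oppr0 add0r.
  by rewrite hornerC mul1r.
have p0 : (partition_number 0)%:R = 1 :> C.
  by rewrite partition_box box_0.
(* For 1/eta the leading exponent is -1/24; M = 23 m^2 is chosen so that (M + 1)/24 is the wanted
   index of the partition function. *)
have H := @rademacher R 0 (23 * n0 + 1) 1 (23 * m ^ 2) 1%:P _ qa p0 _ erefl MN M0.
rewrite add0n in H; apply: hasum_ext (H _) => [c|i]; last by case: i.
have [//|c0] := eqVneq c 0%N; rewrite sqrt_part.
rewrite -lt0n in c0; rewrite -(vsum_1 R c0 cm) chi1.
have c0' : (c%:R : C) != 0 by rewrite pnatr_eq0 -lt0n.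
have m0' : (m%:R : C) != 0 by rewrite pnatr_eq0 -lt0n.
move: (Psi _)%:C (vsum _ _ _ _) => x y; rewrite natrM natrX; field.
by rewrite c0' m0'.
Qed.

Lemma Psi_scale (n m c k : nat) : (0 < c)%N -> (0 < k)%N -> n = (m * k)%N ->
  Psi (pi * n%:R * Num.sqrt 23 / (6 * (c * k)%N%:R)) = Psi (pi * m%:R * Num.sqrt 23 / (6 * c%:R)) :> R.
Proof.
move=> c0 k0 ->; congr Psi; rewrite !natrM.
have c0' : (c%:R : R) != 0 by rewrite pnatr_eq0 -lt0n.
have k0' : (k%:R : R) != 0 by rewrite pnatr_eq0 -lt0n.
by field; rewrite c0' k0'.
Qed.

Lemma salie_part_term (n k : nat) (u v x y : C) : (0 < k)%N ->
  2 * n%:R / 23 * x * (u * v * y) = n%:R * u * v * k%:R ^+ 2 * (2 / (23 * k%:R ^+ 2) * x * y).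
Proof. by move=> k0; field; rewrite pnatr_eq0 -lt0n. Qed.

Theorem cF23_partition (n : nat) : (0 < n)%N -> cF23 R n = n%:R * \sum_(m <- divisors n)
  (kronecker (-23) (n %/ m))%:~R * (chi m%:Z)%:~R * m%:R ^+ 2 * (partition_number ((23 * m ^ 2 + 1) %/ 24))%:R.
Proof.
move=> n0; apply: (hasum_uniq (@cF23_salie R n)); rewrite mulr_sumr.
pose T (m c : nat) : C := n%:R * (kronecker (-23) (n %/ m))%:~R * (chi m%:Z)%:~R * m%:R ^+ 2 *
  (2 / (23 * m%:R ^+ 2) * (Psi (pi * m%:R * Num.sqrt 23 / (6 * c%:R)))%:C * vsum R c m 1).
have HT m : m \in divisors n -> hasum (fun c => if c == 0%N then 0 else T m c)
   (n%:R * ((kronecker (-23) (n %/ m))%:~R * (chi m%:Z)%:~R * m%:R ^+ 2 * (partition_number ((23 * m ^ 2 + 1) %/ 24))%:R)).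
  move=> _; have [cm|cm] := eqVneq (chi m%:Z) 0.
    rewrite cm !(mulr0, mul0r); apply: hasum_ext (@hasum0 R _) => c.
    by rewrite /T cm !(mulr0, mul0r) if_same.
  have E (a b c d e : C) : a * (b * c * d * e) = a * b * c * d * e by ring.
  rewrite [X in hasum _ X]E; apply: hasum_ext (hasumZ _ (partition_hasum cm)) => c.
  by case: (c == 0%N); rewrite ?mulr0.
apply: hasum_ext (hasum_divisors n0 HT) => c; have [//|cn] := eqVneq c 0%N.
have c0 : (0 < c)%N by rewrite lt0n.
have -> : salie R c n = tsum R c 1 n by rewrite salieE// vsum_tsum// coprime1n.
rewrite /tsum mulr_sumr [LHS]big_seq_cond [RHS]big_seq_cond; apply: eq_bigr => k.
rewrite -dvdn_divisors// => /andP[kc kn]; have k0 := dvdn_gt0 c0 kc.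
have ck0 : (0 < c %/ k)%N by rewrite divn_gt0 ?(dvdn_leq c0).
have nk0 : (0 < n %/ k)%N by rewrite divn_gt0 ?(dvdn_leq n0).
rewrite /T (_ : n %/ (n %/ k) = k)%N; last by rewrite divnA// mulKn.
have e := Psi_scale ck0 k0 (esym (divnK kn)); rewrite divnK// in e.
by rewrite e mul1n (salie_part_term n _ _ _ _ nk0).
Qed.

Definition jcoef : nat -> C := xget (fun=> 0) [set a | qser (- 1) a (@jinv R)]%classic.

Lemma jcoefP : qser (- 1) jcoef (@jinv R) /\ jcoef 0 = 1.
Proof.
have [a [qa a0]] := jinv_qser R.
have qj : qser (- 1) jcoef (@jinv R) by rewrite /jcoef; case: xgetP => [b _ //|/(_ a)].
by split=> //; rewrite -a0; exact: (qser_uniq qj qa).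
Qed.

Lemma jcoef_fourier (k : nat) : fourier_coef (- 1) (modular_j R) (- 1 + k%:Z) = jcoef k.
Proof.
apply: qser_fourier; apply: qser_al (qser_ext _ jcoefP.1) => [|z z0]; first by rewrite rmorphN1.
by rewrite modular_jE.
Qed.

Lemma jinv_deriv_S (D : C -> C) : (forall z, 0 < complex.Im z -> cder (@jinv R) z (D z)) ->
  forall z, 0 < complex.Im z -> D (- z^-1) = z ^+ 2 * D z.
Proof.
move=> HD z z0; have zn := Im_neq0 z0.
have h1 : cder (fun w => - w^-1 : C) z (z ^- 2).
  by apply: cder_eq (cderN (cder_inv zn)); rewrite opprK.
have h2 := cder_comp h1 (HD _ (Im_Ninv_gt0 z0)).
have h3 : cder (@jinv R) z (D (- z^-1) * z ^- 2).
  apply: (cder_near z0) h2 => w wz; apply: jinv_S.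
  have : complex.Im z - complex.Im w <= nm (w - z).
    apply: le_trans (Im_nm (w - z)); rewrite ImD ImN -opprB.
    by apply: le_trans (ler_norm _) _; rewrite normrN.
  by move=> h; have := le_lt_trans h wz; rewrite -subr_gt0; lra.
have := cder_uniq h3 (HD z z0) => <-.
by rewrite mulrC -mulrA mulVf ?mulr1// expf_neq0.
Qed.

Lemma wt2_term (w x e p i e' i' : C) : e * i = e' * i' -> w * x * e * (p * i) = w * (x * e' * (p * i')).
Proof.
move=> h; transitivity (w * x * p * (e * i)); first by ring.
by rewrite h; ring.
Qed.

(* With D = J', the form D * P(J) = D * eta * (P(J)/eta) has weight 2, so its constant term vanishes. *)
Lemma faber_next (n0 : nat) (P : {poly C}) (a : nat -> C) :
  qser (- n0%:R - 24^-1) a (fun z => P.[jinv z] * ieta z) -> a 0%N = 1 ->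
  (forall i, (0 < i <= n0)%N -> a i = 0) ->
  a n0.+1 = \sum_(i < n0.+2) (i%:R - 1) * jcoef i * pentc R (n0.+1 - i).
Proof.
move=> qa a0 a1; have [qj j0] := jcoefP; have t0 := tpi_neq0 R.
pose d n := tpi R * (n%:R - 1) * jcoef n.
have rd : rdec d.
  apply: rdec_ext (rdecD (rdecZ (tpi R) (rdec_pow 1 qj.1)) (rdecZ (- tpi R) qj.1)) => n.
  by rewrite /d expr1; ring.
have qd := qsumP (-1) rd; set D := qsum _ _ in qd.
have DD z : 0 < complex.Im z -> cder (@jinv R) z (D z) by move=> z0; exact: qser_cder qj qd z z0.
have qW := qserM (qserM qd (@eta_qser R)) qa.
have al : -1 + 24^-1 + (- n0%:R - 24^-1) = - n0.+1%:R :> C by rewrite -(natr1 n0); ring.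
have := const_term0 (qser_al al qW) _ => H.
have E : cauchy (cauchy d (pentc R)) a n0.+1 = 0.
  apply: H => z z0; have z0' := Im_Ninv_gt0 z0.
  rewrite jinv_S// (jinv_deriv_S DD)//; apply: wt2_term.
  by rewrite !eta_ieta.
have pE : cauchy d (pentc R) 0 = - tpi R.
  by rewrite /cauchy big_ord1 /= subnn /d j0 pentc0 mulr1 sub0r mulrN1 mulr1.
(* The gap in [a] leaves only the two end terms of the convolution, and the leading coefficient of
   [D * eta] is [- tpi]. *)
move: E; rewrite {1}/cauchy big_ord_recl big_ord_recr /= subn0 /bump /= subnn a0 pE mulr1.
rewrite big1 ?add0r => [|i _]; last first.
  by rewrite add1n subSS a1 ?mulr0// subn_gt0 ltn_ord leq_subr.
move=> E; apply: (mulfI t0); have -> : tpi R * a n0.+1 = cauchy d (pentc R) n0.+1.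
  by apply/eqP; rewrite -subr_eq0 -oppr_eq0 opprB; move/eqP: E; rewrite add1n mulNr addrC.
by rewrite mulr_sumr; apply: eq_bigr => i _; rewrite /d -!mulrA.
Qed.

Lemma pentcE (k L : nat) : (forall l, (l ^ 2 = 24 * k + 1)%N -> (l < L)%N) ->
  pentc R k = \sum_(l < L) if (l ^ 2 == 24 * k + 1)%N then (chi l%:Z)%:~R else 0.
Proof.
move=> HL; pose F l : C := if (l ^ 2 == 24 * k + 1)%N then (chi l%:Z)%:~R else 0.
have F0 b l : (forall l, (l ^ 2 = 24 * k + 1)%N -> (l < b)%N) -> (b <= l)%N -> F l = 0.
  by move=> Hb bl; rewrite /F; case: eqP => // /Hb; rewrite ltnNge bl.
have H6 l : (l ^ 2 = 24 * k + 1)%N -> (l < 6 * k.+1)%N.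
  by move=> e; have [//|h] := ltnP l (6 * k.+1); nia.
rewrite /pentc -[LHS](@sum_ord_small _ F _ (maxn L (6 * k.+1))) ?leq_maxr//; last by move=> l; exact: F0.
by apply: sum_ord_small; rewrite ?leq_maxl// => l; exact: F0.
Qed.

(** Writing d^2 = 24 (n0 + 1 - i) + 1 gives i - 1 = (m^2 - d^2)/24, the exponent of q in j; the
    range d^2 <= m^2 + 24 expresses i >= 0, the term i = 0 being the pole of j. *)
Lemma faber_coef (n0 m : nat) (cj : int -> C) : (m ^ 2 = 24 * n0 + 1)%N ->
  (forall k : nat, cj (- 1 + k%:Z) = jcoef k) ->
  \sum_(i < n0.+2) (i%:R - 1) * jcoef i * pentc R (n0.+1 - i) =
  \sum_(1 <= d < (Num.truncn (Num.sqrt ((m ^ 2 + 24)%:R : R))).+1)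
     (chi d%:Z)%:~R * ((m%:R ^+ 2 - d%:R ^+ 2) / 24) * cj ((m%:Z ^+ 2 - d%:Z ^+ 2) %/ 24)%Z.
Proof.
move=> m2 Hcj; set D := Num.truncn _.
have HD l : (l <= D)%N = (l ^ 2 <= m ^ 2 + 24)%N.
  rewrite /D truncn_ge_nat ?sqrtr_ge0// -[in LHS](ger0_norm (ler0n R l)) -sqrtr_sqr.
  by rewrite ler_sqrt ?ler0n// -natrX ler_nat.
pose F l i : C := if (l ^ 2 + 24 * i == m ^ 2 + 24)%N then (chi l%:Z)%:~R * ((i%:R - 1) * jcoef i) else 0.
transitivity (\sum_(l < D.+1) \sum_(i < n0.+2) F l i).
  rewrite exchange_big /=; apply: eq_bigr => i _.
  have in0 : (i <= n0.+1)%N by rewrite -ltnS.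
  rewrite (@pentcE _ D.+1) => [|l e]; last by rewrite ltnS HD e m2; lia.
  rewrite mulr_sumr; apply: eq_bigr => l _; rewrite /F.
  rewrite (_ : (l ^ 2 + 24 * i == m ^ 2 + 24)%N = (l ^ 2 == 24 * (n0.+1 - i) + 1)%N); last by rewrite m2; apply/eqP/eqP; lia.
  by case: ifP => _; rewrite ?mulr0// mulrC.
rewrite -(big_mkord xpredT (fun l => \sum_(i < n0.+2) F l i)) big_ltn// big1 ?add0r => [|i _]; last first.
  by rewrite /F mul0r if_same.
rewrite !big_nat; apply: eq_bigr => l /andP[l1]; rewrite ltnS HD => lm.
have [cl|cl] := eqVneq (chi l%:Z) 0.
  by rewrite cl !mul0r big1// => i _; rewrite /F cl mul0r if_same.
have [k0 l2] := chi_sqr_nat cl.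
have kn : (k0 <= n0.+1)%N by move: lm; rewrite l2 m2; lia.
have k1 : (n0.+1 - k0 < n0.+2)%N by rewrite ltnS leq_subr.
rewrite (bigD1 (Ordinal k1))//= big1 ?addr0 => [|i]; last first.
  rewrite -val_eqE /= /F l2 m2 => /eqP ni; case: eqP => // e; case: ni; lia.
rewrite /F l2 m2 (_ : (_ == _) = true); last by apply/eqP; lia.
rewrite -mulrA; congr (_ * _).
set i := (n0.+1 - k0)%N.
have iE : (n0.+1 = k0 + i)%N by rewrite subnKC.
have -> : (m%:Z ^+ 2 - l%:Z ^+ 2)%R = (-1 + i%:Z) * 24 by rewrite !sqz l2 m2; lia.
rewrite mulzK// Hcj; congr (_ * _).
have sq (x k : nat) : (x ^ 2 = 24 * k + 1)%N -> x%:R ^+ 2 = 24 * k%:R + 1 :> C by move=> h; rewrite -natrX h natrD natrM.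
rewrite (sq _ _ l2) (sq _ _ m2); have -> : n0%:R = k0%:R + i%:R - 1 :> C by rewrite -natrD -iE -natr1 addrK.
by field.
Qed.

Lemma salie_faber_term (n c k : nat) (x y : C) : (0 < c)%N ->
  2 * n%:R / 23 * x * (k%:R * y) = c%:R * k%:R * (2 * n%:R / (23 * c%:R) * x * y).
Proof. by move=> c0; field; rewrite pnatr_eq0 -lt0n. Qed.

Lemma rademacher_term (n m c : nat) (u x y : C) : (0 < m)%N -> (0 < c)%N -> u * u = 1 ->
  u * (n%:R / m%:R) * (2 * m%:R / (23 * c%:R) * u * x * y) = 2 * n%:R / (23 * c%:R) * x * y.
Proof.
move=> m0 c0 cc; transitivity (u * u * (2 * n%:R / (23 * c%:R) * x * y)); last by rewrite cc mul1r.
by field; rewrite !pnatr_eq0 -!lt0n m0 c0.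
Qed.

Theorem cF23_faber (n : nat) : (0 < n)%N -> let cj := fourier_coef (-1) (modular_j R) in
  cF23 R n = \sum_(m <- divisors n) (chi m%:Z)%:~R * (n%:R / m%:R)
   * \sum_(1 <= d < (Num.truncn (Num.sqrt ((m ^ 2 + 24)%:R : R))).+1)
     (chi d%:Z)%:~R * ((m%:R ^+ 2 - d%:R ^+ 2) / 24) * cj ((m%:Z ^+ 2 - d%:Z ^+ 2) %/ 24)%Z.
Proof.
move=> n0 cj; apply: (hasum_uniq (@cF23_salie R n)).
pose T (m c : nat) : C := 2 * n%:R / (23 * c%:R) * (Psi (pi * m%:R * Num.sqrt 23 / (6 * c%:R)))%:C * kloos R 23 m c.
have HT m : m \in divisors n -> hasum (fun c => if c == 0%N then 0 else T m c)
   ((chi m%:Z)%:~R * (n%:R / m%:R) * \sum_(1 <= d < (Num.truncn (Num.sqrt ((m ^ 2 + 24)%:R : R))).+1)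
     (chi d%:Z)%:~R * ((m%:R ^+ 2 - d%:R ^+ 2) / 24) * cj ((m%:Z ^+ 2 - d%:Z ^+ 2) %/ 24)%Z).
  move=> _; have [cm|cm] := eqVneq (chi m%:Z) 0.
    rewrite cm !mul0r; apply: hasum_ext (@hasum0 R _) => -[//|c] /=.
    by rewrite /T kloos0// mulr0.
  have m0 : (0 < m)%N by case: (m) cm.
  have [k0 m2] := chi_sqr_nat cm.
  rewrite -(faber_coef m2 jcoef_fourier).
  have [P [a [qa a0 a1]]] := faber R (leqnn k0).
  rewrite -(faber_next qa a0 a1) -addn1.
  (* With M = 23 the twist moves by one integral step past the leading gap: the coefficient obtained
     is the first one after it, which [faber_next] evaluates. *)
  have H := @rademacher R k0 1 m 23 P a qa a0 a1 m2 erefl isT.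
  apply: hasum_ext (hasumZ _ H) => -[|c] /=; first by rewrite mulr0.
  have cc : ((chi m%:Z)%:~R : C) * (chi m%:Z)%:~R = 1.
    by rewrite -intrM; move: cm; rewrite /chi; do ?case: ifP.
  by rewrite /T -(rademacher_term n _ _ m0 _ cc) ?lt0n.
apply: hasum_ext (hasum_divisors n0 HT) => c; have [//|cn] := eqVneq c 0%N.
have c0 : (0 < c)%N by rewrite lt0n.
have cn' : (c%:R : C) != 0 by rewrite pnatr_eq0.
have E : c%:R * salie R c n = \sum_(g <- divisors c | (g %| n)%N) g%:R * kloos R 23 (n %/ g) (c %/ g).
  by rewrite salieE// vsum_kloos.
apply: (mulfI cn'); rewrite mulr_sumr [RHS]mulrCA E mulr_sumr.
rewrite [LHS]big_seq_cond [RHS]big_seq_cond; apply: eq_bigr => k.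
rewrite -dvdn_divisors// => /andP[kc kn]; have k0 := dvdn_gt0 c0 kc.
have ck0 : (0 < c %/ k)%N by rewrite divn_gt0 ?(dvdn_leq c0).
have e := Psi_scale ck0 k0 (esym (divnK kn)); rewrite divnK// in e.
rewrite /T e; move: (Psi _)%:C (kloos _ _ _ _) => x y.
have {1}-> : (c%:R : C) = (c %/ k)%N%:R * k%:R by rewrite -natrM divnK.
by rewrite (salie_faber_term n _ _ _ ck0).
Qed.

End Final.

Theorem proposition1p7 (R : realType) (n : nat) (hn : (1 <= n)%N) :
  let cF := fourier_coef 1 (F23 R) in
  let cj := fourier_coef (-1) (modular_j R) in
  cF n%:Z =
    n%:R * \sum_(m <- divisors n)
      (kronecker (-23) (n %/ m))%:~R * (kronecker 12 m)%:~R * m%:R ^+ 2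
      * (partition_number ((23 * m ^ 2 + 1) %/ 24))%:R
  /\
  cF n%:Z =
    \sum_(m <- divisors n)
      (kronecker 12 m)%:~R * (n%:R / m%:R)
      * \sum_(1 <= d < (Num.truncn (Num.sqrt ((m ^ 2 + 24)%:R : R))).+1)
          (kronecker 12 d)%:~R
          * ((m%:R ^+ 2 - d%:R ^+ 2) / 24)
          * cj ((m%:Z ^+ 2 - d%:Z ^+ 2) %/ 24)%Z.
Proof.
have m0 m : m \in divisors n -> (0 < m)%N by rewrite -dvdn_divisors// => /(dvdn_gt0 hn).
move=> cF cj; rewrite /cF fourier_F23//; split.
  rewrite cF23_partition//; congr (_ * _); rewrite !big_seq; apply: eq_bigr => m /m0 h.
  by rewrite kronecker12.
rewrite cF23_faber// !big_seq; apply: eq_bigr => m /m0 h; rewrite kronecker12//; congr (_ * _).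
by rewrite !big_nat; apply: eq_bigr => d /andP[d0 _]; rewrite kronecker12.
Qed.
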